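(* Let $\Omega\subset\mathbb R^2$ be a simply connected Lipschitz open set of finite area, let $\lambda>0$, let $u\in H^1_0(\Omega;\mathbb R^2)$ be a non-trivial solution, with pressure $p$, of $$\Delta u+\lambda u=\nabla p\ \text{ in }\Omega,\qquad \nabla\cdot u=0\ \text{ in }\Omega,\qquad u=0\ \text{ on }\partial\Omega,$$ and let $\psi\in H^2_0(\Omega)$ with $u=-\nabla^\perp\psi$ and $w=\nabla\times u=-\Delta\psi$ be the corresponding solutions of $$\Delta^2\psi+\lambda\Delta\psi=0\ \text{ in }\Omega,\qquad \psi=\frac{\partial\psi}{\partial n}=0\ \text{ on }\partial\Omega,$$ and of $$\Delta w+\lambda w=0\ \text{ in }\Omega,\qquad \int_\Omega w\,h\,dx=0\ \text{ for all }h\in H^1(\Omega)\text{ with }\Delta h=0\text{ in }\Omega,$$ respectively. Then a necessary and sufficient condition that either of the conditions $$\Delta\psi=\mathrm{const}\ \text{ on }\partial\Omega,\qquad w=\mathrm{const}\ \text{ on }\partial\Omega$$ (and hence both) be valid is that $\frac{\partial p}{\partial n}=0$ on $\partial\Omega$ or, equivalently, that $\nabla p=0$ in $\Omega$. If this happens, then for any $\nu\in(0,+\infty)$ the function $v(x,t)=e^{-\nu\lambda t}u(x)$ is the solution, with $v(\cdot,0)=u$, of the Navier-Stokes system with zero external force $$\partial_tv+(v\cdot\nabla)v=\nu\Delta v-\nabla\pi,\quad \nabla\cdot v=0\ \text{ in }\Omega\times(0,+\infty),\qquad v=0\ \text{ on }\partial\Omega\times(0,+\infty).$$ If $\Omega$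 is of class $C^{2,\alpha}$, then the converse also holds: if $v(x,t)=e^{-\nu\lambda t}u(x)$ is the solution of this system with $v(\cdot,0)=u$, then $\frac{\partial p}{\partial n}=0$ on $\partial\Omega$.
   Context: Notation: $\nabla^\perp\psi=(-\partial_{x_2}\psi,\partial_{x_1}\psi)$; $\nabla\times u=\partial_{x_1}u^2-\partial_{x_2}u^1$; $n$ is the outward unit normal. Elliptic problems are understood in the weak sense: $u\in H^1_0(\Omega;\mathbb R^2)$, $\nabla\cdot u=0$, and $\int_\Omega\nabla u:\nabla\eta\,dx=\lambda\int_\Omega u\cdot\eta\,dx$ for all divergence-free $\eta\in H^1_0(\Omega;\mathbb R^2)$, with the pressure $p$ (a harmonic function, unique up to an additive constant) such that $\Delta u+\lambda u=\nabla p$ in the sense of distributions; $\int_\Omega\Delta\psi\,\Delta\phi\,dx=\lambda\int_\Omega\nabla\psi\cdot\nabla\phi\,dx$ for all $\phi\in H^2_0(\Omega)$. The condition that $\Delta\psi$ or $w$ is constant on $\partial\Omega$ means that it is an $H^1(\Omega)$ function with constant boundary trace. The condition $\frac{\partial p}{\partial n}=0$ on $\partial\Omega$ is meant in the weak sense: $p\in H^1(\Omega)$ and $\int_\Omega\nabla p\cdot\nabla\eta\,dx=0$ for all $\eta\in H^1(\Omega)$. In the Navier-Stokes system the pressure $\pi=\pi(x,t)$ is an unknown; $v$ is a solution if the system holds for some $\pi$. *)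

(* Defs.v *)
From HB Require Import structures.
From mathcomp Require Import all_boot all_order all_algebra.
From mathcomp Require Import all_classical all_reals all_analysis.
Set Implicit Arguments.
Unset Strict Implicit.
Unset Printing Implicit Defensive.
Import Order.TTheory GRing.Theory Num.Theory.
Import numFieldNormedType.Exports.
Local Open Scope classical_set_scope.
Local Open Scope ring_scope.

Notation plane R := (R * R)%type.
(* A point of space-time is ((x1, x2), t). *)
Notation spacetime R := (R * R * R)%type.

Section Measures.
Context {R : realType}.

Definition area :
    {measure set (measurableTypeR R * measurableTypeR R)%type -> \bar R} :=
  (@lebesgue_measure R \x @lebesgue_measure R)%E.

Definition volume :
    {measure set (measurableTypeR R * measurableTypeR R * measurableTypeR R)%type
       -> \bar R} :=
  (area \x @lebesgue_measure R)%E.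

End Measures.

Section Smooth.
Context {R : realType} {V : normedModType R}.

Definition iter_deriv (s : seq V) (f : V -> R) : V -> R :=
  foldr (fun v g x => 'D_v g x) f s.

Definition smooth (f : V -> R) : Prop :=
  forall (s : seq V) (x : V),
    {for x, continuous (iter_deriv s f)} /\ forall v, derivable (iter_deriv s f) x v.

Definition test (U : set V) (phi : V -> R) : Prop :=
  smooth phi /\
  exists K : set V, [/\ compact K, K `<=` U & forall x, ~ K x -> phi x = 0].

End Smooth.

(* Functions on an open set are total functions of which only the values on the
   set matter; vector fields are families indexed by 'I_2.  Multi-indices are
   sequences of coordinate directions. *)
Section Plane.
Context {R : realType}.
Implicit Types (O : set (plane R)) (f g p psi w : plane R -> R)
  (u eta : 'I_2 -> plane R -> R) (i j : 'I_2) (s : seq 'I_2) (lam : R).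

Definition unit_vec i : plane R := ((i == ord0)%:R, (i == ord_max)%:R).

Definition pd s f : plane R -> R := iter_deriv (map unit_vec s) f.

Definition lap f (x : plane R) : R := \sum_(i < 2) pd [:: i; i] f x.

Definition ae_on O (P : plane R -> Prop) : Prop :=
  {ae area, forall x, O x -> P x}.

Definition L1loc O f : Prop :=
  measurable_fun O f /\
  forall K, compact K -> K `<=` O -> area.-integrable K (EFin \o f).

Definition L2 O f : Prop :=
  measurable_fun O f /\ area.-integrable O (fun x => (f x ^+ 2)%:E).

Definition is_wD O s f g : Prop :=
  [/\ L1loc O f, L1loc O g &
    forall phi, test O phi ->
      \int[area]_(x in O) (f x * pd s phi x) =
      (-1) ^+ size s * \int[area]_(x in O) (g x * phi x)].

(* A chosen representative of the weak derivative (0 if there is none). *)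
Definition wD O s f : plane R -> R := xget (fun=> 0) [set g | is_wD O s f g].

Definition wlap O f (x : plane R) : R := \sum_(i < 2) wD O [:: i; i] f x.

Definition Hk (k : nat) O f : Prop :=
  L2 O f /\
  forall s, (size s <= k)%N -> exists g, is_wD O s f g /\ L2 O g.

Definition Hcvg (k : nat) O (phi : nat -> plane R -> R) f : Prop :=
  forall s, (size s <= k)%N ->
    (\int[area]_(x in O) ((pd s (phi n) x - wD O s f x) ^+ 2)%:E)%E
      @[n --> \oo] --> 0%E.

Definition H0k (k : nat) O f : Prop :=
  Hk k O f /\
  exists phi : nat -> plane R -> R, (forall n, test O (phi n)) /\ Hcvg k O phi f.

Definition simply_connected O : Prop :=
  connected O /\
  forall c : R -> plane R,
    {within `[0, 1], continuous c} -> c @` `[0, 1] `<=` O -> c 0 = c 1 ->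
    exists h : plane R -> plane R,
      [/\ {within `[0, 1] `*` `[0, 1], continuous h},
          h @` (`[0, 1] `*` `[0, 1]) `<=` O,
          forall a, a \in `[0, 1] -> h (a, 0) = c a,
          forall b, b \in `[0, 1] -> h (0, b) = h (1, b) &
          forall a, a \in `[0, 1] -> h (a, 1) = h (0, 1)].

(* Coordinates (a, b) in the orthonormal frame (e, e^perp) with origin x0. *)
Definition frame (x0 e : plane R) (a b : R) : plane R :=
  (x0.1 + a * e.1 - b * e.2, x0.2 + a * e.2 + b * e.1).

(* In the box ]-r, r[ x ]-k, k[ of that frame, O is the subgraph of gam, so that
   its boundary there is the graph of gam. *)
Definition graph_chart O (x0 e : plane R) (r k : R) (gam : R -> R) : Prop :=
  [/\ 0 < r, 0 < k, e.1 ^+ 2 + e.2 ^+ 2 = 1,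
      forall a, `|a| < r -> `|gam a| < k &
      forall a b, `|a| < r -> `|b| < k -> (O (frame x0 e a b) <-> b < gam a)].

Definition lipschitz_chart O (x0 e : plane R) (r k : R) (gam : R -> R) : Prop :=
  graph_chart O x0 e r k gam /\
  exists M : R, forall a b, `|a| < r -> `|b| < r ->
    `|gam a - gam b| <= M * `|a - b|.

Definition holder2_chart (alpha : R) O (x0 e : plane R) (r k : R)
    (gam : R -> R) : Prop :=
  [/\ graph_chart O x0 e r k gam,
      forall a, `|a| < r -> derivable gam a 1 /\ derivable ('D_1 gam) a 1 &
      exists M : R, forall a b, `|a| < r -> `|b| < r ->
        `|'D_1 ('D_1 gam) a - 'D_1 ('D_1 gam) b| <= M * `|a - b| `^ alpha].

Definition lipschitz_open O : Prop :=
  open O /\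
  forall x0, (closure O `\` O) x0 ->
    exists e r k gam, lipschitz_chart O x0 e r k gam /\ gam 0 = 0.

Definition C2alpha_open (alpha : R) O : Prop :=
  open O /\
  forall x0, (closure O `\` O) x0 ->
    exists e r k gam, holder2_chart alpha O x0 e r k gam /\ gam 0 = 0.

(* g is the trace of f on the boundary: the trace map is the closure of the
   restriction map from smooth functions on the plane, with the H^1(O) topology,
   to L^2_loc of the boundary.  For Lipschitz gam, da and the arc length are
   comparable on the graph of gam. *)
Definition is_trace O f g : Prop :=
  exists phi : nat -> plane R -> R,
    [/\ forall n, smooth (phi n), Hcvg 1 O phi f &
        forall x0 e r k gam, lipschitz_chart O x0 e r k gam ->
          (\int[@lebesgue_measure R]_(a in `](- r)%R, r[)
             ((phi n (frame x0 e a (gam a)) - g (frame x0 e a (gam a))) ^+ 2)%:E)%E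
            @[n --> \oo] --> 0%E].

Definition const_on_boundary O f : Prop :=
  Hk 1 O f /\ exists c : R, is_trace O f (fun=> c).

Definition divfree O u : Prop :=
  ae_on O (fun x => \sum_(i < 2) wD O [:: i] (u i) x = 0).

Definition stokes_eigenfield O lam u : Prop :=
  [/\ forall j, H0k 1 O (u j), divfree O u &
      forall eta, (forall j, H0k 1 O (eta j)) -> divfree O eta ->
        \int[area]_(x in O)
          (\sum_(i < 2) \sum_(j < 2) wD O [:: i] (u j) x * wD O [:: i] (eta j) x) =
        lam * \int[area]_(x in O) (\sum_(j < 2) u j x * eta j x)].

Definition harmonic O p : Prop :=
  (forall x, O x ->
     (forall s, (size s <= 2)%N -> {for x, continuous (pd s p)}) /\
     (forall s i, (size s < 2)%N -> derivable (pd s p) x (unit_vec i))) /\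
  (forall x, O x -> lap p x = 0).

(* Delta u + lam u = grad p in the sense of distributions. *)
Definition stokes_pressure O lam u p : Prop :=
  harmonic O p /\
  forall (j : 'I_2) phi, test O phi ->
    \int[area]_(x in O) (u j x * lap phi x + lam * (u j x * phi x)) =
    - \int[area]_(x in O) (p x * pd [:: j] phi x).

Definition buckling_eigenfunction O lam psi : Prop :=
  H0k 2 O psi /\
  forall phi, H0k 2 O phi ->
    \int[area]_(x in O) (wlap O psi x * wlap O phi x) =
    lam * \int[area]_(x in O)
            (\sum_(i < 2) wD O [:: i] psi x * wD O [:: i] phi x).

(* Delta f = - lam f in the sense of distributions. *)
Definition weak_helmholtz O lam f : Prop :=
  forall phi, test O phi ->
    \int[area]_(x in O) (f x * lap phi x + lam * (f x * phi x)) = 0.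

Definition vorticity_eigenfunction O lam w : Prop :=
  [/\ L2 O w, weak_helmholtz O lam w &
      forall h, Hk 1 O h -> weak_helmholtz O 0 h ->
        \int[area]_(x in O) (w x * h x) = 0].

Definition curl O u (x : plane R) : R :=
  wD O [:: ord0] (u ord_max) x - wD O [:: ord_max] (u ord0) x.

Definition grad_perp O f (i : 'I_2) (x : plane R) : R :=
  if i == ord0 then - wD O [:: ord_max] f x else wD O [:: ord0] f x.

Definition weak_neumann O p : Prop :=
  Hk 1 O p /\
  forall q, Hk 1 O q ->
    \int[area]_(x in O) (\sum_(i < 2) wD O [:: i] p x * wD O [:: i] q x) = 0.

Definition grad_zero O p : Prop :=
  forall x, O x -> forall i, 'D_(unit_vec i) p x = 0.

End Plane.

Section NavierStokes.
Context {R : realType}.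
Implicit Types (O : set (plane R)) (f phi pi : spacetime R -> R)
  (v : 'I_2 -> spacetime R -> R) (u : 'I_2 -> plane R -> R).

Definition cylinder O : set (spacetime R) := [set z | O z.1 /\ 0 < z.2].

Definition L1loc_cyl O f : Prop :=
  measurable_fun (cylinder O) f /\
  forall K, compact K -> K `<=` cylinder O ->
    volume.-integrable K (EFin \o f).

Definition dx (i : 'I_2) : spacetime R := (unit_vec i, 0).

Definition dt : spacetime R := (0, 1).

(* G i j is a jointly measurable version of the weak derivative of v^j along x_i;
   the momentum equation, with convection term sum_i v^i G i j, holds in the
   sense of distributions on the cylinder. *)
Definition navier_stokes O (nu : R) v u : Prop :=
  exists (G : 'I_2 -> 'I_2 -> spacetime R -> R) (pi : spacetime R -> R),
    [/\ [/\ forall j, L1loc_cyl O (v j),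
            forall i j, L1loc_cyl O (G i j),
            forall j, L1loc_cyl O (fun z => \sum_(i < 2) v i z * G i j z) &
            L1loc_cyl O pi],
        forall t, 0 < t ->
          [/\ forall j, H0k 1 O (fun x => v j (x, t)),
              forall i j,
                is_wD O [:: i] (fun x => v j (x, t)) (fun x => G i j (x, t)) &
              ae_on O (fun x => \sum_(i < 2) G i i (x, t) = 0)],
        forall (j : 'I_2) phi, test (cylinder O) phi ->
          \int[volume]_(z in cylinder O)
            (- (v j z * iter_deriv [:: dt] phi z)
             + (\sum_(i < 2) v i z * G i j z) * phi z
             - nu * (v j z * \sum_(i < 2) iter_deriv [:: dx i; dx i] phi z)
             - pi z * iter_deriv [:: dx j] phi z) = 0 &
        forall j,
          ae_on O (fun x => v j (x, 0) = u j x) /\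
          (\int[area]_(x in O) ((v j (x, t) - u j x) ^+ 2)%:E)%E
            @[t --> 0^'+] --> 0%E].

Definition decaying (nu lam : R) u (j : 'I_2) (z : spacetime R) : R :=
  expR (- (nu * lam * z.2)) * u j z.1.

End NavierStokes.

(* Main.v *)
Require Import Defs.
From HB Require Import structures.
From mathcomp Require Import all_boot all_order all_algebra.
From mathcomp Require Import all_classical all_reals all_analysis.
From mathcomp Require Import measurable_realfun.
From mathcomp Require Import ring lra.
Import Order.TTheory GRing.Theory Num.Theory.
Import numFieldNormedType.Exports.
Set Implicit Arguments.
Unset Strict Implicit.
Unset Printing Implicit Defensive.
Local Open Scope classical_set_scope.
Local Open Scope ring_scope.

(** Put [F = (- d_2 p, d_1 p)].  Since [u = (d_2 psi, - d_1 psi)], the Stokes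
system says that [q = Delta psi + lam psi] has weak gradient [F], so that
[grad p = 0] means [Delta psi = k - lam psi] for a constant [k]; this gives the
constant traces, and [(u . grad) u = grad (|u|^2 / 2) - Delta psi grad psi] is
then a gradient, which the pressure of the decaying solution absorbs.

Conversely, [F] is divergence-free.  If [Delta psi] has a constant trace, then
[F = grad Delta psi + lam grad psi] is square integrable and orthogonal to both
terms, hence zero.

If the decaying field solves the Navier-Stokes system, then [curl ((u . grad) u) = 0],
that is [grad psi . grad p = 0].  On [E = {grad p <> 0}] we get
[grad psi = mu F], where [mu] satisfies
[grad mu = - W F / |F|^2] with [W = lam psi - q], and the symmetry of the second
derivatives of [mu] makes [grad p / |grad p|^2] an affine field
[(b + a y, - c - a x)] near the points of [E] where [W <> 0].  Along its flow
lines [psi] and [W] are constant and [p] grows at unit rate; if [psi] and [W] do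
not vanish, then the line never leaves [E], because [psi] vanishes outside of
[Omega].  If [a <> 0] the line is a closed circle, which contradicts the growth of
[p]; if [a = 0] the lines fill a half-strip of infinite area.  Hence [W = 0] on
[E], so [F = lam grad psi] on [E], and [F] is square integrable and orthogonal to
[grad psi]: [F = 0]. *)

Definition measurable_base (T : topologicalType) (M : set (set T)) :=
  exists B : nat -> set T, (forall n, M (B n)) /\
    forall x U, nbhs x U -> exists n, B n x /\ B n `<=` U.

Lemma measurable_base_open (T : topologicalType) (M : set (set T)) (U : set T) :
  (forall F : nat -> set T, (forall n, M (F n)) -> M (\bigcup_n F n)) -> M set0 ->
  measurable_base M -> open U -> M U.
Proof.
move=> McU M0 [B [MB HB]] oU.
(* An open set is the union of the basic sets that it contains; the other indices contribute
   [set0]. *)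
have -> : U = \bigcup_n (if `[< B n `<=` U >] then B n else set0).
  apply/seteqP; split=> [x Ux|x [n _]]; last by case: asboolP => // BU /BU.
  have [n [Bx BU]] := HB _ _ (open_nbhs_nbhs (conj oU Ux)).
  by exists n => //; case: asboolP.
by apply: McU => n; case: asboolP.
Qed.

(** The product sigma-algebra is generated by measurable rectangles, the product topology by open
    ones; a countable base connects the two. It passes to products because a pair of indices is
    coded by one number; numbers that code no pair get an arbitrary rectangle. *)
Lemma measurable_baseX (S T : topologicalType) (M1 : set (set S)) (M2 : set (set T))
    (M : set (set (S * T))) :
  (forall A B, M1 A -> M2 B -> M (A `*` B)) ->
  measurable_base M1 -> measurable_base M2 -> measurable_base M.
Proof.
move=> MX [B1 [MB1 HB1]] [B2 [MB2 HB2]].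
exists (fun n => if @unpickle (nat * nat)%type n is Some (i, j) then B1 i `*` B2 j else B1 0%N `*` B2 0%N); split.
  by move=> n; case: unpickle => [[i j]|]; apply: MX.
move=> [x y] U [[/= P Q] [/= Px Qy] PQU].
have [i [Bi Pi]] := HB1 _ _ Px; have [j [Bj Qj]] := HB2 _ _ Qy.
exists (pickle (i, j)); rewrite pickleK; split => // -[a b] [/= Ba Bb].
by apply: PQU; split; [exact: Pi|exact: Qj].
Qed.

(** * Measurability and Fubini *)

Section MeasurableSets.
Context {R : realType}.

Lemma measurable_base_real : @measurable_base R (@measurable _ (measurableTypeR R)).
Proof.
exists (fun n => if @unpickle (rat * rat)%type n is Some (p, q) then `](ratr p), (ratr q)[%classic else set0).
split; first by move=> n; case: unpickle => [[p q]|//]; exact: measurable_itv.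
move=> x U /nbhs_ballP[e /= e0 xU].
have [p pP] := @rat_in_itvoo R (x - e) x ltac:(by rewrite ltrBlDr ltrDl).
have [q qP] := @rat_in_itvoo R x (x + e) ltac:(by rewrite ltrDl).
move: pP qP; rewrite !in_itv/= => /andP[p1 p2] /andP[q1 q2].
exists (pickle (p, q)); rewrite pickleK /= in_itv/= p2 q1; split => // y /=.
rewrite in_itv/= => /andP[y1 y2]; apply: xU; rewrite /ball/= ltr_norml.
by apply/andP; split; lra.
Qed.

Lemma open_measurable2 (U : set (plane R)) : open U ->
  measurable (U : set (measurableTypeR R * measurableTypeR R)%type).
Proof.
apply: (@measurable_base_open _ (@measurable _ (measurableTypeR R * measurableTypeR R)%type)).
- by move=> F mF; exact: bigcup_measurable.
- exact: measurable0.
- apply: (@measurable_baseX _ _ (@measurable _ (measurableTypeR R)) (@measurable _ (measurableTypeR R))).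
  + by move=> A B; exact: measurableX.
  + exact: measurable_base_real.
  + exact: measurable_base_real.
Qed.

Lemma open_measurable3 (U : set (spacetime R)) : open U ->
  measurable (U : set (measurableTypeR R * measurableTypeR R * measurableTypeR R)%type).
Proof.
apply: (@measurable_base_open _
  (@measurable _ (measurableTypeR R * measurableTypeR R * measurableTypeR R)%type)).
- by move=> F mF; exact: bigcup_measurable.
- exact: measurable0.
- apply: (@measurable_baseX _ _
    (@measurable _ (measurableTypeR R * measurableTypeR R)%type) (@measurable _ (measurableTypeR R))).
  + by move=> A B; exact: measurableX.
  + apply: (@measurable_baseX _ _ (@measurable _ (measurableTypeR R)) (@measurable _ (measurableTypeR R))).
    * by move=> A B; exact: measurableX.
    * exact: measurable_base_real.
    * exact: measurable_base_real.
  + exact: measurable_base_real.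
Qed.

Lemma compact_measurable2 (K : set (plane R)) : compact K ->
  measurable (K : set (measurableTypeR R * measurableTypeR R)%type).
Proof.
move=> /compact_closed cK.
rewrite -[K]setCK; apply: measurableC; apply: open_measurable2.
by apply: closed_openC; apply: cK; exact: norm_hausdorff.
Qed.

Lemma compact_measurable3 (K : set (spacetime R)) : compact K ->
  measurable (K : set (measurableTypeR R * measurableTypeR R * measurableTypeR R)%type).
Proof.
move=> /compact_closed cK.
rewrite -[K]setCK; apply: measurableC; apply: open_measurable3.
by apply: closed_openC; apply: cK; exact: norm_hausdorff.
Qed.

Lemma open_preimage_open (T : topologicalType) (O : set T) (f : T -> R) (A : set R) :
  open O -> (forall x, O x -> {for x, continuous f}) -> open A -> open (O `&` f @^-1` A).
Proof.
move=> oO cf oA; rewrite openE => x [Ox Ax]; apply: filterI.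
  by apply: open_nbhs_nbhs; split.
by apply: (cf x Ox); apply: open_nbhs_nbhs; split.
Qed.

Lemma continuous_measurable2 (O : set (plane R)) (f : plane R -> R) :
  open O -> (forall x, O x -> {for x, continuous f}) ->
  measurable_fun (O : set (measurableTypeR R * measurableTypeR R)%type) f.
Proof.
move=> oO cf; apply: (measurability _ (RGenOpens.measurableE R)).
move=> _ [_ [a [b ->] <-]]; apply: open_measurable2.
by apply: open_preimage_open => //; exact: interval_open.
Qed.

Lemma continuous_measurable3 (O : set (spacetime R)) (f : spacetime R -> R) :
  open O -> (forall x, O x -> {for x, continuous f}) ->
  measurable_fun (O : set (measurableTypeR R * measurableTypeR R * measurableTypeR R)%type) f.
Proof.
move=> oO cf; apply: (measurability _ (RGenOpens.measurableE R)).
move=> _ [_ [a [b ->] <-]]; apply: open_measurable3.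
by apply: open_preimage_open => //; exact: interval_open.
Qed.

Definition box (a b c d : R) : set (plane R) := `[a, b]%classic `*` `[c, d]%classic.

Lemma box_compact a b c d : compact (box a b c d).
Proof. by apply: compact_setX; exact: segment_compact. Qed.

Lemma box_measurable a b c d :
  measurable (box a b c d : set (measurableTypeR R * measurableTypeR R)%type).
Proof. by apply: measurableX; exact: measurable_itv. Qed.

Lemma box_area a b c d : (area (box a b c d) < +oo)%E.
Proof.
rewrite /area/= product_measure1E; [|exact: measurable_itv|exact: measurable_itv].
rewrite [X in (X * _)%E](_ : _ = lebesgue_measure `[a, b]%classic)// [X in (_ * X)%E](_ : _ = lebesgue_measure `[c, d]%classic)//.
rewrite !lebesgue_measure_itv /=.
by case: ifP => _; case: ifP => _; rewrite ?mul0e ?mule0 // -?EFinB -?EFinM ltry.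
Qed.

Lemma compact_box (K : set (plane R)) : compact K ->
  exists2 M : R, 0 < M & K `<=` box (- M) M (- M) M.
Proof.
move=> /compact_bounded[M [_ HM]]; exists (`|M| + 1); first by rewrite ltr_wpDl.
move=> [x y] Kx; have := HM (`|M| + 1) ltac:(by rewrite (le_lt_trans (ler_norm _))// ltrDl) _ Kx.
rewrite /= prod_normE /= ge_max => /andP[]; rewrite !ler_norml => h1 h2.
by split; rewrite /= in_itv.
Qed.

Lemma compact_area (K : set (plane R)) : compact K -> (area K < +oo)%E.
Proof.
move=> cK; have [M M0 KM] := compact_box cK.
apply: le_lt_trans (box_area (- M) M (- M) M).
apply: le_measure => //; rewrite inE; [exact: compact_measurable2|exact: box_measurable].
Qed.

Lemma compact_itv_sub (K : set R) : compact K ->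
  exists2 M : R, 0 < M & K `<=` `[- M, M].
Proof.
move=> /compact_bounded[M [_ HM]]; exists (`|M| + 1); first by rewrite ltr_wpDl.
move=> x Kx; have := HM (`|M| + 1) ltac:(by rewrite (le_lt_trans (ler_norm _))// ltrDl) _ Kx.
by rewrite /= ler_norml in_itv.
Qed.

Lemma continuous_bounded_on (T : topologicalType) (K : set T) (f : T -> R) :
  compact K -> (forall x, K x -> {for x, continuous f}) ->
  exists2 M : R, 0 < M & forall x, K x -> `|f x| <= M.
Proof.
move=> cK cf.
have : compact (f @` K).
  apply: continuous_compact => //; apply: continuous_in_subspaceT.
  by move=> x /set_mem Kx; exact: cf.
move=> /compact_itv_sub[M M0 HM]; exists M => // x Kx.
by have := HM (f x) (imageP f Kx); rewrite /= in_itv/= ler_norml.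
Qed.

Lemma bounded_onP (T : Type) (K : set T) (f : T -> R) M :
  (forall x, K x -> `|f x| <= M) -> [bounded f x | x in K].
Proof.
move=> fM; exists M; split; first exact: num_real.
by move=> y My x Kx; exact: le_trans (fM _ Kx) (ltW My).
Qed.

Lemma continuous_integrable2 (O K : set (plane R)) (f : plane R -> R) :
  open O -> (forall x, O x -> {for x, continuous f}) -> compact K -> K `<=` O ->
  area.-integrable K (EFin \o f).
Proof.
move=> oO cf cK KO.
have [M M0 fM] : exists2 M : R, 0 < M & forall x, K x -> `|f x| <= M.
  by apply: continuous_bounded_on => // x /KO; exact: cf.
apply: measurable_bounded_integrable.
- exact: compact_measurable2.
- exact: compact_area.
- apply: measurable_funS KO _; [exact: open_measurable2|].
  exact: continuous_measurable2.
- exact: bounded_onP fM.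
Qed.

End MeasurableSets.

Section RealIntegral.
Context d {T : measurableType d} {R : realType} (mu : {measure set T -> \bar R}).
Implicit Types (D : set T) (f g : T -> R).

Lemma ae_imply (P Q : T -> Prop) : {ae mu, forall x, P x} -> (forall x, P x -> Q x) ->
  {ae mu, forall x, Q x}.
Proof. by move=> aP PQ; apply: filterS aP. Qed.

Lemma ae_imply2 (P Q S : T -> Prop) : {ae mu, forall x, P x} -> {ae mu, forall x, Q x} ->
  (forall x, P x -> Q x -> S x) -> {ae mu, forall x, S x}.
Proof. by move=> aP aQ PQ; apply: filterS2 aP aQ. Qed.

Lemma ae_forall (P : T -> Prop) : (forall x, P x) -> {ae mu, forall x, P x}.
Proof. by move=> aP; exact: aeW. Qed.

Lemma integrable_mfun D f : mu.-integrable D (EFin \o f) -> measurable_fun D f.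
Proof. by case/integrableP => /measurable_EFinP. Qed.

Lemma ae_eq_Rintegral D f g : measurable D -> measurable_fun D f -> measurable_fun D g ->
  {ae mu, forall x, D x -> f x = g x} ->
  \int[mu]_(x in D) f x = \int[mu]_(x in D) g x.
Proof.
move=> mD mf mg fg; rewrite /Rintegral; congr fine.
apply: ae_eq_integral => //; [exact/measurable_EFinP|exact/measurable_EFinP|].
by apply: filterS fg => x h Dx; rewrite h.
Qed.

Lemma ae_eq_integrable D f g : measurable D -> measurable_fun D g ->
  {ae mu, forall x, D x -> f x = g x} ->
  mu.-integrable D (EFin \o f) -> mu.-integrable D (EFin \o g).
Proof.
move=> mD mg fg fi; apply/integrableP; split; first exact/measurable_EFinP.
case/integrableP : (fi) => mf; apply: le_lt_trans; rewrite le_eqVlt; apply/orP; left; apply/eqP.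
apply: ae_eq_integral => //.
- by apply: measurableT_comp => //; exact/measurable_EFinP.
- by apply: measurableT_comp => //.
- by apply: filterS fg => x h Dx /=; rewrite h.
Qed.

Lemma integrableD_EFin D f g : measurable D ->
  mu.-integrable D (EFin \o f) -> mu.-integrable D (EFin \o g) ->
  mu.-integrable D (EFin \o (fun x => f x + g x)).
Proof. by move=> mD fi gi; have := integrableD mD fi gi. Qed.

Lemma integrableB_EFin D f g : measurable D ->
  mu.-integrable D (EFin \o f) -> mu.-integrable D (EFin \o g) ->
  mu.-integrable D (EFin \o (fun x => f x - g x)).
Proof. by move=> mD fi gi; have := integrableB mD fi gi. Qed.

Lemma integrableZ_EFin D k f : measurable D ->
  mu.-integrable D (EFin \o f) -> mu.-integrable D (EFin \o (fun x => k * f x)).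
Proof. by move=> mD fi; have := integrableZl mD k fi. Qed.

Lemma integrableN_EFin D f : measurable D ->
  mu.-integrable D (EFin \o f) -> mu.-integrable D (EFin \o (fun x => - f x)).
Proof. by move=> mD fi; have := integrableN fi. Qed.

Lemma RintegralN D f : measurable D -> mu.-integrable D (EFin \o f) ->
  \int[mu]_(x in D) (- f x) = - \int[mu]_(x in D) f x.
Proof.
move=> mD fi; rewrite -mulN1r -RintegralZl//; apply: eq_Rintegral => x _.
by rewrite mulN1r.
Qed.

Lemma Rintegral0 D : \int[mu]_(x in D) (0 : R) = 0.
Proof. by rewrite /Rintegral integral0. Qed.

Lemma integrable_bndM D f (h : T -> R) (M : R) : measurable D -> mu.-integrable D (EFin \o f) ->
  measurable_fun D h -> (forall x, D x -> `|h x| <= M) ->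
  mu.-integrable D (EFin \o (fun x => f x * h x)).
Proof.
move=> mD fi mh hM; have := integrableMr mD mh (bounded_onP hM) fi.
by apply: eq_integrable => // x _ /=; rewrite mulrC EFinM.
Qed.

Lemma integrable_le D f g : measurable D -> measurable_fun D f ->
  (forall x, D x -> `|f x| <= g x) -> mu.-integrable D (EFin \o g) ->
  mu.-integrable D (EFin \o f).
Proof.
move=> mD mf fg gi; apply: le_integrable gi => //; first exact/measurable_EFinP.
by move=> x Dx /=; rewrite lee_fin; apply: le_trans (fg x Dx) (ler_norm _).
Qed.

Lemma ae_zero_of_integral_zero D f : measurable D -> mu.-integrable D (EFin \o f) ->
  (forall x, D x -> 0 <= f x) -> \int[mu]_(x in D) f x = 0 ->
  {ae mu, forall x, D x -> f x = 0}.
Proof.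
move=> mD fi f0 If.
have mf : measurable_fun D f by exact: integrable_mfun.
have : (\int[mu]_(x in D) `|(f x)%:E| = 0)%E.
  rewrite -[0%E]/((0:R)%:E) -If /Rintegral fineK; last first.
    by apply: integrable_fin_num.
  by apply: eq_integral => x /set_mem Dx; rewrite gee0_abs// lee_fin f0.
move/(ae_eq_integral_abs _ mD); rewrite /ae_eq => H.
have : {ae mu, forall x, D x -> (f x)%:E = 0%E} by apply: H; exact/measurable_EFinP.
by apply: filterS => x h Dx; have [] := h Dx.
Qed.

Lemma le_normr_RintegralM D f g : measurable D -> mu.-integrable D (EFin \o f) ->
  mu.-integrable D (EFin \o g) -> (forall x, D x -> `|f x| <= g x) ->
  `|\int[mu]_(x in D) f x| <= \int[mu]_(x in D) g x.
Proof.
move=> mD fi gi fg; apply: le_trans (le_normr_Rintegral mD fi) _.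
apply: le_Rintegral => //.
have := integrable_abse fi; apply: eq_integrable => //.
Qed.

End RealIntegral.

Section FubiniReal.
Context d1 d2 {T1 : measurableType d1} {T2 : measurableType d2} {R : realType}.
Context (m1 : {sigma_finite_measure set T1 -> \bar R}).
Context (m2 : {sigma_finite_measure set T2 -> \bar R}).
Variable f : T1 * T2 -> R.
Hypothesis fi : (m1 \x m2)%E.-integrable setT (EFin \o f).

Let integrable_G : m2.-integrable setT (fubini_G m1 (EFin \o f)).
Proof.
have mf : measurable_fun setT (EFin \o f) by exact: measurable_int fi.
have h := (integrable21ltyP m1 m2 mf).1 fi.
apply/integrableP; split; first exact: (measurable_fubini_G fi).
apply: le_lt_trans h; apply: ge0_le_integral => //.
- by apply: measurableT_comp => //; exact: (measurable_fubini_G fi).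
- apply: (@measurable_fun_fubini_tonelli_G _ _ _ _ _ m1 (fun z => `|(f z)%:E|%E)) => //.
  by apply: measurableT_comp.
- move=> y _; apply: le_abse_integral => //.
  by apply: (measurableT_comp mf); exact: measurable_pair2.
Qed.

(** The real inner integral is [fine] of the extended one, which is finite only for almost every
    [x]; the two iterated integrals are therefore compared almost everywhere. *)
Lemma Rintegral_prod12 :
  \int[(m1 \x m2)%E]_z f z = \int[m1]_x \int[m2]_y f (x, y).
Proof.
rewrite /Rintegral -integral12_prod_meas1//; congr fine.
have iF := integrable_fubini_F fi.
apply: ae_eq_integral => //.
- exact: measurable_int iF.
- apply/measurable_EFinP.
  by apply: (measurableT_comp _ (measurable_int _ iF)).
- have := integrable_ae measurableT iF; apply: filterS => x h _.
  by rewrite [LHS]/= -[LHS]fineK//; exact: h.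
Qed.

Lemma Rintegral_prod21 :
  \int[(m1 \x m2)%E]_z f z = \int[m2]_y \int[m1]_x f (x, y).
Proof.
rewrite /Rintegral -integral21_prod_meas1//; congr fine.
have iF := integrable_G.
apply: ae_eq_integral => //.
- exact: measurable_int iF.
- apply/measurable_EFinP.
  by apply: (measurableT_comp _ (measurable_int _ iF)).
- have := integrable_ae measurableT iF; apply: filterS => x h _.
  by rewrite [LHS]/= -[LHS]fineK//; exact: h.
Qed.

Lemma integrable_prod1 :
  m1.-integrable setT (EFin \o (fun x => \int[m2]_y f (x, y))).
Proof.
have iF := integrable_fubini_F fi.
have mF : measurable_fun setT (fun x => \int[m2]_y f (x, y)).
  by apply: (measurableT_comp _ (measurable_int _ iF)).
apply/integrableP; split; first exact/measurable_EFinP.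
case/integrableP : (iF) => mf; apply: le_lt_trans; rewrite le_eqVlt; apply/orP; left; apply/eqP.
apply: ae_eq_integral => //.
- by apply: measurableT_comp => //; exact/measurable_EFinP.
- by apply: measurableT_comp.
- have := integrable_ae measurableT iF; apply: filterS => x h _ /=.
  by rewrite -[in RHS](fineK (h I)).
Qed.

Lemma integrable_prod2 :
  m2.-integrable setT (EFin \o (fun y => \int[m1]_x f (x, y))).
Proof.
have iF := integrable_G.
have mF : measurable_fun setT (fun y => \int[m1]_x f (x, y)).
  by apply: (measurableT_comp _ (measurable_int _ iF)).
apply/integrableP; split; first exact/measurable_EFinP.
case/integrableP : (iF) => mf; apply: le_lt_trans; rewrite le_eqVlt; apply/orP; left; apply/eqP.
apply: ae_eq_integral => //.
- by apply: measurableT_comp => //; exact/measurable_EFinP.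
- by apply: measurableT_comp.
- have := integrable_ae measurableT iF; apply: filterS => x h _ /=.
  by rewrite -[in RHS](fineK (h I)).
Qed.

End FubiniReal.

Lemma is_derive_eq' (R : realType) (V : normedModType R) (f : V -> R) x v d d' :
  is_derive x v f d -> d = d' -> is_derive x v f d'.
Proof. by move=> H <-. Qed.

Lemma is_deriveP (R : realType) (V : normedModType R) (f : V -> R) x v d : is_derive x v f d <->
  (fun t : R => t^-1 * (f (t *: v + x) - f x)) @ 0^' --> d.
Proof.
split=> [[fd <-]|fd]; first exact: fd.
have fd' : derivable f x v by apply/cvg_ex; exists d.
by apply: DeriveDef => //; apply/cvg_lim.
Qed.

Lemma is_derive_derivable (R : realType) (V : normedModType R) (f : V -> R) x v d :
  is_derive x v f d -> derivable f x v.
Proof. by case. Qed.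

(** * Derivatives, smooth functions and cutoffs *)

Section Derivatives.
Context {R : realType} {V : normedModType R}.
Implicit Types (f g : V -> R) (x v : V) (h : R -> R).

Lemma is_deriveE f x v d : is_derive x v f d -> 'D_v f x = d.
Proof. by case. Qed.

Lemma derivable_is_derive f x v : derivable f x v -> is_derive x v f ('D_v f x).
Proof. by move=> fd; apply: DeriveDef. Qed.

Lemma is_derive_add f g x v a b : is_derive x v f a -> is_derive x v g b ->
  is_derive x v (fun y => f y + g y) (a + b).
Proof. by move=> fa gb; apply: is_deriveD. Qed.

Lemma is_derive_opp f x v a : is_derive x v f a -> is_derive x v (fun y => - f y) (- a).
Proof. by move=> fa; apply: is_deriveN. Qed.

Lemma is_derive_sub f g x v a b : is_derive x v f a -> is_derive x v g b ->
  is_derive x v (fun y => f y - g y) (a - b).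
Proof. by move=> fa gb; apply: is_deriveB. Qed.

Lemma is_derive_mul f g x v a b : is_derive x v f a -> is_derive x v g b ->
  is_derive x v (fun y => f y * g y) (f x * b + g x * a).
Proof. by move=> fa gb; apply: is_deriveM. Qed.

Lemma is_derive_const (c : R) x v : is_derive x v (fun _ => c) 0.
Proof. exact: is_derive_cst. Qed.

Lemma is_derive_scale (c : R) f x v a : is_derive x v f a ->
  is_derive x v (fun y => c * f y) (c * a).
Proof.
move=> fa; apply: is_derive_eq' (is_derive_mul (is_derive_const c x v) fa) _.
by rewrite mulr0 addr0.
Qed.

Lemma is_derive_exp f x v a n : is_derive x v f a ->
  is_derive x v (fun y => f y ^+ n) (n%:R * f x ^+ n.-1 * a).
Proof.
move=> fa; elim: n => [|n IH].
  under eq_fun do rewrite expr0.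
  by apply: is_derive_eq' (is_derive_const 1 x v) _; rewrite !mul0r.
under eq_fun do rewrite exprS.
apply: is_derive_eq' (is_derive_mul fa IH) _ => /=.
case: n {IH} => [|n] /=; first by rewrite !mul0r mulr0 add0r expr0 !mul1r.
by rewrite [in RHS]mulrSr !exprS; ring.
Qed.

(** Directional derivatives are derivatives along lines, which brings them within reach of the
    one-variable chain rule. *)
Lemma is_derive_line f x v d (t : R) :
  is_derive (t *: v + x) v f d <-> is_derive t 1 (fun s : R => f (s *: v + x)) d.
Proof.
apply: iff_trans (is_deriveP f (t *: v + x) v d) _.
apply: iff_trans _ (iff_sym (is_deriveP (fun s : R => f (s *: v + x)) t 1 d)).
have -> // : (fun s : R => s^-1 * (f (s *: v + (t *: v + x)) - f (t *: v + x))) =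
  (fun s : R => s^-1 * (f ((s *: (1 : R) + t) *: v + x) - f (t *: v + x))).
by apply/funext => s; rewrite scalerDl addrA [s *: 1]mulr1.
Qed.

Lemma is_derive_line0 f x v d :
  is_derive x v f d <-> is_derive (0 : R) 1 (fun s : R => f (s *: v + x)) d.
Proof. by rewrite -is_derive_line scale0r add0r. Qed.

Lemma is_derive_comp1 h f x v a b : is_derive (f x) 1 h a -> is_derive x v f b ->
  is_derive x v (fun y => h (f y)) (a * b).
Proof.
move=> ha /is_derive_line0 fb; apply/is_derive_line0.
by apply: (@is_derive1_comp _ h (fun s : R => f (s *: v + x))); rewrite ?scale0r ?add0r.
Qed.

Lemma is_derive_inv f x v a : f x != 0 -> is_derive x v f a ->
  is_derive x v (fun y => (f y)^-1) (- (f x) ^- 2 * a).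
Proof.
move=> f0 fa; apply: (@is_derive_comp1 (fun y => y^-1)) fa.
apply: is_derive_eq' (@is_deriveV _ id (f x) 1 1 f0 (is_derive_id _ _)) _.
by rewrite /GRing.scale /= mulr1.
Qed.

Lemma is_derive_near f g x v a : (\near x, f x = g x) -> is_derive x v f a ->
  is_derive x v g a.
Proof. exact: near_eq_is_derive. Qed.

Lemma continuous_near f g x : (\near x, f x = g x) -> {for x, continuous f} ->
  {for x, continuous g}.
Proof.
move=> fg cf; have fgx : f x = g x by exact: nbhs_singleton fg.
have H : f y @[y --> x] --> g x by rewrite -fgx; exact: cf.
apply: cvg_trans H; apply: near_eq_cvg.
by apply: filterS fg => y ->.
Qed.

Lemma is_derive_continuous1 (f : R -> R) (x d : R) : is_derive x 1 f d ->
  {for x, continuous f}.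
Proof. by case=> fd _; apply/differentiable_continuous/derivable1_diffP. Qed.

Lemma continuous_add f g x : {for x, continuous f} -> {for x, continuous g} ->
  {for x, continuous (fun y => f y + g y)}.
Proof. exact: continuousD. Qed.

Lemma continuous_sub f g x : {for x, continuous f} -> {for x, continuous g} ->
  {for x, continuous (fun y => f y - g y)}.
Proof. exact: continuousB. Qed.

Lemma continuous_opp f x : {for x, continuous f} -> {for x, continuous (fun y => - f y)}.
Proof. exact: continuousN. Qed.

Lemma continuous_mul f g x : {for x, continuous f} -> {for x, continuous g} ->
  {for x, continuous (fun y => f y * g y)}.
Proof. exact: continuousM. Qed.

Lemma continuous_inv f x : f x != 0 -> {for x, continuous f} ->
  {for x, continuous (fun y => (f y)^-1)}.
Proof. exact: continuousV. Qed.

Lemma continuous_const (c : R) x : {for x, continuous (fun _ : V => c)}.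
Proof. exact: cst_continuous. Qed.

Lemma continuous_comp1 h f x : {for x, continuous f} -> {for f x, continuous h} ->
  {for x, continuous (fun y => h (f y))}.
Proof. by move=> cf ch; exact: (continuous_comp cf ch). Qed.

End Derivatives.

Section SmoothFunctions.
Context {R : realType} {V : normedModType R}.
Implicit Types (f g : V -> R) (x v : V) (s : seq V).

Inductive alg (G : set (V -> R)) : (V -> R) -> Prop :=
| alg_gen f : G f -> alg G f
| alg_cst (c : R) : alg G (fun=> c)
| alg_add f g : alg G f -> alg G g -> alg G (fun x => f x + g x)
| alg_mul f g : alg G f -> alg G g -> alg G (fun x => f x * g x).

(** Smoothness speaks of all iterated derivatives, so an induction on a single function does not
    close. The algebra generated by [G] is stable under every directional derivative, by the Leibniz
    rule, hence contains all iterated derivatives of its members. *)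
Lemma alg_smooth (G : set (V -> R)) :
  (forall f, G f -> forall x, {for x, continuous f} /\ forall v, derivable f x v) ->
  (forall f v, G f -> alg G (fun x => 'D_v f x)) ->
  forall f, alg G f -> smooth f.
Proof.
move=> Gc Gd.
have reg f : alg G f -> forall x, {for x, continuous f} /\ forall v, derivable f x v.
  elim=> {f} [f Gf|c|f g _ IHf _ IHg|f g _ IHf _ IHg] x.
  - exact: Gc.
  - by split=> [|v]; [exact: continuous_const|exact: derivable_cst].
  - have [cf df] := IHf x; have [cg dg] := IHg x.
    by split=> [|v]; [exact: continuous_add|exact: derivableD].
  - have [cf df] := IHf x; have [cg dg] := IHg x.
    by split=> [|v]; [exact: continuous_mul|exact: derivableM].
have der f v : alg G f -> alg G (fun x => 'D_v f x).
  elim=> {f} [f Gf|c|f g af IHf ag IHg|f g af IHf ag IHg].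
  - exact: Gd.
  - have -> : (fun x => 'D_v (fun=> c) x) = (fun=> 0).
      by apply/funext => x; exact: derive_cst.
    exact: alg_cst.
  - have -> : (fun x => 'D_v (fun y => f y + g y) x) = (fun x => 'D_v f x + 'D_v g x).
      apply/funext => x; apply: is_deriveE; apply: is_derive_add.
        by apply: derivable_is_derive; exact: (reg f af x).2.
      by apply: derivable_is_derive; exact: (reg g ag x).2.
    exact: alg_add.
  - have -> : (fun x => 'D_v (fun y => f y * g y) x) =
        (fun x => f x * 'D_v g x + g x * 'D_v f x).
      apply/funext => x; apply: is_deriveE; apply: is_derive_mul.
        by apply: derivable_is_derive; exact: (reg f af x).2.
      by apply: derivable_is_derive; exact: (reg g ag x).2.
    by apply: alg_add; exact: alg_mul.
have iter f s : alg G f -> alg G (iter_deriv s f).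
  by move=> af; elim: s => //= v s IH; exact: der.
by move=> f af s x; exact: reg (iter f s af) x.
Qed.

Lemma iter_deriv_cat s1 s2 f : iter_deriv (s1 ++ s2) f = iter_deriv s1 (iter_deriv s2 f).
Proof. by rewrite /iter_deriv foldr_cat. Qed.

Lemma smooth_iter f s : smooth f -> smooth (iter_deriv s f).
Proof. by move=> sf s' x; rewrite -iter_deriv_cat; exact: sf. Qed.

Lemma smooth_cont f x : smooth f -> {for x, continuous f}.
Proof. by move=> /(_ [::] x)[]. Qed.

Lemma smooth_is_derive f x v : smooth f -> is_derive x v f ('D_v f x).
Proof. by move=> /(_ [::] x)[_ /(_ v)]; exact: derivable_is_derive. Qed.

Lemma smooth_D f v : smooth f -> smooth (fun x => 'D_v f x).
Proof. exact: (@smooth_iter f [:: v]). Qed.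

Lemma smooth_alg f : alg smooth f -> smooth f.
Proof.
apply: alg_smooth => [g sg x|g v sg].
  by split=> [|v]; [exact: smooth_cont|exact: is_derive_derivable (smooth_is_derive x v sg)].
by apply: alg_gen; exact: smooth_D.
Qed.

Lemma smooth_cst (c : R) : smooth (fun _ : V => c).
Proof. exact/smooth_alg/alg_cst. Qed.

Lemma smooth_add f g : smooth f -> smooth g -> smooth (fun x => f x + g x).
Proof. by move=> sf sg; apply/smooth_alg/alg_add; exact: alg_gen. Qed.

Lemma smooth_mul f g : smooth f -> smooth g -> smooth (fun x => f x * g x).
Proof. by move=> sf sg; apply/smooth_alg/alg_mul; exact: alg_gen. Qed.

Lemma smooth_scale (c : R) f : smooth f -> smooth (fun x => c * f x).
Proof. by move=> sf; exact: (smooth_mul (smooth_cst c) sf). Qed.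

Lemma smooth_opp f : smooth f -> smooth (fun x => - f x).
Proof.
by move=> /(smooth_scale (-1)); congr smooth; apply/funext => x; rewrite mulN1r.
Qed.

Lemma smooth_exp f n : smooth f -> smooth (fun x => f x ^+ n).
Proof.
move=> sf; elim: n => [|n IH]; first by under eq_fun do rewrite expr0; exact: smooth_cst.
by under eq_fun do rewrite exprS; exact: smooth_mul.
Qed.

Lemma smooth_lin (l : V -> R) (h : R -> R) :
  (forall (t : R) v x, l (t *: v + x) = t * l v + l x) -> continuous l ->
  smooth h -> smooth (fun x => h (l x)).
Proof.
move=> ll cl sh s x.
have E : forall s, iter_deriv s (fun x => h (l x)) = fun x => iter_deriv (map l s) h (l x).
  elim=> // v s' IH; apply/funext => y /=; rewrite [LHS]/= IH.
  by rewrite /derive; under eq_fun do rewrite /= ll.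
rewrite E; have [ch dh] := sh (map l s) (l x); split.
  by apply: continuous_comp1 => //; exact: cl.
move=> v; have := dh (l v); rewrite /derivable.
by under [X in _ -> cvg (X @ _)]eq_fun do rewrite /= ll.
Qed.

Lemma derive_out (K : set V) f v : closed K -> (forall x, ~ K x -> f x = 0) ->
  forall x, ~ K x -> is_derive x v f 0.
Proof.
move=> cK fK x Kx; apply: is_derive_near (is_derive_const 0 x v).
have : nbhs x (~` K) by apply: open_nbhs_nbhs; split => //; exact: closed_openC.
by apply: filterS => y /fK ->.
Qed.

Lemma iter_deriv_out (K : set V) f s : compact K -> (forall x, ~ K x -> f x = 0) ->
  forall x, ~ K x -> iter_deriv s f x = 0.
Proof.
move=> cK fK; elim: s => //= v s IH x Kx; apply: is_deriveE.
by apply: (@derive_out K) => //; apply: compact_closed => //; exact: norm_hausdorff.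
Qed.

Lemma test_iter U f s : test U f -> test U (iter_deriv s f).
Proof.
move=> [sf [K [cK KU fK]]]; split; first exact: smooth_iter.
by exists K; split => //; exact: iter_deriv_out.
Qed.

Lemma test_sub U U' f : U `<=` U' -> test U f -> test U' f.
Proof.
move=> UU [sf [K [cK KU fK]]]; split => //; exists K; split => //.
exact: subset_trans UU.
Qed.

Lemma test_mul U f g : test U f -> smooth g -> test U (fun x => f x * g x).
Proof.
move=> [sf [K [cK KU fK]]] sg; split; first exact: smooth_mul.
by exists K; split => // x /fK ->; rewrite mul0r.
Qed.

Lemma test_add U f g : test U f -> test U g -> test U (fun x => f x + g x).
Proof.
move=> [sf [K [cK KU fK]]] [sg [L [cL LU gL]]]; split; first exact: smooth_add.
exists (K `|` L); split => [||x /not_orP[Kx Lx]].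
- exact: compactU.
- by move=> x [/KU|/LU].
- by rewrite fK // gL // addr0.
Qed.

Lemma test_scale U (c : R) f : test U f -> test U (fun x => c * f x).
Proof.
move=> tf; have := test_mul tf (smooth_cst c).
by congr test; apply/funext => x; rewrite mulrC.
Qed.

End SmoothFunctions.

Section Bump.
Context {R : realType}.
Implicit Types (x a b : R).

(** The power [n] is carried along because the derivatives of $e^{-1/x}$ are combinations of such
    functions; the family then satisfies the hypotheses of [alg_smooth]. *)
Definition flat (n : nat) x : R := if 0 < x then x ^- n * expR (- x^-1) else 0.

Lemma flat_le0 n x : x <= 0 -> flat n x = 0.
Proof. by move=> x0; rewrite /flat ltNge x0. Qed.

(** This is $e^{1/x}\ge(1/x)^{n+1}/(n+1)!$, one term of the exponential series. *)
Lemma flat_bound n x : `|flat n x| <= n.+1`!%:R * `|x|.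
Proof.
have [x0|x0] := ltP 0 x; last by rewrite flat_le0 // normr0 mulr_ge0.
rewrite /flat x0 ger0_norm; last by rewrite mulr_ge0 ?expR_ge0 // invr_ge0 exprn_ge0 // ltW.
rewrite (gtr0_norm x0) expRN.
rewrite ler_pdivrMr ?expR_gt0 //.
have := @expR_ge1Dxn R (x^-1) n; rewrite invr_ge0 => /(_ (ltW x0)) H.
have : x^-1 ^+ n.+1 / (n.+1)`!%:R <= expR x^-1 by apply: le_trans H; rewrite lerDr.
rewrite ler_pdivrMr ?ltr0n ?fact_gt0 // => H2.
have -> : x ^- n = x * x^-1 ^+ n.+1 by rewrite exprS mulrA mulfV ?gt_eqF // mul1r exprVn.
by rewrite -mulrA mulrCA ler_wpM2l ?(ltW x0) // mulrC.
Qed.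

Lemma is_derive_flat n x : is_derive x 1 (flat n) (flat n.+2 x - n%:R * flat n.+1 x).
Proof.
have [x0|x0|->] := ltgtP x 0.
- rewrite !flat_le0 ?(ltW x0)// mulr0 subr0; apply: is_derive_near (is_derive_const 0 x 1).
  have : \forall y \near x, y < 0 by exact: lt_nbhsl.
  by apply: filterS => y /ltW /flat_le0 ->.
- apply: (@is_derive_near _ _ (fun y : R => y ^- n * expR (- y^-1))).
    have : \forall y \near x, 0 < y by exact: lt_nbhsr.
    by apply: filterS => y y0; rewrite /flat y0.
  have xn0 : x != 0 by rewrite gt_eqF.
  have dV : is_derive x (1 : R) (fun y => y^-1 : R) (- x ^- 2).
    by apply: is_derive_eq' (is_derive_inv xn0 (is_derive_id x 1)) _; rewrite mulr1.
  have dn : is_derive x (1 : R) (fun y => y ^- n : R) (- (n%:R * x ^- n.+1)).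
    have H : is_derive x (1 : R) (fun y : R => y^-1 ^+ n) ((n%:R * x^-1 ^+ n.-1) * (- x ^- 2)).
      exact: is_derive_exp dV.
    under eq_fun do rewrite -exprVn.
    apply: is_derive_eq' H _; case: n => [|n]; first by rewrite !mul0r oppr0.
    by rewrite /= mulrN -mulrA -!exprVn -exprD addn2.
  have de : is_derive x (1 : R) (fun y => expR (- y^-1)) (expR (- x^-1) * x ^- 2).
    apply: (@is_derive_comp1 _ _ expR (fun y : R => - y^-1)).
    by apply: is_derive_eq' (is_derive_opp dV) _; rewrite opprK.
  apply: is_derive_eq' (is_derive_mul dn de) _.
  rewrite /flat x0 -!exprVn !exprS expr0; ring.
- rewrite !flat_le0 // mulr0 subr0; apply/is_deriveP.
  (* The difference quotient of [flat n] at 0 is [flat n.+1], which tends to 0 by [flat_bound]. *)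
  have E : forall t : R, t != 0 -> t^-1 * (flat n (t *: 1 + 0) - flat n 0) = flat n.+1 t.
    move=> t t0; rewrite [t *: 1]mulr1 addr0 (flat_le0 _ (lexx 0)) subr0 /flat.
    by case: ifP => _; rewrite ?mulr0 // exprS invfM mulrA.
  apply/cvgrPdist_le => e e0; near=> t.
  rewrite E; last by near: t; exact: nbhs_dnbhs_neq.
  rewrite sub0r normrN; apply: le_trans (flat_bound _ _) _.
  rewrite -ler_pdivlMl ?ltr0n ?fact_gt0 //; near: t; apply: dnbhs0_le.
  by rewrite mulr_gt0 ?invr_gt0 ?ltr0n ?fact_gt0.
Unshelve. all: by end_near. Qed.

Lemma derive1_scale (f : R -> R) x v d : is_derive x (1 : R) f d -> is_derive x v f (v * d).
Proof.
move=> fd; apply/is_derive_line0; rewrite mulrC.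
have fd' : is_derive (0 *: v + x) 1 f d by rewrite scale0r add0r.
apply: (@is_derive_comp1 _ _ f (fun s : R => s *: v + x)) fd' _.
apply: is_derive_eq' (is_derive_add (is_derive_mul (is_derive_id (0:R) 1) (is_derive_const v _ _)) (is_derive_const x _ _)) _.
by rewrite mulr0 add0r addr0 mulr1.
Qed.

Lemma smooth_flat n : smooth (flat n).
Proof.
apply: (@alg_smooth _ _ (range flat)); last exact/alg_gen/imageT.
- move=> _ [m _ <-] x; split; first exact: is_derive_continuous1 (is_derive_flat m x).
  by move=> v; exact: is_derive_derivable (derive1_scale v (is_derive_flat m x)).
- move=> _ v [m _ <-].
  have -> : (fun x => 'D_v (flat m) x) = (fun x => v * (flat m.+2 x + (- m%:R) * flat m.+1 x)).
    apply/funext => x; rewrite (is_deriveE (derive1_scale v (is_derive_flat m x))).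
    by rewrite mulNr.
  apply: alg_mul; [exact: alg_cst|apply: alg_add; first exact/alg_gen/imageT].
  by apply: alg_mul; [exact: alg_cst|exact/alg_gen/imageT].
Qed.

Definition bump a b x : R := flat 0 (x - a) * flat 0 (b - x).

Lemma smooth_affine (c k : R) (h : R -> R) : smooth h -> smooth (fun x : R => h (c * x + k)).
Proof.
move=> sh s x.
have E : forall s, iter_deriv s (fun x : R => h (c * x + k)) = fun x : R => iter_deriv (map ( *%R c) s) h (c * x + k).
  elim=> // v s' IH; apply/funext => y /=; rewrite [LHS]/= IH /derive /=.
  by under eq_fun do rewrite mulrDr -scalerAr -addrA.
rewrite E; have [ch dh] := sh (map ( *%R c) s) (c * x + k); split.
  apply: (@continuous_comp1 _ _ _ (fun y : R => c * y + k)) => //.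
  apply: continuous_add; last exact: continuous_const.
  by apply: continuous_mul; [exact: continuous_const|exact: cvg_id].
move=> v; have := dh (c * v); rewrite /derivable.
by under [X in _ -> cvg (X @ _)]eq_fun do rewrite /= mulrDr -scalerAr -addrA.
Qed.

Lemma smooth_bump a b : smooth (bump a b).
Proof.
apply: smooth_mul.
  have := smooth_affine 1 (- a) (smooth_flat 0).
  by congr smooth; apply/funext => x; rewrite mul1r.
have := smooth_affine (-1) b (smooth_flat 0).
by congr smooth; apply/funext => x; rewrite mulN1r addrC.
Qed.

Lemma flat_ge0 n x : 0 <= flat n x.
Proof. by rewrite /flat; case: ifP => // x0; rewrite mulr_ge0 ?expR_ge0 // invr_ge0 exprn_ge0 // ltW. Qed.

Lemma flat0_gt0 x : (0 < flat 0 x) = (0 < x).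
Proof. by rewrite /flat; case: ifP => // x0; rewrite expr0 invr1 mul1r expR_gt0. Qed.

Lemma flat0_lt1 x : flat 0 x < 1.
Proof.
rewrite /flat; case: ifP => // x0; rewrite expr0 invr1 mul1r -expR0 ltr_expR oppr_lt0.
by rewrite invr_gt0.
Qed.

Lemma bump_ge0 a b x : 0 <= bump a b x.
Proof. by rewrite mulr_ge0 // flat_ge0. Qed.

Lemma bump_lt1 a b x : bump a b x < 1.
Proof. by rewrite mulr_ilt1 ?flat_ge0 ?flat0_lt1. Qed.

Lemma bump_gt0 a b x : a < x < b -> 0 < bump a b x.
Proof. by move=> /andP[ax xb]; rewrite mulr_gt0 // flat0_gt0 subr_gt0. Qed.

Lemma bump_out a b x : ~~ (a < x < b) -> bump a b x = 0.
Proof.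
rewrite negb_and -!leNgt => /orP[xa|bx]; rewrite /bump.
  by rewrite [flat 0 (x - a)]flat_le0 ?mul0r // subr_le0.
by rewrite [flat 0 (b - x)]flat_le0 ?mulr0 // subr_le0.
Qed.

End Bump.

Section IntegralSupport.
Context d {T : measurableType d} {R : realType} (mu : {measure set T -> \bar R}).
Implicit Types (D K : set T) (f g : T -> R).

Lemma patch_out D K f : (forall x, D x -> ~ K x -> f x = 0) ->
  forall x, D x -> f x = (f \_ K) x.
Proof.
move=> f0 x Dx; rewrite patchE; case: ifPn => //.
by rewrite notin_setE => /f0 ->.
Qed.

Lemma integrable_patch D f : measurable D -> mu.-integrable D (EFin \o f) ->
  mu.-integrable setT (EFin \o (f \_ D)).
Proof. by move=> mD fi; rewrite -restrict_EFin; exact: (integrable_mkcond _ mD).1. Qed.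

Lemma integrable_out D K f : measurable D -> measurable K -> K `<=` D ->
  (forall x, D x -> ~ K x -> f x = 0) -> mu.-integrable K (EFin \o f) ->
  mu.-integrable D (EFin \o f).
Proof.
move=> mD mK KD f0 fi.
have : mu.-integrable setT ((EFin \o f) \_ K) by exact: (integrable_mkcond _ mK).1 fi.
move=> /(integrableS measurableT mD (@subsetT _ _)).
apply: eq_integrable => // x /set_mem Dx.
by rewrite restrict_EFin /= -(patch_out f0).
Qed.

Lemma Rintegral_out D K f : measurable D -> measurable K -> K `<=` D ->
  (forall x, D x -> ~ K x -> f x = 0) ->
  \int[mu]_(x in D) f x = \int[mu]_(x in K) f x.
Proof.
move=> mD mK KD f0.
rewrite [RHS]Rintegral_mkcond [LHS]Rintegral_mkcond.
apply: eq_Rintegral => x _.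
have [Dx|nDx] := pselect (D x); last first.
  by rewrite !patchE !memNset // => /KD.
rewrite [LHS]patchE mem_set //; exact: (patch_out f0).
Qed.

End IntegralSupport.

Lemma measurable_EFin d (T : measurableType d) (R : realType) (D : set T) (f : T -> R) :
  measurable_fun D f -> measurable_fun D (EFin \o f).
Proof. by move=> mf; exact/measurable_EFinP. Qed.

Arguments integrable_out {d T R mu} D K f.
Arguments Rintegral_out {d T R mu} D K f.

(** * The fundamental lemma of the calculus of variations *)

Section Dynkin.
Context d d' {T : measurableType d} {T' : measurableType d'} {R : realType}.
Context (mu : {measure set T -> \bar R}) (phi : T -> T') (G : set (set T')).

(** The sets over which the integral of [f] vanishes form a Dynkin system. The map [phi] makes the
    lemma usable for one coordinate at a time, with [fst] and [snd], and then for the plane, with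
    the identity. *)
Lemma dynkin_integral_zero (f : T -> R) :
  measurable_fun setT phi -> mu.-integrable setT (EFin \o f) ->
  @measurable _ T' = <<s G >> -> setI_closed G ->
  \int[mu]_(x in setT) f x = 0 ->
  (forall A, G A -> \int[mu]_(x in phi @^-1` A) f x = 0) ->
  forall A, measurable A -> \int[mu]_(x in phi @^-1` A) f x = 0.
Proof.
move=> mphi fi GE GI fT fG A.
have mpre B : measurable B -> measurable (phi @^-1` B).
  by move=> mB; rewrite -[X in measurable X]setTI; exact: mphi.
have fiS B : measurable B -> mu.-integrable (phi @^-1` B) (EFin \o f).
  by move=> mB; apply: integrableS fi => //; exact: mpre.
rewrite {1}GE; apply: (@dynkin_induction _ _ G (fun A => \int[mu]_(x in phi @^-1` A) f x = 0)) => //.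
- move=> S mS fS.
  have : \int[mu]_(x in phi @^-1` S `|` phi @^-1` (~` S)) f x = 0.
    by rewrite -preimage_setU setUv.
  rewrite Rintegral_setU ?fS ?add0r //.
  + exact: mpre.
  + by apply: mpre; exact: measurableC.
  + by rewrite -preimage_setU setUv; exact: fi.
  + by apply/disj_setPS => x [].
- move=> F mF tF fF; rewrite preimage_bigcup /Rintegral integral_bigcup //.
  + rewrite eseries0 // => n _ _ /=.
    rewrite -[LHS]fineK ?(integrable_fin_num _ (fiS _ (mF n))) //; last exact: mpre.
    by have := fF n; rewrite /Rintegral => ->.
  + apply/trivIsetP => i j _ _ ij; rewrite -preimage_setI.
    by move/trivIsetP : tF => -> //; rewrite preimage_set0.
  + by move=> k; exact: mpre.
  + by rewrite -preimage_bigcup; apply: fiS; exact: bigcup_measurable.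
Qed.

End Dynkin.

Section Fundamental.
Context {R : realType}.
Implicit Types (a b c d : R).

Definition obox a b c d : set (plane R) := `]a, b[%classic `*` `]c, d[%classic.

Lemma obox_open a b c d : open (obox a b c d).
Proof.
rewrite openE => -[x y] [/= xab ycd].
exists (`]a, b[%classic, `]c, d[%classic) => //=; split;
  by apply: open_nbhs_nbhs; split => //; exact: interval_open.
Qed.

Lemma obox_center (x y r : R) : 0 < r -> obox (x - r) (x + r) (y - r) (y + r) (x, y).
Proof. by move=> r0; split; rewrite /= in_itv /= ltrBlDr ltrDl r0. Qed.

Lemma box_sub_obox (a0 b0 c0 d0 a b c d : R) : a0 < a -> b < b0 -> c0 < c -> d < d0 ->
  box a b c d `<=` obox a0 b0 c0 d0.
Proof.
move=> h1 h2 h3 h4 [x y] [/=]; rewrite !in_itv /= => /andP[x1 x2] /andP[y1 y2].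
split; rewrite /= in_itv /=; apply/andP; split.
- exact: lt_le_trans x1.
- exact: le_lt_trans h2.
- exact: lt_le_trans y1.
- exact: le_lt_trans h4.
Qed.

Lemma obox_measurable a b c d :
  measurable (obox a b c d : set (measurableTypeR R * measurableTypeR R)%type).
Proof. by apply: measurableX; exact: measurable_itv. Qed.

Lemma obox_box a b c d : obox a b c d `<=` box a b c d.
Proof. by move=> [x y] [/= h1 h2]; split; exact: subset_itv_oo_cc. Qed.

(** The whole line is adjoined so that the total integral, from which the Dynkin argument starts, is
    among the given ones. *)
Definition opens1 : set (set R) := [set A | A = setT \/ exists a b, A = `]a, b[%classic].

Lemma itvoo_setI a b c d :
  `]a, b[%classic `&` `]c, d[%classic = `](Num.max a c), (Num.min b d)[%classic.
Proof.
apply/seteqP; split=> x /=; rewrite !in_itv /= gt_max lt_min.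
  by move=> [/andP[-> ->] /andP[-> ->]].
by move=> /andP[/andP[-> ->] /andP[-> ->]].
Qed.

Lemma opens1_setI : setI_closed opens1.
Proof.
move=> A B [->|[a [b ->]]] [->|[c [d ->]]]; rewrite ?setIT ?setTI.
- by left.
- by right; exists c, d.
- by right; exists a, b.
- by right; exists (Num.max a c), (Num.min b d); rewrite -itvoo_setI.
Qed.

Lemma opens1_measurable : @measurable _ (measurableTypeR R) = <<s opens1 >>.
Proof.
apply/seteqP; split.
- rewrite (RGenOpens.measurableE R); apply: smallest_sub; first exact: smallest_sigma_algebra.
  by move=> _ [a [b ->]]; apply: sub_sigma_algebra; right; exists a, b.
- apply: smallest_sub; first exact: sigma_algebra_measurable.
  by move=> _ [->|[a [b ->]]]; [exact: measurableT|exact: measurable_itv].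
Qed.

(** Open intervals are replaced by Borel sets in the first factor, then in the second, and products
    of Borel sets by all measurable sets of the plane. Because [f] vanishes off a bounded box, the
    integrals over unbounded products of [opens1] reduce to integrals over boxes. *)
Lemma zero_on_boxes_ae (f : plane R -> R) : area.-integrable setT (EFin \o f) ->
  (exists2 M : R, 0 < M & forall z, ~ obox (- M) M (- M) M z -> f z = 0) ->
  (forall a b c d, \int[area]_(z in obox a b c d) f z = 0) ->
  {ae area, forall z, f z = 0}.
Proof.
move=> fi [M M0 fM] f0.
have fout A : measurable (A : set (measurableTypeR R * measurableTypeR R)%type) ->
    \int[area]_(z in A) f z = \int[area]_(z in A `&` obox (- M) M (- M) M) f z.
  move=> mA; apply: Rintegral_out => //; first by apply: measurableI => //; exact: obox_measurable.
  by move=> z Az /not_andP[//|]; exact: fM.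
have mopen (B : set R) : opens1 B -> measurable (B : set (measurableTypeR R)).
  by move=> oB; rewrite opens1_measurable; exact: sub_sigma_algebra.
have e1 (A : set R) : opens1 A -> exists a b, A `&` `]- M, M[%classic = `]a, b[%classic.
  move=> [->|[a [b ->]]]; first by exists (- M), M; rewrite setTI.
  by exists (Num.max a (- M)), (Num.min b M); rewrite -itvoo_setI.
have s0 A B : opens1 A -> opens1 B -> \int[area]_(z in A `*` B) f z = 0.
  move=> oA oB; rewrite fout.
    have [a [b Aab]] := e1 A oA; have [c [d Bcd]] := e1 B oB.
    have -> : A `*` B `&` obox (- M) M (- M) M = obox a b c d.
      by rewrite /obox -Aab -Bcd; apply/seteqP; split=> -[x y] /=; tauto.
    exact: f0.
  by apply: measurableX; exact: mopen.
have patchI (A B : set (plane R)) : \int[area]_(z in B) (f \_ A) z = \int[area]_(z in B `&` A) f z.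
  by rewrite Rintegral_mkcondr.
have fiA (A : set (measurableTypeR R * measurableTypeR R)%type) : measurable A ->
    area.-integrable setT (EFin \o (f \_ A)).
  move=> mA; apply: integrable_patch => //; exact: integrableS fi.
have s1 (B : set R) : opens1 B -> forall A : set (measurableTypeR R), measurable A ->
    \int[area]_(z in A `*` B) f z = 0.
  move=> oB A mA.
  have mTB : measurable (setT `*` B : set (measurableTypeR R * measurableTypeR R)%type).
    by apply: measurableX => //; exact: mopen.
  have -> : A `*` B = (fst @^-1` A) `&` (setT `*` B).
    by apply/seteqP; split=> -[x y] /=; tauto.
  rewrite -patchI.
  apply: (@dynkin_integral_zero _ _ (measurableTypeR R * measurableTypeR R)%type (measurableTypeR R) R area fst opens1 (f \_ (setT `*` B))) => //.
  - exact: fiA.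
  - exact: opens1_measurable.
  - exact: opens1_setI.
  - by rewrite patchI setTI; apply: s0 => //; left.
  - move=> A' oA'; rewrite patchI.
    have -> : (fst @^-1` A') `&` (setT `*` B) = A' `*` B.
      by apply/seteqP; split=> -[x y] /=; tauto.
    exact: s0.
have s2 (A B : set (measurableTypeR R)) : measurable A -> measurable B ->
    \int[area]_(z in A `*` B) f z = 0.
  move=> mA mB.
  have mAT : measurable (A `*` setT : set (measurableTypeR R * measurableTypeR R)%type).
    by apply: measurableX.
  have -> : A `*` B = (snd @^-1` B) `&` (A `*` setT).
    by apply/seteqP; split=> -[x y] /=; tauto.
  rewrite -patchI.
  apply: (@dynkin_integral_zero _ _ (measurableTypeR R * measurableTypeR R)%type (measurableTypeR R) R area snd opens1 (f \_ (A `*` setT))) => //.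
  - exact: fiA.
  - exact: opens1_measurable.
  - exact: opens1_setI.
  - by rewrite patchI setTI; apply: s1 => //; left.
  - move=> B' oB'; rewrite patchI.
    have -> : (snd @^-1` B') `&` (A `*` setT) = A `*` B'.
      by apply/seteqP; split=> -[x y] /=; tauto.
    exact: s1.
have s3 (E : set (measurableTypeR R * measurableTypeR R)%type) : measurable E ->
    \int[area]_(z in E) f z = 0.
  move=> mE; rewrite -[E]/(idfun @^-1` E).
  apply: (@dynkin_integral_zero _ _ _ _ _ _ idfun
    [set A `*` B | A in @measurable _ (measurableTypeR R) & B in @measurable _ (measurableTypeR R)]) => //.
  - exact: measurable_id.
  - exact: measurable_prod_measurableType.
  - move=> _ _ [A mA [B mB <-]] [A' mA' [B' mB' <-]].
    exists (A `&` A'); first exact: measurableI.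
    exists (B `&` B'); first exact: measurableI.
    by rewrite setXI.
  - by rewrite -setXTT; exact: s2.
  - by move=> _ [A mA [B mB <-]]; exact: s2.
have : ae_eq area setT (EFin \o f) (cst 0%E).
  apply: integral_ae_eq => // E _ mE; rewrite integral0.
  have := s3 E mE; rewrite /Rintegral => h.
  rewrite -[LHS]fineK ?h //; apply: integrable_fin_num => //.
  exact: integrableS fi.
by move=> H; apply: (ae_imply H) => z /(_ I) [].
Qed.

Definition test1 a b (h : R -> R) := smooth h /\ forall x, ~~ (a < x < b) -> h x = 0.

(** As [bump a b] lies strictly between 0 and 1 on the interval and is 0 elsewhere, these smooth
    functions converge to the indicator of the open interval, with values between 0 and 1. *)
Definition approx a b (n : nat) (x : R) : R := 1 - (1 - bump a b x) ^+ n.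

Lemma test1_approx a b n : test1 a b (approx a b n).
Proof.
split=> [|x xab]; last by rewrite /approx bump_out // subr0 expr1n subrr.
apply: smooth_add; first exact: smooth_cst.
apply: smooth_opp; apply: smooth_exp; apply: smooth_add; first exact: smooth_cst.
by apply: smooth_opp; exact: smooth_bump.
Qed.

Lemma approx_bound a b n x : `|approx a b n x| <= 1.
Proof.
have h0 : 0 <= 1 - bump a b x by rewrite subr_ge0 ltW // bump_lt1.
have h1 : 1 - bump a b x <= 1 by rewrite gerBl bump_ge0.
have h2 : (1 - bump a b x) ^+ n <= 1 by exact: exprn_ile1.
by rewrite ger0_norm ?subr_ge0 // /approx gerBl exprn_ge0.
Qed.

Lemma approx_cvg a b x : approx a b n x @[n --> \oo] --> (\1_(`]a, b[%classic) x : R).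
Proof.
rewrite indicE; have [xab|xab] := boolP (x \in _).
  rewrite -[X in _ --> X]subr0; apply: cvgB; first exact: cvg_cst.
  apply: cvg_expr; rewrite ltr_norml; move: xab; rewrite inE /= in_itv /= => xab.
  have := bump_gt0 xab; have := bump_lt1 a b x; lra.
apply: cvg_near_cst; near=> n; apply: (test1_approx a b n).2.
by move: xab; rewrite notin_setE /= in_itv /= => /negP.
Unshelve. all: by end_near. Qed.

Lemma smooth_measurable (h : R -> R) : smooth h -> measurable_fun setT h.
Proof. by move=> sh; apply: continuous_measurable_fun => x; exact: smooth_cont. Qed.

(** Test functions of product form suffice: products of two [approx] converge to the indicator of a
    smaller box, dominated by 1, so the integral of [g] over every such box vanishes. *)
Lemma fundamental_box a b c d (g : plane R -> R) :
  area.-integrable (box a b c d) (EFin \o g) ->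
  (forall h k, test1 a b h -> test1 c d k ->
    \int[area]_(z in box a b c d) (g z * (h z.1 * k z.2)) = 0) ->
  {ae area, forall z, obox a b c d z -> g z = 0}.
Proof.
move=> gi g0.
have mO := obox_measurable a b c d; have mB := box_measurable a b c d.
have gO : area.-integrable (obox a b c d) (EFin \o g) by apply: integrableS gi => //; exact: obox_box.
suff : {ae area, forall z, (g \_ (obox a b c d)) z = 0}.
  by move=> H; apply: (ae_imply H) => z; rewrite patchE => h zO; move: h; rewrite mem_set.
apply: zero_on_boxes_ae.
- exact: integrable_patch.
- exists (`|a| + `|b| + `|c| + `|d| + 1).
    by rewrite ltr_wpDl // !addr_ge0.
  move=> z zM; rewrite patchE; case: ifPn => // /set_mem [/= z1 z2]; exfalso; apply: zM.
  move: z1 z2; rewrite /= !in_itv /= => /andP[z1 z2] /andP[z3 z4].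
  have := ler_norm b; have := ler_norm d; have := ler_norm (- a); have := ler_norm (- c).
  have := normr_ge0 a; have := normr_ge0 b; have := normr_ge0 c; have := normr_ge0 d.
  by rewrite !normrN => *; split; rewrite /= in_itv /=; apply/andP; split; lra.
- move=> a1 b1 c1 d1; rewrite -Rintegral_mkcondr.
  set a2 := Num.max a1 a; set b2 := Num.min b1 b; set c2 := Num.max c1 c; set d2 := Num.min d1 d.
  have -> : obox a1 b1 c1 d1 `&` obox a b c d = obox a2 b2 c2 d2.
    by rewrite /obox -setXI -!itvoo_setI.
  have sub : obox a2 b2 c2 d2 `<=` box a b c d.
    move=> [x y] [/=]; rewrite !in_itv /= !gt_max !lt_min => /andP[/andP[_ x1] /andP[_ x2]] /andP[/andP[_ y1] /andP[_ y2]].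
    by split; rewrite /= in_itv /= !ltW.
  have sub1 (h : R -> R) : test1 a2 b2 h -> test1 a b h.
    move=> [sh h0]; split => // x xab; apply: h0; apply: contra xab.
    by rewrite /a2 /b2 gt_max lt_min => /andP[/andP[_ ->] /andP[_ ->]].
  have sub2 (h : R -> R) : test1 c2 d2 h -> test1 c d h.
    move=> [sh h0]; split => // x xab; apply: h0; apply: contra xab.
    by rewrite /c2 /d2 gt_max lt_min => /andP[/andP[_ ->] /andP[_ ->]].
  pose f_ n (z : plane R) := g z * (approx a2 b2 n z.1 * approx c2 d2 n z.2).
  pose gI (z : plane R) : R := g z * \1_(obox a2 b2 c2 d2) z.
  have mg : measurable_fun (box a b c d) g by exact: integrable_mfun gi.
  have mf n : measurable_fun (box a b c d) (f_ n).
    apply: measurable_funM => //; apply: measurable_funM.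
      apply: measurable_funTS; apply: (measurableT_comp (smooth_measurable (test1_approx a2 b2 n).1)).
      exact: measurable_fst.
    apply: measurable_funTS; apply: (measurableT_comp (smooth_measurable (test1_approx c2 d2 n).1)).
    exact: measurable_snd.
  have := @dominated_convergence _ _ _ area (box a b c d) mB (fun n => EFin \o f_ n)
    (EFin \o gI) (fun z => `|(g z)%:E|)%E.
  case.
  + by move=> n; exact: measurable_EFin (mf n).
  + apply: measurable_EFin; apply: measurable_funM => //.
    by apply: measurable_funTS; apply: measurable_indic; exact: obox_measurable.
  + apply: aeW => z _; apply: cvg_EFin; first by near=> n.
    apply: cvgM; first exact: cvg_cst.
    have -> : \1_(obox a2 b2 c2 d2) z = \1_(`]a2, b2[%classic) z.1 * \1_(`]c2, d2[%classic) z.2 :> R.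
      by rewrite !indicE -natrM mulnb; congr (_%:R); rewrite /obox in_setX.
    by apply: cvgM; exact: approx_cvg.
  + exact: integrable_abse gi.
  + apply: aeW => z n _; rewrite /= lee_fin !normrM -[leRHS]mulr1 ler_wpM2l //.
    by rewrite mulr_ile1 ?approx_bound.
  move=> _ _ H.
  have f0 n : (\int[area]_(z in box a b c d) (f_ n z)%:E)%E = 0%E.
    have := g0 _ _ (sub1 _ (test1_approx a2 b2 n)) (sub2 _ (test1_approx c2 d2 n)).
    rewrite /Rintegral => h; rewrite -[LHS]fineK ?h //.
    apply: integrable_fin_num => //; apply: le_integrable gi => //; first exact: measurable_EFin (mf n).
    move=> z _; rewrite /= lee_fin !normrM -[leRHS]mulr1 ler_wpM2l //.
    by rewrite mulr_ile1 ?approx_bound.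
  have : (\int[area]_(z in box a b c d) (EFin \o gI) z)%E = 0%E.
    apply: (cvg_unique _ H) => //.
    by apply: cvg_near_cst; near=> n; exact: f0.
  move=> I0; transitivity (fine (\int[area]_(z in box a b c d) (EFin \o gI) z)%E); last by rewrite I0.
  congr fine.
  rewrite [RHS]integral_mkcond [LHS]integral_mkcond; apply: eq_integral => z _.
  rewrite !patchE /gI /= indicE.
  have [zB|zB] := pselect (obox a2 b2 c2 d2 z).
    by rewrite !mem_set //=; [rewrite mulr1|exact: sub].
  by rewrite (memNset zB) mulr0; case: ifP.
Unshelve. all: by end_near. Qed.

End Fundamental.

(** * Calculus of one real variable *)

Section Calculus1.
Context {R : realType}.
Notation leb := (@lebesgue_measure R).

Lemma within_continuous_pt (a b : R) (f : R -> R) :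
  (forall x, a <= x <= b -> {for x, continuous f}) -> {within `[a, b], continuous f}.
Proof.
move=> cf; apply: continuous_in_subspaceT => x; rewrite inE /= in_itv /=.
exact: cf.
Qed.

Lemma integrable_continuous_itv (a b : R) (f : R -> R) :
  (forall x, a <= x <= b -> {for x, continuous f}) -> leb.-integrable `[a, b] (EFin \o f).
Proof.
move=> cf; apply: continuous_compact_integrable; first exact: segment_compact.
exact: within_continuous_pt.
Qed.

Lemma FTC2 (a b : R) (F f : R -> R) : a <= b ->
  (forall x : R, a <= x <= b -> is_derive x 1 F (f x)) ->
  (forall x, a <= x <= b -> {for x, continuous f}) ->
  \int[leb]_(x in `[a, b]) f x = F b - F a.
Proof.
rewrite le_eqVlt => /predU1P[<-|ab] dF cf.
  by rewrite set_itv1 Rintegral_set1 subrr.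
have cF x : a <= x <= b -> {for x, continuous F}.
  by move=> /dF; exact: is_derive_continuous1.
rewrite /Rintegral (@continuous_FTC2 _ f F a b) //.
- exact: within_continuous_pt.
- split=> [x|/=|/=].
  + rewrite in_itv /= => /andP[ax xb].
    by have [] := dF x ltac:(by rewrite !ltW).
  + by apply: cvg_at_right_filter; apply: cF; rewrite lexx ltW.
  + by apply: cvg_at_left_filter; apply: cF; rewrite lexx ltW.
- move=> x; rewrite in_itv /= => /andP[ax xb]; rewrite derive1E.
  by apply: is_deriveE; apply: dF; rewrite !ltW.
Qed.

Lemma antiderivative (f : R -> R) : continuous f ->
  exists F : R -> R, forall x : R, is_derive x 1 F (f x).
Proof.
move=> cf.
have fi a b : leb.-integrable `[a, b] (EFin \o f).
  by apply: integrable_continuous_itv => x _; exact: cf.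
(* One of the two integrals is over an empty interval or a point. Based at some [- M] left of [x],
   [F] is a single integral up to a constant ([FE]), and the fundamental theorem applies near
   [x]. *)
pose F (x : R) := \int[leb]_(t in `[0, x]) f t - \int[leb]_(t in `[x, 0]) f t.
have FE (M x : R) : 0 < M -> - M < x ->
    F x = \int[leb]_(t in `[- M, x]) f t - \int[leb]_(t in `[- M, 0]) f t.
  move=> M0 Mx; rewrite /F; have [x0|x0] := leP 0 x.
    rewrite (@Rintegral_itvB _ _ (BLeft (- M)) (BRight x) 0 (fi _ _) ltac:(by rewrite bnd_simp; lra) ltac:(by rewrite bnd_simp)).
    rewrite Rintegral_itv_obnd_cbnd; last first.
      by apply: integrableS (fi 0 x) => //; exact: subset_itv_oc_cc.
    move: x0; rewrite le_eqVlt => /predU1P[<-|x0].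
      by rewrite set_itv1 Rintegral_set1 subr0.
    by rewrite [X in _ - X](_ : _ = 0) ?subr0 // set_itv_ge ?Rintegral_set0 // bnd_simp -ltNge.
  rewrite [X in X - _](_ : _ = 0); last by rewrite set_itv_ge ?Rintegral_set0 // bnd_simp -ltNge.
  rewrite sub0r -[RHS]opprB; congr (- _).
  rewrite (@Rintegral_itvB _ _ (BLeft (- M)) (BRight 0) x (fi _ _) ltac:(by rewrite bnd_simp ltW) ltac:(by rewrite bnd_simp ltW)).
  rewrite Rintegral_itv_obnd_cbnd //.
  by apply: integrableS (fi x 0) => //; exact: subset_itv_oc_cc.
exists F => x.
pose M := `|x| + 1.
have M0 : 0 < M by rewrite ltr_wpDl.
have Mx : - M < x by have := ler_norm (- x); rewrite normrN /M; lra.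
have [dG G'] := @continuous_FTC1_closed _ f (- M) x (x + 1) ltac:(by rewrite ltrDl) (fi _ _) Mx (cf x).
apply: (@is_derive_near _ _ (fun y => (\int[leb]_(t in `[- M, y]) f t) - \int[leb]_(t in `[- M, 0]) f t)).
  by have := @lt_nbhsr _ (- M) x Mx; apply: filterS => y My; rewrite -FE.
apply: is_derive_eq' (is_derive_sub _ (is_derive_const _ _ _)) _; last exact: subr0.
by rewrite -G' derive1E; exact: derivable_is_derive.
Qed.

Lemma Rintegral_derive_compact (F f : R -> R) (M : R) : 0 < M ->
  (forall x : R, is_derive x 1 F (f x)) -> continuous f ->
  (forall x, ~ (- M <= x <= M) -> F x = 0) ->
  \int[leb]_x f x = 0.
Proof.
move=> M0 dF cf F0.
have f0 x : ~ (- M <= x <= M) -> f x = 0.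
  move=> xM; rewrite -(is_deriveE (dF x)); apply: is_deriveE.
  apply: (@derive_out _ _ `[- M, M]%classic); first exact: itv_closed.
    by move=> y /=; rewrite in_itv /=; exact: F0.
  by rewrite /= in_itv.
(* The interval is enlarged by 1 because the hypothesis gives [F = 0] only strictly beyond [M]. *)
rewrite (Rintegral_out (setT : set (measurableTypeR R)) `[- (M + 1), (M + 1)]%classic) //.
- rewrite (@FTC2 _ _ F) //; first rewrite !F0 ?subrr //; try lra.
  by move=> x _; exact: cf.
- by move=> x _ /=; rewrite in_itv /= => xM; apply: f0 => /andP[? ?]; apply: xM; apply/andP; split; lra.
Qed.

Lemma mvt_const (a b : R) (F : R -> R) : (forall x : R, a < x < b -> is_derive x 1 F 0) ->
  forall x y, a < x < b -> a < y < b -> F x = F y.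
Proof.
move=> dF x y.
wlog xy : x y / x <= y.
  by move=> H xab yab; have [/H->//|/ltW/H<-//] := leP x y.
move: xy; rewrite le_eqVlt => /predU1P[->//|xy] /andP[ax xb] /andP[ay yb].
have [] := @MVT _ F (fun=> 0) x y xy.
- by move=> z; rewrite in_itv /= => /andP[? ?]; apply: dF; apply/andP; split; lra.
- apply: within_continuous_pt => z /andP[? ?]; apply: is_derive_continuous1 (dF z _).
  by apply/andP; split; lra.
- by move=> c _; rewrite mul0r => /eqP; rewrite subr_eq0 => /eqP ->.
Qed.

End Calculus1.

(** * Integration by parts and weak derivatives *)

Section PlaneCalculus.
Context {R : realType}.
Implicit Types (O K : set (plane R)) (f g h : plane R -> R) (i j : 'I_2).
Notation leb := (@lebesgue_measure R).

Lemma unit_vec0 : unit_vec ord0 = (1, 0) :> plane R. Proof. by []. Qed.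
Lemma unit_vec1 : unit_vec ord_max = (0, 1) :> plane R. Proof. by []. Qed.

Lemma sum2 (F : 'I_2 -> R) : \sum_(i < 2) F i = F ord0 + F ord_max.
Proof. by rewrite big_ord_recr big_ord1 /=; congr (F _ + F _); apply: val_inj. Qed.

Lemma ord2P (P : 'I_2 -> Prop) : P ord0 -> P ord_max -> forall i, P i.
Proof.
move=> P0 P1 [[|[|n]] Hn] //.
- by rewrite (_ : Ordinal Hn = ord0) //; exact: val_inj.
- by rewrite (_ : Ordinal Hn = ord_max) //; exact: val_inj.
Qed.

Lemma is_derive_slice0 f (x y d : R) :
  is_derive (x, y) (unit_vec ord0 : plane R) f d <-> is_derive x 1 (fun s => f (s, y)) d.
Proof.
apply: iff_trans (is_deriveP f _ _ d) _.
apply: iff_trans _ (iff_sym (is_deriveP (fun s => f (s, y)) x 1 d)).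
have -> // : (fun t : R => t^-1 * (f (t *: (unit_vec ord0 : plane R) + (x, y)) - f (x, y))) =
   (fun t : R => t^-1 * (f (t *: (1 : R) + x, y) - f (x, y))).
apply/funext => t; rewrite unit_vec0; congr (_ * (f _ - _)).
by apply/pair_equal_spec; split; rewrite //= [t *: 0]mulr0 add0r.
Qed.

Lemma is_derive_slice1 f (x y d : R) :
  is_derive (x, y) (unit_vec ord_max : plane R) f d <-> is_derive y 1 (fun s => f (x, s)) d.
Proof.
apply: iff_trans (is_deriveP f _ _ d) _.
apply: iff_trans _ (iff_sym (is_deriveP (fun s => f (x, s)) y 1 d)).
have -> // : (fun t : R => t^-1 * (f (t *: (unit_vec ord_max : plane R) + (x, y)) - f (x, y))) =
   (fun t : R => t^-1 * (f (x, t *: (1 : R) + y) - f (x, y))).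
apply/funext => t; rewrite unit_vec1; congr (_ * (f _ - _)).
by apply/pair_equal_spec; split; rewrite //= [t *: 0]mulr0 add0r.
Qed.

Lemma continuous_slice0 f (x y : R) : {for (x, y), continuous f} ->
  {for x, continuous (fun s => f (s, y))}.
Proof.
move=> cf; apply: (@continuous_comp _ _ _ (fun s => (s, y)) f) => //.
exact: (@cvg_pair _ _ _ (nbhs x) (nbhs x) (nbhs y) _ _ _ _ _ cvg_id (cvg_cst y)).
Qed.

Lemma continuous_slice1 f (x y : R) : {for (x, y), continuous f} ->
  {for y, continuous (fun s => f (x, s))}.
Proof.
move=> cf; apply: (@continuous_comp _ _ _ (fun s => (x, s)) f) => //.
exact: (@cvg_pair _ _ _ (nbhs y) (nbhs x) (nbhs y) _ _ _ _ _ (cvg_cst x) cvg_id).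
Qed.

Definition C0 O f := forall x, O x -> {for x, continuous f}.

Definition C1 O f := C0 O f /\ forall i x, O x ->
  is_derive x (unit_vec i) f (pd [:: i] f x) /\ {for x, continuous (pd [:: i] f)}.

Definition compact_supp O f := exists K, [/\ compact K, K `<=` O & forall x, ~ K x -> f x = 0].

Definition Cc O f := C0 setT f /\ compact_supp O f.

Definition C1c O f := C1 setT f /\ compact_supp O f.

Lemma pdE i f x : pd [:: i] f x = 'D_(unit_vec i) f x. Proof. by []. Qed.

Lemma C1_pd i O f g : open O -> (forall x, O x -> is_derive x (unit_vec i) f (g x)) -> C0 O g ->
  forall x, O x -> is_derive x (unit_vec i) f (pd [:: i] f x) /\ {for x, continuous (pd [:: i] f)}.
Proof.
move=> oO df cg x Ox; split; first by apply: derivable_is_derive; have [] := df x Ox.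
apply: (@continuous_near _ _ g) (cg x Ox).
have : nbhs x O by exact: open_nbhs_nbhs.
by apply: filterS => y /df dfy; rewrite pdE (is_deriveE dfy).
Qed.

Lemma C1_intro O f (g : 'I_2 -> plane R -> R) : open O -> C0 O f ->
  (forall i x, O x -> is_derive x (unit_vec i) f (g i x)) -> (forall i, C0 O (g i)) -> C1 O f.
Proof. by move=> oO cf df cg; split=> // i; exact: (C1_pd (g := g i)). Qed.

Lemma C1_C0 O f : C1 O f -> C0 O f. Proof. by case. Qed.

Lemma C1_pd_C0 O f i : C1 O f -> C0 O (pd [:: i] f).
Proof. by move=> [_ H] x Ox; have [] := H i x Ox. Qed.

Arguments C1_pd_C0 {O f} i _.

Lemma C1_derive O f i x : C1 O f -> O x -> is_derive x (unit_vec i) f (pd [:: i] f x).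
Proof. by move=> [_ H] Ox; have [] := H i x Ox. Qed.

Lemma C0_sub O O' f : O' `<=` O -> C0 O f -> C0 O' f.
Proof. by move=> OO cf x /OO; exact: cf. Qed.

Lemma C1_sub O O' f : O' `<=` O -> C1 O f -> C1 O' f.
Proof. by move=> OO [cf df]; split=> [|i x /OO]; [exact: C0_sub cf|exact: df]. Qed.

Lemma C0_add O f g : C0 O f -> C0 O g -> C0 O (fun x => f x + g x).
Proof. by move=> cf cg x Ox; apply: continuous_add; [exact: cf|exact: cg]. Qed.

Lemma C0_sub2 O f g : C0 O f -> C0 O g -> C0 O (fun x => f x - g x).
Proof. by move=> cf cg x Ox; apply: continuous_sub; [exact: cf|exact: cg]. Qed.

Lemma C0_mul O f g : C0 O f -> C0 O g -> C0 O (fun x => f x * g x).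
Proof. by move=> cf cg x Ox; apply: continuous_mul; [exact: cf|exact: cg]. Qed.

Lemma C0_opp O f : C0 O f -> C0 O (fun x => - f x).
Proof. by move=> cf x Ox; apply: continuous_opp; exact: cf. Qed.

Lemma C0_cst O (c : R) : C0 O (fun=> c).
Proof. by move=> x _; exact: continuous_const. Qed.

Lemma C1_add O f g : open O -> C1 O f -> C1 O g -> C1 O (fun x => f x + g x).
Proof.
move=> oO Hf Hg; apply: (C1_intro (g := fun i x => pd [:: i] f x + pd [:: i] g x)) => //.
- exact: C0_add (C1_C0 Hf) (C1_C0 Hg).
- by move=> i x Ox; apply: is_derive_add; exact: C1_derive Ox.
- by move=> i; apply: C0_add; exact: C1_pd_C0.
Qed.

Lemma C1_mul O f g : open O -> C1 O f -> C1 O g -> C1 O (fun x => f x * g x).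
Proof.
move=> oO Hf Hg.
apply: (C1_intro (g := fun i x => f x * pd [:: i] g x + g x * pd [:: i] f x)) => //.
- exact: C0_mul (C1_C0 Hf) (C1_C0 Hg).
- by move=> i x Ox; apply: is_derive_mul; exact: C1_derive Ox.
- by move=> i; apply: C0_add; apply: C0_mul; (exact: C1_pd_C0 || exact: C1_C0).
Qed.

Lemma C1_cst O (c : R) : open O -> C1 O (fun=> c).
Proof.
move=> oO; have H i x : O x -> is_derive x (unit_vec i) (fun _ : plane R => c) 0.
  by move=> _; exact: is_derive_const.
apply: (C1_intro oO _ H); first exact: C0_cst.
by move=> i; exact: C0_cst.
Qed.

Lemma C1_inv O f : open O -> C1 O f -> (forall x, O x -> f x != 0) ->
  C1 O (fun x => (f x)^-1).
Proof.
move=> oO Hf f0.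
apply: (C1_intro (g := fun i x => - ((f x)^-1 * (f x)^-1) * pd [:: i] f x)) => //.
- by move=> x Ox; apply: continuous_inv; [exact: f0|exact: (C1_C0 Hf)].
- move=> i x Ox; apply: is_derive_eq' (is_derive_inv (f0 x Ox) (C1_derive i Hf Ox)) _.
  by rewrite -exprVn expr2.
- move=> i; apply: C0_mul; last exact: C1_pd_C0.
  apply: C0_opp; apply: C0_mul => x Ox; apply: continuous_inv; by [exact: f0|exact: (C1_C0 Hf)].
Qed.

Lemma smooth_C1 O f : smooth f -> C1 O f.
Proof.
move=> sf; split=> [x _|i x _]; first exact: smooth_cont.
by split; [exact: smooth_is_derive|exact: (@smooth_cont _ _ (pd [:: i] f) x (smooth_D _ sf))].
Qed.

Lemma test_C1c O f : test O f -> C1c O f.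
Proof. by move=> [sf ?]; split => //; exact: smooth_C1. Qed.

Lemma test_Cc O f : test O f -> Cc O f.
Proof. by move=> [sf ?]; split => // x _; exact: smooth_cont. Qed.

Lemma C1c_Cc O f : C1c O f -> Cc O f.
Proof. by move=> [[]]. Qed.

Lemma smooth_pd s f : smooth f -> smooth (pd s f).
Proof. exact: smooth_iter. Qed.

Lemma test_pd s O f : test O f -> test O (pd s f).
Proof. exact: test_iter. Qed.

Lemma compact_supp_near O f x : compact_supp O f -> ~ O x -> \near x, f x = 0.
Proof.
move=> [K [cK KO f0]] Ox.
have cl : closed K by apply: compact_closed => //; exact: norm_hausdorff.
have : nbhs x (~` K).
  by apply: open_nbhs_nbhs; split; [exact: closed_openC|move=> /KO].
by apply: filterS => y /f0.
Qed.

Lemma Cc_mul O f h : Cc O f -> C0 O h -> Cc O (fun x => f x * h x).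
Proof.
move=> [cf sf] ch; split; last first.
  by have [K [cK KO f0]] := sf; exists K; split=> // x /f0 ->; rewrite mul0r.
move=> x _; have [Ox|Ox] := pselect (O x).
  by apply: continuous_mul; [exact: cf|exact: ch].
have H0 : {for x, continuous (fun _ : plane R => 0 : R)} by exact: cst_continuous.
refine (continuous_near _ H0).
by apply: filterS (compact_supp_near sf Ox) => y ->; rewrite mul0r.
Qed.

Lemma C1c_pd_Cc O f i : C1c O f -> Cc O (pd [:: i] f).
Proof.
move=> [Hf [K [cK KO f0]]]; split; first exact: C1_pd_C0.
exists K; split=> //; exact: (@iter_deriv_out _ _ _ _ [:: unit_vec i]).
Qed.

(** [h] is controlled on [O] only. Near a point outside of [O] the product is 0, because the support
    of [f] is a compact subset of [O]; this makes it $C^1$ on the whole plane. *)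
Lemma C1c_mul O f h : open O -> C1c O f -> C1 O h -> C1c O (fun x => f x * h x) /\
  forall i x, pd [:: i] (fun x => f x * h x) x = f x * pd [:: i] h x + h x * pd [:: i] f x.
Proof.
move=> oO Hf Hh; have [Hf1 sf] := Hf.
have H i x : is_derive x (unit_vec i) (fun x => f x * h x)
    (f x * pd [:: i] h x + h x * pd [:: i] f x).
  have [Ox|Ox] := pselect (O x).
    by apply: is_derive_mul; [exact: C1_derive Hf1 _|exact: C1_derive Hh Ox].
  have fx0 := compact_supp_near sf Ox.
  rewrite (nbhs_singleton fx0) mul0r add0r.
  have -> : pd [:: i] f x = 0.
    by apply: is_deriveE; apply: is_derive_near (is_derive_const 0 x _); apply: filterS fx0 => y ->.
  rewrite mulr0; apply: is_derive_near (is_derive_const 0 x _).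
  by apply: filterS fx0 => y ->; rewrite mul0r.
split; last by move=> i x; exact: is_deriveE.
split; last by have [K [cK KO f0]] := sf; exists K; split=> // x /f0 ->; rewrite mul0r.
apply: (@C1_intro setT _ _ openT _ (fun i x _ => H i x)).
- exact: (Cc_mul (C1c_Cc Hf) (C1_C0 Hh)).1.
- move=> i; apply: C0_add; first exact: (Cc_mul (C1c_Cc Hf) (C1_pd_C0 i Hh)).1.
  by under eq_fun do rewrite mulrC; exact: (Cc_mul (C1c_pd_Cc i Hf) (C1_C0 Hh)).1.
Qed.

Lemma C1c_sub O O' f : O `<=` O' -> C1c O f -> C1c O' f.
Proof.
move=> OO [cf [K [cK KO f0]]]; split=> //; exists K; split=> //; exact: subset_trans OO.
Qed.

Lemma Cc_integrable O f : Cc O f -> area.-integrable setT (EFin \o f).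
Proof.
move=> [cf [K [cK KO f0]]]; apply: (integrable_out (setT : set (measurableTypeR R * measurableTypeR R)%type) K) => //.
- exact: compact_measurable2.
- by move=> x _; exact: f0.
- by apply: (@continuous_integrable2 _ setT) => //; exact: openT.
Qed.

Lemma Cc_Rintegral O f : open O -> Cc O f -> \int[area]_(x in O) f x = \int[area]_x f x.
Proof.
move=> oO [cf [K [cK KO f0]]]; rewrite [RHS](Rintegral_out (setT : set (measurableTypeR R * measurableTypeR R)%type) O) //.
- exact: open_measurable2.
- by move=> x _ Ox; apply: f0 => /KO.
Qed.

Lemma Rintegral_pd_Cc f i : C1c setT f -> \int[area]_x pd [:: i] f x = 0.
Proof.
move=> Hf; have gi := Cc_integrable (C1c_pd_Cc i Hf).
have [Hf1 [K [cK _ f0]]] := Hf; have [M M0 KM] := compact_box cK.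
have cg : forall x, {for x, continuous (pd [:: i] f)} by move=> x; exact: (C1_pd_C0 i Hf1 x I).
move: i gi cg; apply: ord2P => gi cg.
- rewrite (Rintegral_prod21 gi) -[RHS](@Rintegral0 _ _ _ leb setT).
  apply: eq_Rintegral => y _.
  apply: (@Rintegral_derive_compact _ (fun x => f (x, y)) (fun x => pd [:: ord0] f (x, y)) M M0).
  + by move=> x; apply/is_derive_slice0; exact: C1_derive Hf1 _.
  + by move=> x; exact: continuous_slice0 (cg _).
  + by move=> x xM; apply: f0 => /KM [/=]; rewrite in_itv.
- rewrite (Rintegral_prod12 gi) -[RHS](@Rintegral0 _ _ _ leb setT).
  apply: eq_Rintegral => x _.
  apply: (@Rintegral_derive_compact _ (fun y => f (x, y)) (fun y => pd [:: ord_max] f (x, y)) M M0).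
  + by move=> y; apply/is_derive_slice1; exact: C1_derive Hf1 _.
  + by move=> y; exact: continuous_slice1 (cg _).
  + by move=> y yM; apply: f0 => /KM [/= _]; rewrite in_itv.
Qed.

Lemma Cc_integrableO O f : open O -> Cc O f -> area.-integrable O (EFin \o f).
Proof.
move=> oO Hf; apply: integrableS (Cc_integrable Hf) => //; exact: open_measurable2.
Qed.

Lemma integration_by_parts2 O f h i : open O -> C1c O f -> C1 O h ->
  \int[area]_(x in O) (h x * pd [:: i] f x) = - \int[area]_(x in O) (pd [:: i] h x * f x).
Proof.
move=> oO Hf Hh; have [Hfh E] := C1c_mul oO Hf Hh; have mO := open_measurable2 oO.
have i1 : Cc O (fun x => h x * pd [:: i] f x).
  by under eq_fun do rewrite mulrC; exact: Cc_mul (C1c_pd_Cc i Hf) (C1_C0 Hh).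
have i2 : Cc O (fun x => pd [:: i] h x * f x).
  by under eq_fun do rewrite mulrC; exact: Cc_mul (C1c_Cc Hf) (C1_pd_C0 i Hh).
apply/eqP; rewrite -addr_eq0 -RintegralD //; [|exact: Cc_integrableO|exact: Cc_integrableO].
have := Rintegral_pd_Cc i (C1c_sub (@subsetT _ _) Hfh).
rewrite -(Cc_Rintegral oO (C1c_pd_Cc i Hfh)) => H; apply/eqP; rewrite -H.
by apply: eq_Rintegral => x _; rewrite E addrC; congr (_ + _); rewrite mulrC.
Qed.

End PlaneCalculus.

Arguments C1_pd_C0 {R O f} i _.
Arguments C1_derive {R O f} i {x} _ _.

(** * Square-integrable functions and convergence in $L^2$ *)

Section SquareIntegrable.
Context d {T : measurableType d} {R : realType} (mu : {measure set T -> \bar R}).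
Context (D : set T) (mD : measurable D).
Implicit Types (f g h : T -> R).

Definition sqi f := measurable_fun D f /\ mu.-integrable D (fun x => (f x ^+ 2)%:E).

Lemma sqi_mul f g : sqi f -> sqi g -> mu.-integrable D (EFin \o (fun x => f x * g x)).
Proof.
move=> [mf fi] [mg gi].
apply: (integrable_le mD (g := fun x => f x ^+ 2 + g x ^+ 2)).
- exact: measurable_funM.
- move=> x _; rewrite ler_norml; apply/andP.
  have h1 := sqr_ge0 (f x + g x); have h2 := sqr_ge0 (f x - g x).
  have h3 := sqr_ge0 (f x); have h4 := sqr_ge0 (g x).
  split; nra.
- exact: integrableD_EFin.
Qed.

Lemma sqi_le f g : measurable_fun D f -> sqi g -> (forall x, D x -> `|f x| <= `|g x|) -> sqi f.
Proof.
move=> mf [mg gi] fg; split => //.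
apply: (integrable_le mD (f := fun x => f x ^+ 2) (g := fun x => g x ^+ 2)) => //.
- exact: measurable_funX.
- by move=> x Dx; rewrite normrX -[g x ^+ 2]ger0_norm ?sqr_ge0 // normrX lerXn2r ?nnegrE // fg.
Qed.

Lemma sqi_add f g : sqi f -> sqi g -> sqi (fun x => f x + g x).
Proof.
move=> sf sg; split; first by apply: measurable_funD; [exact: sf.1|exact: sg.1].
have := integrableD_EFin mD (integrableD_EFin mD sf.2 sg.2) (integrableZ_EFin 2 mD (sqi_mul sf sg)).
by apply: eq_integrable => // x _ /=; congr EFin; ring.
Qed.

Lemma sqi_scale (c : R) f : sqi f -> sqi (fun x => c * f x).
Proof.
move=> sf; split; first by apply: measurable_funM => //; exact: sf.1.
have := integrableZ_EFin (c ^+ 2) mD sf.2.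
by apply: eq_integrable => // x _ /=; congr EFin; ring.
Qed.

Lemma sqi_opp f : sqi f -> sqi (fun x => - f x).
Proof. by move=> /(sqi_scale (-1)); congr sqi; apply/funext => x; rewrite mulN1r. Qed.

Lemma sqi_sub f g : sqi f -> sqi g -> sqi (fun x => f x - g x).
Proof. by move=> sf sg; apply: sqi_add => //; exact: sqi_opp. Qed.

Lemma sqi_bndM f h (M : R) : sqi f -> measurable_fun D h -> (forall x, D x -> `|h x| <= M) ->
  sqi (fun x => f x * h x).
Proof.
move=> sf mh hM; apply: (@sqi_le _ (fun x => M * f x)).
- by apply: measurable_funM => //; exact: sf.1.
- exact: sqi_scale.
- move=> x Dx; rewrite !normrM mulrC ler_wpM2r // (le_trans (hM x Dx)) //; exact: ler_norm.
Qed.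

Lemma sqi_ae f g : measurable_fun D g -> {ae mu, forall x, D x -> f x = g x} -> sqi f -> sqi g.
Proof.
move=> mg fg [mf fi]; split => //.
apply: (ae_eq_integrable (f := fun x => f x ^+ 2) (g := fun x => g x ^+ 2)) => //.
- exact: measurable_funX.
- by apply: (ae_imply fg) => x h Dx; rewrite h.
Qed.

Definition L2norm f := Num.sqrt (\int[mu]_(x in D) (f x ^+ 2)).

Lemma L2norm_ge0 f : 0 <= L2norm f. Proof. exact: sqrtr_ge0. Qed.

Lemma L2norm_sq f : L2norm f ^+ 2 = \int[mu]_(x in D) (f x ^+ 2).
Proof. by rewrite sqr_sqrtr // Rintegral_ge0 // => x _; exact: sqr_ge0. Qed.

Lemma cauchy_schwarz_L2 f g : sqi f -> sqi g ->
  `|\int[mu]_(x in D) (f x * g x)| <= L2norm f * L2norm g.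
Proof.
move=> sf sg.
set A := \int[mu]_(x in D) (f x ^+ 2); set C := \int[mu]_(x in D) (g x ^+ 2).
set B := \int[mu]_(x in D) (f x * g x).
have A0 : 0 <= A by rewrite Rintegral_ge0 // => x _; exact: sqr_ge0.
have C0 : 0 <= C by rewrite Rintegral_ge0 // => x _; exact: sqr_ge0.
have H t : 0 <= t ^+ 2 * A + 2 * t * B + C.
  have : 0 <= \int[mu]_(x in D) ((t * f x + g x) ^+ 2) by rewrite Rintegral_ge0 // => x _; exact: sqr_ge0.
  have -> : \int[mu]_(x in D) ((t * f x + g x) ^+ 2) =
     \int[mu]_(x in D) (t ^+ 2 * f x ^+ 2 + 2 * t * (f x * g x) + g x ^+ 2).
    by apply: eq_Rintegral => x _; ring.
  have i1 := integrableZ_EFin (t ^+ 2) mD sf.2.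
  have i2 := integrableZ_EFin (2 * t) mD (sqi_mul sf sg).
  rewrite RintegralD //; [|exact: integrableD_EFin|exact: sg.2].
  rewrite RintegralD // !RintegralZl //; [exact: sqi_mul|exact: sf.2].
have BAC : B ^+ 2 <= A * C.
  move: A0; rewrite le_eqVlt => /predU1P[A0|A0].
    have B0 : B = 0.
      apply/eqP; apply: contraT => B0.
      (* If the leading coefficient is 0 and [B] is not, the nonnegative polynomial is affine in
         [t], and this [t] would give it the value -1. *)
      have := H (- (C + 1) / (2 * B)); rewrite -A0 mulr0 add0r.
      have -> : 2 * (- (C + 1) / (2 * B)) * B = - (C + 1) by field.
      lra.
    by rewrite B0 -A0 expr0n mul0r.
  have := H (- B / A).
  have -> : (- B / A) ^+ 2 * A + 2 * (- B / A) * B + C = (A * C - B ^+ 2) / A by field; lra.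
  by rewrite pmulr_lge0 ?invr_gt0 // subr_ge0.
rewrite -(ler_pXn2r (ltn0Sn 1)) ?nnegrE ?mulr_ge0 ?L2norm_ge0 //.
by rewrite exprMn !L2norm_sq real_normK // num_real.
Qed.

Definition cvgL2 (fn : nat -> T -> R) f := [/\ forall n, sqi (fn n), sqi f &
  L2norm (fun x => fn n x - f x) @[n --> \oo] --> (0 : R)].

Lemma cvgL2_cst f : sqi f -> cvgL2 (fun=> f) f.
Proof.
move=> sf; split => //; apply: cvg_near_cst; apply: nearW => n.
rewrite /L2norm (_ : Rintegral _ _ _ = 0) ?sqrtr0 // -[RHS](@Rintegral0 _ _ _ mu D).
by apply: eq_Rintegral => x _; rewrite subrr expr0n.
Qed.

Lemma cvgL2_mul fn gn f g : cvgL2 fn f -> cvgL2 gn g ->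
  \int[mu]_(x in D) (fn n x * gn n x) @[n --> \oo] --> \int[mu]_(x in D) (f x * g x).
Proof.
move=> [sfn sf cf] [sgn sg cg].
have bnd n : `|\int[mu]_(x in D) (f x * g x) - \int[mu]_(x in D) (fn n x * gn n x)| <=
   L2norm (fun x => fn n x - f x) * L2norm (fun x => gn n x - g x) +
   L2norm f * L2norm (fun x => gn n x - g x) + L2norm (fun x => fn n x - f x) * L2norm g.
  have df := sqi_sub (sfn n) sf; have dg := sqi_sub (sgn n) sg.
  rewrite distrC -RintegralB //; [|exact: sqi_mul|exact: sqi_mul].
  have -> : \int[mu]_(x in D) (fn n x * gn n x - f x * g x) =
    \int[mu]_(x in D) ((fn n x - f x) * (gn n x - g x) + f x * (gn n x - g x) + (fn n x - f x) * g x).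
    by apply: eq_Rintegral => x _; ring.
  rewrite RintegralD //; [|by apply: integrableD_EFin => //; exact: sqi_mul|exact: sqi_mul].
  rewrite RintegralD //; [|exact: sqi_mul|exact: sqi_mul].
  apply: le_trans (ler_normD _ _) _; rewrite lerD //; last exact: cauchy_schwarz_L2.
  by apply: le_trans (ler_normD _ _) _; rewrite lerD //; exact: cauchy_schwarz_L2.
apply/cvgrPdist_le => e e0.
have lim : L2norm (fun x => fn n x - f x) * L2norm (fun x => gn n x - g x) +
   L2norm f * L2norm (fun x => gn n x - g x) + L2norm (fun x => fn n x - f x) * L2norm g
   @[n --> \oo] --> (0 * 0 + L2norm f * 0 + 0 * L2norm g : R).
  apply: cvgD; [apply: cvgD|]; apply: cvgM => //; exact: cvg_cst.
move: lim; rewrite !mul0r mulr0 !addr0 => /cvgrPdist_le /(_ e e0).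
apply: filterS => n; rewrite sub0r normrN => h.
by apply: le_trans (bnd n) _; apply: le_trans h; exact: ler_norm.
Qed.

Lemma cvgL2_scale (c : R) fn f : cvgL2 fn f -> cvgL2 (fun n x => c * fn n x) (fun x => c * f x).
Proof.
move=> [sfn sf cf]; split; [by move=> n; exact: sqi_scale|exact: sqi_scale|].
have : `|c| * L2norm (fun x => fn n x - f x) @[n --> \oo] --> (`|c| * 0 : R).
  by apply: cvgM => //; exact: cvg_cst.
rewrite mulr0; apply: cvg_trans; apply: near_eq_cvg; apply: nearW => n.
rewrite /L2norm -sqrtr_sqr -sqrtrM ?sqr_ge0 // -RintegralZl //; last exact: (sqi_sub (sfn n) sf).2.
by congr Num.sqrt; apply: eq_Rintegral => x _; ring.
Qed.

Lemma L2norm_le f g (M : R) : 0 <= M -> sqi f -> sqi g ->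
  (forall x, D x -> `|f x| <= M * `|g x|) -> L2norm f <= M * L2norm g.
Proof.
move=> M0 sf sg fg.
rewrite -(ler_pXn2r (ltn0Sn 1)) ?nnegrE ?mulr_ge0 ?L2norm_ge0 // exprMn !L2norm_sq.
rewrite -RintegralZl //; last exact: sg.2.
apply: le_Rintegral => //; [exact: sf.2|exact: integrableZ_EFin sg.2|].
move=> x Dx; rewrite -exprMn -[f x ^+ 2]real_normK ?num_real //.
rewrite -[leRHS]real_normK ?num_real // ler_pXn2r ?nnegrE //.
by rewrite normrM (ger0_norm M0) fg.
Qed.

Lemma cvgL2_bndM fn f h (M : R) : cvgL2 fn f -> measurable_fun D h ->
  (forall x, D x -> `|h x| <= M) -> cvgL2 (fun n x => fn n x * h x) (fun x => f x * h x).
Proof.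
move=> [sfn sf cf] mh hM.
have hM' x : D x -> `|h x| <= `|M| by move=> Dx; apply: le_trans (hM x Dx) _; exact: ler_norm.
split; [by move=> n; exact: sqi_bndM hM|exact: sqi_bndM hM|].
have H : `|M| * L2norm (fun x => fn n x - f x) @[n --> \oo] --> (0 : R).
  by rewrite -[X in _ --> X](mulr0 `|M|); apply: cvgM => //; exact: cvg_cst.
apply/cvgrPdist_le => e e0; move/cvgrPdist_le : H => /(_ e e0); apply: filterS => n.
rewrite !sub0r !normrN [X in X <= _ -> _]ger0_norm ?mulr_ge0 ?L2norm_ge0 //.
apply: le_trans; rewrite ger0_norm ?L2norm_ge0 //; apply: L2norm_le => //.
- by apply: sqi_sub; exact: sqi_bndM hM.
- exact: sqi_sub.
- by move=> x Dx; rewrite -mulrBl normrM mulrC ler_wpM2r // hM'.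
Qed.

(** The Sobolev convergence [Hcvg] is stated with extended integrals; the real norm is what the
    algebra of limits handles. *)
Lemma cvgL2P fn f : (forall n, sqi (fn n)) -> sqi f ->
  (\int[mu]_(x in D) ((fn n x - f x) ^+ 2)%:E)%E @[n --> \oo] --> 0%E <-> cvgL2 fn f.
Proof.
move=> sfn sf.
have fi n : (\int[mu]_(x in D) ((fn n x - f x) ^+ 2)%:E)%E =
    (\int[mu]_(x in D) ((fn n x - f x) ^+ 2))%:E.
  by rewrite /Rintegral fineK //; apply: integrable_fin_num => //; exact: (sqi_sub (sfn n) sf).2.
split=> [H|[_ _ H]].
- split => //; rewrite -(sqrtr0 R).
  apply: (@continuous_cvg _ _ _ _ _ _ Num.sqrt 0); first exact: sqrt_continuous.
  exact: (fine_cvg H).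
- under eq_fun do rewrite fi -L2norm_sq.
  apply: cvg_EFin; first by near=> n.
  have : (L2norm (fun x => fn n x - f x)) ^+ 2 @[n --> \oo] --> ((0 : R) ^+ 2).
    by rewrite expr2; under eq_fun do rewrite expr2; exact: cvgM.
  by rewrite expr0n.
Unshelve. all: by end_near. Qed.

Lemma sqi_integrable f : (mu D < +oo)%E -> sqi f -> mu.-integrable D (EFin \o f).
Proof.
move=> fD sf.
have s1 : sqi (fun=> 1).
  split; first exact: measurable_cst.
  apply: (measurable_bounded_integrable (f := fun=> 1 ^+ 2)) => //.
  by apply: (@bounded_onP _ _ _ _ 1) => x _; rewrite expr1n normr1.
have := sqi_mul sf s1; apply: eq_integrable => // x _ /=; by rewrite mulr1.
Qed.

End SquareIntegrable.

(** * Properties almost everywhere and weak derivatives on open sets *)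

Section PlaneIntegrals.
Context {R : realType}.
Implicit Types (O K : set (plane R)) (f g h p : plane R -> R) (i j : 'I_2).

Lemma L2_sqi O f : L2 O f <-> sqi area O f.
Proof. by []. Qed.

Lemma ae_on_imply O (P Q : plane R -> Prop) : ae_on O P -> (forall x, O x -> P x -> Q x) -> ae_on O Q.
Proof. by move=> aP PQ; apply: (ae_imply aP) => x h Ox; apply: PQ => //; exact: h. Qed.

Lemma ae_on_imply2 O (P Q S : plane R -> Prop) : ae_on O P -> ae_on O Q ->
  (forall x, O x -> P x -> Q x -> S x) -> ae_on O S.
Proof.
by move=> aP aQ PQ; apply: (ae_imply2 aP aQ) => x h1 h2 Ox; apply: PQ => //; [exact: h1|exact: h2].
Qed.

Lemma ae_on_all O (P : plane R -> Prop) : (forall x, O x -> P x) -> ae_on O P.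
Proof. by move=> h; apply: ae_forall => x; exact: h. Qed.

Lemma ae_on_sub O O' (P : plane R -> Prop) : O' `<=` O -> ae_on O P -> ae_on O' P.
Proof. by move=> OO aP; apply: (ae_imply aP) => x h /OO. Qed.

Lemma nbhs_box O (x y : R) : open O -> O (x, y) ->
  exists2 r : R, 0 < r & box (x - r) (x + r) (y - r) (y + r) `<=` O.
Proof.
move=> oO Oxy; have /nbhs_ballP[e /= e0 He] : nbhs (x, y) O by exact: open_nbhs_nbhs.
exists (e / 2); first by rewrite divr_gt0.
move=> [a b] [/=]; rewrite !in_itv /= => /andP[a1 a2] /andP[b1 b2]; apply: He.
by split; rewrite /ball /= ltr_norml; apply/andP; split; lra.
Qed.

(** Countably many boxes with rational corners, with closures in [O], cover [O], so only countably
    many null sets are united. *)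
Lemma ae_on_local O (P : plane R -> Prop) : open O ->
  (forall a b c d, a < b -> c < d -> box a b c d `<=` O -> ae_on (obox a b c d) P) -> ae_on O P.
Proof.
move=> oO H.
pose N := fun n => if @unpickle (rat * rat * rat * rat)%type n is Some (a, b, c, d) then
  if `[< (ratr a : R) < ratr b /\ (ratr c : R) < ratr d /\
     box (ratr a) (ratr b) (ratr c) (ratr d) `<=` O >]
  then obox (ratr a) (ratr b) (ratr c) (ratr d) `&` ~` P else set0 else set0 : set (plane R).
apply: (@negligibleS _ _ _ area (\bigcup_n N n)); last first.
  apply: negligible_bigcup => n; rewrite /N; case: unpickle => [[[[a b] c] d]|]; last exact: negligible_set0.
  case: asboolP => [[ab [cd bO]]|_]; last exact: negligible_set0.
  have := H _ _ _ _ ab cd bO; rewrite /ae_on /almost_everywhere /prop_near1 /nbhs /=.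
  by apply: negligibleS => z [oz nP] /(_ oz).
move=> [x y] /= /not_implyP[Oxy nP].
have [r r0 rO] := nbhs_box oO Oxy.
have [a a1] := @rat_in_itvoo R (x - r) x ltac:(by rewrite ltrBlDr ltrDl).
have [b b1] := @rat_in_itvoo R x (x + r) ltac:(by rewrite ltrDl).
have [c c1] := @rat_in_itvoo R (y - r) y ltac:(by rewrite ltrBlDr ltrDl).
have [d d1] := @rat_in_itvoo R y (y + r) ltac:(by rewrite ltrDl).
move: a1 b1 c1 d1; rewrite !in_itv /= => /andP[a1 a2] /andP[b1 b2] /andP[c1 c2] /andP[d1 d2].
exists (pickle (a, b, c, d)); [exact: I|]; rewrite /N pickleK; case: asboolP => [_|[]].
  by split => //; split; rewrite /= in_itv /= ?a2 ?c2.
split; [lra|split; [lra|]].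
move=> z [/=]; rewrite !in_itv /= => /andP[z1 z2] /andP[z3 z4]; apply: rO.
by split; rewrite /= in_itv /=; apply/andP; split; lra.
Qed.

Lemma test_tensor a b c d O (h k : R -> R) : box a b c d `<=` O -> test1 a b h -> test1 c d k ->
  test O (fun z : plane R => h z.1 * k z.2).
Proof.
move=> bO [sh h0] [sk k0]; split.
  apply: smooth_mul.
    by apply: smooth_lin => // z; exact: cvg_fst.
  by apply: smooth_lin => // z; exact: cvg_snd.
exists (box a b c d); split => //; first exact: box_compact.
move=> [x y] nb /=; have [xab|xab] := boolP (a < x < b); last by rewrite h0 // mul0r.
have [ycd|ycd] := boolP (c < y < d); last by rewrite k0 // mulr0.
exfalso; apply: nb; move: xab ycd => /andP[x1 x2] /andP[y1 y2].
by split; rewrite /= in_itv /= !ltW.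
Qed.

Lemma Cc_bounded O f : Cc O f -> exists2 M : R, 0 < M & forall x, `|f x| <= M.
Proof.
move=> [cf [K [cK KO f0]]].
have [M M0 HM] := continuous_bounded_on cK (fun x _ => cf x I).
exists M => // x; have [Kx|/f0 ->] := pselect (K x); first exact: HM.
by rewrite normr0 ltW.
Qed.

Lemma Cc_measurable O D f : Cc O f ->
  measurable_fun (D : set (measurableTypeR R * measurableTypeR R)%type) f.
Proof.
by move=> [cf _]; apply: measurable_funTS; apply: continuous_measurable2 => //; exact: openT.
Qed.

Arguments Cc_measurable {O} D {f} _.

Lemma C0_measurable O f : open O -> C0 O f ->
  measurable_fun (O : set (measurableTypeR R * measurableTypeR R)%type) f.
Proof. by move=> oO cf; exact: continuous_measurable2. Qed.

Lemma L1loc_Cc O g f : open O -> L1loc O g -> Cc O f ->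
  area.-integrable O (EFin \o (fun x => g x * f x)).
Proof.
move=> oO [mg gi] Hf; have [M M0 fM] := Cc_bounded Hf; have [_ [K [cK KO f0]]] := Hf.
apply: (integrable_out (O : set (measurableTypeR R * measurableTypeR R)%type) K) => //.
- exact: open_measurable2.
- exact: compact_measurable2.
- by move=> x _ /f0 ->; rewrite mulr0.
- apply: (integrable_bndM (M := M)) => //; first exact: compact_measurable2.
  + exact: gi.
  + exact: Cc_measurable Hf.
Qed.

Lemma C0_L1loc O f : open O -> C0 O f -> L1loc O f.
Proof.
move=> oO cf; split; first exact: C0_measurable.
by move=> K cK KO; exact: (continuous_integrable2 oO cf).
Qed.

Lemma L2_L1loc O f : open O -> L2 O f -> L1loc O f.
Proof.
move=> oO [mf fi]; split => // K cK KO.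
have mK := compact_measurable2 cK; have mO := open_measurable2 oO.
apply: (sqi_integrable mK (compact_area cK)).
by split; [exact: measurable_funS mf|exact: integrableS fi].
Qed.

Lemma L1loc_add O f g : open O -> L1loc O f -> L1loc O g -> L1loc O (fun x => f x + g x).
Proof.
move=> oO [mf fi] [mg gi]; split; first exact: measurable_funD.
move=> K cK KO; apply: integrableD_EFin; [exact: compact_measurable2|exact: fi|exact: gi].
Qed.

Lemma L1loc_scale O (c : R) f : open O -> L1loc O f -> L1loc O (fun x => c * f x).
Proof.
move=> oO [mf fi]; split; first exact: measurable_funM.
by move=> K cK KO; apply: integrableZ_EFin; [exact: compact_measurable2|exact: fi].
Qed.

Lemma L1loc_opp O f : open O -> L1loc O f -> L1loc O (fun x => - f x).
Proof.
by move=> oO /(L1loc_scale (-1) oO); congr L1loc; apply/funext => x; rewrite mulN1r.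
Qed.

Lemma L1loc_sub O f g : open O -> L1loc O f -> L1loc O g -> L1loc O (fun x => f x - g x).
Proof. by move=> oO Hf Hg; apply: L1loc_add => //; exact: L1loc_opp. Qed.

Lemma L1loc_mulC0 O f g : open O -> L1loc O f -> C0 O g -> L1loc O (fun x => f x * g x).
Proof.
move=> oO [mf fi] cg; split; first by apply: measurable_funM => //; exact: C0_measurable.
move=> K cK KO; have [M M0 gM] := continuous_bounded_on cK (fun x Kx => cg x (KO x Kx)).
apply: (integrable_bndM (M := M)) => //; [exact: compact_measurable2|exact: fi|].
apply: measurable_funS KO _; [exact: open_measurable2|exact: C0_measurable].
Qed.

Lemma L1loc_ae O f g : open O ->
  measurable_fun (O : set (measurableTypeR R * measurableTypeR R)%type) g ->
  ae_on O (fun x => f x = g x) -> L1loc O f -> L1loc O g.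
Proof.
move=> oO mg fg [mf fi]; split => // K cK KO; have mO := open_measurable2 oO.
apply: ae_eq_integrable (fi K cK KO); [exact: compact_measurable2|exact: measurable_funS mg|].
exact: ae_on_sub fg.
Qed.

Lemma L1loc_subset O O' f : open O -> O' `<=` O -> measurable (O' : set (measurableTypeR R * measurableTypeR R)%type) ->
  L1loc O f -> L1loc O' f.
Proof.
move=> oO OO mO' [mf fi]; split; first by apply: measurable_funS mf => //; exact: open_measurable2.
by move=> K cK KO; apply: fi => //; exact: subset_trans OO.
Qed.

Lemma fundamental_open O g : open O -> L1loc O g ->
  (forall phi, test O phi -> \int[area]_(x in O) (g x * phi x) = 0) -> ae_on O (fun x => g x = 0).
Proof.
move=> oO [mg gi] H; apply: ae_on_local => // a b c d ab cd bO.
apply: fundamental_box; first by apply: gi => //; exact: box_compact.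
move=> h k th tk; have tt := test_tensor bO th tk.
rewrite -(H _ tt); apply/esym.
apply: (Rintegral_out (O : set (measurableTypeR R * measurableTypeR R)%type)) => //.
- exact: open_measurable2.
- exact: box_measurable.
- move=> [x y] _ nb /=; have [xab|xab] := boolP (a < x < b); last by rewrite (th.2 _ xab) mul0r mulr0.
  have [ycd|ycd] := boolP (c < y < d); last by rewrite (tk.2 _ ycd) !mulr0.
  exfalso; apply: nb; move: xab ycd => /andP[x1 x2] /andP[y1 y2].
  by split; rewrite /= in_itv /= !ltW.
Qed.

Lemma fundamental_eq O f g : open O -> L1loc O f -> L1loc O g ->
  (forall phi, test O phi ->
    \int[area]_(x in O) (f x * phi x) = \int[area]_(x in O) (g x * phi x)) ->
  ae_on O (fun x => f x = g x).
Proof.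
move=> oO Lf Lg H; have mO := open_measurable2 oO.
have : ae_on O (fun x => f x - g x = 0).
  apply: fundamental_open => //; first exact: L1loc_sub.
  move=> phi tp; under eq_Rintegral do rewrite mulrBl.
  by rewrite RintegralB // ?H ?subrr //; apply: L1loc_Cc => //; exact: test_Cc.
by move=> H'; apply: (ae_on_imply H') => x _ /eqP; rewrite subr_eq0 => /eqP.
Qed.

Lemma C0_ae_eq O f g : open O -> C0 O f -> C0 O g -> ae_on O (fun x => f x = g x) ->
  forall x, O x -> f x = g x.
Proof.
move=> oO cf cg fg x Ox; apply/eqP; apply: contraT => fgx.
pose U := O `&` [set y | f y - g y != 0].
have oU : open U.
  have o0 : open [set t : R | t != 0].
    rewrite (_ : [set t : R | _] = `]-oo, 0[%classic `|` `]0, +oo[%classic).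
      by apply: openU; exact: interval_open.
    by apply/seteqP; split=> t /=; rewrite !in_itv /= andbT neq_lt => /orP.
  exact: (open_preimage_open oO (C0_sub2 cf cg) o0).
have Ux : U x by split => //=; rewrite subr_eq0.
case: x Ux {Ox fgx} => x y Ux; have [r r0 rU] := nbhs_box oU Ux.
have : area.-negligible (obox (x - r) (x + r) (y - r) (y + r)).
  apply: negligibleS fg => z /obox_box /rU [Oz /= fgz] /(_ Oz) E.
  by rewrite E subrr eqxx in fgz.
move/negligibleP => /(_ (obox_measurable _ _ _ _)).
rewrite /area/= product_measure1E; [|exact: measurable_itv|exact: measurable_itv].
rewrite [X in (X * _)%E](_ : _ = lebesgue_measure `](x - r), (x + r)[%classic)//.
rewrite [X in (_ * X)%E](_ : _ = lebesgue_measure `](y - r), (y + r)[%classic)//.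
rewrite !lebesgue_measure_itv /= !lte_fin !ifT; [|lra|lra].
by rewrite -!EFinB -EFinM => -[]; nra.
Qed.

Lemma ae_on_eq_Rintegral O f g : open O ->
  measurable_fun (O : set (measurableTypeR R * measurableTypeR R)%type) f ->
  measurable_fun (O : set (measurableTypeR R * measurableTypeR R)%type) g ->
  ae_on O (fun x => f x = g x) -> \int[area]_(x in O) f x = \int[area]_(x in O) g x.
Proof. by move=> oO mf mg fg; apply: ae_eq_Rintegral => //; exact: open_measurable2. Qed.

Lemma is_wD_unique O s f g h : open O -> is_wD O s f g -> is_wD O s f h ->
  ae_on O (fun x => g x = h x).
Proof.
move=> oO [_ Lg Hg] [_ Lh Hh]; apply: fundamental_eq => // phi tp.
have := Hg phi tp; rewrite (Hh phi tp) => E.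
apply: (@mulfI _ ((-1) ^+ size s)); last exact/esym.
by rewrite expf_neq0 // oppr_eq0 oner_eq0.
Qed.

Lemma is_wD_wD O s f g : is_wD O s f g -> is_wD O s f (wD O s f).
Proof. by move=> H; rewrite /wD; case: xgetP => [h -> //|/(_ g)]. Qed.

Lemma wD_ae O s f g : open O -> is_wD O s f g -> ae_on O (fun x => wD O s f x = g x).
Proof. by move=> oO H; exact: is_wD_unique (is_wD_wD H) H. Qed.

Lemma is_wD_ae O s f f' g g' : open O -> is_wD O s f g ->
  measurable_fun (O : set (measurableTypeR R * measurableTypeR R)%type) f' ->
  measurable_fun (O : set (measurableTypeR R * measurableTypeR R)%type) g' ->
  ae_on O (fun x => f x = f' x) -> ae_on O (fun x => g x = g' x) -> is_wD O s f' g'.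
Proof.
move=> oO [Lf Lg H] mf mg ff gg; have Lf' := L1loc_ae oO mf ff Lf; have Lg' := L1loc_ae oO mg gg Lg.
split => // phi tp.
have mphi D s' : measurable_fun (D : set (measurableTypeR R * measurableTypeR R)%type) (pd s' phi).
  exact: (Cc_measurable _ (test_Cc (test_pd s' tp))).
have := H phi tp.
rewrite (@ae_on_eq_Rintegral O (fun x => f x * pd s phi x) (fun x => f' x * pd s phi x)) //.
- rewrite (@ae_on_eq_Rintegral O (fun x => g x * phi x) (fun x => g' x * phi x)) //.
  + by apply: measurable_funM; [exact: Lg.1|exact: mphi _ [::]].
  + by apply: measurable_funM; [exact: mg|exact: mphi _ [::]].
  + by apply: (ae_on_imply gg) => x _ ->.
- by apply: measurable_funM; [exact: Lf.1|exact: mphi].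
- by apply: measurable_funM; [exact: mf|exact: mphi].
- by apply: (ae_on_imply ff) => x _ ->.
Qed.

Lemma C1_is_wD O f i : open O -> C1 O f -> is_wD O [:: i] f (pd [:: i] f).
Proof.
move=> oO Hf; split; [exact: (C0_L1loc oO (C1_C0 Hf))|exact: (C0_L1loc oO (C1_pd_C0 i Hf))|].
move=> phi tp; rewrite expr1 mulN1r.
by apply: integration_by_parts2 => //; exact: test_C1c.
Qed.

Lemma is_wD_add O s f g f' g' : open O -> is_wD O s f f' -> is_wD O s g g' ->
  is_wD O s (fun x => f x + g x) (fun x => f' x + g' x).
Proof.
move=> oO [Lf Lf' Hf] [Lg Lg' Hg]; have mO := open_measurable2 oO.
split; [exact: L1loc_add|exact: L1loc_add|].
move=> phi tp; have cp := test_Cc tp; have cpd := test_Cc (test_pd s tp).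
under eq_Rintegral do rewrite mulrDl; rewrite RintegralD //; [|exact: L1loc_Cc|exact: L1loc_Cc].
under [in RHS]eq_Rintegral do rewrite mulrDl; rewrite RintegralD //; [|exact: L1loc_Cc|exact: L1loc_Cc].
by rewrite mulrDr Hf // Hg.
Qed.

Lemma is_wD_scale O s (c : R) f f' : open O -> is_wD O s f f' ->
  is_wD O s (fun x => c * f x) (fun x => c * f' x).
Proof.
move=> oO [Lf Lf' Hf]; have mO := open_measurable2 oO.
split; [exact: L1loc_scale|exact: L1loc_scale|].
move=> phi tp; have cp := test_Cc tp; have cpd := test_Cc (test_pd s tp).
under eq_Rintegral do rewrite -mulrA; rewrite RintegralZl //; last exact: L1loc_Cc.
under [in RHS]eq_Rintegral do rewrite -mulrA; rewrite RintegralZl //; last exact: L1loc_Cc.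
by rewrite Hf // mulrCA.
Qed.

Lemma Cc_L2 O f : open O -> Cc O f -> L2 O f.
Proof.
move=> oO Hf; split; first exact: Cc_measurable Hf.
have := Cc_integrableO oO (Cc_mul Hf (C0_sub (@subsetT _ _) Hf.1)).
by apply: eq_integrable => [|x _ /=]; [exact: open_measurable2|rewrite expr2].
Qed.

Lemma H0k_approx k O f : open O -> H0k k O f ->
  exists phi : nat -> plane R -> R, (forall n, test O (phi n)) /\
    forall s, (size s <= k)%N -> cvgL2 area O (fun n => pd s (phi n)) (wD O s f).
Proof.
move=> oO [[Lf Hf] [phi [tp cp]]]; exists phi; split => // s sk.
have mO := open_measurable2 oO.
apply/(cvgL2P mO); last exact: cp.
- by move=> n; apply: Cc_L2 => //; apply: test_Cc; exact: test_pd.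
- have [g [wg Lg]] := Hf s sk.
  apply: (sqi_ae mO _ _ Lg); first by have [_ []] := is_wD_wD wg.
  by apply: (ae_on_imply (wD_ae oO wg)) => x _ ->.
Qed.

Lemma Hk_wD k O f s : open O -> Hk k O f -> (size s <= k)%N ->
  is_wD O s f (wD O s f) /\ L2 O (wD O s f).
Proof.
move=> oO [Lf Hf] sk; have [g [wg Lg]] := Hf s sk; split; first exact: is_wD_wD wg.
apply: (sqi_ae (open_measurable2 oO) _ _ Lg).
  by have [_ []] := is_wD_wD wg.
by apply: (ae_on_imply (wD_ae oO wg)) => x _ ->.
Qed.

Lemma wD_nil O f : open O -> L1loc O f -> ae_on O (fun x => wD O [::] f x = f x).
Proof.
move=> oO Lf; apply: wD_ae => //; split => // phi tp.
by rewrite expr0 mul1r.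
Qed.

End PlaneIntegrals.

Arguments Cc_measurable {R O} D {f} _.

(** * Area-preserving maps and slices *)

Section Preserving.
Context d {T : measurableType d} {R : realType} (mu : {measure set T -> \bar R}).
Implicit Types (phi : T -> T) (D : set T) (f : T -> R).

Definition preserves phi := measurable_fun setT phi /\
  forall A, measurable A -> mu (phi @^-1` A) = mu A.

Lemma preserves_comp phi phi' : preserves phi -> preserves phi' -> preserves (phi \o phi').
Proof.
move=> [mp hp] [mp' hp']; split; first exact: measurableT_comp.
move=> A mA; have -> : (phi \o phi') @^-1` A = phi' @^-1` (phi @^-1` A) by [].
rewrite hp' ?hp //; by rewrite -[X in measurable X]setTI; exact: mp.
Qed.

Lemma preserves_measurable phi D : preserves phi -> measurable D -> measurable (phi @^-1` D).
Proof. by move=> [mp _] mD; rewrite -[X in measurable X]setTI; exact: mp. Qed.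

Lemma preserves_ge0_integral phi D (f : T -> \bar R) : preserves phi -> measurable D ->
  measurable_fun D f -> (forall x, D x -> (0 <= f x)%E) ->
  (\int[mu]_(x in phi @^-1` D) f (phi x) = \int[mu]_(x in D) f x)%E.
Proof.
move=> [mp hp] mD mf f0.
rewrite -(@ge0_integral_pushforward _ _ _ _ _ _ mp mu D f mD mf); last by move=> x /set_mem; exact: f0.
by apply: eq_measure_integral => A mA _; exact: hp.
Qed.

Lemma preserves_integrable phi D f : preserves phi -> measurable D ->
  mu.-integrable D (EFin \o f) -> mu.-integrable (phi @^-1` D) (EFin \o (f \o phi)).
Proof.
move=> Hp mD /integrableP[mf fi]; have mpD := preserves_measurable Hp mD.
apply/integrableP; split.
  apply: (measurable_comp mD _ mf) => //; last by apply: measurable_funTS; exact: Hp.1.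
  by move=> _ [x Dx <-].
rewrite (@preserves_ge0_integral phi D (fun x => `|(f x)%:E|%E)) //.
exact: measurableT_comp.
Qed.

Lemma preserves_Rintegral phi D f : preserves phi -> measurable D ->
  mu.-integrable D (EFin \o f) -> \int[mu]_(x in phi @^-1` D) f (phi x) = \int[mu]_(x in D) f x.
Proof.
move=> Hp mD fi; rewrite /Rintegral; congr fine.
have mf : measurable_fun D (EFin \o f) by exact: measurable_int fi.
rewrite integralE [RHS]integralE; congr (_ - _)%E.
- transitivity (\int[mu]_(x in phi @^-1` D) ((EFin \o f)^\+ (phi x)))%E; first by apply: eq_integral => x _; rewrite !funeposE.
  by apply: preserves_ge0_integral => //; exact: measurable_funepos.
- transitivity (\int[mu]_(x in phi @^-1` D) ((EFin \o f)^\- (phi x)))%E; first by apply: eq_integral => x _; rewrite !funenegE.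
  by apply: preserves_ge0_integral => //; exact: measurable_funeneg.
Qed.

Lemma preserves_ae phi (P : T -> Prop) : preserves phi -> {ae mu, forall x, P x} ->
  {ae mu, forall x, P (phi x)}.
Proof.
move=> Hp [N [mN N0 PN]]; exists (phi @^-1` N); split.
- exact: preserves_measurable.
- by rewrite Hp.2.
- by move=> x nP; exact: PN.
Qed.

End Preserving.

Section Area.
Context {R : realType}.
Notation leb := (@lebesgue_measure R).
Notation mplane := (measurableTypeR R * measurableTypeR R)%type.

Lemma lebesgue_translation (t : R) (A : set (measurableTypeR R)) : measurable A ->
  leb ((fun y : measurableTypeR R => y + t) @^-1` A) = leb A.
Proof.
move=> mA; have mphi : measurable_fun setT ((fun y => y + t) : measurableTypeR R -> measurableTypeR R).
  by apply: measurable_funD.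
apply/esym.
apply: (@lebesgue_measure_unique _ (pushforward leb ((fun y => y + t) : measurableTypeR R -> measurableTypeR R))) mA => _ [[a b]] _ <-.
rewrite /= /pushforward.
rewrite (_ : _ @^-1` _ = `](a - t), (b - t)]%classic); last first.
  by apply/seteqP; split=> y /=; rewrite !in_itv /= ltrBlDr lerBrDr.
rewrite !lebesgue_measure_itv /= !lte_fin ltrD2r; case: ifP => // _.
by rewrite -!EFinB; congr EFin; ring.
Qed.

(** Every vertical section is translated, so this is Fubini with the translation invariance of
    length. Shears are the case of an affine [h]. *)
Lemma area_fiber (h : R -> R) : measurable_fun (setT : set (measurableTypeR R)) (h : measurableTypeR R -> measurableTypeR R) ->
  preserves area (fun z : mplane => (z.1, z.2 + h z.1)).
Proof.
move=> mh.
have mp : measurable_fun setT (fun z : mplane => (z.1, z.2 + h z.1) : mplane).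
  apply: measurable_fun_pair; first exact: measurable_fst.
  apply: measurable_funD; first exact: measurable_snd.
  by apply: measurableT_comp => //; exact: measurable_fst.
split => // A mA; rewrite /area /= /product_measure1; apply: eq_integral => x _ /=.
rewrite -[RHS](lebesgue_translation (h x)); last exact: measurable_xsection.
congr (leb _); apply/seteqP; split=> y; rewrite /xsection /= !inE //.
Qed.

Lemma area_swap : preserves area (fun z : mplane => (z.2, z.1)).
Proof.
have mp : measurable_fun setT (fun z : mplane => (z.2, z.1) : mplane).
  by apply: measurable_fun_pair; [exact: measurable_snd|exact: measurable_fst].
split => // A mA; apply/esym.
apply: (@product_measure_unique _ _ _ _ _ leb leb
   (pushforward area (fun z : mplane => (z.2, z.1) : mplane))) mA => B C mB mC.
rewrite /= /pushforward (_ : _ @^-1` _ = C `*` B); last first.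
  by apply/seteqP; split=> -[x y] /= [].
by rewrite /area /= product_measure1E // muleC.
Qed.

Lemma area_shear1 (t c : R) : preserves area (fun z : mplane => (z.1, z.2 + (t * z.1 + c))).
Proof.
apply: (@area_fiber (fun x => t * x + c)).
by apply: measurable_funD => //; exact: measurable_funM.
Qed.

Lemma area_shear0 (t c : R) : preserves area (fun z : mplane => (z.1 + (t * z.2 + c), z.2)).
Proof.
exact: (preserves_comp area_swap (preserves_comp (area_shear1 t c) area_swap)).
Qed.

(** A rotation with cosine $c$ and sine $s\ne0$ is a product of three shears, with coefficients
    $(c-1)/s$, $s$, $(c-1)/s$. If $s=0$ it is the identity or the half turn, which is the square of
    the quarter turn. *)
Lemma area_rotation (e : plane R) : e.1 ^+ 2 + e.2 ^+ 2 = 1 ->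
  preserves area (fun z : mplane => (z.1 * e.1 - z.2 * e.2, z.1 * e.2 + z.2 * e.1)).
Proof.
have H (c s : R) : c ^+ 2 + s ^+ 2 = 1 -> s != 0 ->
    preserves area (fun z : mplane => (z.1 * c - z.2 * s, z.1 * s + z.2 * c)).
  move=> cs s0.
  have := preserves_comp (area_shear0 ((c - 1) / s) 0)
     (preserves_comp (area_shear1 s 0) (area_shear0 ((c - 1) / s) 0)).
  congr preserves; apply/funext => -[x y] /=.
  have cs' : c ^+ 2 = 1 - s ^+ 2 by rewrite -cs addrK.
  set k := (c - 1) / s.
  have ks : k * s = c - 1 by rewrite /k divfK.
  have kc : k * (c + 1) = - s.
    apply: (mulIf s0); rewrite mulrAC ks -subr_sqr expr1n cs'; ring.
  rewrite !addr0; apply/pair_equal_spec; split.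
    transitivity (x * (1 + k * s) + y * (k * (2 + k * s))); first by ring.
    rewrite ks (_ : 2 + (c - 1) = c + 1); last by ring.
    by rewrite kc; ring.
  transitivity (x * s + y * (1 + k * s)); first by ring.
  by rewrite ks; ring.
case: e => c s /= cs; have [s0|s0] := eqVneq s 0; last exact: H.
have : (c - 1) * (c + 1) = 0.
  by rewrite -subr_sqr expr1n -cs s0 expr0n addr0 subrr.
move=> /eqP; rewrite mulf_eq0 subr_eq0 addr_eq0 => /orP[|] /eqP ->.
  have := area_shear1 0 0; congr preserves; apply/funext => -[x y] /=.
  by rewrite s0; apply/pair_equal_spec; split; ring.
have H1 := H 0 1 ltac:(by rewrite expr0n expr1n add0r) (oner_neq0 _).
have := preserves_comp H1 H1; congr preserves; apply/funext => -[x y] /=.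
by rewrite s0; apply/pair_equal_spec; split; ring.
Qed.

Lemma area_frame (x0 e : plane R) : e.1 ^+ 2 + e.2 ^+ 2 = 1 ->
  preserves area (fun z : mplane => frame x0 e z.1 z.2).
Proof.
move=> /area_rotation H.
have := preserves_comp (area_shear0 0 x0.1) (preserves_comp (area_shear1 0 x0.2) H).
by congr preserves; apply/funext => -[x y] /=; apply/pair_equal_spec; split; ring.
Qed.

Lemma ae_slice (P : plane R -> Prop) : {ae area, forall z, P z} ->
  {ae leb, forall x, {ae leb, forall y, P (x, y)}}.
Proof.
move=> [N [mN N0 PN]].
have : {ae leb, forall x, leb (xsection N x) = 0%E}.
  have mx : measurable_fun setT (fun x => leb (xsection N x)) by exact: measurable_fun_xsection.
  have E : (\int[leb]_x `|leb (xsection N x)|)%E = 0%E.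
    rewrite -[RHS]N0 /area /= /product_measure1; apply: eq_integral => x _ /=.
    by rewrite gee0_abs.
  have H := (ae_eq_integral_abs leb measurableT mx).1 E.
  by apply: (ae_imply H) => x; exact.
move=> H; apply: (ae_imply H) => x Nx0; exists (xsection N x); split => //.
  exact: measurable_xsection.
by move=> y nP; rewrite /xsection /= inE; exact: PN.
Qed.

Lemma ae_snd (Q : R -> Prop) : {ae leb, forall y, Q y} -> {ae area, forall z, Q z.2}.
Proof.
move=> [N [mN N0 QN]]; exists (setT `*` N); split.
- exact: measurableX.
- by rewrite /area /= product_measure1E //= N0 mule0.
- by move=> [x y] /= nQ; split => //; exact: QN.
Qed.

Lemma ae_exists (a b : R) (P : R -> Prop) : a < b -> {ae leb, forall x, P x} ->
  exists2 x, a < x < b & P x.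
Proof.
move=> ab [N [mN N0 PN]].
apply: contrapT => nex.
have sub : `]a, b[%classic `<=` N.
  move=> x /=; rewrite in_itv /= => xab; apply: PN => Px; apply: nex; by exists x.
have : (leb `]a, b[%classic <= leb N)%E.
  by apply: (@le_measure _ _ _ leb) => //; rewrite inE.
rewrite N0 lebesgue_measure_itv /= lte_fin ab -EFinB lee_fin; lra.
Qed.

End Area.

Section Tensor.
Context d1 d2 {T1 : measurableType d1} {T2 : measurableType d2} {R : realType}.
Context (m1 : {sigma_finite_measure set T1 -> \bar R}).
Context (m2 : {sigma_finite_measure set T2 -> \bar R}).
Variables (u : T1 -> R) (v : T2 -> R).
Hypotheses (ui : m1.-integrable setT (EFin \o u)) (vi : m2.-integrable setT (EFin \o v)).

Lemma measurable_tensor : measurable_fun setT (fun z : T1 * T2 => u z.1 * v z.2).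
Proof.
apply: measurable_funM.
  by apply: (measurableT_comp (integrable_mfun ui)); exact: measurable_fst.
by apply: (measurableT_comp (integrable_mfun vi)); exact: measurable_snd.
Qed.

Lemma integrable_tensor : (m1 \x m2)%E.-integrable setT (EFin \o (fun z : T1 * T2 => u z.1 * v z.2)).
Proof.
apply/(integrable12ltyP m1 m2); first exact: measurable_EFin measurable_tensor.
have mu' : measurable_fun setT (fun x => `|(u x)%:E|%E).
  by apply: measurableT_comp => //; apply: measurable_EFin; exact: integrable_mfun ui.
have mv' : measurable_fun setT (fun x => `|(v x)%:E|%E).
  by apply: measurableT_comp => //; apply: measurable_EFin; exact: integrable_mfun vi.
have E x : (\int[m2]_y `|(u x * v y)%:E| =
    `|(u x)%:E| * \int[m2]_y `|(v y)%:E|)%E.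
  rewrite -ge0_integralZl //; apply: eq_integral => y _ /=.
  by rewrite normrM.
under eq_integral do rewrite /= E.
have [_ ui'] := integrableP _ _ _ ui; have [_ vi'] := integrableP _ _ _ vi.
have fv : (\int[m2]_y `|(v y)%:E|)%E \is a fin_num by rewrite ge0_fin_numE // integral_ge0.
rewrite -(fineK fv) ge0_integralZr //.
  by rewrite fineK //; apply: lte_mul_pinfty => //; [exact: integral_ge0|rewrite ge0_fin_numE // integral_ge0].
by rewrite lee_fin fine_ge0 // integral_ge0.
Qed.

Lemma Rintegral_tensor : \int[(m1 \x m2)%E]_z (u z.1 * v z.2) = \int[m1]_x u x * \int[m2]_y v y.
Proof.
rewrite (Rintegral_prod12 integrable_tensor) /=.
rewrite -RintegralZr //; apply: eq_Rintegral => x _.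
by rewrite RintegralZl.
Qed.

End Tensor.

Section Slices.
Context d1 d2 {T1 : measurableType d1} {T2 : measurableType d2} {R : realType}.
Context (m1 : {sigma_finite_measure set T1 -> \bar R}).
Context (m2 : {sigma_finite_measure set T2 -> \bar R}).
Variable f : T1 * T2 -> R.
Hypothesis fi : (m1 \x m2)%E.-integrable setT (EFin \o f).

Lemma integrable_slice2 : {ae m2, forall y, m1.-integrable setT (EFin \o (fun x => f (x, y)))}.
Proof.
have mf : measurable_fun setT (EFin \o f) by exact: measurable_int fi.
have h := (integrable21ltyP m1 m2 mf).1 fi.
have mg : measurable_fun setT (fun y => \int[m1]_x `|(f (x, y))%:E|)%E.
  apply: (@measurable_fun_fubini_tonelli_G _ _ _ _ _ m1 (fun z => `|(f z)%:E|%E)) => //.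
  by apply: measurableT_comp.
have gi : m2.-integrable setT (fun y => \int[m1]_x `|(f (x, y))%:E|)%E.
  apply/integrableP; split => //; apply: le_lt_trans h; rewrite le_eqVlt; apply/orP; left; apply/eqP.
  by apply: eq_integral => y _; rewrite gee0_abs // integral_ge0.
apply: (ae_imply (integrable_ae measurableT gi)) => y /(_ I).
rewrite ge0_fin_numE ?integral_ge0 // => hy; apply/integrableP; split => //.
by apply: (measurableT_comp mf); exact: measurable_pair2.
Qed.

End Slices.

(** * Weak solutions with continuous gradients *)

Section Schwarz.
Context {R : realType}.
Implicit Types (O : set (plane R)) (f g : plane R -> R).

Lemma mvt_lin (a b : R) (F : R -> R) (d : R -> R) : a < b ->
  (forall x : R, a <= x <= b -> is_derive x 1 F (d x)) ->
  exists2 c, a < c < b & F b - F a = d c * (b - a).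
Proof.
move=> ab dF; have [] := @MVT _ F d a b ab.
- by move=> x; rewrite in_itv /= => /andP[ax xb]; apply: dF; rewrite !ltW.
- by apply: within_continuous_pt => x xab; exact: is_derive_continuous1 (dF x xab).
- by move=> c; rewrite in_itv /=; exists c.
Qed.

(* Both mixed derivatives are limits of the same second difference quotient. *)
Lemma schwarz O f (i01 i10 : plane R -> R) : open O ->
  C1 O f ->
  (forall x, O x -> is_derive x (unit_vec ord0) (pd [:: ord_max] f) (i01 x)) ->
  (forall x, O x -> is_derive x (unit_vec ord_max) (pd [:: ord0] f) (i10 x)) ->
  C0 O i01 -> C0 O i10 -> forall x, O x -> i01 x = i10 x.
Proof.
move=> oO Hf d01 d10 c01 c10 [x y] Oxy.
apply/eqP; rewrite -subr_eq0 -normr_eq0 eq_le normr_ge0 andbT.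
apply/ler_addgt0Pr => e e0; rewrite add0r.
have e2 : 0 < e / 2 by rewrite divr_gt0.
have [r1 r10 H1] : exists2 r, 0 < r & forall z, ball (x, y) r z -> `|i01 (x, y) - i01 z| < e / 2.
  by have /cvgrPdist_lt /(_ _ e2) /nbhs_ballP[r r0 Hr] := c01 _ Oxy; exists r.
have [r2 r20 H2] : exists2 r, 0 < r & forall z, ball (x, y) r z -> `|i10 (x, y) - i10 z| < e / 2.
  by have /cvgrPdist_lt /(_ _ e2) /nbhs_ballP[r r0 Hr] := c10 _ Oxy; exists r.
have [r3 r30 H3] := nbhs_box oO Oxy.
pose h := Num.min (Num.min r1 r2) r3 / 2.
have m0 : 0 < Num.min (Num.min r1 r2) r3 by rewrite !lt_min r10 r20 r30.
have h0 : 0 < h by rewrite divr_gt0.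
have hr1 : h < r1 /\ h < r2 /\ h < r3.
  have : h < Num.min (Num.min r1 r2) r3 by rewrite /h ltr_pdivrMr // ltr_pMr // ltr1n.
  by rewrite !lt_min => /andP[/andP[-> ->] ->].
case: hr1 => hr1 [hr2 hr3].
have inO s t : x <= s <= x + h -> y <= t <= y + h -> O (s, t).
  move=> /andP[s1 s2] /andP[t1 t2]; apply: H3.
  by split; rewrite /= in_itv /=; apply/andP; split; lra.
have inb r s t : h < r -> x < s < x + h -> y < t < y + h -> ball (x, y) r (s, t).
  move=> hr /andP[s1 s2] /andP[t1 t2].
  by split; rewrite /ball /= ltr_norml; apply/andP; split; lra.
pose D := f (x + h, y + h) - f (x, y + h) - (f (x + h, y) - f (x, y)).
have [s s1 Es] : exists2 c, x < c < x + h & D = (pd [:: ord0] f (c, y + h) - pd [:: ord0] f (c, y)) * h.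
  have [|c c1 Ec] := @mvt_lin x (x + h) (fun s => f (s, y + h) - f (s, y))
    (fun s => pd [:: ord0] f (s, y + h) - pd [:: ord0] f (s, y)) ltac:(by rewrite ltrDl).
    move=> s sx; apply: is_derive_sub; apply/is_derive_slice0; apply: (C1_derive _ Hf); apply: inO => //.
      by rewrite lerDl lexx ltW.
    by rewrite lexx lerDl ltW.
  exists c => //; move: Ec; rewrite (_ : x + h - x = h); last by ring.
  by move=> <-; rewrite /D; ring.
have [t t1 Et] : exists2 c, y < c < y + h & D = (pd [:: ord_max] f (x + h, c) - pd [:: ord_max] f (x, c)) * h.
  have [|c c1 Ec] := @mvt_lin y (y + h) (fun s => f (x + h, s) - f (x, s))
    (fun s => pd [:: ord_max] f (x + h, s) - pd [:: ord_max] f (x, s)) ltac:(by rewrite ltrDl).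
    move=> s' sx; apply: is_derive_sub; apply/is_derive_slice1; apply: (C1_derive _ Hf); apply: inO => //.
      by rewrite lerDl lexx ltW.
    by rewrite lexx lerDl ltW.
  exists c => //; move: Ec; rewrite (_ : y + h - y = h); last by ring.
  by move=> <-; rewrite /D; ring.
have [c c1 Ec] : exists2 c, y < c < y + h & D = i10 (s, c) * h * h.
  have [|c c1 Ec] := @mvt_lin y (y + h) (fun t => pd [:: ord0] f (s, t)) (fun t => i10 (s, t)) ltac:(by rewrite ltrDl).
    move=> t' ty; apply/is_derive_slice1; apply: d10; apply: inO => //.
    by move: s1 => /andP[? ?]; rewrite !ltW.
  exists c => //; rewrite Es Ec; congr (_ * _); congr (_ * _); ring.
have [c' c1' Ec'] : exists2 c, x < c < x + h & D = i01 (c, t) * h * h.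
  have [|c' c1' Ec'] := @mvt_lin x (x + h) (fun s => pd [:: ord_max] f (s, t)) (fun s => i01 (s, t)) ltac:(by rewrite ltrDl).
    move=> t' ty; apply/is_derive_slice0; apply: d01; apply: inO => //.
    by move: t1 => /andP[? ?]; rewrite !ltW.
  exists c' => //; rewrite Et Ec'; congr (_ * _); congr (_ * _); ring.
have E : i10 (s, c) = i01 (c', t).
  by apply: (mulIf (lt0r_neq0 h0)); apply: (mulIf (lt0r_neq0 h0)); rewrite -Ec.
have A1 := H1 _ (inb _ _ _ hr1 c1' t1); have A2 := H2 _ (inb _ _ _ hr2 s1 c1).
have -> : i01 (x, y) - i10 (x, y) = (i01 (x, y) - i01 (c', t)) - (i10 (x, y) - i10 (s, c)).
  by rewrite E; ring.
by apply: le_trans (ler_normB _ _) _; rewrite [leRHS](splitr e) lerD // ltW.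
Qed.

Lemma smooth_pdC f : smooth f -> forall x, pd [:: ord0; ord_max] f x = pd [:: ord_max; ord0] f x.
Proof.
move=> sf x.
have s1 i : smooth (pd [:: i] f) by exact: (@smooth_pd _ [:: i]).
apply: (@schwarz setT f) => //; first exact: openT.
- exact: smooth_C1.
- by move=> z _; exact: smooth_is_derive (s1 _).
- by move=> z _; exact: smooth_is_derive (s1 _).
- by move=> z _; apply: smooth_cont; exact: (@smooth_pd _ [:: ord0; ord_max]).
- by move=> z _; apply: smooth_cont; exact: (@smooth_pd _ [:: ord_max; ord0]).
Qed.

Lemma pd_cat s1 s2 f : pd (s1 ++ s2) f = pd s1 (pd s2 f).
Proof. by rewrite /pd map_cat iter_deriv_cat. Qed.

Lemma ord2_cases (i : 'I_2) : i = ord0 \/ i = ord_max.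
Proof. by move: i; apply: ord2P; [left|right]. Qed.

Lemma lapE f x : lap f x = pd [:: ord0; ord0] f x + pd [:: ord_max; ord_max] f x.
Proof. exact: (sum2 (fun i => pd [:: i; i] f x)). Qed.

Lemma smooth_pdC2 f i j : smooth f -> pd [:: i; j] f = pd [:: j; i] f.
Proof.
move=> sf; have H := smooth_pdC sf.
case: (ord2_cases i) => ->; case: (ord2_cases j) => ->.
- reflexivity.
- by apply/funext => x; rewrite H.
- by apply/funext => x; rewrite H.
- reflexivity.
Qed.

Lemma smooth_lap_pd f j : smooth f -> pd [:: j] (lap f) = lap (pd [:: j] f).
Proof.
move=> sf; apply/funext => x; rewrite lapE.
have E i : pd [:: i; i] (pd [:: j] f) = pd [:: j] (pd [:: i; i] f).
  rewrite -(pd_cat [:: i; i] [:: j]) -(pd_cat [:: j] [:: i; i]) /cat.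
  rewrite (pd_cat [:: i] [:: i; j]) (smooth_pdC2 i j sf) -(pd_cat [:: i] [:: j; i]) /cat.
  rewrite (pd_cat [:: i; j] [:: i]) (smooth_pdC2 i j (smooth_pd [:: i] sf)).
  by rewrite -(pd_cat [:: j; i] [:: i]) /cat.
rewrite !E.
have H i : is_derive x (unit_vec j) (pd [:: i; i] f) (pd [:: j] (pd [:: i; i] f) x).
  by apply: smooth_is_derive; exact: smooth_pd.
have -> : lap f = (fun y => pd [:: ord0; ord0] f y + pd [:: ord_max; ord_max] f y).
  by apply/funext => y; exact: lapE.
exact: is_deriveE (is_derive_add (H ord0) (H ord_max)).
Qed.

End Schwarz.

Section LocallyConstant.
Context {R : realType}.
Implicit Types (O : set (plane R)) (f : plane R -> R).

Lemma local_constant_rect a b c d f (x y x' y' : R) :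
  (forall i z, obox a b c d z -> is_derive z (unit_vec i) f 0) ->
  obox a b c d (x, y) -> obox a b c d (x', y') -> f (x, y) = f (x', y').
Proof.
move=> df [/=]; rewrite !in_itv /= => xab ycd [/=]; rewrite !in_itv /= => x'ab y'cd.
transitivity (f (x', y)).
  apply: (@mvt_const _ a b (fun s => f (s, y))) => // s sab.
  by apply/is_derive_slice0; apply: df; split; rewrite /= in_itv.
apply: (@mvt_const _ c d (fun s => f (x', s))) => // s scd.
by apply/is_derive_slice1; apply: df; split; rewrite /= in_itv.
Qed.

Lemma connected_constant O f : open O -> connected O ->
  (forall i z, O z -> is_derive z (unit_vec i) f 0) ->
  forall z z', O z -> O z' -> f z = f z'.
Proof.
move=> oO cO df z z' Oz Oz'.
have loc x : O x -> \forall y \near x, O y /\ f y = f x.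
  case: x => x y Oxy; have [r r0 rO] := nbhs_box oO Oxy.
  have : nbhs (x, y) (obox (x - r) (x + r) (y - r) (y + r)).
    apply: open_nbhs_nbhs; split; first exact: obox_open.
    exact: obox_center.
  apply: filterS => -[x' y'] b'; split; first exact/rO/obox_box.
  apply: (@local_constant_rect (x - r) (x + r) (y - r) (y + r)) => //.
    by move=> i w bw; apply: df; exact/rO/obox_box.
  exact: obox_center.
have : O `&` [set y | f y = f z] = O.
  apply: cO.
  - by exists z.
  - exists (O `&` [set y | f y = f z]); last by rewrite setIA setIid.
    rewrite openE => y [Oy fy]; apply: filterS (loc y Oy) => w [Ow fw].
    by split => //=; rewrite fw.
  - exists (~` (O `&` [set y | f y <> f z])).
      apply: open_closedC; rewrite openE => y [Oy fy].
      by apply: filterS (loc y Oy) => w [Ow fw]; split => //=; rewrite fw.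
    apply/seteqP; split=> y [Oy fy]; split => //.
      by move=> [_]; exact.
    by apply: contrapT => nf; apply: fy.
by move=> E; have : (O `&` [set y | f y = f z]) z' by [rewrite E]; case=> _ /= ->.
Qed.

End LocallyConstant.

Section WeakRegularity.
Context {R : realType}.
Notation leb := (@lebesgue_measure R).
Notation mplane := (measurableTypeR R * measurableTypeR R)%type.
Implicit Types (O : set (plane R)) (f g : plane R -> R).

Lemma test1_antiderivative (a b : R) (h : R -> R) : a < b -> test1 a b h ->
  \int[leb]_x h x = 0 ->
  exists2 H : R -> R, test1 a b H & forall x : R, is_derive x 1 H (h x).
Proof.
move=> ab [sh h0] Ih.
have ch : continuous h by move=> x; exact: smooth_cont.
have [H0 dH0] := antiderivative ch.
pose H x := H0 x - H0 a.
have dH (x : R) : is_derive x 1 H (h x).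
  by apply: is_derive_eq' (is_derive_sub (dH0 x) (is_derive_const _ _ _)) _; rewrite subr0.
have Hlo x : x <= a -> H x = 0.
  move=> xa; have <- : H a = 0 by rewrite /H subrr.
  move: xa; rewrite le_eqVlt => /predU1P[->//|xa].
  have [s /andP[s1 s2]] := mvt_lin xa (fun s _ => dH s).
  by rewrite h0 ?mul0r; [move=> /eqP; rewrite subr_eq0 => /eqP -> //|rewrite negb_and -leNgt ltW].
have Hb : H b = 0.
  have := @FTC2 _ a b H h (ltW ab) (fun x _ => dH x) (fun x _ => ch x).
  rewrite (Hlo a (lexx _)) subr0 => <-; rewrite -Ih; apply/esym.
  apply: (Rintegral_out (setT : set (measurableTypeR R)) `[a, b]%classic) => //.
  move=> x _; rewrite /= in_itv /= => xab; apply: h0; apply/negP => /andP[? ?]; apply: xab.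
  by rewrite !ltW.
have Hhi x : b <= x -> H x = 0.
  rewrite le_eqVlt => /predU1P[<-//|bx].
  have [s /andP[s1 s2]] := mvt_lin bx (fun s _ => dH s).
  rewrite h0 ?mul0r ?Hb ?subr0 // negb_and -[X in _ || X]leNgt (ltW s1) orbT //.
exists H; [|exact: dH]; split; last first.
  by move=> x; rewrite negb_and -!leNgt => /orP[/Hlo|/Hhi].
apply: (@alg_smooth _ _ [set g | g = H \/ smooth g]); last by apply: alg_gen; left.
- move=> g [->|sg] x; split.
  + exact: is_derive_continuous1 (dH x).
  + by move=> v; exact: is_derive_derivable (derive1_scale v (dH x)).
  + exact: smooth_cont.
  + by move=> v; exact: is_derive_derivable (smooth_is_derive x v sg).
- move=> g v [->|sg]; last by apply: alg_gen; right; exact: smooth_D.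
  have -> : (fun x => 'D_v H x) = (fun x => v * h x).
    by apply/funext => x; exact: is_deriveE (derive1_scale v (dH x)).
  by apply: alg_mul; [exact: alg_cst|apply: alg_gen; right].
Qed.

Lemma test1_integrable (a b : R) (h : R -> R) : test1 a b h -> leb.-integrable setT (EFin \o h).
Proof.
move=> [sh h0].
apply: (integrable_out (setT : set (measurableTypeR R)) `[a, b]%classic) => //.
  move=> x _; rewrite /= in_itv /= => xab; apply: h0; apply/negP => /andP[? ?]; apply: xab.
  by rewrite !ltW.
by apply: integrable_continuous_itv => x _; exact: smooth_cont.
Qed.

Lemma test1_bounded (a b : R) (h : R -> R) : test1 a b h -> exists2 M : R, 0 < M & forall x, `|h x| <= M.
Proof.
move=> [sh h0].
have [M M0 HM] := @continuous_bounded_on _ _ `[a, b]%classic h (@segment_compact _ a b) (fun x _ => smooth_cont sh).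
exists M => // x; have [xab|/h0 ->] := boolP (a < x < b); last by rewrite normr0 ltW.
by apply: HM; rewrite /= in_itv /=; move: xab => /andP[? ?]; rewrite !ltW.
Qed.

Lemma test1_normalized (a b : R) : a < b -> exists2 h, test1 a b h & \int[leb]_x h x = 1.
Proof.
move=> ab.
have tb : test1 a b (bump a b) by split; [exact: smooth_bump|exact: bump_out].
set J := \int[leb]_x bump a b x.
have J0 : 0 <= J by apply: Rintegral_ge0 => x _; exact: bump_ge0.
have Jn0 : J != 0.
  apply/eqP => E.
  have := ae_zero_of_integral_zero (mu := leb) measurableT (test1_integrable tb) (fun x _ => bump_ge0 a b x) E.
  by move=> /(ae_exists ab)[x xab] /(_ I)/eqP; rewrite gt_eqF // bump_gt0.
exists (fun x => J^-1 * bump a b x).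
  by split; [apply: smooth_scale; exact: smooth_bump|move=> x /bump_out ->; rewrite mulr0].
by rewrite RintegralZl // ?mulVf //; exact: test1_integrable tb.
Qed.

Lemma test1_lin (a b : R) (c : R) h k : test1 a b h -> test1 a b k -> test1 a b (fun x => h x - c * k x).
Proof.
move=> [sh h0] [sk k0]; split; last by move=> x xab; rewrite h0 // k0 // mulr0 subr0.
exact: (smooth_add sh (smooth_opp (smooth_scale c sk))).
Qed.

(** The argument of du Bois-Reymond: a test function [al] minus its integral times a fixed
    normalized [th] is the derivative of a test function, hence invisible to [f]. So [f] depends on
    the second coordinate alone, and [k] is its average along rows with weight [th]. *)
Lemma weak_slice_zero (a b c d : R) f : a < b -> c < d ->
  area.-integrable (obox a b c d) (EFin \o f) ->
  (forall h k, test1 a b h -> test1 c d k ->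
    \int[area]_(z in obox a b c d) (f z * ('D_1 h z.1 * k z.2)) = 0) ->
  exists k : R -> R, measurable_fun setT k /\ {ae area, forall z, obox a b c d z -> f z = k z.2}.
Proof.
move=> ab cd fi H.
have [th tth Ith] := test1_normalized ab.
have mO := obox_measurable a b c d.
pose F := f \_ (obox a b c d).
have Fi : area.-integrable setT (EFin \o F) by exact: integrable_patch.
have mh (h : R -> R) : smooth h -> measurable_fun setT (fun z : mplane => h z.1).
  by move=> sh; apply: (measurableT_comp (smooth_measurable sh)); exact: measurable_fst.
have mk (h : R -> R) : smooth h -> measurable_fun setT (fun z : mplane => h z.2).
  by move=> sh; apply: (measurableT_comp (smooth_measurable sh)); exact: measurable_snd.
have FTi h k : test1 a b h -> test1 c d k ->
    area.-integrable setT (EFin \o (fun z => F z * (h z.1 * k z.2))).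
  move=> Th Tk; have [M1 M10 HM1] := test1_bounded Th; have [M2 M20 HM2] := test1_bounded Tk.
  apply: (integrable_bndM (M := M1 * M2)) => //.
    by apply: measurable_funM; [apply: mh; exact: Th.1|apply: mk; exact: Tk.1].
  by move=> z _; rewrite normrM ler_pM.
pose Fth z := F z * th z.1.
have Fthi : area.-integrable setT (EFin \o Fth).
  have [M M0 HM] := test1_bounded tth.
  apply: (integrable_bndM (M := M)) => //; first by apply: mh; exact: tth.1.
pose k y := \int[leb]_x Fth (x, y).
have ki : leb.-integrable setT (EFin \o k) by exact: integrable_prod2 Fthi.
have mkk : measurable_fun setT k by exact: integrable_mfun ki.
exists k; split => //.
have Ki : area.-integrable setT (EFin \o (fun z : plane R => \1_(`[a, b]%classic) z.1 * k z.2)).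
  apply: (@integrable_tensor _ _ _ _ _ leb leb (\1_(`[a, b]%classic) : R -> R) k) => //.
  exact: integrable_indic_itv.
pose G (z : plane R) := F z - \1_(`[a, b]%classic) z.1 * k z.2.
have Gi : area.-integrable setT (EFin \o G) by exact: integrableB_EFin.
have H2 : {ae area, forall z, obox a b c d z -> G z = 0}.
  apply: fundamental_box; first by apply: integrableS Gi => //; exact: box_measurable.
  move=> al be Tal Tbe.
  have ali := test1_integrable Tal.
  set J := \int[leb]_x al x.
  have T2 := test1_lin J Tal tth.
  have J2 : \int[leb]_x (al x - J * th x) = 0.
    rewrite RintegralB ?RintegralZl ?Ith ?mulr1 ?subrr //; [exact: test1_integrable tth|].
    by apply: integrableZ_EFin => //; exact: test1_integrable tth.
  have [A TA dA] := test1_antiderivative ab T2 J2.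
  have tout (h : R -> R) (k' : R -> R) z : test1 a b h -> test1 c d k' -> ~ obox a b c d z -> h z.1 * k' z.2 = 0.
    move=> [_ h0] [_ k0] nz; have [z1|/h0 ->] := boolP (a < z.1 < b); last by rewrite mul0r.
    have [z2|/k0 ->] := boolP (c < z.2 < d); last by rewrite mulr0.
    by exfalso; apply: nz; split; rewrite /= in_itv.
  rewrite -(Rintegral_out (setT : set mplane) (box a b c d)) //; last 2 first.
    exact: box_measurable.
    by move=> z _ nb; rewrite tout ?mulr0 // => /obox_box.
  have E z : G z * (al z.1 * be z.2) = F z * (al z.1 * be z.2) - (al z.1 * (k z.2 * be z.2)).
    rewrite /G mulrBl; congr (_ - _); rewrite indicE.
    have [z1|z1] := boolP (a < z.1 < b).
      by rewrite mem_set /= ?mul1r ?in_itv /=; [ring|move: z1 => /andP[? ?]; rewrite !ltW].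
    by rewrite (Tal.2 _ z1) !(mul0r, mulr0).
  under eq_Rintegral do rewrite E.
  have [M2 M20 HM2] := test1_bounded Tbe.
  have kbi : leb.-integrable setT (EFin \o (fun y => k y * be y)).
    by apply: (integrable_bndM (M := M2)) => //; exact: smooth_measurable Tbe.1.
  rewrite RintegralB //; [|exact: FTi|exact: (integrable_tensor ali kbi)].
  have E2 : \int[leb]_y (k y * be y) = \int[area]_z (F z * (th z.1 * be z.2)).
    have i2 := FTi _ _ tth Tbe.
    rewrite (Rintegral_prod21 i2); apply: ae_eq_Rintegral => //.
    - exact: integrable_mfun kbi.
    - exact: integrable_mfun (integrable_prod2 i2).
    - apply: (ae_imply (integrable_slice2 Fthi)) => y hy _.
      by rewrite -RintegralZr //; apply: eq_Rintegral => x _; rewrite /Fth /=; ring.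
  have Et : \int[area]_z (al z.1 * (k z.2 * be z.2)) = J * \int[leb]_y (k y * be y).
    exact: (Rintegral_tensor ali kbi).
  rewrite Et E2.
  have E3 : \int[area]_z (F z * ((al z.1 - J * th z.1) * be z.2)) = 0.
    rewrite (Rintegral_out (setT : set mplane) (obox a b c d)) //; last first.
      by move=> z _ nb; rewrite (tout _ _ _ T2 Tbe nb) mulr0.
    rewrite -[RHS](H _ _ TA Tbe); apply: eq_Rintegral => z /set_mem zb.
    by rewrite (is_deriveE (dA z.1)) /F patchE mem_set.
  rewrite -[RHS]E3 -RintegralZl //; last exact: FTi.
  rewrite -RintegralB; [|by []|exact: FTi|apply: integrableZ_EFin => //; exact: FTi].
  by apply: eq_Rintegral => z _; ring.
apply: (ae_imply H2) => z h zb; move: (h zb).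
rewrite /G /F patchE mem_set // indicE mem_set ?mul1r; last by case: zb => /subset_itv_oo_cc.
by move=> /eqP; rewrite subr_eq0 => /eqP.
Qed.

End WeakRegularity.

Section WeakC1.
Context {R : realType}.
Notation leb := (@lebesgue_measure R).
Notation mplane := (measurableTypeR R * measurableTypeR R)%type.
Implicit Types (O : set (plane R)) (f g : plane R -> R).

(** In contrast to [ae_on_local], the property is known only on some neighbourhood of each point;
    the rational boxes of the cover are selected by the property itself. *)
Lemma ae_on_nbhs O (P : plane R -> Prop) :
  (forall x y, O (x, y) -> exists2 r, 0 < r & ae_on (obox (x - r) (x + r) (y - r) (y + r)) P) ->
  ae_on O P.
Proof.
move=> H.
pose N := fun n => if @unpickle (rat * rat * rat * rat)%type n is Some (a, b, c, d) then
  if `[< ae_on (obox (ratr a) (ratr b) (ratr c) (ratr d)) P >]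
  then obox (ratr a) (ratr b) (ratr c) (ratr d) `&` ~` P else set0 else set0 : set (plane R).
apply: (@negligibleS _ _ _ area (\bigcup_n N n)); last first.
  apply: negligible_bigcup => n; rewrite /N; case: unpickle => [[[[a b] c] d]|]; last exact: negligible_set0.
  case: asboolP => [bP|_]; last exact: negligible_set0.
  move: bP; rewrite /ae_on /almost_everywhere /prop_near1 /nbhs /=.
  by apply: negligibleS => z [oz nP] /(_ oz).
move=> [x y] /= /not_implyP[Oxy nP].
have [r r0 rP] := H _ _ Oxy.
have [a a1] := @rat_in_itvoo R (x - r) x ltac:(by rewrite ltrBlDr ltrDl).
have [b b1] := @rat_in_itvoo R x (x + r) ltac:(by rewrite ltrDl).
have [c c1] := @rat_in_itvoo R (y - r) y ltac:(by rewrite ltrBlDr ltrDl).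
have [d d1] := @rat_in_itvoo R y (y + r) ltac:(by rewrite ltrDl).
move: a1 b1 c1 d1; rewrite !in_itv /= => /andP[a1 a2] /andP[b1 b2] /andP[c1 c2] /andP[d1 d2].
exists (pickle (a, b, c, d)); [exact: I|]; rewrite /N pickleK; case: asboolP => [_|[]].
  by split => //; split; rewrite /= in_itv /= ?a2 ?c2.
apply: ae_on_sub rP => z [/=]; rewrite !in_itv /= => /andP[z1 z2] /andP[z3 z4].
by split; rewrite /= in_itv /=; apply/andP; split; lra.
Qed.

Lemma Rintegral_cst_itv (a b c : R) : a <= b -> \int[leb]_(x in `[a, b]) c = c * (b - a).
Proof.
move=> ab.
have H (x : R) : a <= x <= b -> is_derive x 1 (fun x : R => c * x) c.
  move=> _; apply: is_derive_eq' (is_derive_scale c (is_derive_id x 1)) _.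
  by rewrite mulr1.
rewrite (FTC2 ab H); first by ring.
by move=> x _; exact: cst_continuous.
Qed.

(** [test1] requires the value 0 at the endpoints too; there the derivative is, by continuity, a
    limit of its zero values outside of the interval. *)
Lemma test1_D (a b : R) (h : R -> R) : a < b -> test1 a b h -> test1 a b (fun x : R => 'D_1 h x).
Proof.
move=> ab Th.
have sD : smooth (fun x : R => 'D_1 h x) by apply: smooth_D; exact: Th.1.
split=> // x xab.
have side (s : R) : ~~ (a <= s <= b) -> 'D_1 h s = 0.
  move=> nab; apply: is_deriveE; apply: (@derive_out _ _ `[a, b]%classic); first exact: itv_closed.
    move=> y /= yab; apply: Th.2; apply/negP => /andP[? ?]; apply: yab; by rewrite in_itv /= !ltW.
  by rewrite /= in_itv; exact/negP.
have [h0|/negP] := pselect (a <= x <= b); last exact: side.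
have cD : {for x, continuous (fun s : R => 'D_1 h s)} by exact: smooth_cont sD.
apply/eqP; rewrite -normr_le0; apply/ler_addgt0Pr => e e0; rewrite add0r.
have /cvgrPdist_le /(_ _ e0) /nbhs_ballP[r /= r0 Hr] := cD.
have [xa|xa] := eqVneq x a.
  have := Hr (a - r / 2); rewrite (side (a - r / 2)) ?subr0; last by rewrite negb_and -ltNge; apply/orP; left; lra.
  by apply; rewrite /ball /= xa ltr_norml; apply/andP; split; lra.
have xb : x = b.
  move: h0 => /andP[ax xb']; apply/eqP; rewrite eq_le xb' /=; move: xab; rewrite negb_and.
  by rewrite lt_neqAle eq_sym xa ax /= -leNgt.
have := Hr (b + r / 2); rewrite (side (b + r / 2)) ?subr0; last by rewrite negb_and -!ltNge; apply/orP; right; lra.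
by apply; rewrite /ball /= xb ltr_norml; apply/andP; split; lra.
Qed.

Definition prim g (a0 x y : R) := \int[leb]_(s in `[a0, x]) g (s, y).

Section Primitive.
Variables (O : set (plane R)) (g : plane R -> R) (a0 b0 c0 d0 : R).
Hypotheses (oO : open O) (cg : C0 O g) (bO : box a0 b0 c0 d0 `<=` O).

Let gslice s y : a0 <= s <= b0 -> c0 <= y <= d0 -> {for s, continuous (fun t => g (t, y))}.
Proof.
by move=> sab ycd; apply: continuous_slice0; apply: cg; apply: bO; split; rewrite /= in_itv.
Qed.

Let gslice1 s y : a0 <= s <= b0 -> c0 <= y <= d0 -> {for y, continuous (fun t => g (s, t))}.
Proof.
by move=> sab ycd; apply: continuous_slice1; apply: cg; apply: bO; split; rewrite /= in_itv.
Qed.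

Let gi a b y : a0 <= a -> b <= b0 -> c0 <= y <= d0 ->
  leb.-integrable `[a, b] (EFin \o (fun s => g (s, y))).
Proof.
move=> ha hb ycd; apply: integrable_continuous_itv => s /andP[s1 s2]; apply: gslice => //.
by apply/andP; split; [exact: le_trans s1|exact: le_trans hb].
Qed.

Lemma prim_derive (x y : R) : a0 < x < b0 -> c0 <= y <= d0 ->
  is_derive x 1 (fun s => prim g a0 s y) (g (x, y)).
Proof.
move=> /andP[ax xb] ycd.
have := @continuous_FTC1_closed _ (fun s => g (s, y)) a0 x b0 xb (gi (lexx _) (lexx _) ycd) ax.
case; first by apply: gslice => //; rewrite !ltW.
by move=> dP E; rewrite -E derive1E; exact: derivable_is_derive.
Qed.

Lemma prim_sub (x x' y : R) : a0 <= x -> x <= x' -> x' <= b0 -> c0 <= y <= d0 ->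
  prim g a0 x' y - prim g a0 x y = \int[leb]_(s in `[x, x']) g (s, y).
Proof.
move=> ax xx xb ycd.
have i1 : leb.-integrable [set` `[a0, x']] (EFin \o (fun s => g (s, y))) by exact: gi.
rewrite /prim (@Rintegral_itvB _ _ (BLeft a0) (BRight x') x i1) ?bnd_simp //.
rewrite Rintegral_itv_obnd_cbnd //.
by apply: integrableS (gi ax xb ycd) => //; exact: subset_itv_oc_cc.
Qed.

(** Continuity in [y] for fixed [x] is continuity under the integral sign; a Lipschitz bound in [x]
    that is uniform in [y] turns it into joint continuity. *)
Lemma prim_C0 : C0 (obox a0 b0 c0 d0) (fun z => prim g a0 z.1 z.2).
Proof.
have [M M0 HM] := continuous_bounded_on (@box_compact _ a0 b0 c0 d0) (fun z bz => cg (bO bz)).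
move=> [x y] [/=]; rewrite !in_itv /= => /andP[ax xb] /andP[cy yd].
have cy' : {for y, continuous (fun t => prim g a0 x t)}.
  have H := @continuity_under_integral _ _ _ leb (fun t s => g (s, t)) `[a0, x]%classic (measurable_itv _) c0 d0.
  apply: (H _ _ (fun=> M)).
  - by move=> t; rewrite /= in_itv /= => /andP[ct td]; apply: gi; [by []|exact: ltW|apply/andP; split; exact: ltW].
  - apply: ae_forall => s /=; rewrite in_itv /= => /andP[s1 s2] t; rewrite inE /= in_itv /= => /andP[ct td].
    by apply: gslice1; apply/andP; split; first [exact: ltW|exact: (le_trans s2 (ltW xb))|by []].
  - apply: integrable_continuous_itv => s _; exact: cst_continuous.
  - move=> t; rewrite /= in_itv /= => /andP[ct td].
    apply: ae_forall => s /=; rewrite in_itv /= => /andP[s1 s2].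
    by apply: HM; split; rewrite /= in_itv /=; apply/andP; split; lra.
  - by rewrite inE /= in_itv /= cy yd.
apply/cvgrPdist_le => e e0.
have e2 : 0 < e / 2 by rewrite divr_gt0.
have /cvgrPdist_le /(_ _ e2) /nbhs_ballP[r /= r0 Hr] := cy'.
have Me : 0 < e / 2 / M by rewrite divr_gt0.
pose U : set (plane R) := obox a0 b0 c0 d0 `&` obox (x - e / 2 / M) (x + e / 2 / M) (y - r) (y + r).
have : nbhs (x, y) U.
  apply: open_nbhs_nbhs; split; first by apply: openI; exact: obox_open.
  split; split; rewrite /= in_itv /=; apply/andP; split; lra.
apply: filterS => -[x' y'] [[/=]]; rewrite !in_itv /= => /andP[ax' xb'] /andP[cy1 yd1] [/=].
rewrite !in_itv /= => /andP[x1 x2] /andP[y1 y2].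
have A : `|prim g a0 x y - prim g a0 x y'| <= e / 2.
  by apply: Hr; rewrite /ball /= ltr_norml; apply/andP; split; lra.
have gM (p q : R) : a0 <= p -> p <= q -> q <= b0 -> `|prim g a0 q y' - prim g a0 p y'| <= M * (q - p).
  move=> ap pq qb; have ycd : c0 <= y' <= d0 by rewrite !ltW.
  rewrite (prim_sub ap pq qb ycd).
  apply: le_trans (le_normr_RintegralM (g := fun=> M) _ _ _ _) _ => //.
  - exact: gi.
  - apply: integrable_continuous_itv => s _; exact: cst_continuous.
  - move=> s /=; rewrite in_itv /= => /andP[s1 s2]; apply: HM.
    by split; rewrite /= in_itv //=; apply/andP; split; lra.
  by rewrite Rintegral_cst_itv.
have B : `|prim g a0 x y' - prim g a0 x' y'| <= e / 2.
  have [xx|xx] := leP x x'.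
    rewrite distrC; apply: le_trans (gM x x' (ltW ax) xx (ltW xb')) _.
    by rewrite mulrC -ler_pdivlMr //; lra.
  apply: le_trans (gM x' x (ltW ax') (ltW xx) (ltW xb)) _.
  by rewrite mulrC -ler_pdivlMr //; lra.
rewrite /= (_ : prim g a0 x y - prim g a0 x' y' = (prim g a0 x y - prim g a0 x y') + (prim g a0 x y' - prim g a0 x' y')); last by ring.
by apply: le_trans (ler_normD _ _) _; rewrite [leRHS](splitr e) lerD.
Qed.

Variables (a b c d : R).
Hypotheses (haa : a0 < a) (hab : a < b) (hbb : b < b0) (hcc : c0 < c) (hcd : c < d) (hdd : d < d0).

Let sub0 : box a b c d `<=` obox a0 b0 c0 d0.
Proof.
move=> [x y] [/=]; rewrite !in_itv /= => /andP[x1 x2] /andP[y1 y2].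
split; rewrite /= in_itv /=; apply/andP; split.
- exact: lt_le_trans haa x1.
- exact: le_lt_trans x2 hbb.
- exact: lt_le_trans hcc y1.
- exact: le_lt_trans y2 hdd.
Qed.

Let sub1 : obox a0 b0 c0 d0 `<=` O. Proof. by move=> z /obox_box; exact: bO. Qed.

Lemma prim_integrable : area.-integrable (obox a b c d) (EFin \o (fun z => prim g a0 z.1 z.2)).
Proof.
have := continuous_integrable2 (@obox_open _ a0 b0 c0 d0) prim_C0 (@box_compact _ a b c d) sub0.
apply: integrableS; [exact: box_measurable|exact: obox_measurable|exact: obox_box].
Qed.

Lemma prim_weak (h k : R -> R) : test1 a b h -> test1 c d k ->
  \int[area]_(z in obox a b c d) (prim g a0 z.1 z.2 * ('D_1 h z.1 * k z.2) + g z * (h z.1 * k z.2)) = 0.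
Proof.
move=> Th Tk.
pose u (z : plane R) := prim g a0 z.1 z.2 * ('D_1 h z.1 * k z.2) + g z * (h z.1 * k z.2).
have sD : smooth (fun x : R => 'D_1 h x) by apply: smooth_D; exact: Th.1.
have D0 x : ~~ (a < x < b) -> 'D_1 h x = 0 by exact: (test1_D hab Th).2.
have uout z : ~ obox a b c d z -> u z = 0.
  move=> nz; rewrite /u; have [z1|z1] := boolP (a < z.1 < b); last first.
    by rewrite (Th.2 _ z1) (D0 _ z1) !(mul0r, mulr0) addr0.
  have [z2|/Tk.2 ->] := boolP (c < z.2 < d); last by rewrite !mulr0 addr0.
  by exfalso; apply: nz; split; rewrite /= in_itv.
have c1 (h' : R -> R) (z : plane R) : smooth h' -> {for z, continuous (fun z : plane R => h' z.1)}.
  move=> sh; apply: continuous_comp1; [exact: cvg_fst|exact: (smooth_cont sh)].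
have c2 (h' : R -> R) (z : plane R) : smooth h' -> {for z, continuous (fun z : plane R => h' z.2)}.
  move=> sh; apply: continuous_comp1; [exact: cvg_snd|exact: (smooth_cont sh)].
have ucont : C0 (obox a0 b0 c0 d0) u.
  move=> z bz; apply: continuous_add; apply: continuous_mul.
  - exact: prim_C0.
  - by apply: continuous_mul; [exact: (c1 _ z sD)|exact: (c2 _ z Tk.1)].
  - by apply: cg; exact: sub1.
  - by apply: continuous_mul; [exact: (c1 _ z Th.1)|exact: (c2 _ z Tk.1)].
have ui : area.-integrable setT (EFin \o u).
  apply: (integrable_out (setT : set mplane) (box a b c d)) => //.
  - exact: box_measurable.
  - by move=> z _ nz; apply: uout => /obox_box.
  - exact: (continuous_integrable2 (@obox_open _ a0 b0 c0 d0) ucont (@box_compact _ a b c d) sub0).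
rewrite -(Rintegral_out (setT : set mplane) (obox a b c d) u) //; last 2 first.
- exact: obox_measurable.
- by move=> z _; exact: uout.
rewrite (Rintegral_prod21 ui) -[RHS](@Rintegral0 _ _ _ leb setT).
apply: eq_Rintegral => y _.
have [ycd|ycd] := boolP (c < y < d); last first.
  by rewrite -[RHS](@Rintegral0 _ _ _ leb setT); apply: eq_Rintegral => x _; rewrite /u /= (Tk.2 _ ycd) !mulr0 addr0.
have ycd0 : c0 <= y <= d0.
  by move: ycd => /andP[y1 y2]; rewrite (ltW (lt_trans hcc y1)) (ltW (lt_trans y2 hdd)).
rewrite (Rintegral_out (setT : set (measurableTypeR R)) `[a, b]%classic) //; last first.
  move=> x _; rewrite /= in_itv /= => xab; apply: uout => -[/=]; rewrite in_itv /= => /andP[? ?] _.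
  by apply: xab; rewrite !ltW.
have dP x : a <= x <= b -> is_derive x 1 (fun s => prim g a0 s y) (g (x, y)).
  by move=> /andP[x1 x2]; apply: prim_derive => //; rewrite (lt_le_trans haa x1) (le_lt_trans x2 hbb).
have dF x : a <= x <= b -> is_derive x 1 (fun s => k y * (prim g a0 s y * h s)) (u (x, y)).
  move=> xab; have := is_derive_scale (k y) (is_derive_mul (dP x xab) (smooth_is_derive x 1 Th.1)).
  by move/is_derive_eq'; apply; rewrite /u /=; ring.
rewrite (@FTC2 _ a b (fun s => k y * (prim g a0 s y * h s)) (fun x => u (x, y)) (ltW hab) dF).
  by rewrite !(Th.2 a, Th.2 b) ?mulr0 ?subrr // ltxx ?andbF.
move=> x xab; apply: continuous_slice0; apply: ucont; apply: sub0.
by split; rewrite /= in_itv //=; move: ycd => /andP[? ?]; rewrite !ltW.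
Qed.

(** Minus the primitive of [g] along rows, [f] has weak derivative 0 in the first direction, and
    [weak_slice_zero] applies. *)
Lemma weak_slice f : area.-integrable (obox a b c d) (EFin \o f) ->
  (forall h k, test1 a b h -> test1 c d k ->
    \int[area]_(z in obox a b c d) (f z * ('D_1 h z.1 * k z.2)) =
    - \int[area]_(z in obox a b c d) (g z * (h z.1 * k z.2))) ->
  exists k : R -> R, measurable_fun setT k /\
    {ae area, forall z, obox a b c d z -> f z = prim g a0 z.1 z.2 + k z.2}.
Proof.
move=> fi Hf; have mO := obox_measurable a b c d.
have [|h k Th Tk|k [mk Hk]] := @weak_slice_zero _ a b c d (fun z => f z - prim g a0 z.1 z.2) hab hcd.
- by apply: integrableB_EFin => //; exact: prim_integrable.
- have [M2 M20 HM2] := test1_bounded Tk.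
  have sD : smooth (fun x : R => 'D_1 h x) by apply: smooth_D; exact: Th.1.
  have mt (h' : R -> R) : smooth h' -> measurable_fun (obox a b c d : set mplane) (fun z : mplane => h' z.1 * k z.2).
    move=> sh; apply: measurable_funTS; apply: measurable_funM.
      by apply: (measurableT_comp (smooth_measurable sh)); exact: measurable_fst.
    by apply: (measurableT_comp (smooth_measurable Tk.1)); exact: measurable_snd.
  have bt (h' : R -> R) : smooth h' -> exists M, forall z : plane R, obox a b c d z -> `|h' z.1 * k z.2| <= M.
    move=> sh.
    have [M M0 HM] := @continuous_bounded_on _ _ `[a, b]%classic h' (@segment_compact _ a b) (fun x _ => smooth_cont sh).
    exists (M * M2) => z [/= z1 _]; rewrite normrM ler_pM //; apply: HM; exact: subset_itv_oo_cc.
  have int (F : plane R -> R) (h' : R -> R) : smooth h' -> area.-integrable (obox a b c d) (EFin \o F) ->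
      area.-integrable (obox a b c d) (EFin \o (fun z => F z * (h' z.1 * k z.2))).
    move=> sh Fi; have [M HM] := bt _ sh.
    by apply: (integrable_bndM (M := M)) => //; exact: mt.
  have gint : area.-integrable (obox a b c d) (EFin \o g).
    have := continuous_integrable2 oO cg (@box_compact _ a b c d) (subset_trans sub0 sub1).
    apply: integrableS; [exact: box_measurable|exact: obox_measurable|exact: obox_box].
  have := prim_weak Th Tk; rewrite RintegralD //; [|exact: (int _ _ sD prim_integrable)|exact: (int _ _ Th.1 gint)].
  move=> E; under eq_Rintegral do rewrite mulrBl.
  rewrite RintegralB //; [|exact: (int _ _ sD fi)|exact: (int _ _ sD prim_integrable)].
  by rewrite (Hf _ _ Th Tk) -opprD addrC E oppr0.
- exists k; split => //; apply: (ae_imply Hk) => z h zb.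
  by have := h zb; move=> /eqP; rewrite subr_eq addrC => /eqP.
Qed.

End Primitive.

End WeakC1.

Section WeakC1.
Context {R : realType}.
Notation leb := (@lebesgue_measure R).
Notation mplane := (measurableTypeR R * measurableTypeR R)%type.
Implicit Types (O : set (plane R)) (f : plane R -> R) (g : 'I_2 -> plane R -> R).

Lemma C0_swap a b c d f : C0 (obox a b c d) f -> C0 (obox c d a b) (fun z => f (z.2, z.1)).
Proof.
move=> cf [x y] [/= h1 h2].
have cs : {for (x, y), continuous (fun z : plane R => (z.2, z.1) : plane R)}.
  by apply: (@cvg_pair _ _ _ _ (nbhs y) (nbhs x)); [exact: cvg_snd|exact: cvg_fst].
by apply: (continuous_comp cs); apply: cf; split.
Qed.

Lemma ae_on_swap a b c d (P : plane R -> Prop) : ae_on (obox a b c d) P ->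
  ae_on (obox c d a b) (fun z => P (z.2, z.1)).
Proof.
move=> h; have := preserves_ae (@area_swap R) h => h'.
apply: (ae_imply h') => -[x y] H [/= h1 h2]; exact: H.
Qed.

(** The function [k] is only measurable. Freezing the first coordinate at some [x1] for which both
    representations of [f] agree for almost every [y] expresses [k] almost everywhere by the
    continuous function $Q(x_1,y)+m(x_1)-P(x_1,y)$. *)
Lemma slice_regular a b c d (P Q : plane R -> R) (k m : R -> R) f : a < b ->
  C0 (obox a b c d) P -> C0 (obox a b c d) Q ->
  ae_on (obox a b c d) (fun z => f z = P z + k z.2) ->
  ae_on (obox a b c d) (fun z => f z = Q z + m z.1) ->
  exists K : R -> R, C0 (obox a b c d) (fun z => P z + K z.2) /\
    ae_on (obox a b c d) (fun z => f z = P z + K z.2).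
Proof.
move=> ab cP cQ fP fQ.
have PQ : ae_on (obox a b c d) (fun z => P z + k z.2 = Q z + m z.1).
  by apply: (ae_on_imply2 fP fQ) => z _ -> ->.
have [x1 x1ab H] := ae_exists ab (ae_slice PQ).
pose K y := Q (x1, y) + m x1 - P (x1, y).
have := ae_snd H => H2.
exists K; split.
  move=> [x y] [/= xab ycd].
  have [c1 c2] : obox a b c d (x1, y) /\ obox a b c d (x, y) by split; split; rewrite //= in_itv.
  apply: continuous_add; first exact: cP.
  have cK : {for y, continuous K}.
    apply: continuous_sub; last by apply: continuous_slice1; exact: cP.
    by apply: continuous_add; [apply: continuous_slice1; exact: cQ|exact: continuous_const].
  by apply: (@continuous_comp1 _ _ K (fun z : plane R => z.2)); [exact: cvg_snd|exact: cK].
apply: (ae_imply2 fP H2) => -[x y] h1 h2 [/= xab ycd].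
rewrite h1; last by split.
by rewrite /K /= -h2; [ring|split; rewrite //= in_itv].
Qed.

Lemma tensor_pd (h k : R -> R) z : smooth h -> smooth k ->
  pd [:: ord0] (fun z : plane R => h z.1 * k z.2) z = 'D_1 h z.1 * k z.2 /\
  pd [:: ord_max] (fun z : plane R => h z.1 * k z.2) z = h z.1 * 'D_1 k z.2.
Proof.
case: z => x y sh sk; split; rewrite pdE; apply: is_deriveE.
  apply/is_derive_slice0 => /=.
  apply: is_derive_eq' (is_derive_mul (smooth_is_derive x 1 sh) (is_derive_const (k y) x 1)) _.
  by rewrite mulr0 add0r mulrC.
apply/is_derive_slice1 => /=.
apply: is_derive_eq' (is_derive_mul (is_derive_const (h x) y 1) (smooth_is_derive y 1 sk)) _.
by rewrite mulr0 addr0.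
Qed.

Lemma weak_C1_local O f g a0 b0 c0 d0 a b c d :
  open O -> is_wD O [:: ord0] f (g ord0) -> is_wD O [:: ord_max] f (g ord_max) ->
  (forall i, C0 O (g i)) -> box a0 b0 c0 d0 `<=` O ->
  a0 < a -> a < b -> b < b0 -> c0 < c -> c < d -> d < d0 ->
  exists F, [/\ C0 (obox a b c d) F,
    forall i z, obox a b c d z -> is_derive z (unit_vec i) F (g i z) &
    ae_on (obox a b c d) (fun z => f z = F z)].
Proof.
move=> oO [[mf fi] _ W0] [_ _ W1] cg bO ha hab hb hc hcd hd.
have sub : box a b c d `<=` O.
  by move=> z /(box_sub_obox ha hb hc hd) /obox_box; exact: bO.
have mO := open_measurable2 oO; have mB := obox_measurable a b c d.
have fB : area.-integrable (obox a b c d) (EFin \o f).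
  have := fi _ (@box_compact _ a b c d) sub.
  apply: integrableS; [exact: box_measurable|exact: obox_measurable|exact: obox_box].
have sO : (obox a b c d : set mplane) `<=` (O : set mplane) by apply: subset_trans sub; exact: obox_box.
have out (h k : R -> R) (H : plane R -> R) : test1 a b h -> test1 c d k ->
    \int[area]_(z in O) (H z * (h z.1 * k z.2)) = \int[area]_(z in obox a b c d) (H z * (h z.1 * k z.2)).
  move=> Th Tk.
  apply: (Rintegral_out (O : set mplane) (obox a b c d)) => // z _ nz.
  have [z1|/Th.2 ->] := boolP (a < z.1 < b); last by rewrite mul0r mulr0.
  have [z2|/Tk.2 ->] := boolP (c < z.2 < d); last by rewrite !mulr0.
  by exfalso; apply: nz; split; rewrite /= in_itv.
have [h k Th Tk|k [mk Hk]] := weak_slice oO (cg ord0) bO ha hab hb hc hcd hd fB.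
  have := W0 _ (test_tensor sub Th Tk).
  rewrite (out _ _ _ Th Tk) mulN1r => <-; rewrite -(out _ _ _ (test1_D hab Th) Tk).
  by apply: eq_Rintegral => z _; rewrite (tensor_pd z Th.1 Tk.1).1.
(* The second direction is reduced to the first one by exchanging the coordinates. *)
pose O' : set (plane R) := [set z | O (z.2, z.1)].
have cs : continuous (fun z : plane R => (z.2, z.1) : plane R).
  by move=> [x y]; apply: (@cvg_pair _ _ _ _ (nbhs y) (nbhs x)); [exact: cvg_snd|exact: cvg_fst].
have oO' : open O' by apply: (@open_comp _ _ (fun z : plane R => (z.2, z.1) : plane R)) => // z _; exact: cs.
have cg' : C0 O' (fun z => g ord_max (z.2, z.1)).
  by move=> z Oz; apply: (continuous_comp (cs z)); exact: cg.
have bO' : box c0 d0 a0 b0 `<=` O' by move=> [x y] [? ?]; apply: bO; split.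
have fB' : area.-integrable (obox c d a b) (EFin \o (fun z => f (z.2, z.1))).
  have := preserves_integrable (@area_swap R) mB fB.
  by congr (_.-integrable _ _); apply/seteqP; split => -[x y] [? ?]; split.
have swapI (H : plane R -> R) : area.-integrable (obox a b c d) (EFin \o H) ->
    \int[area]_(z in obox c d a b) H (z.2, z.1) = \int[area]_(z in obox a b c d) H z.
  move=> Hi; rewrite -(preserves_Rintegral (@area_swap R) mB Hi).
  by congr (Rintegral _ _ _); apply/seteqP; split => -[x y] [? ?]; split.
have intB (H : plane R -> R) h k' : test1 a b h -> test1 c d k' ->
    area.-integrable (obox a b c d) (EFin \o H) ->
    area.-integrable (obox a b c d) (EFin \o (fun z => H z * (h z.1 * k' z.2))).
  move=> Th Tk Hi; have [M1 M10 HM1] := test1_bounded Th; have [M2 M20 HM2] := test1_bounded Tk.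
  apply: (integrable_bndM (M := M1 * M2)) => //.
    apply: measurable_funTS; apply: measurable_funM.
      by apply: (measurableT_comp (smooth_measurable Th.1)); exact: measurable_fst.
    by apply: (measurableT_comp (smooth_measurable Tk.1)); exact: measurable_snd.
  by move=> z _; rewrite normrM ler_pM.
have gB : area.-integrable (obox a b c d) (EFin \o g ord_max).
  have := continuous_integrable2 oO (cg ord_max) (@box_compact _ a b c d) sub.
  apply: integrableS; [exact: box_measurable|exact: obox_measurable|exact: obox_box].
have [h k' Th Tk|m [mm Hm]] := weak_slice oO' cg' bO' hc hcd hd ha hab hb fB'.
  have := W1 _ (test_tensor sub Tk Th).
  rewrite (out _ _ _ Tk Th) mulN1r => E.
  have E2 : \int[area]_(z in obox c d a b) (g ord_max (z.2, z.1) * (h z.1 * k' z.2)) =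
      \int[area]_(z in obox a b c d) (g ord_max z * (k' z.1 * h z.2)).
    rewrite -(swapI _ (intB _ _ _ Tk Th gB)); apply: eq_Rintegral => z _ /=; by rewrite (mulrC (h _)).
  rewrite E2 -E.
  have E3 : \int[area]_(z in obox c d a b) (f (z.2, z.1) * ('D_1 h z.1 * k' z.2)) =
      \int[area]_(z in obox a b c d) (f z * (k' z.1 * 'D_1 h z.2)).
    rewrite -(swapI _ (intB _ _ _ Tk (test1_D hcd Th) fB)); apply: eq_Rintegral => z _ /=; by rewrite (mulrC (k' _)).
  rewrite E3 -(out _ _ _ Tk (test1_D hcd Th)).
  by apply: eq_Rintegral => z _; rewrite (tensor_pd z Tk.1 Th.1).2.
set B := obox a b c d.
have sB0 : B `<=` obox a0 b0 c0 d0.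
  by move=> z /obox_box; exact: box_sub_obox.
have sB0' : obox c d a b `<=` obox c0 d0 a0 b0.
  by move=> [x y] [h1 h2]; have [? ?] := sB0 (y, x) (conj h2 h1); split.
pose P z := prim (g ord0) a0 z.1 z.2.
pose Q' z := prim (fun z => g ord_max (z.2, z.1)) c0 z.1 z.2.
have cP : C0 B P by apply: (C0_sub sB0); exact: (prim_C0 (cg ord0) bO).
have cQ' : C0 (obox c d a b) Q' by apply: (C0_sub sB0'); exact: (prim_C0 cg' bO').
have Hm' : ae_on B (fun z => f z = Q' (z.2, z.1) + m z.1).
  have Hm1 : ae_on (obox c d a b) (fun z => f (z.2, z.1) = Q' z + m z.2) := Hm.
  by apply: (ae_on_imply (ae_on_swap Hm1)) => -[x y] _.
have [K [cK fK]] := slice_regular hab cP (C0_swap cQ') Hk Hm'.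
have [M [cM fM]] := slice_regular hcd cQ' (C0_swap cP) Hm (ae_on_swap Hk).
(* Two continuous representatives of [f] coincide everywhere. The left one is visibly differentiable
   in the first direction, the right one in the second. *)
have PQ z : B z -> P z + K z.2 = Q' (z.2, z.1) + M z.1.
  have cM' : C0 B (fun z => Q' (z.2, z.1) + M z.1) := C0_swap cM.
  have E : ae_on B (fun z => P z + K z.2 = Q' (z.2, z.1) + M z.1).
    by apply: (ae_on_imply2 fK (ae_on_swap fM)) => -[x y] _ /= -> .
  by move=> /(C0_ae_eq (@obox_open _ a b c d) cK cM' E).
exists (fun z => P z + K z.2); split => //.
move=> i [x y] Bz; have [/=] := sB0 _ Bz; rewrite !in_itv /= => /andP[x1 x2] /andP[y1 y2].
have [->|->] := ord2_cases i.
  apply/is_derive_slice0 => /=.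
  apply: is_derive_eq' (is_derive_add (prim_derive (cg ord0) bO _ _) (is_derive_const (K y) x 1)) _.
  - by rewrite x1.
  - by rewrite !ltW.
  - by rewrite addr0.
apply: (@is_derive_near _ _ (fun z => Q' (z.2, z.1) + M z.1)).
  have : nbhs (x, y) B by apply: open_nbhs_nbhs; split; [exact: obox_open|].
  by apply: filterS => z /PQ ->.
apply/is_derive_slice1 => /=.
apply: is_derive_eq' (is_derive_add (prim_derive cg' bO' _ _) (is_derive_const (M x) y 1)) _.
- by rewrite y1.
- by rewrite !ltW.
- by rewrite addr0.
Qed.

(** The local representatives are glued: [F z] is the value at [z] of the representative chosen for
    [z]. On overlaps the chosen ones are continuous and equal almost everywhere, hence equal. *)
Lemma weak_C1 O f g : open O ->
  is_wD O [:: ord0] f (g ord0) -> is_wD O [:: ord_max] f (g ord_max) -> (forall i, C0 O (g i)) ->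
  exists F, [/\ C0 O F, forall i z, O z -> is_derive z (unit_vec i) F (g i z) &
    ae_on O (fun z => f z = F z)].
Proof.
move=> oO W0 W1 cg.
pose B (z : plane R) r := obox (z.1 - r) (z.1 + r) (z.2 - r) (z.2 + r).
pose rep z (Fr : (plane R -> R) * R) := [/\ 0 < Fr.2, B z Fr.2 `<=` O, C0 (B z Fr.2) Fr.1,
  forall i y, B z Fr.2 y -> is_derive y (unit_vec i) Fr.1 (g i y) &
  ae_on (B z Fr.2) (fun y => f y = Fr.1 y)].
have ex z : exists Fr, O z -> rep z Fr.
  have [Oz|nOz] := pselect (O z); last by exists (f, 0).
  case: z Oz => x y Oz; have [r r0 rO] := nbhs_box oO Oz.
  have [F [F1 F2 F3]] := @weak_C1_local O f g _ _ _ _ (x - r / 2) (x + r / 2) (y - r / 2) (y + r / 2)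
     oO W0 W1 cg rO ltac:(lra) ltac:(lra) ltac:(lra) ltac:(lra) ltac:(lra) ltac:(lra).
  exists (F, r / 2) => _; split => //; first by rewrite divr_gt0.
  move=> [x' y'] [/=]; rewrite !in_itv /= => /andP[? ?] /andP[? ?]; apply: rO.
  by split; rewrite /= in_itv /=; apply/andP; split; lra.
have [Fr HFr] := choice ex.
pose F z := (Fr z).1 z.
have Bz z r : 0 < r -> B z r z by move=> r0; case: z => x y; exact: obox_center.
have FE z y : O z -> B z (Fr z).2 y -> F y = (Fr z).1 y.
  move=> Oz By; have [r0 BO cF dF aF] := HFr _ Oz.
  have [r0' BO' cF' dF' aF'] := HFr _ (BO _ By).
  pose U := B z (Fr z).2 `&` B y (Fr y).2.
  have oU : open U by apply: openI; exact: obox_open.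
  have UB : U `<=` B z (Fr z).2 by move=> ? [].
  have UB' : U `<=` B y (Fr y).2 by move=> ? [].
  rewrite /F; apply: (C0_ae_eq oU (C0_sub UB' cF') (C0_sub UB cF)); last by split => //; exact: Bz.
  by apply: (ae_on_imply2 (ae_on_sub UB' aF') (ae_on_sub UB aF)) => ? _ <- <-.
have nB z : O z -> \forall y \near z, (Fr z).1 y = F y.
  move=> Oz; have [r0 BO cF dF aF] := HFr _ Oz.
  have : nbhs z (B z (Fr z).2) by apply: open_nbhs_nbhs; split; [exact: obox_open|exact: Bz].
  by apply: filterS => y /(FE _ _ Oz) ->.
exists F; split.
- move=> z Oz; have [r0 BO cF dF aF] := HFr _ Oz.
  by apply: (continuous_near (nB z Oz)); apply: cF; exact: Bz.
- move=> i z Oz; have [r0 BO cF dF aF] := HFr _ Oz.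
  by apply: (is_derive_near (nB z Oz)); apply: dF; exact: Bz.
- apply: ae_on_nbhs => x y Oxy; have [r0 BO cF dF aF] := HFr _ Oxy.
  exists (Fr (x, y)).2 => //; apply: (ae_on_imply aF) => z zB ->.
  by rewrite -(FE _ _ Oxy zB).
Qed.

End WeakC1.

(** * Sobolev functions and constant traces up to null sets *)

Section Sobolev.
Context {R : realType}.
Notation mplane := (measurableTypeR R * measurableTypeR R)%type.
Implicit Types (O : set (plane R)) (f g p psi w : plane R -> R).

Lemma size_le1 (s : seq 'I_2) : (size s <= 1)%N -> s = [::] \/ exists i, s = [:: i].
Proof. by case: s => [|i [|]] //; [left|right; exists i]. Qed.

Lemma is_wD_nil O f : L1loc O f -> is_wD O [::] f f.
Proof. by split=> // phi _; rewrite expr0 mul1r. Qed.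

Lemma Hk1_intro O f (g : 'I_2 -> plane R -> R) : open O -> L2 O f ->
  (forall i, is_wD O [:: i] f (g i) /\ L2 O (g i)) -> Hk 1 O f.
Proof.
move=> oO f2 fg; split=> // s /size_le1[->|[i ->]]; last by exists (g i).
by exists f; split=> //; apply: is_wD_nil; exact: L2_L1loc.
Qed.

Lemma L2_ae O f g : open O -> measurable_fun (O : set mplane) g -> ae_on O (fun x => f x = g x) ->
  L2 O f -> L2 O g.
Proof.
move=> oO mg fg /L2_sqi f2; apply/L2_sqi; apply: (sqi_ae _ mg fg f2); exact: open_measurable2.
Qed.

Lemma L2_add O f g : open O -> L2 O f -> L2 O g -> L2 O (fun x => f x + g x).
Proof. by move=> /open_measurable2 mO /L2_sqi ? /L2_sqi ?; apply/L2_sqi; exact: sqi_add. Qed.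

Lemma L2_scale O (c : R) f : open O -> L2 O f -> L2 O (fun x => c * f x).
Proof. by move=> /open_measurable2 mO /L2_sqi ?; apply/L2_sqi; exact: sqi_scale. Qed.

Lemma L2_cst O (c : R) : open O -> (area O < +oo)%E -> L2 O (fun=> c).
Proof.
move=> oO fO; split; first exact: measurable_cst.
have mO := open_measurable2 oO; apply/integrableP; split; first exact: measurable_cst.
by rewrite integral_cst //= lte_mul_pinfty // lee_fin normr_ge0.
Qed.

Lemma L2_integrable_mul O f g : open O -> L2 O f -> L2 O g ->
  area.-integrable O (EFin \o (fun x => f x * g x)).
Proof. by move=> /open_measurable2 mO /L2_sqi ? /L2_sqi ?; exact: sqi_mul. Qed.

Lemma Hk1_ae O f g : open O -> measurable_fun (O : set mplane) g ->
  ae_on O (fun x => f x = g x) -> Hk 1 O f ->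
  Hk 1 O g /\ forall s, (size s <= 1)%N -> ae_on O (fun x => wD O s f x = wD O s g x).
Proof.
move=> oO mg fg Hf.
have wf s : (size s <= 1)%N -> is_wD O s g (wD O s f).
  move=> s1; have [wf [mf _]] := Hk_wD oO Hf s1.
  by apply: (is_wD_ae oO wf mg mf fg); exact: ae_on_all.
split.
  split; first by apply: L2_ae fg Hf.1.
  by move=> s s1; exists (wD O s f); split; [exact: wf|exact: (Hk_wD oO Hf s1).2].
move=> s s1; by apply: (ae_on_imply (wD_ae oO (wf _ s1))) => x _ ->.
Qed.

Lemma Hcvg_ae O (phi : nat -> plane R -> R) f g : open O -> measurable_fun (O : set mplane) g ->
  ae_on O (fun x => f x = g x) -> Hk 1 O f -> (forall n, smooth (phi n)) -> Hcvg 1 O phi f -> Hcvg 1 O phi g.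
Proof.
move=> oO mg fg Hf sphi cf s s1; have [Hg E] := Hk1_ae oO mg fg Hf.
have mO := open_measurable2 oO.
apply: cvg_trans (cf _ s1).
apply: near_eq_cvg; near=> n.
have mp : measurable_fun (O : set mplane) (pd s (phi n)).
  by apply: C0_measurable => // x _; exact: smooth_cont (smooth_pd s (sphi n)).
have [_ [m1 _]] := Hk_wD oO Hf s1; have [_ [m2 _]] := Hk_wD oO Hg s1.
apply: ge0_ae_eq_integral => //.
- by apply: measurable_EFin; apply: measurable_funX; exact: measurable_funB.
- by apply: measurable_EFin; apply: measurable_funX; exact: measurable_funB.
- by move=> x _; rewrite lee_fin sqr_ge0.
- by move=> x _; rewrite lee_fin sqr_ge0.
- have E' : ae_on O (fun x => ((pd s (phi n) x - wD O s f x) ^+ 2)%:E = ((pd s (phi n) x - wD O s g x) ^+ 2)%:E).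
    by apply: (ae_on_imply (E _ s1)) => x _ ->.
  exact: E'.
Unshelve. all: by end_near.
Qed.

Lemma const_on_boundary_ae O f g : open O -> measurable_fun (O : set mplane) g ->
  ae_on O (fun x => f x = g x) -> const_on_boundary O f -> const_on_boundary O g.
Proof.
move=> oO mg fg [Hf [c [phi [sphi cphi trphi]]]].
have [Hg _] := Hk1_ae oO mg fg Hf; split; [exact: Hg|exists c, phi].
by split; [exact: sphi|exact: (Hcvg_ae oO mg fg Hf sphi cphi)|exact: trphi].
Qed.

Lemma test_sqi O f s : open O -> test O f -> sqi area O (pd s f).
Proof. by move=> oO tf; apply/L2_sqi; apply: Cc_L2 => //; apply: test_Cc; exact: test_pd. Qed.

(** With test functions [phi n] that approximate [f], the smooth functions [c + k * phi n] equal [c]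
    on every chart graph, because the points of a graph lie outside of [O]; the integrals in the
    definition of the trace are 0. *)
Lemma const_on_boundary_affine O f (c k : R) : open O -> L2 O (fun=> 1) -> H0k 1 O f ->
  const_on_boundary O (fun x => c + k * f x).
Proof.
move=> oO one H; have Hf := H.1; have mO := open_measurable2 oO.
have c2 : L2 O (fun=> c) by have := L2_scale c oO one; under eq_fun do rewrite mulr1.
have wc i : is_wD O [:: i] (fun x => c + k * f x) (fun x => k * wD O [:: i] f x).
  have [wf _] := @Hk_wD _ _ _ _ [:: i] oO Hf isT.
  have := is_wD_add oO (C1_is_wD i oO (@C1_cst _ O c oO)) (is_wD_scale k oO wf).
  have E x : pd [:: i] (fun _ : plane R => c) x = 0 by rewrite pdE; exact: is_deriveE (is_derive_const _ _ _).
  by under [X in is_wD _ _ _ X -> _]eq_fun do rewrite E add0r.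
have [phi [tphi cphi]] := H0k_approx oO H.
have L : L2 O (fun x => c + k * f x) by apply: L2_add => //; apply: L2_scale => //; exact: Hf.1.
have HH : Hk 1 O (fun x => c + k * f x).
  by apply: (Hk1_intro oO L) => i; split; [exact: wc|apply: L2_scale => //; exact: (@Hk_wD _ _ _ _ [:: i] oO Hf isT).2].
split=> //; exists c, (fun n x => c + k * phi n x); split.
- by move=> n; apply: smooth_add; [exact: smooth_cst|apply: smooth_scale; case: (tphi n)].
- move=> s s1.
  have [ws w2] := Hk_wD oO Hf s1.
  have /(cvgL2P mO) : cvgL2 area O (fun n x => k * pd s (phi n) x) (fun x => k * wD O s f x).
    by apply: cvgL2_scale => //; exact: cphi.
  move=> /(_ (fun n => sqi_scale mO k (test_sqi s oO (tphi n)))) /(_ (sqi_scale mO k (proj1 (L2_sqi _ _) w2))).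
  move=> cv; apply: cvg_trans cv; apply: near_eq_cvg; near=> n.
  have [sp _] := tphi n.
  have ph x : pd s (fun x => c + k * phi n x) x = (if s is [::] then c else 0) + k * pd s (phi n) x.
    have [->|[i ->]] := size_le1 s1; first by [].
    rewrite pdE; apply: is_deriveE.
    by apply: is_derive_add (is_derive_const _ _ _) (is_derive_scale _ (smooth_is_derive _ _ sp)).
  have E : ae_on O (fun x => wD O s (fun x => c + k * f x) x = (if s is [::] then c else 0) + k * wD O s f x).
    have [->|[i ->]] := size_le1 s1.
      apply: (ae_on_imply2 (wD_nil oO (L2_L1loc oO L)) (wD_nil oO (L2_L1loc oO Hf.1))) => x _ -> -> //.
    by apply: (ae_on_imply (wD_ae oO (wc i))) => x _ ->; rewrite add0r.
  have mp : measurable_fun (O : set mplane) (pd s (phi n)).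
    by apply: C0_measurable => // x _; exact: smooth_cont (smooth_pd s sp).
  have mp' : measurable_fun (O : set mplane) (pd s (fun x => c + k * phi n x)).
    apply: C0_measurable => // x _; apply: smooth_cont; apply: smooth_pd.
    by apply: smooth_add; [exact: smooth_cst|exact: smooth_scale].
  have [_ [m2 _]] := Hk_wD oO HH s1; have [m1 _] := w2.
  apply: ge0_ae_eq_integral => //.
  - by apply: measurable_EFin; apply: measurable_funX; apply: measurable_funB => //; exact: measurable_funM.
  - by apply: measurable_EFin; apply: measurable_funX; exact: measurable_funB.
  - by move=> x _; rewrite lee_fin sqr_ge0.
  - by move=> x _; rewrite lee_fin sqr_ge0.
  - have E' : ae_on O (fun x => ((k * pd s (phi n) x - k * wD O s f x) ^+ 2)%:E =
        ((pd s (fun x => c + k * phi n x) x - wD O s (fun x => c + k * f x) x) ^+ 2)%:E).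
      by apply: (ae_on_imply E) => x _ ->; rewrite ph; congr (_ ^+ 2)%:E; ring.
    exact: E'.
- move=> x0 e r k' gam [[r0 k0 e1 gk] gO _].
  apply: cvg_near_cst; near=> n.
  rewrite integral0_eq // => a; rewrite /= in_itv /= => /andP[a1 a2].
  have ar : `|a| < r by rewrite ltr_norml a1.
  have nO : ~ O (frame x0 e a (gam a)) by move/(gO _ _ ar (gk _ ar)); rewrite ltxx.
  have [_ [K [_ KO Kphi]]] := tphi n.
  by rewrite (Kphi _ (fun Kx => nO (KO _ Kx))) mulr0 addr0 subrr expr0n.
Unshelve. all: by end_near.
Qed.

End Sobolev.

#[local] Opaque wD Rintegral.

(** * The pressure and the stream function *)

Section Pressure.
Context {R : realType}.
Notation mplane := (measurableTypeR R * measurableTypeR R)%type.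
Implicit Types (O : set (plane R)) (f g p psi w : plane R -> R).

Definition rot_grad p (i : 'I_2) (x : plane R) : R :=
  if i == ord0 then - pd [:: ord_max] p x else pd [:: ord0] p x.

Lemma harmonic_C1_pd O p s : open O -> Defs.harmonic O p -> (size s <= 1)%N -> C1 O (pd s p).
Proof.
move=> oO [H _] s1.
have c s' : (size s' <= 2)%N -> C0 O (pd s' p) by move=> s2 x Ox; exact: (H x Ox).1.
apply: (@C1_intro _ O (pd s p) (fun i => pd (i :: s) p)) => //.
- by apply: c; exact: leq_trans s1 _.
- by move=> i x Ox; apply: derivable_is_derive; apply: (H x Ox).2; exact: leq_ltn_trans s1 _.
- by move=> i; apply: c.
Qed.

Lemma harmonic_C1 O p : open O -> Defs.harmonic O p -> C1 O p.
Proof. by move=> oO hp; exact: (@harmonic_C1_pd O p [::]). Qed.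

Lemma rot_grad_C1 O p i : open O -> Defs.harmonic O p -> C1 O (rot_grad p i).
Proof.
move=> oO hp; have [->|->] := ord2_cases i; rewrite /rot_grad /=.
  have := C1_mul oO (@C1_cst _ O (-1) oO) (harmonic_C1_pd (s := [:: ord_max]) oO hp isT).
  by under eq_fun do rewrite mulN1r.
exact: harmonic_C1_pd.
Qed.

Lemma rot_grad_C0 O p i : open O -> Defs.harmonic O p -> C0 O (rot_grad p i).
Proof. by move=> oO hp; apply: C1_C0; exact: rot_grad_C1. Qed.

Lemma harmonic_pdC O p x : open O -> Defs.harmonic O p -> O x ->
  pd [:: ord0; ord_max] p x = pd [:: ord_max; ord0] p x.
Proof.
move=> oO hp Ox.
have d i := harmonic_C1_pd (s := [:: i]) oO hp isT.
apply: (schwarz oO (harmonic_C1 oO hp)) => //.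
- by move=> y Oy; exact: (C1_derive ord0 (d ord_max)).
- by move=> y Oy; exact: (C1_derive ord_max (d ord0)).
- exact: (C1_pd_C0 ord0 (d ord_max)).
- exact: (C1_pd_C0 ord_max (d ord0)).
Qed.

Lemma wlapE O f x : wlap O f x = wD O [:: ord0; ord0] f x + wD O [:: ord_max; ord_max] f x.
Proof. by rewrite /wlap sum2. Qed.

Lemma wlap_L2 O psi : open O -> Hk 2 O psi -> L2 O (wlap O psi).
Proof.
move=> oO H; rewrite (_ : wlap O psi = (fun x => wD O [:: ord0; ord0] psi x + wD O [:: ord_max; ord_max] psi x)); last by apply/funext => x; rewrite wlapE.
by apply: L2_add => //; apply: (Hk_wD oO H _).2.
Qed.

Lemma test_pd_lap O phi : test O phi -> test O (lap phi).
Proof.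
move=> T; rewrite (_ : lap phi = (fun x => pd [:: ord0; ord0] phi x + pd [:: ord_max; ord_max] phi x)); last by apply/funext => x; rewrite lapE.
by apply: test_add; exact: test_pd.
Qed.

(** As $u=(\partial_2\psi,-\partial_1\psi)$, the two components of the Stokes system read
    $\partial_2q=\partial_1p$ and $-\partial_1q=\partial_2p$ for $q=\Delta\psi+\lambda\psi$. In the
    weak form one derivative of $\psi$ and the Laplacian are moved through the test function
    ([lapI]). *)
Lemma weak_gradient_rotated_pressure O lam u p psi : open O -> H0k 2 O psi ->
  (forall j, H0k 1 O (u j)) -> stokes_pressure O lam u p ->
  ae_on O (fun x => forall j, u j x = - grad_perp O psi j x) ->
  forall i, is_wD O [:: i] (fun x => wlap O psi x + lam * psi x) (rot_grad p i).
Proof.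
move=> oO [H _] Hu [hp Hp] upsi i.
have mO := open_measurable2 oO.
have W s : (size s <= 2)%N -> is_wD O s psi (wD O s psi) by move=> s2; exact: (Hk_wD oO H s2).1.
have wL := wlap_L2 oO H; have p2 := H.1.
split.
- by apply: L1loc_add => //; [exact: L2_L1loc|apply: L1loc_scale => //; exact: L2_L1loc].
- by apply: C0_L1loc => //; exact: rot_grad_C0.
move=> phi T.
have intT f h : L2 O f -> test O h -> area.-integrable O (EFin \o (fun x => f x * h x)).
  by move=> f2 Th; apply: L2_integrable_mul => //; exact: Cc_L2 (test_Cc Th).
have w1 k : L2 O (wD O [:: k] psi) by exact: (Hk_wD oO H (s := [:: k]) _).2.
have lapI j : \int[area]_(x in O) (wD O [:: j] psi x * lap phi x + lam * (wD O [:: j] psi x * phi x)) =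
    - \int[area]_(x in O) ((wlap O psi x + lam * psi x) * pd [:: j] phi x).
  have Tl := test_pd_lap T; have Tj := test_pd [:: j] T.
  rewrite RintegralD //; [|exact: intT|by apply: integrableZ_EFin => //; exact: intT].
  rewrite RintegralZl //; last exact: intT.
  have [_ _ /(_ _ Tl)] := W [:: j] isT; rewrite expr1 mulN1r => /(congr1 -%R); rewrite opprK => <-.
  have [_ _ /(_ _ T)] := W [:: j] isT; rewrite expr1 mulN1r => /(congr1 -%R); rewrite opprK => <-.
  rewrite (smooth_lap_pd _ T.1).
  have -> : \int[area]_(x in O) (psi x * lap (pd [:: j] phi) x) = \int[area]_(x in O) (wlap O psi x * pd [:: j] phi x).
    under eq_Rintegral do rewrite lapE mulrDr.
    under [RHS]eq_Rintegral do rewrite wlapE mulrDl.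
    have W2 k : L2 O (wD O [:: k; k] psi) by exact: (Hk_wD oO H (s := [:: k; k]) _).2.
    have Tkk k := test_pd [:: k; k] Tj.
    rewrite (RintegralD mO (intT _ _ p2 (Tkk ord0)) (intT _ _ p2 (Tkk ord_max))).
    rewrite (RintegralD mO (intT _ _ (W2 ord0) Tj) (intT _ _ (W2 ord_max) Tj)).
    have Wj k : \int[area]_(x in O) (psi x * pd [:: k; k] (pd [:: j] phi) x) =
        \int[area]_(x in O) (wD O [:: k; k] psi x * pd [:: j] phi x).
      have [_ _ Wk] := W [:: k; k] isT; rewrite (Wk _ Tj).
      by rewrite sqrrN expr1n mul1r.
    exact: (f_equal2 +%R (Wj ord0) (Wj ord_max)).
  have E x : (wlap O psi x + lam * psi x) * pd [:: j] phi x = wlap O psi x * pd [:: j] phi x + lam * (psi x * pd [:: j] phi x) by ring.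
  under [in RHS]eq_Rintegral do rewrite E.
  rewrite RintegralD //; [|exact: intT|by apply: integrableZ_EFin => //; exact: intT].
  by rewrite RintegralZl //; [ring|exact: intT].
have u2 j : L2 O (u j) by exact: (Hu j).1.1.
have ibp k : \int[area]_(x in O) (p x * pd [:: k] phi x) = - \int[area]_(x in O) (pd [:: k] p x * phi x).
  by apply: integration_by_parts2 => //; [exact: test_C1c|exact: harmonic_C1].
have mph f : test O f -> measurable_fun (O : set mplane) f.
  by move=> [sf _]; apply: C0_measurable => // x _; exact: smooth_cont sf.
have uj j (c : R) k : ae_on O (fun x => u j x = c * wD O [:: k] psi x) ->
    c * \int[area]_(x in O) ((wlap O psi x + lam * psi x) * pd [:: k] phi x) =
    - \int[area]_(x in O) (pd [:: j] p x * phi x).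
  move=> E; have := Hp j phi T; rewrite ibp opprK => <-.
  rewrite -[in LHS](opprK (Rintegral _ _ _)) -lapI mulrN -RintegralZl //; last first.
    apply: integrableD_EFin => //; first by apply: intT => //; exact: test_pd_lap.
    by apply: integrableZ_EFin => //; exact: intT.
  congr (- _); apply: (ae_on_eq_Rintegral oO); first last.
  - by apply: (ae_on_imply E) => x _ ->; ring.
  - have mu' : measurable_fun (O : set mplane) (u j) := (u2 j).1.
    by apply: measurable_funD; apply: measurable_funM => //; [apply: mph; exact: test_pd_lap|apply: measurable_funM => //; exact: mph].
  - have mw : measurable_fun (O : set mplane) (wD O [:: k] psi) := (w1 k).1.
    by apply: measurable_funM => //; apply: measurable_funD; apply: measurable_funM => //; [apply: mph; exact: test_pd_lap|apply: measurable_funM => //; exact: mph].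
rewrite expr1 mulN1r.
have [->|->] := ord2_cases i; rewrite /rot_grad /=.
  have := @uj ord_max (-1) ord0; rewrite mulN1r => /(_ _)/(congr1 -%R); rewrite !opprK => ->.
    under [in RHS]eq_Rintegral do rewrite mulNr.
    rewrite RintegralN ?opprK //.
    by apply: Cc_integrableO => //; under eq_fun do rewrite mulrC; apply: Cc_mul; [exact: test_Cc|exact: C1_pd_C0 (harmonic_C1 _ _)].
  by apply: (ae_on_imply upsi) => x _ /(_ ord_max) ->; rewrite /grad_perp /= mulN1r.
have := @uj ord0 1 ord_max; rewrite mul1r; apply.
by apply: (ae_on_imply upsi) => x _ /(_ ord0) ->; rewrite /grad_perp /= opprK mul1r.
Qed.

(** The Neumann condition contains $p\in H^1$, so [p] may be tested with itself; continuity of the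
    gradient turns almost everywhere into everywhere. *)
Lemma weak_neumann_grad_zero O p : open O -> Defs.harmonic O p -> weak_neumann O p -> grad_zero O p.
Proof.
move=> oO hp [H N] x Ox i; have mO := open_measurable2 oO.
have C := harmonic_C1 oO hp.
have w2 k : sqi area O (wD O [:: k] p) by apply/L2_sqi; exact: (Hk_wD oO H (s := [:: k]) _).2.
have N0 := N p H; rewrite (eq_Rintegral _ (fun x _ => sum2 _)) in N0.
have sq (a b : R) : 0 <= a * a + b * b by rewrite -!expr2 addr_ge0 ?sqr_ge0.
have sq0 (a b : R) : a * a + b * b = 0 -> a = 0 /\ b = 0.
  move=> /eqP; rewrite -!expr2 paddr_eq0 ?sqr_ge0 // !sqrf_eq0 => /andP[/eqP -> /eqP ->] //.
have Z : {ae area, forall x, O x -> wD O [:: ord0] p x * wD O [:: ord0] p x + wD O [:: ord_max] p x * wD O [:: ord_max] p x = 0}.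
  apply: (ae_zero_of_integral_zero mO _ _ N0); last by move=> y _; exact: sq.
  by apply: (integrableD_EFin mO); apply: (sqi_mul mO); exact: w2.
have Z' : ae_on O (fun x => pd [:: i] p x = (fun=> 0) x).
  apply: (ae_on_imply2 Z (wD_ae oO (C1_is_wD i oO C))) => y Oy + <-.
  by move=> /sq0[z0 z1]; have [->|->] := ord2_cases i.
by apply: (C0_ae_eq oO (C1_pd_C0 i C) (@C0_cst _ O 0) Z').
Qed.

(** On the connected set [O] the pressure is a constant, and constants are in $H^1$ because the area
    is finite. *)
Lemma grad_zero_weak_neumann O p : open O -> connected O -> (area O < +oo)%E ->
  Defs.harmonic O p -> grad_zero O p -> weak_neumann O p.
Proof.
move=> oO cO fO hp Z; have mO := open_measurable2 oO; have C := harmonic_C1 oO hp.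
have pc x y : O x -> O y -> p x = p y.
  apply: (connected_constant oO cO) => i z Oz; exact: (is_derive_eq' (C1_derive i C Oz) (Z z Oz i)).
have [c pE] : exists c, forall x, O x -> p x = c.
  have [[x0 Ox0]|nO] := pselect (exists x, O x); last by exists 0 => x Ox; exfalso; apply: nO; exists x.
  by exists (p x0) => x Ox; exact: pc.
have p2 : L2 O p.
  apply: (L2_ae oO _ _ (L2_cst c oO fO)).
    by apply: C0_measurable => //; exact: C1_C0.
  by apply: ae_on_all => x /pE ->.
have H : Hk 1 O p.
  apply: (Hk1_intro oO p2) => i; split; first exact: (C1_is_wD i oO C).
  apply: (L2_ae oO _ _ (L2_cst 0 oO fO)).
    by apply: C0_measurable => //; exact: C1_pd_C0.
  by apply: ae_on_all => x Ox; rewrite pdE (Z x Ox i).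
have aux (a b a' b' : R) : a = 0 -> b = 0 -> a * a' + b * b' = 0 by move=> -> ->; ring.
split=> // q Hq; under eq_Rintegral do rewrite sum2.
rewrite -[RHS](@Rintegral0 _ _ _ area O).
have wz i : ae_on O (fun x => wD O [:: i] p x = 0).
  by apply: (ae_on_imply (wD_ae oO (C1_is_wD i oO C))) => x Ox ->; exact: Z.
have mw f i : Hk 1 O f -> measurable_fun (O : set mplane) (wD O [:: i] f).
  by move=> Hf; exact: (Hk_wD oO Hf (s := [:: i]) _).2.1.
apply: (ae_on_eq_Rintegral oO); last 2 first.
- exact: measurable_cst.
- by apply: (ae_on_imply2 (wz ord0) (wz ord_max)) => x _; exact: aux.
by apply: measurable_funD; apply: measurable_funM; exact: mw.
Qed.

Lemma weak_gradient_zero O f : open O -> connected O ->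
  (forall i, exists2 g, is_wD O [:: i] f g & forall x, O x -> g x = 0) ->
  exists c, ae_on O (fun x => f x = c).
Proof.
move=> oO cO H.
have H0 i : is_wD O [:: i] f (fun=> 0).
  have [g wg gz] := H i; apply: (is_wD_ae oO wg); last 2 first.
  - exact: ae_on_all.
  - by apply: ae_on_all => x /gz.
  - by have [[]] := wg.
  - exact: measurable_cst.
have [F [cF dF aF]] := weak_C1 (g := fun _ _ => 0) oO (H0 _) (H0 _) (fun _ => @C0_cst _ O 0).
have Fc := connected_constant oO cO dF.
have [[x0 Ox0]|nO] := pselect (exists x, O x); last first.
  by exists 0; apply: ae_on_all => x Ox; exfalso; apply: nO; exists x.
by exists (F x0); apply: (ae_on_imply aF) => x Ox ->; exact: Fc.
Qed.

End Pressure.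

#[local] Transparent wD Rintegral.

Section ChainRule.
Context {R : realType}.
Implicit Types (O : set (plane R)) (f : plane R -> R).

Lemma mvt_between (a b : R) (F d : R -> R) :
  (forall x : R, Num.min a b <= x <= Num.max a b -> is_derive x 1 F (d x)) ->
  exists2 c, `|c - a| <= `|b - a| & F b - F a = d c * (b - a).
Proof.
case: (ltgtP a b) => [ab|ba|->] H.
- have [c /andP[c1 c2] E] := mvt_lin ab H; exists c => //.
  by rewrite !ger0_norm ?subr_ge0 ?lerD2r ?(ltW c2) ?(ltW c1) ?(ltW ab).
- have [c /andP[c1 c2] E] := mvt_lin ba H; exists c.
    by rewrite !ler0_norm ?subr_le0 ?lerN2 ?lerD2r ?(ltW c2) ?(ltW c1) ?(ltW ba).
  by rewrite -opprB E; ring.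
- by exists b; rewrite ?subrr ?mulr0.
Qed.

Lemma mvt2 a b c d f (z z' : plane R) : C1 (obox a b c d) f -> obox a b c d z -> obox a b c d z' ->
  exists xi xj : plane R,
  [/\ `|xi.1 - z.1| <= `|z'.1 - z.1| /\ `|xi.2 - z.2| <= `|z'.2 - z.2|,
      `|xj.1 - z.1| <= `|z'.1 - z.1| /\ `|xj.2 - z.2| <= `|z'.2 - z.2| &
      f z' - f z = pd [:: ord0] f xi * (z'.1 - z.1) + pd [:: ord_max] f xj * (z'.2 - z.2)].
Proof.
case: z z' => [x y] [x' y'] C [/= z1 z2] [/= z1' z2'].
have sub (u u' v v' t : R) : u \in `]v, v'[ -> u' \in `]v, v'[ -> Num.min u u' <= t <= Num.max u u' -> t \in `]v, v'[.
  rewrite !in_itv /= => /andP[? ?] /andP[? ?]; rewrite ge_min le_max => /andP[/orP[|] ? /orP[|] ?]; apply/andP; split; lra.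
have [xi xi1 E1] := @mvt_between x x' (fun s => f (s, y')) (fun s => pd [:: ord0] f (s, y'))
  (fun t ht => proj1 (@is_derive_slice0 _ f t y' _) (C1_derive ord0 C (conj (sub _ _ _ _ _ z1 z1' ht) z2' : obox a b c d (t, y')))).
have [xj xj1 E2] := @mvt_between y y' (fun s => f (x, s)) (fun s => pd [:: ord_max] f (x, s))
  (fun t ht => proj1 (@is_derive_slice1 _ f x t _) (C1_derive ord_max C (conj z1 (sub _ _ _ _ _ z2 z2' ht) : obox a b c d (x, t)))).
exists (xi, y'), (x, xj); split => /=; [by split|by rewrite subrr normr0; split|].
rewrite -E1 -E2; ring.
Qed.

(** Only partial derivatives are at hand. The increment of [f] is split along two sides of a
    rectangle ([mvt2]); the intermediate points tend to the base point, where the partial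
    derivatives are continuous. *)
Lemma C1_chain O f (c1 c2 : R -> R) (t d1 d2 : R) : open O -> C1 O f -> O (c1 t, c2 t) ->
  is_derive t 1 c1 d1 -> is_derive t 1 c2 d2 ->
  is_derive t 1 (fun s => f (c1 s, c2 s))
    (pd [:: ord0] f (c1 t, c2 t) * d1 + pd [:: ord_max] f (c1 t, c2 t) * d2).
Proof.
move=> oO C Ot D1 D2; have [r r0 rO] := nbhs_box oO Ot.
pose B := obox (c1 t - r) (c1 t + r) (c2 t - r) (c2 t + r).
have CB : C1 B f by apply: C1_sub C => z /obox_box; exact: rO.
have Bt : B (c1 t, c2 t) by exact: obox_center.
have k1 := is_derive_continuous1 D1; have k2 := is_derive_continuous1 D2.
have sh : (fun s : R => s *: 1 + t) @ 0^' --> t.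
  have -> : (fun s : R => s *: 1 + t) = (fun s : R => s + t) by apply/funext => s; rewrite [s *: 1]mulr1.
  have h : (fun s : R => s + t) @ (0 : R) --> ((0 : R) + t).
    by apply: (@continuous_add _ _ (fun s : R => s) (fun=> t)); [exact: cvg_id|exact: continuous_const].
  rewrite add0r in h.
  by apply: cvg_trans h; apply: cvg_app; exact: nbhs_dnbhs.
have l1 : c1 (s *: 1 + t) @[s --> 0^'] --> c1 t by apply: (cvg_comp _ _ sh k1).
have l2 : c2 (s *: 1 + t) @[s --> 0^'] --> c2 t by apply: (cvg_comp _ _ sh k2).
have ex s : exists m : R * R, B (c1 (s *: 1 + t), c2 (s *: 1 + t)) ->
    (forall i : 'I_2, exists xi : plane R,
      [/\ `|xi.1 - c1 t| <= `|c1 (s *: 1 + t) - c1 t|, `|xi.2 - c2 t| <= `|c2 (s *: 1 + t) - c2 t| &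
        (if i == ord0 then m.1 else m.2) = pd [:: i] f xi]) /\
    f (c1 (s *: 1 + t), c2 (s *: 1 + t)) - f (c1 t, c2 t) =
      m.1 * (c1 (s *: 1 + t) - c1 t) + m.2 * (c2 (s *: 1 + t) - c2 t).
  have [Bs|nB] := pselect (B (c1 (s *: 1 + t), c2 (s *: 1 + t))); last by exists (0, 0) => /nB.
  have [xi [xj [[h1 h2] [h3 h4] E]]] := mvt2 CB Bt Bs.
  exists (pd [:: ord0] f xi, pd [:: ord_max] f xj) => _; split => // i.
  by have [->|->] := ord2_cases i; [exists xi|exists xj].
have [m Hm] := choice ex.
have near_box (rho : R) : 0 < rho -> \forall s \near 0^', `|c1 (s *: 1 + t) - c1 t| < rho /\ `|c2 (s *: 1 + t) - c2 t| < rho.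
  move=> rho0; have n1 := proj1 (cvgrPdist_lt _ _) l1 _ rho0; have n2 := proj1 (cvgrPdist_lt _ _) l2 _ rho0.
  by apply: filterS2 (n1 _) (n2 _) => s; rewrite distrC => ? ; rewrite distrC.
have inB : \forall s \near 0^', B (c1 (s *: 1 + t), c2 (s *: 1 + t)).
  apply: filterS (near_box r r0) => s []; rewrite !ltr_distl => /andP[? ?] /andP[? ?].
  by split; rewrite /= in_itv /=; apply/andP; split; lra.
have lm i : (fun s => if i == ord0 then (m s).1 else (m s).2) @ 0^' --> pd [:: i] f (c1 t, c2 t).
  apply/cvgrPdist_le => e e0.
  have /cvgrPdist_le /(_ _ e0) N := C1_pd_C0 i C _ Ot.
  have [rho rho0 Hrho] : exists2 rho : R, 0 < rho & forall z : plane R, `|z.1 - c1 t| < rho -> `|z.2 - c2 t| < rho ->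
      `|pd [:: i] f (c1 t, c2 t) - pd [:: i] f z| <= e.
    have /nbhs_ballP[rho /= rho0 H] := N.
    by exists rho => // z z1 z2; apply: H; split; rewrite /ball /= distrC.
  apply: filterS2 inB (near_box rho rho0) => s Bs [n1 n2].
  have [Hi _] := Hm s Bs; have [xi [h1 h2 ->]] := Hi i.
  by apply: Hrho; [exact: le_lt_trans n1|exact: le_lt_trans n2].
apply/is_deriveP.
have cv := cvgD (cvgM (lm ord0) (proj1 (is_deriveP _ _ _ _) D1)) (cvgM (lm ord_max) (proj1 (is_deriveP _ _ _ _) D2)).
apply: cvg_trans (cv _ _ _); apply: near_eq_cvg; apply: filterS inB => s Bs /=.
have [_ ->] := Hm s Bs.
rewrite [LHS](_ : _ = (m s).1 * (s^-1 * (c1 (s *: 1 + t) - c1 t)) + (m s).2 * (s^-1 * (c2 (s *: 1 + t) - c2 t))) //.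
ring.
Qed.

End ChainRule.

(** * Cutoff functions with explicit derivative bounds *)

Section Cutoffs.
Context {R : realType}.
Notation leb := (@lebesgue_measure R).
Notation mplane := (measurableTypeR R * measurableTypeR R)%type.
Implicit Types (h g : R -> R).

Lemma is_derive_continuousT (F h : R -> R) : (forall x : R, is_derive x 1 F (h x)) -> continuous F.
Proof. by move=> D x; exact: is_derive_continuous1 (D x). Qed.

Lemma continuous_for (f : R -> R) : (forall t, {for t, continuous f}) -> continuous f.
Proof. by []. Qed.

Lemma step_exists : exists sg h (B : R), [/\ 0 < B, forall t : R, is_derive t 1 sg (h t), continuous h,
  [/\ forall t, t <= 0 -> sg t = 0, forall t, 1 <= t -> sg t = 1 & forall t, ~~ (0 < t < 1) -> h t = 0] &
  forall t, `|sg t| <= B /\ `|h t| <= B].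
Proof.
have [h Th h1] := @test1_normalized R 0 1 ltr01.
have ch : continuous h by move=> x; exact: smooth_cont Th.1.
have [H HD] := antiderivative ch; pose sg t := H t - H 0.
have D (t : R) : is_derive t 1 sg (h t).
  by apply: is_derive_eq' (is_derive_sub (HD t) (is_derive_const _ _ _)) _; rewrite subr0.
have z t : t <= 0 -> sg t = 0.
  rewrite le_eqVlt => /orP[/eqP ->|t0]; first by rewrite /sg subrr.
  have [c /andP[c1 c2] E] := mvt_lin t0 (fun x _ => D x).
  have : sg 0 - sg t = 0 by rewrite E Th.2 ?mul0r // negb_and -!leNgt (ltW c2).
  by rewrite /sg subrr sub0r => /eqP; rewrite oppr_eq0 => /eqP.
have s1 : sg 1 = 1.
  have E : \int[leb]_(x in `[0, 1]) h x = sg 1 by rewrite (FTC2 ler01 (fun x _ => HD x)) // => x _; exact: ch.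
  rewrite -[LHS]E.
  rewrite -[RHS]h1 (Rintegral_out (setT : set (measurableTypeR R)) `[0, 1]%classic) //.
  move=> x _ /= x01; apply: Th.2; apply/negP => /andP[x0 x1]; apply: x01.
  by rewrite in_itv /= !ltW.
have o t : 1 <= t -> sg t = 1.
  rewrite le_eqVlt => /orP[/eqP <- //|t1].
  have [c /andP[c1 c2] E] := mvt_lin t1 (fun x _ => D x).
  have : sg t - sg 1 = 0 by rewrite E Th.2 ?mul0r // negb_and -!leNgt (ltW c1) orbT.
  by rewrite s1 => /eqP; rewrite subr_eq0 => /eqP.
have [B1 B10 HB1] := test1_bounded Th.
have [B2 B20 HB2] := @continuous_bounded_on R R (`[0, 1]%classic : set R) sg (@segment_compact _ 0 1) (fun x _ => is_derive_continuous1 (D x)).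
exists sg, h, (B1 + B2 + 1); split => //; [by rewrite !addr_gt0|by split => //; exact: Th.2|].
move=> t; split; last by apply: le_trans (HB1 t) _; rewrite -addrA lerDl addr_ge0 // ltW.
have [t0|t0] := leP t 0; first by rewrite z // normr0 !addr_ge0 // ltW.
have [t1|t1] := leP 1 t; first by rewrite o // normr1 lerDr addr_ge0 // ltW.
have : `|sg t| <= B2 by apply: HB2; rewrite /= in_itv /= !ltW.
by move/le_trans; apply; rewrite addrAC lerDr addr_ge0 // ltW.
Qed.

(** [g] is the mean of [gam] over [[t - ep, t + ep]]. Its derivative is a difference quotient of
    [gam], so the Lipschitz constant is kept. It serves to build $C^1$ cutoffs along a boundary that
    is only Lipschitz. *)
Lemma mollified_lipschitz (gam : R -> R) (M ep : R) : 0 < ep ->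
  (forall a b, `|gam a - gam b| <= M * `|a - b|) ->
  exists g g', [/\ forall t : R, is_derive t 1 g (g' t), continuous g',
    forall t, `|g t - gam t| <= M * ep & forall t, `|g' t| <= M].
Proof.
move=> ep0 L.
have M0 : 0 <= M by have := le_trans (normr_ge0 _) (L 1 0); rewrite subr0 normr1 mulr1.
have cg : continuous gam.
  move=> x; apply/cvgrPdist_le => e e0; have M1 : 0 < M + 1 by rewrite ltr_wpDl.
  apply/nbhs_ballP; exists (e / (M + 1)); rewrite /= ?divr_gt0 // => y; rewrite /ball /= => xy.
  apply: le_trans (L x y) _; apply: le_trans (_ : (M + 1) * `|x - y| <= _).
    by rewrite ler_wpM2r // lerDl.
  by rewrite mulrC -ler_pdivlMr // ltW.
have [G GD] := antiderivative cg.
have sh (c t : R) : is_derive t 1 (fun s : R => G (s + c)) (gam (t + c)).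
  have D1 : is_derive t 1 (fun s : R => s + c) 1.
    by apply: is_derive_eq' (is_derive_add (is_derive_id t 1) (is_derive_const c t 1)) _; rewrite addr0.
  by apply: is_derive_eq' (is_derive_comp1 (f := fun s : R => s + c) (GD (t + c)) D1) _; rewrite mulr1.
have ep2 : 0 < 2 * ep by rewrite mulr_gt0.
exists (fun t => (2 * ep)^-1 * (G (t + ep) - G (t + - ep))), (fun t => (2 * ep)^-1 * (gam (t + ep) - gam (t + - ep))).
split.
- by move=> t; apply: is_derive_scale; apply: is_derive_sub.
- apply: continuous_for => t; apply: continuous_mul; first exact: continuous_const.
  have cs (c : R) : {for t, continuous (fun s : R => gam (s + c))}.
    apply: (@continuous_comp1 _ _ gam (fun s : R => s + c)); last exact: cg.
    by apply: continuous_add; [exact: cvg_id|exact: continuous_const].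
  by apply: continuous_sub.
- move=> t; have lt : t + - ep < t + ep by rewrite ltrD2l gtrN.
  have [c /andP[c1 c2] ->] := mvt_lin lt (fun x _ => GD x).
  rewrite (_ : (2 * ep)^-1 * _ = gam c); last by field; rewrite gt_eqF.
  apply: le_trans (L c t) _; rewrite ler_wpM2l // ler_distl; apply/andP; split; lra.
- move=> t; rewrite normrM gtr0_norm ?invr_gt0 // mulrC ler_pdivrMr //.
  apply: le_trans (L _ _) _; rewrite ler_wpM2l // (_ : t + ep - _ = 2 * ep); last by ring.
  by rewrite gtr0_norm.
Qed.

Lemma tensor_C1 (h h' k k' : R -> R) : (forall t : R, is_derive t 1 h (h' t)) ->
  (forall t : R, is_derive t 1 k (k' t)) -> continuous h' -> continuous k' ->
  C1 setT (fun z : plane R => h z.1 * k z.2) /\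
  forall z, pd [:: ord0] (fun z : plane R => h z.1 * k z.2) z = h' z.1 * k z.2 /\
            pd [:: ord_max] (fun z : plane R => h z.1 * k z.2) z = h z.1 * k' z.2.
Proof.
move=> Dh Dk ch ck.
have d0 z : is_derive z (unit_vec ord0 : plane R) (fun z : plane R => h z.1 * k z.2) (h' z.1 * k z.2).
  case: z => x y; apply/is_derive_slice0 => /=.
  apply: is_derive_eq' (is_derive_mul (Dh x) (is_derive_const (k y) x 1)) _.
  by rewrite mulr0 add0r mulrC.
have d1 z : is_derive z (unit_vec ord_max : plane R) (fun z : plane R => h z.1 * k z.2) (h z.1 * k' z.2).
  case: z => x y; apply/is_derive_slice1 => /=.
  apply: is_derive_eq' (is_derive_mul (is_derive_const (h x) y 1) (Dk y)) _.
  by rewrite mulr0 addr0.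
have c1 (g : R -> R) z : continuous g -> {for z, continuous (fun z : plane R => g z.1)}.
  move=> cg; apply: (@continuous_comp1 _ _ g (fun z : plane R => z.1)); [exact: cvg_fst|exact: cg].
have c2 (g : R -> R) z : continuous g -> {for z, continuous (fun z : plane R => g z.2)}.
  move=> cg; apply: (@continuous_comp1 _ _ g (fun z : plane R => z.2)); [exact: cvg_snd|exact: cg].
have chh := is_derive_continuousT Dh; have ckk := is_derive_continuousT Dk.
split; last by move=> z; split; rewrite pdE; exact: is_deriveE.
apply: (@C1_intro _ setT _ (fun i z => if i == ord0 then h' z.1 * k z.2 else h z.1 * k' z.2)).
- exact: openT.
- by move=> z _; apply: continuous_mul; [exact: c1|exact: c2].
- by move=> i z _; have [->|->] := ord2_cases i.
- by move=> i z _; have [->|->] := ord2_cases i; apply: continuous_mul; [exact: c1|exact: c2|exact: c1|exact: c2].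
Qed.

Lemma plateau1 : exists2 B : R, 0 < B & forall (c r : R), 0 < r -> exists s s' : R -> R,
  [/\ forall t : R, is_derive t 1 s (s' t), continuous s',
    forall t, ~~ (c - r <= t <= c + r) -> s t = 0,
    forall t, c - r / 2 <= t <= c + r / 2 -> s t = 1 &
    forall t, `|s t| <= B /\ `|s' t| <= B / r].
Proof.
have [sg [h [B [B0 D ch [z o _] bd]]]] := step_exists.
(* [B ^+ 2] bounds the product of the two steps. Its derivative has two terms of size at most
   [B * (B * (2 / r))], which gives [4 * B ^+ 2 / r]. *)
exists (4 * B ^+ 2 + B ^+ 2); first by rewrite addr_gt0 ?mulr_gt0 ?exprn_gt0.
move=> c r r0; have r2 : 0 < 2 / r by rewrite divr_gt0.
have rr : r^-1 * r = 1 by rewrite mulVf // gt_eqF.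
pose a (t : R) := 2 / r * (t + (r - c)); pose b (t : R) := 2 / r * (c + r - t).
have Da (t : R) : is_derive t 1 a (2 / r).
  apply: is_derive_eq' (is_derive_scale (2 / r) (is_derive_add (is_derive_id t 1) (is_derive_const _ t 1))) _.
  by rewrite addr0 mulr1.
have Db (t : R) : is_derive t 1 b (- (2 / r)).
  apply: is_derive_eq' (is_derive_scale (2 / r) (is_derive_sub (is_derive_const _ t 1) (is_derive_id t 1))) _.
  by rewrite sub0r mulrN mulr1.
have c' g (f : R -> R) t d : continuous g -> is_derive t (1 : R) f d -> {for t, continuous (fun s => g (f s))}.
  by move=> cg Df; apply: (continuous_comp1 (is_derive_continuous1 Df)); exact: cg.
have csg : continuous sg := is_derive_continuousT D.
exists (fun t => sg (a t) * sg (b t)),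
  (fun t => sg (a t) * (h (b t) * - (2 / r)) + sg (b t) * (h (a t) * (2 / r))).
split.
- by move=> t; apply: is_derive_mul; apply: is_derive_comp1.
- apply: continuous_for => t; apply: continuous_add.
    apply: continuous_mul; first exact: (c' sg a t _ csg (Da t)).
    by apply: continuous_mul; [exact: (c' h b t _ ch (Db t))|exact: continuous_const].
  apply: continuous_mul; first exact: (c' sg b t _ csg (Db t)).
  by apply: continuous_mul; [exact: (c' h a t _ ch (Da t))|exact: continuous_const].
- move=> t; rewrite negb_and -!ltNge => /orP[t1|t1].
    by rewrite z ?mul0r // pmulr_rle0 //; lra.
  by rewrite [X in _ * X]z ?mulr0 // pmulr_rle0 //; lra.
- move=> t /andP[t1 t2].
  have e1 : 1 <= a t by rewrite -ler_pdivrMl // invf_div mulr1; lra.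
  have e2 : 1 <= b t by rewrite -ler_pdivrMl // invf_div mulr1; lra.
  by rewrite !o // mulr1.
- move=> t; have [s1 h1] := bd (a t); have [s2 h2] := bd (b t); split.
    rewrite normrM; apply: le_trans (ler_pM _ _ s1 s2) _ => //.
    by rewrite -expr2 lerDr mulr_ge0 // sqr_ge0.
  have n2 (u v : R) : `|u * (v * (2 / r))| = `|u| * (`|v| * (2 / r)) by rewrite normrM (normrM v) (gtr0_norm r2).
  apply: le_trans (ler_normD _ _) _; rewrite mulrN mulrN normrN !n2.
  have u1 : `|sg (a t)| * (`|h (b t)| * (2 / r)) <= B * (B * (2 / r)).
    by apply: ler_pM => //; [rewrite mulr_ge0 // ltW|rewrite ler_wpM2r // ltW].
  have u2 : `|sg (b t)| * (`|h (a t)| * (2 / r)) <= B * (B * (2 / r)).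
    by apply: ler_pM => //; [rewrite mulr_ge0 // ltW|rewrite ler_wpM2r // ltW].
  apply: le_trans (lerD u1 u2) _.
  rewrite [leLHS](_ : _ = (4 * B ^+ 2) / r); last by field; rewrite gt_eqF.
  by rewrite ler_wpM2r ?invr_ge0 ?(ltW r0) // lerDl sqr_ge0.
Qed.

Lemma plateau2 : exists2 B : R, 0 < B & forall (x y r : R), 0 < r -> exists eta : plane R -> R,
  [/\ C1 setT eta, forall z, ~ box (x - r) (x + r) (y - r) (y + r) z -> eta z = 0,
    forall z, box (x - r / 2) (x + r / 2) (y - r / 2) (y + r / 2) z -> eta z = 1,
    forall z, `|eta z| <= B & forall i z, `|pd [:: i] eta z| <= B / r].
Proof.
have [B B0 H] := plateau1; exists (B * B); first exact: mulr_gt0.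
move=> x y r r0.
have [s [s' [D1 c1 o1 p1 b1]]] := H x r r0; have [k [k' [D2 c2 o2 p2 b2]]] := H y r r0.
have [C P] := tensor_C1 D1 D2 c1 c2.
exists (fun z => s z.1 * k z.2); split => //.
- move=> [u v] nb /=; have [u1|/o1 ->] := boolP (x - r <= u <= x + r); last by rewrite mul0r.
  have [v1|/o2 ->] := boolP (y - r <= v <= y + r); last by rewrite mulr0.
  by exfalso; apply: nb; split; rewrite /= in_itv.
- by move=> [u v] [/=]; rewrite !in_itv /= => /p1 -> /p2 ->; rewrite mulr1.
- by move=> z; rewrite normrM ler_pM // ?(b1 _).1 ?(b2 _).1.
- move=> i z; have [P0 P1] := P z; have [->|->] := ord2_cases i.
    rewrite P0 normrM mulrAC; apply: ler_pM => //; [exact: (b1 _).2|exact: (b2 _).1].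
  by rewrite P1 normrM -mulrA; apply: ler_pM => //; [exact: (b1 _).1|exact: (b2 _).2].
Qed.

End Cutoffs.

(** * Constant traces *)

Section Strip.
Context {R : realType}.
Notation leb := (@lebesgue_measure R).
Notation mplane := (measurableTypeR R * measurableTypeR R)%type.
Implicit Types (gam : R -> R) (f : plane R -> R).

Lemma continuous_pair (T : topologicalType) (f g : T -> R) x :
  {for x, continuous f} -> {for x, continuous g} -> {for x, continuous (fun y => (f y, g y) : plane R)}.
Proof.
by move=> cf cg; apply: (@cvg_pair _ _ _ _ (nbhs (f x)) (nbhs (g x))); [exact: cf|exact: cg].
Qed.

Lemma ge0_Rintegral_subset (A B : set (measurableTypeR R)) (f : R -> R) : measurable A -> measurable B ->
  A `<=` B -> leb.-integrable B (EFin \o f) -> (forall x, 0 <= f x) ->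
  \int[leb]_(x in A) f x <= \int[leb]_(x in B) f x.
Proof.
move=> mA mB AB fB f0; apply: fine_le.
- exact: integral_fune_fin_num (integrableS mB mA AB fB).
- exact: integral_fune_fin_num fB.
apply: ge0_subset_integral => //; first by have /integrableP[] := fB.
by move=> x _; rewrite lee_fin.
Qed.

(** Since $G(x)=G(b)-\int_x^bg$, the Cauchy-Schwarz inequality gives $G(x)^2\le2G(b)^2+2d\int g^2$;
    this is integrated over an interval of length $d$. The factor $d^2$ in front of $\int g^2$ is
    what the boundary cutoffs rely on. *)
Lemma strip_estimate1 (G g : R -> R) (b d : R) : 0 < d ->
  (forall x : R, b - d <= x <= b -> is_derive x 1 G (g x)) ->
  (forall x, b - d <= x <= b -> {for x, continuous g}) ->
  (\int[leb]_(x in `](b - d)%R, b[) (G x ^+ 2)%:E <=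
   (2 * d)%:E * (G b ^+ 2)%:E + (2 * d ^+ 2)%:E * \int[leb]_(x in `](b - d)%R, b[) (g x ^+ 2)%:E)%E.
Proof.
move=> d0 D cg; have db : b - d < b by rewrite gtrBl.
have c2 x : b - d <= x <= b -> {for x, continuous (fun x => g x ^+ 2)}.
  by move=> xb; exact: (continuous_mul (cg x xb) (cg x xb)).
pose J := \int[leb]_(x in `[b - d, b]) (g x ^+ 2).
have iJ := integrable_continuous_itv c2.
have JE : (\int[leb]_(x in `](b - d)%R, b[) (g x ^+ 2)%:E)%E = J%:E.
  rewrite /J /Rintegral fineK; last exact: integral_fune_fin_num iJ.
  have mc (A : set R) : measurable (A : set (measurableTypeR R)) -> A `<=` `[b - d, b]%classic ->
      measurable_fun (A : set (measurableTypeR R)) (fun x => (g x ^+ 2)%:E).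
    by move=> mA sA; apply: measurable_funS sA _ => //; have /integrableP[] := iJ.
  rewrite -integral_itv_bndo_bndc; last by apply: mc => //; exact: subset_itv_co_cc.
  by rewrite -integral_itv_obnd_cbnd //; apply: mc => //; exact: subset_itv_oo_cc.
have bd x : b - d < x < b -> G x ^+ 2 <= 2 * G b ^+ 2 + 2 * (d * J).
  move=> /andP[x1 x2].
  have sub y : x <= y <= b -> b - d <= y <= b by move=> /andP[y1 ->]; rewrite (le_trans (ltW x1) y1).
  have E : \int[leb]_(y in `[x, b]) g y = G b - G x.
    by apply: FTC2 => [|y /sub|y /sub]; [exact: ltW|exact: D|exact: cg].
  have m1 : measurable (`[x, b]%classic : set (measurableTypeR R)) by exact: measurable_itv.
  have ig : leb.-integrable `[x, b] (EFin \o g).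
    by apply: integrable_continuous_itv => y /sub; exact: cg.
  have ig2 : leb.-integrable `[x, b] (EFin \o (fun y => g y ^+ 2)).
    by apply: integrable_continuous_itv => y /sub; exact: c2.
  have i1 : leb.-integrable `[x, b] (EFin \o (fun y : R => (1 : R) ^+ 2)).
    by apply: integrable_continuous_itv => y _; exact: continuous_const.
  have s1 : sqi leb `[x, b] (fun=> 1) by split; [exact: measurable_cst|exact: i1].
  have sg : sqi leb `[x, b] g by split; [exact: (integrable_mfun ig)|exact: ig2].
  have CS := cauchy_schwarz_L2 m1 sg s1.
  have E2 : (G b - G x) ^+ 2 <= d * J.
    rewrite -E; have -> : \int[leb]_(y in `[x, b]) g y = \int[leb]_(y in `[x, b]) (g y * 1).
      by apply: eq_Rintegral => y _; rewrite mulr1.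
    rewrite -real_normK ?num_real //; apply: le_trans (lerXn2r _ _ _ CS) _; rewrite ?nnegrE ?mulr_ge0 ?L2norm_ge0 //.
    rewrite exprMn !L2norm_sq mulrC.
    under eq_Rintegral do rewrite expr1n.
    rewrite (Rintegral_cst_itv 1 (ltW x2)) mul1r; apply: ler_pM => //.
    - by rewrite subr_ge0 ltW.
    - by apply: Rintegral_ge0 => y _; exact: sqr_ge0.
    - by rewrite lerBlDr -lerBlDl ltW.
    - apply: ge0_Rintegral_subset => //.
      by move=> y; exact: sqr_ge0.
  have -> : G x ^+ 2 = (G b - (G b - G x)) ^+ 2 by congr (_ ^+ 2); ring.
  have q (u v : R) : (u - v) ^+ 2 <= 2 * u ^+ 2 + 2 * v ^+ 2.
    by rewrite -subr_ge0 (_ : _ - _ = (u + v) ^+ 2) ?sqr_ge0 //; ring.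
  by apply: le_trans (q _ _) _; rewrite lerD2l ler_wpM2l.
have J0 : 0 <= J by apply: Rintegral_ge0 => y _; exact: sqr_ge0.
have mo : measurable (`]b - d, b[%classic : set (measurableTypeR R)) by exact: measurable_itv.
apply: (@le_trans _ _ (\int[leb]_(x in `](b - d)%R, b[) (cst (2 * G b ^+ 2 + 2 * (d * J))%:E) x)%E).
  apply: ge0_le_integral => //.
  - by move=> x _; rewrite lee_fin sqr_ge0.
  - apply: measurable_EFin; apply: measurable_funX.
    have cG : leb.-integrable `[b - d, b] (EFin \o G).
      by apply: integrable_continuous_itv => y yb; exact: is_derive_continuous1 (D y yb).
    by apply: measurable_funS (integrable_mfun cG) => //; exact: subset_itv_oo_cc.
have mE : leb `]b - d, b[%classic = d%:E.
  by rewrite lebesgue_measure_itv /= lte_fin db -EFinD; congr (_%:E); ring.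
have := integral_cst leb mo (2 * G b ^+ 2 + 2 * (d * J))%:E; rewrite [X in (_ * X)%E](mE : _ = _) => ->.
rewrite JE -!EFinM -EFinD lee_fin.
by rewrite le_eqVlt; apply/orP; left; apply/eqP; ring.
Qed.

Definition strip gam (r d : R) : set (plane R) :=
  [set z | `|z.1| < r /\ gam z.1 - d < z.2 < gam z.1].

Lemma strip_open gam r d : continuous gam -> open (strip gam r d).
Proof.
move=> cg.
have cf (z : plane R) : {for z, continuous (fun z : plane R => z.1)} by exact: cvg_fst.
have cs (z : plane R) : {for z, continuous (fun z : plane R => z.2)} by exact: cvg_snd.
have cgf (z : plane R) : {for z, continuous (fun z : plane R => gam z.1)}.
  by apply: (continuous_comp1 (cf z)); exact: cg.
have -> : strip gam r d = ([set: plane R] `&` (fun z : plane R => z.1) @^-1` `]- r, r[%classic) `&`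
    (([set: plane R] `&` (fun z : plane R => z.2 - gam z.1) @^-1` `]- d, 0[%classic)).
  apply/seteqP; split => -[x y]; rewrite /strip /preimage /= !in_itv /= ltr_norml.
    by move=> [/andP[? ?] /andP[? ?]]; do 2 split => //; apply/andP; split; lra.
  by move=> [[_ /andP[? ?]] [_ /andP[? ?]]]; split; apply/andP; split; lra.
apply: openI; apply: open_preimage_open; try exact: openT; try exact: itv_open.
- by move=> z _; exact: cf.
- by move=> z _; apply: continuous_sub.
Qed.

Lemma strip_tonelli gam r d (F : plane R -> \bar R) : continuous gam ->
  measurable_fun (strip gam r d : set mplane) F -> (forall z, 0 <= F z)%E ->
  (\int[area]_(z in strip gam r d) F z =
   \int[leb]_(a in `](- r)%R, r[) \int[leb]_(b in `](gam a - d)%R, gam a[) F (a, b))%E /\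
  measurable_fun (`]- r, r[%classic : set (measurableTypeR R))
    (fun a => (\int[leb]_(b in `](gam a - d)%R, gam a[) F (a, b))%E).
Proof.
move=> cg mF F0; have mS := open_measurable2 (strip_open (r := r) (d := d) cg).
pose P := F \_ (strip gam r d).
have mP : measurable_fun setT (P : mplane -> \bar R) by apply/(measurable_restrictT _ mS).
have P0 z : (0 <= P z)%E by rewrite /P patchE; case: ifP.
have mf := measurable_fun_fubini_tonelli_F (m2 := leb) P mP P0.
have inner a : a \in `]- r, r[ -> (fubini_F leb P a = \int[leb]_(b in `](gam a - d)%R, gam a[) F (a, b))%E.
  rewrite in_itv /= => ar; rewrite /fubini_F [RHS]integral_mkcond; apply: eq_integral => b _.
  rewrite /P !patchE; congr (if _ then _ else _).
  by apply/idP/idP; rewrite !inE /strip /= in_itv /= ltr_norml; [case|split].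
have outer a : a \notin `]- r, r[ -> (fubini_F leb P a = 0)%E.
  rewrite in_itv /= => ar; rewrite /fubini_F integral0_eq // => b _; rewrite /P patchE ifN //.
  by rewrite notin_setE /strip /= ltr_norml => -[ar' _]; move: ar; rewrite ar'.
split.
  rewrite integral_mkcond -/P (fubini_tonelli1 (m1 := leb) (m2 := leb) P mP P0) -/(fubini_F leb P) [RHS]integral_mkcond.
  apply: eq_integral => a _; rewrite patchE; case: ifPn.
    by rewrite inE /= => /inner.
  by rewrite notin_setE /= => /negP /outer.
apply: (@eq_measurable_fun _ _ _ _ _ (fubini_F leb P)).
  by move=> a; rewrite inE /= => /inner.
exact: measurable_funTS.
Qed.

Lemma strip_estimate gam r d (H h : plane R -> R) : 0 < d -> continuous gam ->
  C0 setT H -> C0 setT h -> (forall a b : R, is_derive b 1 (fun s : R => H (a, s)) (h (a, b))) ->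
  (\int[area]_(z in strip gam r d) (H z ^+ 2)%:E <=
   (2 * d)%:E * \int[leb]_(a in `](- r)%R, r[) (H (a, gam a) ^+ 2)%:E +
   (2 * d ^+ 2)%:E * \int[area]_(z in strip gam r d) (h z ^+ 2)%:E)%E.
Proof.
move=> d0 cg cH ch D.
have m2 (f : plane R -> R) : C0 setT f -> measurable_fun (strip gam r d : set mplane) (fun z => (f z ^+ 2)%:E).
  move=> cf; apply: measurable_EFin; apply: measurable_funX; apply: measurable_funTS.
  by apply: C0_measurable => //; exact: openT.
have f0 (f : plane R -> R) z : (0 <= (f z ^+ 2)%:E)%E by rewrite lee_fin sqr_ge0.
have [-> m1] := strip_tonelli cg (m2 _ cH) (f0 H).
have [-> m1'] := strip_tonelli cg (m2 _ ch) (f0 h).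
have mr : measurable (`]- r, r[%classic : set (measurableTypeR R)) by exact: measurable_itv.
have cgr (a : R) : {for a, continuous (fun a => H (a, gam a))}.
  have c2 : {for a, continuous (fun a : R => (a, gam a) : plane R)}.
    by apply: continuous_pair; [exact: cvg_id|exact: cg].
  by apply: (continuous_comp c2); exact: cH.
have mg : measurable_fun (`]- r, r[%classic : set (measurableTypeR R)) (fun a => (H (a, gam a) ^+ 2)%:E).
  apply: measurable_EFin; apply: measurable_funX; apply: measurable_funTS.
  by apply: continuous_measurable_fun => a; exact: cgr.
have i0 (f : plane R -> R) a : (0 <= \int[leb]_(b in `](gam a - d)%R, gam a[) (f (a, b) ^+ 2)%:E)%E.
  by apply: integral_ge0 => b _.
have dd : (0 <= 2 * d /\ 0 <= 2 * d ^+ 2)%R by split; rewrite mulr_ge0 ?sqr_ge0 // ltW.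
have g0 a : (0 <= (H (a, gam a) ^+ 2)%:E)%E by rewrite lee_fin sqr_ge0.
rewrite -(ge0_integralZl_EFin leb mr (fun a _ => g0 a) mg dd.1).
rewrite -(ge0_integralZl_EFin leb mr (fun a _ => i0 h a) m1' dd.2).
rewrite -ge0_integralD //; first last.
- by apply: emeasurable_funM => //; exact: measurable_cst.
- by move=> a _; apply: mule_ge0 => //; rewrite lee_fin dd.2.
- by apply: emeasurable_funM => //; exact: measurable_cst.
- by move=> a _; apply: mule_ge0 => //; rewrite lee_fin dd.1.
apply: ge0_le_integral => //.
- by apply: emeasurable_funD; apply: emeasurable_funM => //; exact: measurable_cst.
move=> a _; apply: (strip_estimate1 (G := fun b => H (a, b)) (g := fun b => h (a, b)) d0) => x _.
by apply: continuous_slice1; exact: ch.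
Qed.

(** The inverse of [frame x0 e] for a unit vector [e]. *)
Definition coord (x0 e x : plane R) : plane R :=
  ((x.1 - x0.1) * e.1 + (x.2 - x0.2) * e.2, (x.2 - x0.2) * e.1 - (x.1 - x0.1) * e.2).

Lemma coord_frame (x0 e : plane R) a b : e.1 ^+ 2 + e.2 ^+ 2 = 1 -> coord x0 e (frame x0 e a b) = (a, b).
Proof.
move=> e1; rewrite /coord /frame /=; congr (_, _).
  by rewrite -[RHS]mulr1 -e1; ring.
by rewrite -[RHS]mulr1 -e1; ring.
Qed.

Lemma frame_coord (x0 e x : plane R) : e.1 ^+ 2 + e.2 ^+ 2 = 1 ->
  frame x0 e (coord x0 e x).1 (coord x0 e x).2 = x.
Proof.
case: x => x y e1; rewrite /coord /frame /=; congr (_, _).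
  by rewrite (_ : _ - _ = x0.1 + (x - x0.1) * (e.1 ^+ 2 + e.2 ^+ 2)); [rewrite e1; ring|ring].
by rewrite (_ : _ + _ = x0.2 + (y - x0.2) * (e.1 ^+ 2 + e.2 ^+ 2)); [rewrite e1; ring|ring].
Qed.

Lemma coord_continuous (x0 e : plane R) : continuous (coord x0 e).
Proof.
move=> x.
have cf : {for x, continuous (fun z : plane R => z.1)} by exact: cvg_fst.
have cs : {for x, continuous (fun z : plane R => z.2)} by exact: cvg_snd.
have cc (c : R) : {for x, continuous (fun _ : plane R => c)} by exact: continuous_const.
apply: (@continuous_pair (plane R) (fun x => (x.1 - x0.1) * e.1 + (x.2 - x0.2) * e.2)
  (fun x => (x.2 - x0.2) * e.1 - (x.1 - x0.1) * e.2)).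
  by apply: continuous_add; apply: continuous_mul => //; apply: continuous_sub.
by apply: continuous_sub; apply: continuous_mul => //; apply: continuous_sub.
Qed.

Definition frame_strip (x0 e : plane R) gam r d := coord x0 e @^-1` strip gam r d.

Lemma frame_strip_open x0 e gam r d : continuous gam -> open (frame_strip x0 e gam r d).
Proof.
by move=> cg; apply: open_comp; [move=> x _; exact: coord_continuous|exact: strip_open].
Qed.

Lemma frame_strip_estimate (x0 e : plane R) gam r d f : e.1 ^+ 2 + e.2 ^+ 2 = 1 -> 0 < d ->
  continuous gam -> C1 setT f ->
  (\int[area]_(x in frame_strip x0 e gam r d) (f x ^+ 2)%:E <=
   (2 * d)%:E * \int[leb]_(a in `](- r)%R, r[) (f (frame x0 e a (gam a)) ^+ 2)%:E +
   (2 * d ^+ 2)%:E * \int[area]_(x in frame_strip x0 e gam r d)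
     (pd [:: ord0] f x ^+ 2 + pd [:: ord_max] f x ^+ 2)%:E)%E.
Proof.
move=> e1 d0 cg Cf.
have mS := open_measurable2 (frame_strip_open (x0 := x0) (e := e) (r := r) (d := d) cg).
have cfr (z : plane R) : {for z, continuous (fun z : plane R => frame x0 e z.1 z.2)}.
  have cf : {for z, continuous (fun z : plane R => z.1)} by exact: cvg_fst.
  have cs : {for z, continuous (fun z : plane R => z.2)} by exact: cvg_snd.
  have cc (c : R) : {for z, continuous (fun _ : plane R => c)} by exact: continuous_const.
  apply: continuous_pair.
    by apply: continuous_sub; [apply: continuous_add => //|]; apply: continuous_mul.
  by apply: continuous_add; [apply: continuous_add => //|]; apply: continuous_mul.
have C0fr g : C0 setT g -> C0 setT (fun z : plane R => g (frame x0 e z.1 z.2)).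
  by move=> cg' z _; apply: (continuous_comp (cfr z)); exact: cg'.
pose H (z : plane R) := f (frame x0 e z.1 z.2).
pose g x := pd [:: ord0] f x * - e.2 + pd [:: ord_max] f x * e.1.
pose h (z : plane R) := g (frame x0 e z.1 z.2).
have Cg : C0 setT g.
  by apply: C0_add; apply: C0_mul; first [exact: C1_pd_C0|exact: C0_cst].
have D (a b : R) : is_derive b 1 (fun s : R => H (a, s)) (h (a, b)).
  apply: (@C1_chain _ setT f (fun b => x0.1 + a * e.1 - b * e.2) (fun b => x0.2 + a * e.2 + b * e.1)) => //.
  - exact: openT.
  - apply: is_derive_eq' (is_derive_sub (is_derive_const _ b 1) (is_derive_mul (is_derive_id b 1) (is_derive_const e.2 b 1))) _.
    by rewrite mulr0 !add0r mulr1.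
  - apply: is_derive_eq' (is_derive_add (is_derive_const _ b 1) (is_derive_mul (is_derive_id b 1) (is_derive_const e.1 b 1))) _.
    by rewrite mulr0 !add0r mulr1.
have mf (k : plane R -> R) : C0 setT k -> measurable_fun (frame_strip x0 e gam r d : set mplane) (fun x => (k x)%:E).
  by move=> ck; apply: measurable_EFin; apply: measurable_funTS; apply: C0_measurable => //; exact: openT.
have S : (fun z : mplane => frame x0 e z.1 z.2) @^-1` frame_strip x0 e gam r d = strip gam r d.
  by apply/seteqP; split => -[a b]; rewrite /frame_strip /preimage /= coord_frame.
have tr (k : plane R -> R) : C0 setT k -> (forall x, 0 <= k x) ->
    (\int[area]_(z in strip gam r d) (k (frame x0 e z.1 z.2))%:E = \int[area]_(x in frame_strip x0 e gam r d) (k x)%:E)%E.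
  move=> ck k0; rewrite -S; have := preserves_ge0_integral (area_frame x0 e1) mS (mf _ ck).
  by apply => x _; rewrite lee_fin.
have sq k : C0 setT k -> C0 setT (fun x => k x ^+ 2).
  by move=> ck; under eq_fun do rewrite expr2; exact: C0_mul.
have := strip_estimate r d0 cg (C0fr _ Cf.1) (C0fr _ Cg) D.
rewrite (tr (fun x => f x ^+ 2)) //; [|exact: sq Cf.1|by move=> x; exact: sqr_ge0].
rewrite (tr (fun x => g x ^+ 2)) //; [|exact: sq|by move=> x; exact: sqr_ge0].
move/le_trans; apply; apply: leeD => //; apply: lee_wpmul2l; first by rewrite lee_fin mulr_ge0 ?sqr_ge0.
apply: ge0_le_integral => //.
- by move=> x _; rewrite lee_fin sqr_ge0.
- by apply: mf; exact: sq.
- by apply: mf; apply: C0_add; apply: sq; exact: C1_pd_C0.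
(* The derivative across the strip is at most the length of the gradient, by Lagrange's identity
   $|\nabla f|^2|e|^2-(\nabla f\cdot e^\perp)^2=(\nabla f\cdot e)^2$. *)
move=> x _; rewrite lee_fin -subr_ge0 -[X in X - _]mulr1 -e1.
rewrite (_ : _ - _ = (pd [:: ord0] f x * e.1 + pd [:: ord_max] f x * e.2) ^+ 2) ?sqr_ge0 //.
have aux (s t a c : R) : (s ^+ 2 + t ^+ 2) * (a ^+ 2 + c ^+ 2) - (s * - c + t * a) ^+ 2 = (s * a + t * c) ^+ 2 by ring.
exact: aux.
Qed.

End Strip.

#[local] Opaque pd.

Lemma dominated_Rintegral d (T : measurableType d) (R : realType) (mu : {measure set T -> \bar R})
    (D : set T) (fn : nat -> T -> R) (f g : T -> R) : measurable D ->
  (forall n, measurable_fun D (fn n)) -> measurable_fun D f ->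
  (forall x, D x -> fn n x @[n --> \oo] --> f x) -> mu.-integrable D (EFin \o g) ->
  (forall n x, D x -> `|fn n x| <= g x) ->
  \int[mu]_(x in D) fn n x @[n --> \oo] --> \int[mu]_(x in D) f x.
Proof.
move=> mD mfn mf cf ig fg.
have if_ n : mu.-integrable D (EFin \o fn n) by apply: (integrable_le mD (mfn n) (fg n)).
have gb x : D x -> `|f x| <= g x.
  move=> Dx; have /cvg_norm cn := cf x Dx.
  by apply: (@ler_cvg_to _ _ _ _ (fun n => `|fn n x|) (fun=> g x) `|f x| (g x) cn); [exact: cvg_cst|apply: nearW => n; exact: fg].
have if' : mu.-integrable D (EFin \o f) by apply: (integrable_le mD mf gb).
have [] := @dominated_convergence _ _ _ mu D mD (fun n => EFin \o fn n) (EFin \o f) (EFin \o g).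
- by move=> n; exact: measurable_EFin (mfn n).
- exact: measurable_EFin mf.
- apply: aeW => x Dx; apply: cvg_EFin; first exact: nearW.
  exact: cf.
- exact: ig.
- by apply: aeW => x n Dx; rewrite /= lee_fin fg.
move=> _ _ H; apply: (fine_cvg _); rewrite fineK; first exact: H.
exact: integral_fune_fin_num if'.
Qed.

(** Compactness is used in its near-covering form, for the filter of all families that contain every
    good set beyond some good one; no finite subcover has to be named. *)
Lemma compact_union_ind (T : topologicalType) (K : set T) (good : set T -> Prop) : compact K ->
  good set0 -> (forall V W, good V -> good W -> good (V `|` W)) ->
  (forall x, exists V, [/\ open V, V x & good V]) -> exists2 V, good V & K `<=` V.
Proof.
move=> /compact_near_coveringP cK g0 gU gx.
pose F : set_system (set T) := [set A | exists2 V, good V & forall W, good W -> V `<=` W -> A W].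
have FF : Filter F.
  split.
  - by exists set0.
  - move=> A B [V gV VA] [W gW WB]; exists (V `|` W); first exact: gU.
    move=> X gX; rewrite subUset => -[VX WX]; split; [exact: VA|exact: WB].
  - by move=> A B AB [V gV VA]; exists V => // W gW VW; apply: AB; exact: VA.
have [|V gV VA] := cK _ F (fun W x => W x) FF.
  move=> x _; have [V [oV Vx gV]] := gx x.
  exists (V, [set W | V `<=` W]) => /=.
    by split; [exact: open_nbhs_nbhs|exists V].
  by move=> [y W] [/= Vy VW]; exact: VW.
by exists V => //; exact: VA.
Qed.

(** * Pairing a divergence-free field with a gradient up to the boundary *)

Section EnergyForm.
Context {R : realType}.
Notation mplane := (measurableTypeR R * measurableTypeR R)%type.
Implicit Types (eta theta : plane R -> R).

Definition bC1 eta := C1 setT eta /\ exists2 M : R, 0 < M & forall x, `|eta x| <= M /\ forall i, `|pd [:: i] eta x| <= M.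

Lemma C1_pd_mul (O : set (plane R)) (f g : plane R -> R) i x : C1 O f -> C1 O g -> O x ->
  pd [:: i] (fun x => f x * g x) x = f x * pd [:: i] g x + g x * pd [:: i] f x.
Proof.
by move=> Cf Cg Ox; rewrite pdE; apply: is_deriveE; exact: (is_derive_mul (C1_derive i Cf Ox) (C1_derive i Cg Ox)).
Qed.

Lemma C1_pd_sub (O : set (plane R)) (f g : plane R -> R) i x : C1 O f -> C1 O g -> O x ->
  pd [:: i] (fun x => f x - g x) x = pd [:: i] f x - pd [:: i] g x.
Proof.
by move=> Cf Cg Ox; rewrite pdE; apply: is_deriveE; exact: (is_derive_sub (C1_derive i Cf Ox) (C1_derive i Cg Ox)).
Qed.

Lemma C1_sub2 (O : set (plane R)) (f g : plane R -> R) : open O -> C1 O f -> C1 O g -> C1 O (fun x => f x - g x).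
Proof.
move=> oO Cf Cg; have := C1_add oO Cf (C1_mul oO (@C1_cst _ O (-1) oO) Cg).
by under eq_fun do rewrite mulN1r.
Qed.

Lemma distr_assoc (a b c d e : R) : a * (b * c + d * e) = a * b * c + a * d * e.
Proof. by rewrite mulrDr !mulrA. Qed.

Lemma bC1_mul eta theta : bC1 eta -> bC1 theta -> bC1 (fun x => eta x * theta x).
Proof.
move=> [C1e [M1 M10 H1]] [C1t [M2 M20 H2]]; split; first exact: (C1_mul openT C1e C1t).
exists (2 * (M1 * M2)); first by rewrite !mulr_gt0.
have d (x y M N : R) : `|x| <= M -> `|y| <= N -> `|x * y| <= M * N by move=> ? ?; rewrite normrM ler_pM.
have m0 : M1 * M2 <= 2 * (M1 * M2) by rewrite ler_peMl ?mulr_ge0 ?ltW // ltrDl.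
move=> x; split => [|i].
  by apply: le_trans m0; apply: d; [exact: (H1 x).1|exact: (H2 x).1].
rewrite (C1_pd_mul i C1e C1t) //; apply: le_trans (ler_normD _ _) _.
have -> : 2 * (M1 * M2) = M1 * M2 + M2 * M1 by ring.
apply: lerD; apply: d; by [exact: (H1 x).1|exact: (H2 x).1|exact: (proj2 (H1 x) i)|exact: (proj2 (H2 x) i)].
Qed.

Lemma bC1_sub eta theta : bC1 eta -> bC1 theta -> bC1 (fun x => eta x - theta x).
Proof.
move=> [C1e [M1 M10 H1]] [C1t [M2 M20 H2]]; split; first exact: (C1_sub2 openT C1e C1t).
exists (M1 + M2); first by rewrite addr_gt0.
move=> x; split => [|i].
  by apply: le_trans (ler_normB _ _) _; apply: lerD; [exact: (H1 x).1|exact: (H2 x).1].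
rewrite (C1_pd_sub i C1e C1t) //.
by apply: le_trans (ler_normB _ _) _; apply: lerD; [exact: (proj2 (H1 x) i)|exact: (proj2 (H2 x) i)].
Qed.

Lemma bC1_cst (c : R) : bC1 (fun=> c).
Proof.
split; first exact: (C1_cst _ openT); exists (`|c| + 1); first by rewrite ltr_wpDl.
move=> x; split=> [|i]; first by rewrite lerDl.
by rewrite pdE (is_deriveE (is_derive_const c x _)) normr0 addr_ge0.
Qed.

Lemma C1c_bC1 (O : set (plane R)) eta : C1c O eta -> bC1 eta.
Proof.
move=> C; split; first by case: C.
have [M0 M00 H0] := Cc_bounded (C1c_Cc C).
have [M1 M10 H1] := Cc_bounded (C1c_pd_Cc ord0 C).
have [M2 M20 H2] := Cc_bounded (C1c_pd_Cc ord_max C).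
exists (M0 + M1 + M2); first by rewrite !addr_gt0.
move=> x; split=> [|i].
  by apply: le_trans (H0 x) _; rewrite -addrA lerDl addr_ge0 // ltW.
have [->|->] := ord2_cases i.
  by apply: le_trans (H1 x) _; rewrite addrAC lerDr addr_ge0 // ltW.
by apply: le_trans (H2 x) _; rewrite lerDr addr_ge0 // ltW.
Qed.

Lemma C1_measurable eta (D : set mplane) : C1 setT eta -> measurable_fun D eta.
Proof. by move=> C; apply: measurable_funTS; apply: (C0_measurable openT); exact: C1_C0. Qed.

Lemma C1_pd_measurable i eta (D : set mplane) : C1 setT eta -> measurable_fun D (pd [:: i] eta).
Proof. by move=> C; apply: measurable_funTS; apply: (C0_measurable openT); exact: C1_pd_C0. Qed.

Lemma compact_supp_pd (U : set (plane R)) eta i x : C1c U eta -> ~ U x -> eta x = 0 /\ pd [:: i] eta x = 0.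
Proof.
move=> C nU; have [_ [K [_ KU e0]]] := C1c_Cc C; have [_ [K' [_ KU' e0']]] := C1c_pd_Cc i C.
by split; [apply: e0 => /KU|apply: e0' => /KU'].
Qed.

Variables (O : set (plane R)) (F : 'I_2 -> plane R -> R) (f : plane R -> R) (df : 'I_2 -> plane R -> R).
Hypotheses (oO : open O) (F2 : forall i, sqi area O (F i)) (f2 : sqi area O f) (df2 : forall i, sqi area O (df i)).
Let mO := open_measurable2 oO.

(** Formally $\int_OF\cdot\nabla(f\eta)$, with [df] in the role of $\nabla f$. It vanishes for [eta]
    supported in [O], since [F] is divergence-free; the aim is the value for $\eta=1$, which is
    $\int_OF\cdot\nabla f$. *)
Definition energy eta := \int[area]_(x in O)
  ((F ord0 x * df ord0 x + F ord_max x * df ord_max x) * eta x +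
   f x * (F ord0 x * pd [:: ord0] eta x + F ord_max x * pd [:: ord_max] eta x)).

Let bmul (a b h : plane R -> R) : sqi area O a -> sqi area O b -> measurable_fun (O : set mplane) h ->
  (exists M : R, forall x, `|h x| <= M) -> area.-integrable O (EFin \o (fun x => a x * b x * h x)).
Proof.
move=> sa sb mh [M HM]; apply: (integrable_bndM mO (sqi_mul mO sa sb) mh (M := M)) => x _; exact: HM.
Qed.

Let bpd i eta : bC1 eta -> exists M : R, forall x, `|pd [:: i] eta x| <= M.
Proof. by move=> [_ [M _ H]]; exists M => x; exact: (H x).2. Qed.

Let b0 eta : bC1 eta -> exists M : R, forall x, `|eta x| <= M.
Proof. by move=> [_ [M _ H]]; exists M => x; exact: (H x).1. Qed.

Lemma energy_integrable eta : bC1 eta -> area.-integrable O (EFin \o (fun x =>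
  (F ord0 x * df ord0 x + F ord_max x * df ord_max x) * eta x +
   f x * (F ord0 x * pd [:: ord0] eta x + F ord_max x * pd [:: ord_max] eta x))).
Proof.
move=> B; have C := B.1.
have E : (fun x => (F ord0 x * df ord0 x + F ord_max x * df ord_max x) * eta x +
   f x * (F ord0 x * pd [:: ord0] eta x + F ord_max x * pd [:: ord_max] eta x)) =
  (fun x => (F ord0 x * df ord0 x * eta x + F ord_max x * df ord_max x * eta x) +
   (f x * F ord0 x * pd [:: ord0] eta x + f x * F ord_max x * pd [:: ord_max] eta x)).
  by apply/funext => x; rewrite mulrDl distr_assoc.
rewrite E; apply: (integrableD_EFin mO); apply: (integrableD_EFin mO).
- exact: (bmul (F2 ord0) (df2 ord0) (C1_measurable C) (b0 B)).
- exact: (bmul (F2 ord_max) (df2 ord_max) (C1_measurable C) (b0 B)).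
- exact: (bmul f2 (F2 ord0) (C1_pd_measurable ord0 C) (bpd ord0 B)).
- exact: (bmul f2 (F2 ord_max) (C1_pd_measurable ord_max C) (bpd ord_max B)).
Qed.

Lemma energy_sub eta theta : bC1 eta -> bC1 theta ->
  energy (fun x => eta x - theta x) = energy eta - energy theta.
Proof.
move=> Be Bt; rewrite /energy -(RintegralB mO (energy_integrable Be) (energy_integrable Bt)).
apply: eq_Rintegral => x _; rewrite !(C1_pd_sub _ Be.1 Bt.1) //.
set a := pd _ _ _; set b := pd _ _ _; set c := pd _ _ _; set d := pd _ _ _; ring.
Qed.

Variable (phi : nat -> plane R -> R).
Hypotheses (Cphi : forall n, C1 setT (phi n)) (cphi : cvgL2 area O phi f)
  (cdphi : forall i, cvgL2 area O (fun n => pd [:: i] (phi n)) (df i)).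
Hypothesis HF : forall eta, C1c O eta ->
  \int[area]_(x in O) (F ord0 x * pd [:: ord0] eta x + F ord_max x * pd [:: ord_max] eta x) = 0.

(** For the $C^1$ approximations [phi n] of [f], the product [phi n * eta] is an admissible test
    function in [HF]; the energy is the limit of these zeros. *)
Lemma energy_interior eta : C1c O eta -> energy eta = 0.
Proof.
move=> Ce; have B := C1c_bC1 Ce; have C := B.1.
pose A n (x : plane R) := (F ord0 x * (pd [:: ord0] (phi n) x * eta x) + F ord_max x * (pd [:: ord_max] (phi n) x * eta x)) +
   (F ord0 x * (phi n x * pd [:: ord0] eta x) + F ord_max x * (phi n x * pd [:: ord_max] eta x)).
have A0 n : \int[area]_(x in O) A n x = 0.
  have [Cm pm] := C1c_mul oO Ce (C1_sub (@subsetT _ O) (Cphi n)).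
  rewrite -[RHS](HF Cm); apply: eq_Rintegral => x _; rewrite /A !pm.
  set a := pd _ _ _; set b := pd _ _ _; set c := pd _ _ _; set d := pd _ _ _; ring.
have cv (a : plane R -> R) (bn : nat -> plane R -> R) (b h : plane R -> R) : sqi area O a -> cvgL2 area O bn b ->
    measurable_fun (O : set mplane) h -> (exists M : R, forall x, `|h x| <= M) ->
    \int[area]_(x in O) (a x * (bn n x * h x)) @[n --> \oo] --> \int[area]_(x in O) (a x * (b x * h x)) /\
    forall n, area.-integrable O (EFin \o (fun x => a x * (bn n x * h x))).
  move=> sa cb mh [M HM]; have cbh := cvgL2_bndM mO cb mh (fun x _ => HM x).
  split; first exact: (cvgL2_mul mO (cvgL2_cst sa) cbh).
  by move=> n; apply: (sqi_mul mO sa); case: cbh.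
have [c1 i1] := cv _ _ _ eta (F2 ord0) (cdphi ord0) (C1_measurable C) (b0 B).
have [c2 i2] := cv _ _ _ eta (F2 ord_max) (cdphi ord_max) (C1_measurable C) (b0 B).
have [c3 i3] := cv _ _ _ _ (F2 ord0) cphi (C1_pd_measurable ord0 C) (bpd ord0 B).
have [c4 i4] := cv _ _ _ _ (F2 ord_max) cphi (C1_pd_measurable ord_max C) (bpd ord_max B).
have lim : \int[area]_(x in O) A n x @[n --> \oo] --> energy eta.
  have -> : energy eta = (\int[area]_(x in O) (F ord0 x * (df ord0 x * eta x)) + \int[area]_(x in O) (F ord_max x * (df ord_max x * eta x))) +
     (\int[area]_(x in O) (F ord0 x * (f x * pd [:: ord0] eta x)) + \int[area]_(x in O) (F ord_max x * (f x * pd [:: ord_max] eta x))).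
    have j (a b h : plane R -> R) : sqi area O a -> sqi area O b -> measurable_fun (O : set mplane) h ->
        (exists M : R, forall x, `|h x| <= M) -> area.-integrable O (EFin \o (fun x => a x * (b x * h x))).
      by move=> sa sb mh [M HM]; apply: (sqi_mul mO sa); apply: (sqi_bndM mO sb mh (M := M)) => x _.
    have j1 := j _ _ _ (F2 ord0) (df2 ord0) (C1_measurable C) (b0 B).
    have j2 := j _ _ _ (F2 ord_max) (df2 ord_max) (C1_measurable C) (b0 B).
    have j3 := j _ _ _ (F2 ord0) f2 (C1_pd_measurable ord0 C) (bpd ord0 B).
    have j4 := j _ _ _ (F2 ord_max) f2 (C1_pd_measurable ord_max C) (bpd ord_max B).
    rewrite -(RintegralD mO j1 j2) -(RintegralD mO j3 j4).
    rewrite -(RintegralD mO (integrableD_EFin mO j1 j2) (integrableD_EFin mO j3 j4)).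
    apply: eq_Rintegral => x _.
    have aux (p q p' q' e r s t : R) : (p * p' + q * q') * e + t * (p * r + q * s) =
      p * (p' * e) + q * (q' * e) + (p * (t * r) + q * (t * s)) by clear; ring.
    exact: aux.
  have E : (fun n => \int[area]_(x in O) A n x) = (fun n => (\int[area]_(x in O) (F ord0 x * (pd [:: ord0] (phi n) x * eta x)) + \int[area]_(x in O) (F ord_max x * (pd [:: ord_max] (phi n) x * eta x))) +
     (\int[area]_(x in O) (F ord0 x * (phi n x * pd [:: ord0] eta x)) + \int[area]_(x in O) (F ord_max x * (phi n x * pd [:: ord_max] eta x)))).
    apply/funext => n; rewrite -(RintegralD mO (i1 n) (i2 n)) -(RintegralD mO (i3 n) (i4 n)).
    by rewrite -(RintegralD mO (integrableD_EFin mO (i1 n) (i2 n)) (integrableD_EFin mO (i3 n) (i4 n))).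
  rewrite E; exact: (cvgD (cvgD c1 c2) (cvgD c3 c4)).
apply: (cvg_unique _ lim) => //.
by apply: cvg_near_cst; apply: nearW.
Qed.

(** A single integrable function that controls all products in the energy; its integrals over
    shrinking strips tend to 0. *)
Definition density (x : plane R) := F ord0 x ^+ 2 + F ord_max x ^+ 2 + (df ord0 x ^+ 2 + df ord_max x ^+ 2) + f x ^+ 2.

Lemma density_integrable : area.-integrable O (EFin \o density).
Proof.
have s a : sqi area O a -> area.-integrable O (EFin \o (fun x => a x ^+ 2)) by case.
by apply: (integrableD_EFin mO); [apply: (integrableD_EFin mO); apply: (integrableD_EFin mO)|]; apply: s.
Qed.

(** Since [eta * theta] is supported in [O], the energy of [eta] is that of [eta * (1 - theta)],
    whose integrand is 0 off the strip [S]. The dangerous term is $fF\cdot\eta\nabla\theta$ with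
    $|\nabla\theta|\le B/d$; the last hypothesis, $\int_Sf^2\le Kd^2\int_S|df|^2$, removes the power
    of $d$, so that the bound depends on $d$ only through [S]. *)
Lemma energy_cutoff_bound (S : set (plane R)) eta theta (A B K d : R) : measurable (S : set mplane) -> S `<=` O ->
  0 <= A -> 0 <= B -> 0 <= K -> 0 < d ->
  bC1 eta -> bC1 theta -> C1c O (fun x => eta x * theta x) ->
  (forall x, `|eta x| <= A) -> (forall i x, `|pd [:: i] eta x| <= A) ->
  (forall x, `|1 - theta x| <= B) -> (forall i x, `|pd [:: i] theta x| <= B / d) ->
  (forall x, O x -> ~ S x -> eta x * (1 - theta x) = 0 /\
     forall i, pd [:: i] eta x * (1 - theta x) = 0 /\ eta x * pd [:: i] theta x = 0) ->
  \int[area]_(x in S) (f x ^+ 2) <= K * d ^+ 2 * \int[area]_(x in S) (df ord0 x ^+ 2 + df ord_max x ^+ 2) ->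
  `|energy eta| <= A * B * (2 + K) * \int[area]_(x in S) density x.
Proof.
move=> mS SO A0 B0 K0 d0 Be Bt Cet bA bpA bB bpB out fS.
pose G (x : plane R) := (F ord0 x * df ord0 x + F ord_max x * df ord_max x) * (eta x * (1 - theta x)) +
  f x * (F ord0 x * (pd [:: ord0] eta x * (1 - theta x)) + F ord_max x * (pd [:: ord_max] eta x * (1 - theta x))) -
  f x * (F ord0 x * (eta x * pd [:: ord0] theta x) + F ord_max x * (eta x * pd [:: ord_max] theta x)).
have ie := energy_integrable Be; have iet := energy_integrable (bC1_mul Be Bt).
have pE i x : pd [:: i] (fun x => eta x * theta x) x = eta x * pd [:: i] theta x + theta x * pd [:: i] eta x.
  by rewrite (C1_pd_mul i Be.1 Bt.1).
have EG : energy eta = \int[area]_(x in O) G x.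
  rewrite -[LHS]subr0 -(energy_interior Cet) /energy -(RintegralB mO ie iet).
  apply: eq_Rintegral => x _; rewrite !pE /G.
  set a := pd _ eta _; set b := pd _ eta _; set c := pd _ theta _; set d' := pd _ theta _; ring.
have iG : area.-integrable O (EFin \o G).
  have := integrableB_EFin mO ie iet; congr (_.-integrable _ (_ \o _)); apply/funext => x; rewrite !pE /G.
  set a := pd _ eta _; set b := pd _ eta _; set c := pd _ theta _; set d' := pd _ theta _; ring.
have G0 x : O x -> ~ S x -> G x = 0.
  move=> Ox nS; have [z0 zi] := out x Ox nS.
  have aux (h t p q y1 y2 y3 y4 y5 : R) : y1 = 0 -> y2 = 0 -> y3 = 0 -> y4 = 0 -> y5 = 0 ->
    h * y1 + t * (p * y2 + q * y3) - t * (p * y4 + q * y5) = 0.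
    by move=> -> -> -> -> ->; ring.
  exact: aux z0 (zi ord0).1 (zi ord_max).1 (zi ord0).2 (zi ord_max).2.
rewrite EG (Rintegral_out (O : set mplane) (S : set mplane) G mO mS SO G0).
have iS (h : plane R -> R) : area.-integrable O (EFin \o h) -> area.-integrable S (EFin \o h).
  exact: (integrableS mO mS SO).
have iq := iS _ density_integrable.
have if2 : area.-integrable S (EFin \o (fun x => f x ^+ 2)) by apply: iS; case: f2.
have idf : area.-integrable S (EFin \o (fun x => df ord0 x ^+ 2 + df ord_max x ^+ 2)).
  by apply: iS; apply: (integrableD_EFin mO); [case: (df2 ord0)|case: (df2 ord_max)].
have AB0 : 0 <= A * B by rewrite mulr_ge0.
(* Each product is bounded by $|xy|\le(x^2+y^2)/2$. In the two terms with $\nabla\theta$ the factor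
   $1/d$ is first given to [v], the value of [f], which produces [d ^- 2 * v ^+ 2]. *)
have pt (a0 a1 c0 c1 v e g0 g1 k0 k1 : R) : `|e| <= A * B -> `|g0| <= A * B -> `|g1| <= A * B ->
    `|k0| <= A * B / d -> `|k1| <= A * B / d ->
    `|(a0 * c0 + a1 * c1) * e + v * (a0 * g0 + a1 * g1) - v * (a0 * k0 + a1 * k1)| <=
    A * B * (2 * (a0 ^+ 2 + a1 ^+ 2 + (c0 ^+ 2 + c1 ^+ 2) + v ^+ 2) + d ^- 2 * v ^+ 2).
  move=> he hg0 hg1 hk0 hk1.
  have am (x y z : R) : `|z| <= A * B -> `|x * y * z| <= A * B * ((x ^+ 2 + y ^+ 2) / 2).
    move=> hz; rewrite normrM mulrC; apply: ler_pM => //.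
    rewrite normrM ler_pdivlMr // -subr_ge0 -(real_normK (num_real x)) -(real_normK (num_real y)).
    by rewrite (_ : _ - _ = (`|x| - `|y|) ^+ 2) ?sqr_ge0 //; ring.
  have amk (x y z : R) : `|z| <= A * B / d -> `|x * y * z| <= A * B * ((d ^- 2 * x ^+ 2 + y ^+ 2) / 2).
    move=> hz; have dn : d != 0 by rewrite gt_eqF.
    rewrite (_ : x * y * z = (x / d) * y * (z * d)); last by field.
    rewrite (_ : d ^- 2 * x ^+ 2 = (x / d) ^+ 2); last by field.
    by apply: am; rewrite normrM (gtr0_norm d0) -ler_pdivlMr.
  have h1 := am a0 c0 e he; have h2 := am a1 c1 e he; have h3 := am v a0 g0 hg0; have h4 := am v a1 g1 hg1.
  have h5 := amk v a0 k0 hk0; have h6 := amk v a1 k1 hk1.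
  rewrite (_ : _ - _ = a0 * c0 * e + a1 * c1 * e + v * a0 * g0 + v * a1 * g1 + - (v * a0 * k0) + - (v * a1 * k1)); last by ring.
  have N (x y s t : R) : `|x| <= s -> `|y| <= t -> `|x + y| <= s + t.
    by move=> ? ?; apply: le_trans (ler_normD _ _) _; exact: lerD.
  rewrite -normrN in h5; rewrite -normrN in h6.
  apply: le_trans (N _ _ _ _ (N _ _ _ _ (N _ _ _ _ (N _ _ _ _ (N _ _ _ _ h1 h2) h3) h4) h5) h6) _.
  rewrite -subr_ge0 (_ : _ - _ = A * B * ((a0 ^+ 2 + a1 ^+ 2) / 2 + (c0 ^+ 2 + c1 ^+ 2) * (3 / 2) + v ^+ 2)); last by field; rewrite gt_eqF.
  apply: mulr_ge0 => //; apply: addr_ge0; last exact: sqr_ge0.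
  by apply: addr_ge0; apply: mulr_ge0; rewrite ?addr_ge0 ?sqr_ge0 // ?divr_ge0 // invr_ge0.
have GB x : S x -> `|G x| <= A * B * (2 * density x + d ^- 2 * f x ^+ 2).
  move=> Sx; apply: pt.
  - by rewrite normrM ler_pM.
  - by rewrite normrM ler_pM.
  - by rewrite normrM ler_pM.
  - by rewrite normrM -mulrA ler_pM.
  - by rewrite normrM -mulrA ler_pM.
have ib : area.-integrable S (EFin \o (fun x => A * B * (2 * density x + d ^- 2 * f x ^+ 2))).
  by apply: (integrableZ_EFin _ mS); apply: (integrableD_EFin mS); apply: (integrableZ_EFin _ mS).
apply: le_trans (le_normr_RintegralM mS (iS _ iG) ib GB) _.
rewrite (RintegralZl _ mS); last by apply: (integrableD_EFin mS); apply: (integrableZ_EFin _ mS).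
rewrite (RintegralD mS) ?(RintegralZl _ mS); try by [exact: iq|exact: if2|apply: (integrableZ_EFin _ mS)].
rewrite -[leRHS]mulrA ler_wpM2l // [leRHS]mulrDl lerD2l.
apply: le_trans (_ : d ^- 2 * (K * d ^+ 2 * \int[area]_(x in S) (df ord0 x ^+ 2 + df ord_max x ^+ 2)) <= _).
  by rewrite ler_wpM2l // invr_ge0 sqr_ge0.
rewrite (_ : d ^- 2 * _ = K * \int[area]_(x in S) (df ord0 x ^+ 2 + df ord_max x ^+ 2)); last by field; rewrite gt_eqF.
rewrite ler_wpM2l //; apply: le_Rintegral => // x _.
by rewrite /density [leRHS](_ : _ = (df ord0 x ^+ 2 + df ord_max x ^+ 2) + (F ord0 x ^+ 2 + F ord_max x ^+ 2 + f x ^+ 2)) ?lerDl ?addr_ge0 ?sqr_ge0 //; ring.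
Qed.

Hypothesis Hloc : forall x : plane R, exists U : set (plane R), [/\ open U, U x & forall eta, C1c U eta -> energy eta = 0].

#[local] Opaque energy.

Lemma energy_zero eta : C1c setT eta -> energy eta = 0.
Proof.
(* A good set is one near which [eta] can be erased: some [theta] vanishes on it and multiplication
   by [theta] leaves all energies unchanged. Products of such factors serve for unions, so no
   partition of unity is needed. Locally [theta] is 1 minus a plateau, by linearity and [Hloc]. *)
pose good (V : set (plane R)) := exists theta, [/\ bC1 theta, forall x, V x -> theta x = 0 &
  forall eta, C1c setT eta -> energy eta = energy (fun x => eta x * theta x)].
have g0 : good set0.
  exists (fun=> 1); split; [exact: bC1_cst|by []|move=> h _].
  by congr energy; apply/funext => x; rewrite mulr1.
have gU V W : good V -> good W -> good (V `|` W).
  move=> [t1 [B1 z1 e1]] [t2 [B2 z2 e2]]; exists (fun x => t1 x * t2 x); split.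
  - exact: bC1_mul.
  - by move=> x [/z1|/z2] ->; rewrite ?mul0r ?mulr0.
  - move=> h Ch; rewrite (e1 h Ch) (e2 _ (C1c_mul openT Ch B1.1).1).
    by congr energy; apply/funext => x; rewrite mulrA.
have [B _ plat] := @plateau2 R.
have gx x : exists V, [/\ open V, V x & good V].
  have [U [oU Ux HU]] := Hloc x; case: x Ux => x y Ux.
  have [r r0 rU] := nbhs_box oU Ux.
  have [p [Cp po p1 _ _]] := plat x y r r0.
  exists (obox (x - r / 2) (x + r / 2) (y - r / 2) (y + r / 2)); split; first exact: obox_open.
    by apply: obox_center; rewrite divr_gt0.
  have Cpc : C1c U p.
    by split => //; exists (box (x - r) (x + r) (y - r) (y + r)); split => //; exact: box_compact.
  have Bp := C1c_bC1 Cpc.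
  exists (fun z => 1 - p z); split.
  - exact: (bC1_sub (bC1_cst 1) Bp).
  - by move=> z /obox_box /p1 ->; rewrite subrr.
  - move=> h Ch; have Bh := C1c_bC1 Ch.
    have E : (fun z => h z * (1 - p z)) = (fun z => h z - h z * p z) by apply/funext => z; ring.
    rewrite E (energy_sub Bh (bC1_mul Bh Bp)).
    rewrite [X in _ - X](HU _ _) ?subr0 //.
    have := (C1c_mul oU Cpc (C1_sub (@subsetT _ U) Ch.1)).1.
    by congr (C1c _ _); apply/funext => z; rewrite mulrC.
move=> Ce; have [_ [K [cK _ e0]]] := Ce.
have [V [t [Bt tz te]] KV] := compact_union_ind cK g0 gU gx.
rewrite te //.
have -> : (fun x => eta x * t x) = (fun x => eta x - eta x).
  apply/funext => x; rewrite subrr; by have [/KV /tz ->|/e0 ->] := pselect (K x); rewrite ?mulr0 ?mul0r.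
by rewrite energy_sub ?subrr //; exact: (C1c_bC1 Ce).
Qed.

#[local] Transparent energy.

(** The constant 1 has no compact support and [O] may be unbounded, so plateaus of radius $n+1$ take
    its place. Their gradients are at most $B/(n+1)$, so the part of the energy with $\nabla\eta$
    tends to 0. *)
Lemma energy_whole : \int[area]_(x in O) (F ord0 x * df ord0 x + F ord_max x * df ord_max x) = 0.
Proof.
have [B B0 plat] := @plateau2 R.
have [p Hp] := choice (fun n : nat => plat 0 0 (n.+1%:R : R) (ltr0Sn _ _)).
have Cp n : C1c setT (p n).
  have [C o _ _ _] := Hp n; split => //.
  by exists (box (0 - n.+1%:R) (0 + n.+1%:R) (0 - n.+1%:R) (0 + n.+1%:R)); split => //; exact: box_compact.
pose h x := F ord0 x * df ord0 x + F ord_max x * df ord_max x.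
pose k n x := F ord0 x * pd [:: ord0] (p n) x + F ord_max x * pd [:: ord_max] (p n) x.
have ih : area.-integrable O (EFin \o h) by apply: (integrableD_EFin mO); apply: (sqi_mul mO).
have mp n : measurable_fun (O : set mplane) (p n) by apply: C1_measurable; case: (Cp n).
have b n : forall x, `|p n x| <= B by have [] := Hp n.
have ihp n : area.-integrable O (EFin \o (fun x => h x * p n x)).
  by apply: (integrable_bndM mO ih (mp n) (M := B)).
have lim1 : \int[area]_(x in O) (h x * p n x) @[n --> \oo] --> \int[area]_(x in O) h x.
  have cv z : O z -> h z * p n z @[n --> \oo] --> h z.
    case: z => x y _; apply: cvg_near_cst.
    have [N HN] : exists N : nat, `|x| + `|y| <= N%:R by exists (Num.trunc (`|x| + `|y|)).+1; apply: ltW; exact: truncnS_gt.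
    near=> n; have [_ _ o1 _ _] := Hp n; rewrite o1 ?mulr1 //.
    have nN : N%:R * 2 <= n%:R :> R by rewrite -natrM ler_nat; near: n; exact: nbhs_infty_ge.
    have n1 : n.+1%:R = n%:R + 1 :> R by rewrite -natr1.
    have := ler_norm x; have := ler_norm y; have := lerNnormlW (lexx `|x|); have := lerNnormlW (lexx `|y|).
    have := normr_ge0 x; have := normr_ge0 y => ? ? ? ? ? ?.
    by split; rewrite /= in_itv /= n1; apply/andP; split; lra.
  have dom n x : O x -> `|h x * p n x| <= B * `|h x| by move=> _; rewrite normrM mulrC ler_wpM2r.
  have mhp n := integrable_mfun (ihp n).
  have iB := integrableZ_EFin B mO (integrable_norm ih).
  exact: (dominated_Rintegral mO mhp (integrable_mfun ih) cv iB dom).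
have ik n : area.-integrable O (EFin \o (fun x => f x * k n x)).
  have C := (Cp n).1; have Bp := C1c_bC1 (Cp n).
  have E : (fun x => f x * k n x) = (fun x => f x * F ord0 x * pd [:: ord0] (p n) x + f x * F ord_max x * pd [:: ord_max] (p n) x).
    by apply/funext => x; exact: distr_assoc.
  rewrite E; apply: (integrableD_EFin mO).
  - exact: (bmul f2 (F2 ord0) (C1_pd_measurable ord0 C) (bpd ord0 Bp)).
  - exact: (bmul f2 (F2 ord_max) (C1_pd_measurable ord_max C) (bpd ord_max Bp)).
have lim2 : \int[area]_(x in O) (f x * k n x) @[n --> \oo] --> (0 : R).
  pose J := \int[area]_(x in O) (`|f x * F ord0 x| + `|f x * F ord_max x|).
  have iJ : area.-integrable O (EFin \o (fun x => `|f x * F ord0 x| + `|f x * F ord_max x|)).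
    by apply: (integrableD_EFin mO); apply: integrable_norm; exact: (sqi_mul mO).
  have bnd n : `|\int[area]_(x in O) (f x * k n x)| <= B * J * n.+1%:R^-1.
    rewrite -mulrA mulrC -mulrA mulrC -(RintegralZl _ mO iJ).
    apply: (le_normr_RintegralM mO (ik n)); first by apply: (integrableZ_EFin _ mO).
    move=> x _; have [_ _ _ _ bp] := Hp n.
    have b0' := bp ord0 x; have b1' := bp ord_max x.
    rewrite [leRHS]mulrC in b0'; rewrite [leRHS]mulrC in b1'.
    have aux (a c d q q' K : R) : `|q| <= K -> `|q'| <= K -> `|a * (c * q + d * q')| <= K * (`|a * c| + `|a * d|).
      clear=> h h'; rewrite mulrDr !mulrA mulrDr (mulrC K) (mulrC K _).
      apply: le_trans (ler_normD _ _) _; rewrite (normrM (a * c)) (normrM (a * d)).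
      by apply: lerD; exact: ler_wpM2l.
    exact: aux b0' b1'.
  apply/norm_cvg0P; apply: (squeeze_cvgr (f := fun=> 0) (h := fun n => B * J * n.+1%:R^-1)).
  - by apply: nearW => n; rewrite normr_ge0 bnd.
  - exact: cvg_cst.
  - rewrite -[X in _ --> X](mulr0 (B * J)); apply: cvgM; first exact: cvg_cst.
    exact: cvg_harmonic.
have E n : \int[area]_(x in O) (h x * p n x) = - \int[area]_(x in O) (f x * k n x).
  apply/eqP; rewrite -subr_eq0 opprK -(RintegralD mO (ihp n) (ik n)).
  by apply/eqP; exact: (energy_zero (Cp n)).
have lim3 : \int[area]_(x in O) (h x * p n x) @[n --> \oo] --> (- 0 : R).
  by under eq_fun do rewrite E; exact: cvgN lim2.
by rewrite oppr0 in lim3; apply: (cvg_unique _ lim1).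
Unshelve. all: by end_near.
Qed.

End EnergyForm.

Section Clamp.
Context {R : realType}.
Implicit Types (r a b : R).

(** The projection onto [[- r, r]]. Composition with it extends a Lipschitz chart function to the
    whole line without a larger constant. *)
Definition clamp r a := if a < - r then - r else if r < a then r else a.

Lemma clamp_le r a : 0 <= r -> `|clamp r a| <= r.
Proof.
move=> r0; rewrite /clamp; case: ltP => h1; first by rewrite normrN ger0_norm.
case: ltP => h2; first by rewrite ger0_norm.
by rewrite ler_norml h1.
Qed.

Lemma clamp_id r a : `|a| < r -> clamp r a = a.
Proof.
rewrite ltr_norml /clamp => /andP[h1 h2]; case: ltP => h3; first by lra.
by case: ltP => h4 //; lra.
Qed.

Lemma clamp_lip r a b : 0 <= r -> `|clamp r a - clamp r b| <= `|a - b|.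
Proof.
move=> r0; have h := ler_norm (a - b); have h' := ler_norm (b - a); rewrite (distrC b a) in h'.
rewrite /clamp ler_norml; case: ltP => ?; case: ltP => ?; try (case: ltP => ?); try (case: ltP => ?); apply/andP; split; lra.
Qed.

End Clamp.

Section RestrictL2.
Context d {T : measurableType d} {R : realType} (mu : {measure set T -> \bar R}).
Context (D S : set T) (mD : measurable D) (mS : measurable S) (SD : S `<=` D).
Implicit Types (f g : T -> R).

Lemma sqi_subset f : sqi mu D f -> sqi mu S f.
Proof. by move=> [mf fi]; split; [exact: measurable_funS mf|exact: integrableS fi]. Qed.

Lemma cvgL2_subset (fn : nat -> T -> R) f : cvgL2 mu D fn f -> cvgL2 mu S fn f.
Proof.
move=> [sfn sf cf]; split; [by move=> n; exact: sqi_subset|exact: sqi_subset|].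
apply: (squeeze_cvgr _ _ cf (f := fun=> 0)); last exact: cvg_cst.
apply: nearW => n; rewrite L2norm_ge0 /=; apply: ler_wsqrtr.
have [m i] := sqi_sub mD (sfn n) sf.
apply: fine_le; [exact: integral_fune_fin_num (integrableS mD mS SD i)|exact: integral_fune_fin_num i|].
apply: ge0_subset_integral => //; first by have /integrableP[] := i.
by move=> x _; rewrite lee_fin sqr_ge0.
Qed.

End RestrictL2.

Section Chart.
Context {R : realType}.
Notation leb := (@lebesgue_measure R).
Notation mplane := (measurableTypeR R * measurableTypeR R)%type.
Variables (O : set (plane R)) (F : 'I_2 -> plane R -> R) (f : plane R -> R) (df : 'I_2 -> plane R -> R).
Hypotheses (oO : open O) (F2 : forall i, sqi area O (F i)) (f2 : sqi area O f) (df2 : forall i, sqi area O (df i)).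
Variable (phi : nat -> plane R -> R).
Hypotheses (Cphi : forall n, C1 setT (phi n)) (cphi : cvgL2 area O phi f)
  (cdphi : forall i, cvgL2 area O (fun n => pd [:: i] (phi n)) (df i)).
Hypothesis HF : forall eta, C1c O eta ->
  \int[area]_(x in O) (F ord0 x * pd [:: ord0] eta x + F ord_max x * pd [:: ord_max] eta x) = 0.
Let mO := open_measurable2 oO.

(** The strip estimate is applied to the approximations; its boundary term disappears in the limit
    because [f] has trace 0 on the graph. *)
Lemma strip_limit (x0 e : plane R) gam (r d : R) : e.1 ^+ 2 + e.2 ^+ 2 = 1 -> 0 < d -> continuous gam ->
  frame_strip x0 e gam r d `<=` O ->
  (\int[leb]_(a in `](- r)%R, r[) ((phi n (frame x0 e a (gam a))) ^+ 2)%:E)%E @[n --> \oo] --> 0%E ->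
  \int[area]_(x in frame_strip x0 e gam r d) (f x ^+ 2) <=
  2 * d ^+ 2 * \int[area]_(x in frame_strip x0 e gam r d) (df ord0 x ^+ 2 + df ord_max x ^+ 2).
Proof.
move=> e1 d0 cg SO tr; set S := frame_strip x0 e gam r d.
have mS : measurable (S : set mplane) := open_measurable2 (frame_strip_open cg).
have cS g gn : cvgL2 area O gn g -> cvgL2 area S gn g by apply: cvgL2_subset.
have sq g gn : cvgL2 area O gn g -> \int[area]_(x in S) (gn n x ^+ 2) @[n --> \oo] --> \int[area]_(x in S) (g x ^+ 2).
  by move=> /cS c; exact: (cvgL2_mul mS c c).
have isq g gn n : cvgL2 area O gn g -> area.-integrable S (EFin \o (fun x => gn n x ^+ 2)).
  by move=> /cS[+ _ _] => /(_ n)[].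
have isq' g gn : cvgL2 area O gn g -> area.-integrable S (EFin \o (fun x => g x ^+ 2)).
  by move=> /cS[_ + _] => -[].
pose t n := (\int[leb]_(a in `](- r)%R, r[) ((phi n (frame x0 e a (gam a))) ^+ 2)%:E)%E.
move/fine_cvgP: (tr) => [tf tc].
have : \forall n \near \oo, \int[area]_(x in S) (phi n x ^+ 2) <=
   2 * d * fine (t n) + 2 * d ^+ 2 * (\int[area]_(x in S) (pd [:: ord0] (phi n) x ^+ 2) + \int[area]_(x in S) (pd [:: ord_max] (phi n) x ^+ 2)).
  apply: filterS tf => n tn.
  have := frame_strip_estimate x0 r e1 d0 cg (Cphi n); rewrite -/S -/(t n).
  have i0 := isq _ _ n cphi; have i1 := isq _ _ n (cdphi ord0); have i2 := isq _ _ n (cdphi ord_max).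
  have E (g : plane R -> R) : area.-integrable S (EFin \o g) -> (\int[area]_(x in S) (g x)%:E)%E = (\int[area]_(x in S) g x)%:E.
    by move=> ig; rewrite /Rintegral fineK //; exact: integral_fune_fin_num ig.
  rewrite (E _ i0) (E _ (integrableD_EFin mS i1 i2)) -(fineK (tn : t n \is a fin_num)) -!EFinM -EFinD lee_fin.
  by rewrite (RintegralD mS i1 i2).
move=> H; rewrite (RintegralD mS (isq' _ _ (cdphi ord0)) (isq' _ _ (cdphi ord_max))).
have c1 := sq _ _ cphi.
have c2 : 2 * d * fine (t n) + 2 * d ^+ 2 * (\int[area]_(x in S) (pd [:: ord0] (phi n) x ^+ 2) + \int[area]_(x in S) (pd [:: ord_max] (phi n) x ^+ 2)) @[n --> \oo] -->
    2 * d * 0 + 2 * d ^+ 2 * (\int[area]_(x in S) (df ord0 x ^+ 2) + \int[area]_(x in S) (df ord_max x ^+ 2)).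
  apply: cvgD; first by apply: cvgM; [exact: cvg_cst|exact: tc].
  by apply: cvgM; [exact: cvg_cst|apply: cvgD; [exact: sq (cdphi ord0)|exact: sq (cdphi ord_max)]].
rewrite mulr0 add0r in c2.
exact: (ler_cvg_to c1 c2 H).
Qed.

Lemma coord_derive (x0 e x : plane R) i :
  is_derive x (unit_vec i) (fun x : plane R => (coord x0 e x).1) (if i == ord0 then e.1 else e.2) /\
  is_derive x (unit_vec i) (fun x : plane R => (coord x0 e x).2) (if i == ord0 then - e.2 else e.1).
Proof.
have D (a b c t : R) : is_derive t 1 (fun s : R => (s - a) * b + c) b.
  apply: is_derive_eq' (is_derive_add (is_derive_mul (is_derive_sub (is_derive_id t 1) (is_derive_const a t 1))
    (is_derive_const b t 1)) (is_derive_const c t 1)) _.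
  by rewrite mulr0 subr0 mulr1 add0r addr0.
case: x => x y; have [->|->] := ord2_cases i => /=; split.
- by apply/is_derive_slice0 => /=; exact: D.
- apply/is_derive_slice0 => /=; have := D x0.1 (- e.2) ((y - x0.2) * e.1) x.
  by congr (is_derive _ _ _ _); apply/funext => s; ring.
- apply/is_derive_slice1 => /=; have := D x0.2 e.2 ((x - x0.1) * e.1) y.
  by congr (is_derive _ _ _ _); apply/funext => s; ring.
- by apply/is_derive_slice1 => /=; exact: D.
Qed.

Lemma coord_continuous12 (x0 e x : plane R) : {for x, continuous (fun x : plane R => (coord x0 e x).1)} /\
  {for x, continuous (fun x : plane R => (coord x0 e x).2)}.
Proof.
have cf : {for x, continuous (fun z : plane R => z.1)} by exact: cvg_fst.
have cs : {for x, continuous (fun z : plane R => z.2)} by exact: cvg_snd.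
have cc (c : R) : {for x, continuous (fun _ : plane R => c)} by exact: continuous_const.
split.
  by apply: continuous_add; apply: continuous_mul => //; apply: continuous_sub.
by apply: continuous_sub; apply: continuous_mul => //; apply: continuous_sub.
Qed.

(** For every small [d], a cutoff that vanishes within depth [d] of the boundary and is 1 beyond
    depth [4 * d] bounds the energy by a constant times the integral of [density] over the strip of
    depth [4 * d]. The constant does not depend on [d], and the strips shrink to nothing. *)
Lemma chart_energy (x0 e : plane R) (r k : R) gam : lipschitz_chart O x0 e r k gam -> gam 0 = 0 ->
  (forall r', lipschitz_chart O x0 e r' k gam ->
    (\int[leb]_(a in `](- r')%R, r'[) ((phi n (frame x0 e a (gam a))) ^+ 2)%:E)%E @[n --> \oo] --> 0%E) ->
  exists U : set (plane R), [/\ open U, U x0 & forall eta, C1c U eta -> energy O F f df eta = 0].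
Proof.
move=> [[r0 k0 e1 gk gO] [M ML]] gam0 tr.
pose r' := r / 2; have r'0 : 0 < r' by rewrite divr_gt0.
have r'r : r' < r by rewrite /r'; lra.
pose gc a := gam (clamp r' a).
have cl a : `|clamp r' a| < r by apply: le_lt_trans (clamp_le a (ltW r'0)) r'r.
have gcE a : `|a| < r' -> gc a = gam a by move=> ar; rewrite /gc clamp_id.
have gL a b : `|gc a - gc b| <= `|M| * `|a - b|.
  apply: le_trans (ML _ _ (cl a) (cl b)) _.
  apply: (@le_trans _ _ (`|M| * `|clamp r' a - clamp r' b|)); first by rewrite ler_wpM2r // ler_norm.
  by rewrite ler_wpM2l // clamp_lip // ltW.
have gcc : continuous gc.
  have [g [g' [D _ _ _]]] := mollified_lipschitz ltr01 gL.
  move=> a; apply/cvgrPdist_le => ep ep0; have M1 : 0 < `|M| + 1 by rewrite ltr_wpDl.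
  apply/nbhs_ballP; exists (ep / (`|M| + 1)); rewrite /= ?divr_gt0 // => y; rewrite /ball /= => xy.
  apply: le_trans (gL a y) _; apply: le_trans (_ : (`|M| + 1) * `|a - y| <= _).
    by rewrite ler_wpM2r // lerDl.
  by rewrite mulrC -ler_pdivlMr // ltW.
have gck a : `|gc a| < k by apply: gk.
(* Strips of depth less than [ka] stay in the box of the chart, hence in [O]: [ka] is the distance
   from the lowest point of the graph over [[- r', r']] to the bottom of the box. *)
have [ka [ka0 Hka]] : exists ka : R, 0 < ka /\ forall a, `|a| < r' -> - k + ka <= gc a.
  have r'm : - r' <= r' by lra.
  have [c _ cm] := EVT_min r'm (within_continuous_pt (fun x _ => gcc x)).
  exists (gc c + k); split; first by have := gck c; rewrite ltr_norml => /andP[? _]; lra.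
  move=> a; rewrite ltr_norml => /andP[a1 a2]; rewrite addrC addrK; apply: cm.
  by rewrite in_itv /= !ltW.
pose U := coord x0 e @^-1` obox (- r') r' (- k) k.
have oU : open U by apply: open_comp; [move=> x _; exact: coord_continuous|exact: obox_open].
have Ux0 : U x0.
  rewrite /U /preimage /coord /= !subrr !mul0r addr0 subr0.
  by split; rewrite /= in_itv /=; apply/andP; split; lra.
have UP x : U x -> `|(coord x0 e x).1| < r' /\ `|(coord x0 e x).2| < k.
  by move=> [/=]; rewrite !in_itv /= !ltr_norml.
have OU x : `|(coord x0 e x).1| < r' -> `|(coord x0 e x).2| < k -> O x <-> (coord x0 e x).2 < gc (coord x0 e x).1.
  move=> h1 h2; rewrite -[in O x](frame_coord x0 x e1) (gcE _ h1); apply: gO => //; exact: lt_trans r'r.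
have SO d : 0 < d -> 4 * d < ka -> frame_strip x0 e gc r' (4 * d) `<=` O.
  move=> d0 dk x [h1 /andP[h2 h3]]; apply/OU => //.
  have := Hka _ h1; have := gck (coord x0 e x).1; rewrite !ltr_norml => /andP[_ ?] ?; apply/andP; split; lra.
exists U; split => // eta Ce; have Be := C1c_bC1 Ce.
have [_ [A A0 HA]] := Be.
have [sg [h [Bs [Bs0 Ds ch [sz so hz] bs]]]] := @step_exists R.
(* [1 + Bs] bounds [1 - theta], and [Bs * (|M| + 1) / d] bounds the derivatives of [theta]; [B] is
   chosen to serve both. *)
pose B := (1 + Bs) * (`|M| + 2).
have B0 : 0 <= B by rewrite mulr_ge0 // addr_ge0 // ltW.
have bound d : 0 < d -> 4 * d < ka ->
    `|energy O F f df eta| <= A * B * (2 + 32) * \int[area]_(x in frame_strip x0 e gc r' (4 * d)) density F f df x.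
  move=> d0 dk; set S := frame_strip _ _ _ _ _.
  have M1 : 0 < `|M| + 1 by rewrite ltr_wpDl.
  (* The averaging radius is [d / (|M| + 1)], so that [g] differs from the graph function by at most
     [d]. *)
  have [g [g' [Dg cg' gg gb]]] := mollified_lipschitz (divr_gt0 d0 M1) gL.
  have gd a : `|g a - gc a| <= d.
    apply: le_trans (gg a) _; rewrite mulrA ler_pdivrMr // mulrC ler_wpM2l ?(ltW d0) // lerDl //.
  (* At depth less than [d] below the graph, the depth below [g] is less than [2 * d] and [T < 0],
     so [theta = 0]. At depth at least [4 * d] it is at least [3 * d] and [T >= 1], so [theta = 1].
     The shift by 2 leaves room for the error [d] between the two graphs. *)
  pose T x := d^-1 * (g (coord x0 e x).1 - (coord x0 e x).2) - 2.
  pose theta x := sg (T x).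
  pose c1 (i : 'I_2) := if i == ord0 then e.1 else e.2.
  pose c2 (i : 'I_2) := if i == ord0 then - e.2 else e.1.
  have eb : `|e.1| <= 1 /\ `|e.2| <= 1.
    by split; rewrite -sqrtr_sqr -[leRHS]sqrtr1 ler_wsqrtr // -e1 ?lerDl ?lerDr sqr_ge0.
  have c1b i : `|c1 i| <= 1 by rewrite /c1; case: ifP => _; case: eb.
  have c2b i : `|c2 i| <= 1 by rewrite /c2; case: ifP => _; rewrite ?normrN; case: eb.
  have D1 i x := (coord_derive x0 e x i).1.
  have D2 i x := (coord_derive x0 e x i).2.
  have DT i x : is_derive x (unit_vec i) T (d^-1 * (g' (coord x0 e x).1 * c1 i - c2 i)).
    have := is_derive_sub (is_derive_scale d^-1 (is_derive_sub (is_derive_comp1 (Dg _) (D1 i x)) (D2 i x))) (is_derive_const 2 x (unit_vec i)).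
    by rewrite subr0.
  have Dt i x : is_derive x (unit_vec i) theta (h (T x) * (d^-1 * (g' (coord x0 e x).1 * c1 i - c2 i))).
    exact: is_derive_comp1 (Ds _) (DT i x).
  have cc1 x := (coord_continuous12 x0 e x).1.
  have cc2 x := (coord_continuous12 x0 e x).2.
  have cT x : {for x, continuous T}.
    apply: continuous_sub; last exact: continuous_const.
    apply: continuous_mul; first exact: continuous_const.
    apply: continuous_sub; last exact: cc2.
    by apply: (continuous_comp1 (cc1 x)); exact: (is_derive_continuousT Dg).
  have Ct : C1 setT theta.
    apply: (@C1_intro _ setT theta (fun i x => h (T x) * (d^-1 * (g' (coord x0 e x).1 * c1 i - c2 i)))) => //; first exact: openT.
      by move=> x _; apply: (continuous_comp1 (cT x)); exact: (is_derive_continuousT Ds).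
    move=> i x _; apply: continuous_mul; first by apply: (continuous_comp1 (cT x)); exact: ch.
    apply: continuous_mul; first exact: continuous_const.
    apply: continuous_sub; last exact: continuous_const.
    apply: continuous_mul; last exact: continuous_const.
    by apply: (continuous_comp1 (cc1 x)); exact: cg'.
  have pt i x : pd [:: i] theta x = h (T x) * (d^-1 * (g' (coord x0 e x).1 * c1 i - c2 i)).
    by rewrite pdE; exact: is_deriveE (Dt i x).
  have b1 x : `|1 - theta x| <= B.
    apply: le_trans (ler_normB _ _) _; rewrite normr1; apply: le_trans (_ : (1 + Bs) * 1 <= _).
      by rewrite mulr1 lerD2l; exact: (bs _).1.
    by apply: ler_wpM2l; [rewrite addr_ge0 // ltW|have := normr_ge0 M; lra].
  have b2 i x : `|pd [:: i] theta x| <= B / d.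
    rewrite pt mulrCA normrM (gtr0_norm (_ : 0 < d^-1)) ?invr_gt0 // mulrC ler_wpM2r ?invr_ge0 ?(ltW d0) // normrM.
    apply: ler_pM => //; first by apply: le_trans (proj2 (bs _)) _; rewrite lerDr.
    apply: le_trans (ler_normB _ _) _; rewrite (_ : `|M| + 2 = `|M| * 1 + 1 + 1); last by ring.
    apply: le_trans (_ : `|M| * 1 + 1 <= _); last by rewrite lerDl.
    by apply: lerD => //; rewrite normrM; apply: ler_pM.
  have Bt : bC1 theta.
    split => //; exists (1 + Bs + B / d + 1); first by rewrite ltr_wpDl // !addr_ge0 ?divr_ge0 // ltW.
    move=> x; split=> [|i]; last first.
      by apply: le_trans (b2 i x) _; rewrite addrAC lerDr addr_ge0 // addr_ge0 // ltW.
    by apply: le_trans (proj1 (bs _)) _; rewrite -addrA addrAC lerDr addr_ge0 // addr_ge0 // divr_ge0 // ltW.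
  have tzero x : gc (coord x0 e x).1 - (coord x0 e x).2 < d -> theta x = 0.
    move=> hx; apply: sz; rewrite /T subr_le0 mulrC ler_pdivrMr //.
    by have := gd (coord x0 e x).1; rewrite ler_norml => /andP[? ?]; lra.
  have tone x : 4 * d <= gc (coord x0 e x).1 - (coord x0 e x).2 -> 1 <= T x.
    move=> hx; rewrite /T lerBrDr mulrC ler_pdivlMr //.
    by have := gd (coord x0 e x).1; rewrite ler_norml => /andP[? ?]; lra.
  have Cet : C1c O (fun x => eta x * theta x).
    split; first exact: (C1_mul openT Be.1 Ct).
    have [_ [K [cK KU e0]]] := Ce.
    exists (K `&` (fun x => gc (coord x0 e x).1 - (coord x0 e x).2) @^-1` [set t | d <= t]); split.
    - apply: compact_closedI => //; apply: closed_comp; last exact: closed_ge.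
      move=> x _; have : {for x, continuous (fun x => gc (coord x0 e x).1 - (coord x0 e x).2)}; last exact.
      apply: continuous_sub; last exact: cc2.
      by apply: (continuous_comp1 (cc1 x)); exact: gcc.
    - move=> x [Kx /= hx]; have [h1 h2] := UP _ (KU _ Kx); apply/OU => //.
      by rewrite -subr_gt0; exact: lt_le_trans hx.
    - move=> x nK; have [Kx|/e0 ->] := pselect (K x); last by rewrite mul0r.
      rewrite tzero ?mulr0 // ltNge; apply/negP => hx; apply: nK; split => //.
  have mS : measurable (S : set mplane) := open_measurable2 (frame_strip_open gcc).
  apply: (energy_cutoff_bound oO F2 f2 df2 Cphi cphi cdphi HF mS (SO d d0 dk) (ltW A0) B0 _ d0 Be Bt Cet) => //.
  - by move=> x; exact: (HA x).1.
  - by move=> i x; exact: (proj2 (HA x) i).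
  - move=> x Ox nS; have [Ux|nU] := pselect (U x); last first.
      have z i := compact_supp_pd i Ce nU.
      by rewrite (z ord0).1 mul0r; split=> // i; rewrite (z i).2 !mul0r.
    have [h1 h2] := UP x Ux; have bg := (OU x h1 h2).1 Ox.
    have T1 : 1 <= T x.
      apply: tone; rewrite leNgt; apply/negP => hx; apply: nS; split; first exact: h1.
      by apply/andP; split; [rewrite ltrBlDr -ltrBlDl; exact: hx|exact: bg].
    have t1 : theta x = 1 by exact: so.
    rewrite t1 subrr !mulr0; split=> // i; rewrite mulr0 pt hz ?mul0r ?mulr0 //.
    by rewrite negb_and -!leNgt T1 orbT.
  have d4 : 0 < 4 * d by rewrite mulr_gt0.
  have := strip_limit (x0 := x0) (r := r') e1 d4 gcc (SO d d0 dk).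
  rewrite (_ : 2 * (4 * d) ^+ 2 = 32 * d ^+ 2); last by ring.
  apply; have tr' : lipschitz_chart O x0 e r' k gam.
    have lt a : `|a| < r' -> `|a| < r by move=> ?; exact: lt_trans r'r.
    split; last by exists M => a b /lt ? /lt ?; exact: ML.
    by split => // [a /lt|a b /lt]; [exact: gk|exact: gO].
  apply: cvg_trans (tr _ tr'); apply: near_eq_cvg; apply: nearW => n.
  by apply: eq_integral => a; rewrite inE /= in_itv /= -ltr_norml => /gcE ->.
(* The depth [4 * dl n] is [ka / 2 / n.+1], below [ka] as required and tending to 0. *)
pose dl n := ka / 8 / n.+1%:R.
have dl0 n : 0 < dl n by rewrite !divr_gt0.
have dlk n : 4 * dl n < ka.
  rewrite /dl mulrA ltr_pdivrMr // (_ : 4 * (ka / 8) = ka * 2^-1); last by field.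
  rewrite ltr_pM2l // (@lt_le_trans _ _ 1) // ?invf_lt1 ?ltr1n //.
  by rewrite ler1n.
pose S n := frame_strip x0 e gc r' (4 * dl n).
have mS n : measurable (S n : set mplane) := open_measurable2 (frame_strip_open gcc).
have iq := density_integrable oO F2 f2 df2.
have lim : \int[area]_(x in S n) density F f df x @[n --> \oo] --> (0 : R).
  have E n : \int[area]_(x in S n) density F f df x = \int[area]_(x in O) (density F f df x * \1_(S n) x).
    rewrite (Rintegral_out (O : set mplane) (S n : set mplane)) //; last 2 first.
    - exact: SO.
    - by move=> x _ nS; rewrite indicE memNset // mulr0.
    by apply: eq_Rintegral => x xS; rewrite indicE xS mulr1.
  have m1 n : measurable_fun (O : set mplane) (\1_(S n) : plane R -> R).
    by apply: measurable_funTS; exact: measurable_indic.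
  have H1 n : measurable_fun (O : set mplane) (fun x => density F f df x * \1_(S n) x).
    by apply: measurable_funM => //; exact: integrable_mfun iq.
  have H3 x : O x -> density F f df x * \1_(S n) x @[n --> \oo] --> (0 : R).
    move=> Ox; apply: cvg_near_cst.
    have [hx|hx] := ltP (coord x0 e x).2 (gc (coord x0 e x).1); last first.
      by apply: nearW => n; rewrite indicE memNset ?mulr0 // => -[_ /andP[_ h']]; move: h'; rewrite ltNge hx.
    have g0 : 0 < gc (coord x0 e x).1 - (coord x0 e x).2 by rewrite subr_gt0.
    have H0 : ka / 2 * (n.+1%:R^-1 : R) @[n --> \oo] --> (0 : R).
      by rewrite -[X in _ --> X](mulr0 (ka / 2)); apply: cvgM; [exact: cvg_cst|exact: cvg_harmonic].
    have H0' := proj1 (cvgrPdist_lt _ _) H0 _ g0; apply: filterS (H0' _) => n.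
    rewrite sub0r normrN => hn; rewrite indicE memNset ?mulr0 // => -[_ /andP[hS _]].
    have En : ka / 2 * n.+1%:R^-1 = 4 * dl n by rewrite /dl; field.
    move: (le_lt_trans (ler_norm _) hn); rewrite En ltrBrDr -ltrBrDl => /lt_trans /(_ hS).
    by rewrite ltxx.
  have H5 n x : O x -> `|density F f df x * \1_(S n) x| <= `|density F f df x|.
    by move=> _; rewrite normrM indicE; case: (x \in S n); rewrite ?normr1 ?mulr1 // normr0 mulr0.
  have L := dominated_Rintegral mO H1 (@measurable_cst _ _ _ _ (O : set mplane) (0 : R)) H3 (integrable_norm iq) H5.
  rewrite Rintegral0 in L.
  by apply: cvg_trans L; apply: near_eq_cvg; apply: nearW => n; rewrite E.
have cl' : A * B * (2 + 32) * \int[area]_(x in S n) density F f df x @[n --> \oo] --> A * B * (2 + 32) * (0 : R).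
  by apply: cvgM; [exact: cvg_cst|exact: lim].
rewrite mulr0 in cl'.
apply/eqP; rewrite -normr_le0.
apply: (ler_cvg_to (cvg_cst `|energy O F f df eta|) cl').
by apply: nearW => n; exact: bound.
Qed.

End Chart.

Section ConstantTrace.
Context {R : realType}.
Notation leb := (@lebesgue_measure R).
Notation mplane := (measurableTypeR R * measurableTypeR R)%type.
Implicit Types (O : set (plane R)) (f p psi : plane R -> R) (F : 'I_2 -> plane R -> R).

Lemma energy_disjoint O F f (df : 'I_2 -> plane R -> R) (U : set (plane R)) eta :
  C1c U eta -> (forall x, O x -> ~ U x) -> energy O F f df eta = 0.
Proof.
move=> Ce OU; rewrite /energy -[RHS](@Rintegral0 _ _ _ area O).
apply: eq_Rintegral => x; rewrite inE => /OU nU.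
have z i := compact_supp_pd i Ce nU.
by rewrite (z ord0).1 (z ord0).2 (z ord_max).2 !mulr0 addr0 mulr0 addr0.
Qed.

(** Convergence of extended integrals to 0 makes them finite only eventually. The shift by [N]
    discards the functions for which some integral may be infinite. *)
Lemma Hcvg_cvgL2 O (phi : nat -> plane R -> R) f : open O -> Hk 1 O f -> (forall n, smooth (phi n)) ->
  Hcvg 1 O phi f -> exists N, forall s, (size s <= 1)%N ->
    cvgL2 area O (fun n => pd s (phi (n + N)%N)) (wD O s f).
Proof.
move=> oO Hf sphi cf; have mO := open_measurable2 oO.
have mp s n : measurable_fun (O : set mplane) (pd s (phi n)).
  by apply: C0_measurable => // x _; exact: smooth_cont (smooth_pd s (sphi n)).
have one s : (size s <= 1)%N -> exists N, forall n, (N <= n)%N -> sqi area O (pd s (phi n)).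
  move=> s1; have [_ /L2_sqi w2] := Hk_wD oO Hf s1.
  move/fine_cvgP: (cf s s1) => [[N _ HN] _]; exists N => n Nn.
  have md : measurable_fun (O : set mplane) (fun x => pd s (phi n) x - wD O s f x).
    by apply: measurable_funB => //; case: w2.
  have d2 : sqi area O (fun x => pd s (phi n) x - wD O s f x).
    split => //; apply/integrableP; split; first by apply: measurable_EFin; exact: measurable_funX.
    under eq_integral do rewrite gee0_abs ?lee_fin ?sqr_ge0 //.
    by have := HN n Nn; rewrite /= fin_numE => /andP[_ hn]; rewrite ltey.
  have := sqi_add mO d2 w2; congr (sqi _ _ _); apply/funext => x; exact: subrK.
have [N0 H0] := one [::] isT; have [N1 H1] := one [:: ord0] isT; have [N2 H2] := one [:: ord_max] isT.
pose N := maxn N0 (maxn N1 N2); exists N => s s1.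
have [_ /L2_sqi w2] := Hk_wD oO Hf s1.
have sn n : sqi area O (pd s (phi (n + N)%N)).
  have [->|[i ->]] := size_le1 s1.
    by apply: H0; apply: leq_trans (leq_addl _ _); exact: leq_maxl.
  have [->|->] := ord2_cases i.
    by apply: H1; apply: leq_trans (leq_addl _ _); rewrite leq_max leq_maxl orbT.
  by apply: H2; apply: leq_trans (leq_addl _ _); rewrite leq_max leq_maxr orbT.
apply/(cvgL2P mO sn w2).
have := cf s s1; rewrite -(cvg_shiftn N); exact.
Qed.

(* Near the boundary, [f] minus its trace is cut off across a strip of width [d];
   the strip estimate bounds the L2 norm of [f] there by [d] times that of its
   gradient, which compensates the factor [1 / d] in the derivative of the cutoff. *)
Lemma constant_trace_orthogonal O F f : lipschitz_open O -> (area O < +oo)%E ->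
  (forall i, L2 O (F i)) ->
  (forall eta, C1c O eta ->
    \int[area]_(x in O) (F ord0 x * pd [:: ord0] eta x + F ord_max x * pd [:: ord_max] eta x) = 0) ->
  const_on_boundary O f ->
  \int[area]_(x in O) (F ord0 x * wD O [:: ord0] f x + F ord_max x * wD O [:: ord_max] f x) = 0.
Proof.
move=> [oO lipO] fO F2 HF [Hf [c [phi [sphi cf tr]]]]; have mO := open_measurable2 oO.
have [N HN] := Hcvg_cvgL2 oO Hf sphi cf.
(* After subtraction of the constant, the approximations tend to 0 on every boundary chart, as
   [chart_energy] requires. *)
pose Phi n x := phi (n + N)%N x - c.
have c2 : sqi area O (fun=> c) by apply/L2_sqi; exact: L2_cst.
have w2 s : (size s <= 1)%N -> sqi area O (wD O s f) by move=> s1; apply/L2_sqi; exact: (Hk_wD oO Hf s1).2.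
have f2 : sqi area O (fun x => wD O [::] f x - c) by apply: (sqi_sub mO) => //; exact: w2.
have df2 i : sqi area O (wD O [:: i] f) by exact: w2.
have F2' i : sqi area O (F i) by apply/L2_sqi; exact: F2.
have CPhi n : C1 setT (Phi n) by apply: (C1_sub2 openT); [exact: smooth_C1|exact: (C1_cst _ openT)].
have cPhi : cvgL2 area O Phi (fun x => wD O [::] f x - c).
  have [s1 s2 cv] := HN [::] isT; split => //; first by move=> n; apply: (sqi_sub mO) => //; exact: s1.
  apply: cvg_trans cv; apply: near_eq_cvg; apply: nearW => n; congr (L2norm _ _ _); apply/funext => x.
  by rewrite /Phi opprB addrA subrK.
have cdPhi i : cvgL2 area O (fun n => pd [:: i] (Phi n)) (wD O [:: i] f).
  have -> : (fun n => pd [:: i] (Phi n)) = (fun n => pd [:: i] (phi (n + N)%N)).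
    apply/funext => n; apply/funext => x; rewrite /Phi (@C1_pd_sub _ setT) //; [|exact: smooth_C1|exact: (C1_cst _ openT)].
    by rewrite [X in _ - X]pdE (is_deriveE (is_derive_const c x _)) subr0.
  exact: HN.
have W := energy_whole oO F2' f2 df2.
apply: W => x.
have [Ox|nOx] := pselect (O x).
  by exists O; split => // eta Ce; exact: (energy_interior oO F2' f2 df2 CPhi cPhi cdPhi HF Ce).
have [cx|ncx] := pselect (closure O x); last first.
  exists (~` closure O); split => //; first exact/closed_openC/closed_closure.
  move=> eta Ce; apply: (energy_disjoint _ _ _ Ce) => y Oy; apply; exact: subset_closure.
have [e [r [k [gam [ch g0]]]]] := lipO x (conj cx nOx).
apply: (chart_energy oO F2' f2 df2 CPhi cPhi cdPhi HF ch g0) => r' ch'.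
by have := tr _ _ _ _ _ ch'; rewrite -(cvg_shiftn N); exact.
Qed.

Lemma rot_grad_divfree O p eta : open O -> Defs.harmonic O p -> C1c O eta ->
  \int[area]_(x in O) (rot_grad p ord0 x * pd [:: ord0] eta x + rot_grad p ord_max x * pd [:: ord_max] eta x) = 0.
Proof.
move=> oO hp Ce; have mO := open_measurable2 oO.
have C i := rot_grad_C1 i oO hp.
have ii i : area.-integrable O (EFin \o (fun x => rot_grad p i x * pd [:: i] eta x)).
  have E : (fun x => rot_grad p i x * pd [:: i] eta x) = (fun x => pd [:: i] eta x * rot_grad p i x) by apply/funext => x; rewrite mulrC.
  by rewrite E; apply: Cc_integrableO => //; apply: Cc_mul (C1c_pd_Cc i Ce) (C1_C0 (C i)).
rewrite (RintegralD mO (ii ord0) (ii ord_max)) !(integration_by_parts2 _ oO Ce (C _)).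
have jj i : area.-integrable O (EFin \o (fun x => pd [:: i] (rot_grad p i) x * eta x)).
  have E : (fun x => pd [:: i] (rot_grad p i) x * eta x) = (fun x => eta x * pd [:: i] (rot_grad p i) x) by apply/funext => x; rewrite mulrC.
  by rewrite E; apply: Cc_integrableO => //; apply: Cc_mul (C1c_Cc Ce) (C1_pd_C0 i (C i)).
rewrite -opprD -(RintegralD mO (jj ord0) (jj ord_max)); apply/eqP; rewrite oppr_eq0; apply/eqP.
rewrite -[RHS](@Rintegral0 _ _ _ area O); apply: eq_Rintegral => x; rewrite inE => Ox.
have E0 : pd [:: ord0] (rot_grad p ord0) x = - pd [:: ord0; ord_max] p x.
  rewrite pdE; apply: is_deriveE; rewrite /rot_grad /=.
  exact: (is_derive_opp (C1_derive ord0 (harmonic_C1_pd (s := [:: ord_max]) oO hp isT) Ox)).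
have E1 : pd [:: ord_max] (rot_grad p ord_max) x = pd [:: ord_max; ord0] p x.
  rewrite pdE; apply: is_deriveE; rewrite /rot_grad /=.
  exact: (C1_derive ord_max (harmonic_C1_pd (s := [:: ord0]) oO hp isT) Ox).
by rewrite E0 E1 (harmonic_pdC oO hp Ox) mulNr addNr.
Qed.

Lemma divfree_orthogonal O F psi k : open O -> (0 < k)%N -> (forall i, L2 O (F i)) ->
  (forall eta, C1c O eta ->
    \int[area]_(x in O) (F ord0 x * pd [:: ord0] eta x + F ord_max x * pd [:: ord_max] eta x) = 0) ->
  H0k k O psi ->
  \int[area]_(x in O) (F ord0 x * wD O [:: ord0] psi x + F ord_max x * wD O [:: ord_max] psi x) = 0.
Proof.
move=> oO k0 F2 HF H0; have mO := open_measurable2 oO.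
have [phi [tphi cphi]] := H0k_approx oO H0.
have F2' i : sqi area O (F i) by apply/L2_sqi; exact: F2.
have c i := cphi [:: i] k0.
have w2 i : sqi area O (wD O [:: i] psi) by case: (c i).
have p2 i n : sqi area O (pd [:: i] (phi n)) by case: (c i).
have l i := cvgL2_mul mO (cvgL2_cst (F2' i)) (c i).
have lim := cvgD (l ord0) (l ord_max).
rewrite (RintegralD mO (sqi_mul mO (F2' ord0) (w2 ord0)) (sqi_mul mO (F2' ord_max) (w2 ord_max))).
apply: (cvg_unique _ (lim _)) => //.
apply: cvg_near_cst; apply: nearW => n.
rewrite -[RHS](HF _ (test_C1c (tphi n))).
by rewrite (RintegralD mO (sqi_mul mO (F2' ord0) (p2 ord0 n)) (sqi_mul mO (F2' ord_max) (p2 ord_max n))).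
Qed.

Lemma rot_grad_zero O p : open O -> Defs.harmonic O p -> (forall i, L2 O (rot_grad p i)) ->
  \int[area]_(x in O) (rot_grad p ord0 x * rot_grad p ord0 x + rot_grad p ord_max x * rot_grad p ord_max x) = 0 ->
  grad_zero O p.
Proof.
move=> oO hp F2 I0; have mO := open_measurable2 oO.
have F2' i : sqi area O (rot_grad p i) by apply/L2_sqi; exact: F2.
have sq (a b : R) : 0 <= a * a + b * b by rewrite -!expr2 addr_ge0 ?sqr_ge0.
have sq0 (a b : R) : a * a + b * b = 0 -> a = 0 /\ b = 0.
  by move=> /eqP; rewrite -!expr2 paddr_eq0 ?sqr_ge0 // !sqrf_eq0 => /andP[/eqP -> /eqP ->].
have Z := ae_zero_of_integral_zero mO (integrableD_EFin mO (sqi_mul mO (F2' ord0) (F2' ord0)) (sqi_mul mO (F2' ord_max) (F2' ord_max))) (fun x _ => sq _ _) I0.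
have Z' i : ae_on O (fun x => rot_grad p i x = 0).
  by apply: (ae_on_imply Z) => x _ /sq0[z0 z1]; have [->|->] := ord2_cases i.
have Z0 i := C0_ae_eq oO (rot_grad_C0 (i := i) oO hp) (@C0_cst _ O 0) (Z' i).
move=> x Ox i; rewrite -pdE; have [->|->] := ord2_cases i; first exact: Z0 ord_max x Ox.
by have := Z0 ord0 x Ox; rewrite /rot_grad /= => /eqP; rewrite oppr_eq0 => /eqP.
Qed.

(** The sign [sg] treats $f=\Delta\psi$ and $f=w=-\Delta\psi$ together: $F=\mathrm{sg}\,\nabla
    f+\lambda\nabla\psi$. Square integrability of $F$ comes from this formula, and $F$ is orthogonal
    to each of the two terms. *)
Lemma constant_trace_grad_zero O p psi f (lam sg : R) : lipschitz_open O -> (area O < +oo)%E ->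
  Defs.harmonic O p -> H0k 2 O psi ->
  (forall i, is_wD O [:: i] (fun x => wlap O psi x + lam * psi x) (rot_grad p i)) ->
  ae_on O (fun x => wlap O psi x = sg * f x) -> const_on_boundary O f -> grad_zero O p.
Proof.
move=> lO fO hp H0 Wq fE cf; have [oO _] := lO; have mO := open_measurable2 oO.
have H2 := H0.1; have Hf := cf.1.
have wL := wlap_L2 oO H2.
have W1 i : is_wD O [:: i] (wlap O psi) (fun x => sg * wD O [:: i] f x).
  have [wf [mw _]] := Hk_wD (s := [:: i]) oO Hf isT.
  apply: (is_wD_ae oO (is_wD_scale sg oO wf)); last 2 first.
  - by apply: (ae_on_imply fE) => x _ ->.
  - exact: ae_on_all.
  - by case: wL.
  - by apply: measurable_funM.
have W2 i : is_wD O [:: i] psi (wD O [:: i] psi) /\ L2 O (wD O [:: i] psi) := Hk_wD (s := [:: i]) oO H2 isT.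
have FE i : ae_on O (fun x => sg * wD O [:: i] f x + lam * wD O [:: i] psi x = rot_grad p i x).
  exact: (is_wD_unique oO (is_wD_add oO (W1 i) (is_wD_scale lam oO (W2 i).1)) (Wq i)).
have df2 i : L2 O (wD O [:: i] f) by exact: (Hk_wD (s := [:: i]) oO Hf isT).2.
have mF i : measurable_fun (O : set mplane) (rot_grad p i) by apply: C0_measurable => //; exact: rot_grad_C0.
have F2 i : L2 O (rot_grad p i).
  apply: (L2_ae oO (mF i) (FE i)).
  by apply: (L2_add oO); apply: (L2_scale _ oO) => //; exact: (W2 i).2.
have HF eta := @rot_grad_divfree O p eta oO hp.
have I1 := constant_trace_orthogonal lO fO F2 HF cf.
have I2 := divfree_orthogonal oO (isT : (0 < 2)%N) F2 HF H0.
apply: (rot_grad_zero oO hp F2).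
have m2 i := L2_integrable_mul oO (F2 i) (df2 i); have m3 i := L2_integrable_mul oO (F2 i) (W2 i).2.
transitivity (sg * 0 + lam * 0 : R); last by rewrite !mulr0 addr0.
rewrite -{1}I1 -I2 -(RintegralZl _ mO (integrableD_EFin mO (m2 ord0) (m2 ord_max))).
rewrite -(RintegralZl _ mO (integrableD_EFin mO (m3 ord0) (m3 ord_max))).
rewrite -(RintegralD mO); last 2 first.
- exact: (integrableZ_EFin _ mO (integrableD_EFin mO (m2 ord0) (m2 ord_max))).
- exact: (integrableZ_EFin _ mO (integrableD_EFin mO (m3 ord0) (m3 ord_max))).
have mw i : measurable_fun (O : set mplane) (wD O [:: i] f) := (df2 i).1.
have mw' i : measurable_fun (O : set mplane) (wD O [:: i] psi) := (W2 i).2.1.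
apply: (ae_on_eq_Rintegral oO).
- by apply: measurable_funD; apply: measurable_funM.
- by apply: measurable_funD; apply: measurable_funM => //; apply: measurable_funD; apply: measurable_funM.
- apply: (ae_on_imply2 (FE ord0) (FE ord_max)) => x _.
  set F0 := rot_grad _ _ _; set F1 := rot_grad _ _ _.
  set a := wD _ _ _ _; set b := wD _ _ _ _; set c := wD _ _ _ _; set d := wD _ _ _ _ => e0 e1.
  by rewrite -{2}e0 -{2}e1; ring.
Qed.

End ConstantTrace.

#[local] Transparent pd.

(** * Flows orthogonal to the pressure gradient *)

Section ContinuousRepresentative.
Context {R : realType}.
Notation leb := (@lebesgue_measure R).
Notation mplane := (measurableTypeR R * measurableTypeR R)%type.
Implicit Types (O : set (plane R)) (f phi psi : plane R -> R).

Lemma pd_out (K : set (plane R)) f (s : seq 'I_2) : compact K -> (forall x, ~ K x -> f x = 0) ->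
  forall x, ~ K x -> pd s f x = 0.
Proof. exact: iter_deriv_out. Qed.

Lemma pd_nil f : pd [::] f = f. Proof. by []. Qed.

Lemma smooth_pd_lin f g (c : R) (s : seq 'I_2) x : smooth f -> smooth g ->
  pd s (fun x => f x + c * g x) x = pd s f x + c * pd s g x.
Proof.
move=> sf sg; elim: s x => [//|i s IH] x.
have -> : pd (i :: s) (fun x => f x + c * g x) x = 'D_(unit_vec i) (pd s (fun x => f x + c * g x)) x by [].
rewrite (_ : pd s (fun x => f x + c * g x) = (fun x => pd s f x + c * pd s g x)); last exact/funext.
by apply: is_deriveE; apply: is_derive_add; [|apply: is_derive_scale]; apply: smooth_is_derive; exact: smooth_pd.
Qed.

#[local] Opaque pd wD Rintegral.

Lemma cvg0_small (u : nat -> R) : u n @[n --> \oo] --> (0 : R) ->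
  forall e, 0 < e -> exists N, forall n, (N <= n)%N -> u n <= e.
Proof.
move=> cu e e0; have [N _ HN] := proj1 (cvgrPdist_le _ _) cu _ e0.
exists N => n Nn; have := HN n Nn; rewrite /= sub0r normrN.
by apply: le_trans; exact: ler_norm.
Qed.

Lemma derive_le_integral (F g : R -> R) (M x : R) : 0 < M -> (forall t : R, is_derive t 1 F (g t)) ->
  continuous g -> (forall t, ~ (- M <= t <= M) -> F t = 0 /\ g t = 0) ->
  `|F x| <= \int[leb]_t `|g t|.
Proof.
move=> M0 D cg out.
have mT : measurable (setT : set (measurableTypeR R)) by exact: measurableT.
have mi (a b : R) : measurable (`[a, b]%classic : set (measurableTypeR R)) by exact: measurable_itv.
have ig : leb.-integrable setT (EFin \o g).
  apply: (integrable_out (setT : set (measurableTypeR R)) `[- M, M]%classic) => //.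
    by move=> t _ /= nt; apply: (out t _).2 => h; apply: nt; rewrite in_itv.
  by apply: integrable_continuous_itv => t _; exact: cg.
have ian : leb.-integrable setT (EFin \o (fun t => `|g t|)) := integrable_norm ig.
have [xM|xM] := leP x (- M).
  have lt : x - 1 < - M by lra.
  have z : F x = 0.
    move: xM; rewrite le_eqVlt => /orP[/eqP xM|xM]; last by apply: (out x _).1 => /andP[h _]; lra.
    have c : F (x - 1) = 0 by apply: (out _ _).1 => /andP[h _]; lra.
    have xx : x - 1 < x by lra.
    have [y /andP[y1 y2] E] := mvt_lin xx (fun t _ => D t).
    by move: E; rewrite c subr0 (out y _).2 ?mul0r // => /andP[h _]; lra.
  by rewrite z normr0; apply: Rintegral_ge0 => t _; exact: normr_ge0.
have F0 : F (- M - 1) = 0 by apply: (out _ _).1 => /andP[h _]; lra.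
have xx : - M - 1 <= x by lra.
have <- : \int[leb]_(t in `[- M - 1, x]) g t = F x.
  by rewrite (FTC2 xx (fun t _ => D t)) ?F0 ?subr0 // => t _; exact: cg.
apply: (@le_trans _ _ (\int[leb]_(t in `[- M - 1, x]) `|g t|)).
  apply: (le_normr_RintegralM (mi _ _)) => //.
    by apply: integrableS ig.
  by apply: integrableS ian.
by apply: ge0_Rintegral_subset.
Qed.

(** A test function is the iterated integral of its mixed second derivative, so in the plane two
    derivatives in $L^1$ control the supremum. *)
Lemma sup_le_integral O phi x : test O phi ->
  `|phi x| <= \int[area]_z `|pd [:: ord_max; ord0] phi z|.
Proof.
move=> T; have [sphi [K [cK KO phi0]]] := T.
have [M M0 KM] := compact_box cK.
have d (i : 'I_2) g z : smooth g -> is_derive z (unit_vec i) g (pd [:: i] g z).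
  by move=> sg; rewrite pdE; exact: smooth_is_derive.
have out s z : ~ box (- M) M (- M) M z -> pd s phi z = 0.
  by move=> nb; apply: (pd_out s (@box_compact _ (- M) M (- M) M) _ nb) => y ny; apply: phi0 => /KM.
have s0 := smooth_pd [:: ord0] sphi.
have i2 : area.-integrable setT (EFin \o (fun z => `|pd [:: ord_max; ord0] phi z|)).
  by apply: integrable_norm; apply: (@Cc_integrable _ O); apply: test_Cc; exact: test_pd.
have k1 (s y : R) : `|pd [:: ord0] phi (s, y)| <= \int[leb]_t `|pd [:: ord_max; ord0] phi (s, t)|.
  have D (t : R) : is_derive t 1 (fun t => pd [:: ord0] phi (s, t)) (pd [:: ord_max; ord0] phi (s, t)).
    by apply/is_derive_slice1; exact: (d _ ord_max _ (s, t) s0).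
  have c : continuous (fun t => pd [:: ord_max; ord0] phi (s, t)).
    by move=> t; apply: continuous_slice1; exact: smooth_cont (smooth_pd [:: ord_max; ord0] sphi).
  have o t : ~ (- M <= t <= M) -> pd [:: ord0] phi (s, t) = 0 /\ pd [:: ord_max; ord0] phi (s, t) = 0.
    by move=> nt; split; apply: out => -[/= _]; rewrite in_itv.
  exact: (derive_le_integral y M0 D c o).
case: x => x y.
apply: le_trans (_ : `|phi (x, y)| <= \int[leb]_s `|pd [:: ord0] phi (s, y)|) _.
  have D (t : R) : is_derive t 1 (fun t => phi (t, y)) (pd [:: ord0] phi (t, y)).
    by apply/is_derive_slice0; exact: (d _ ord0 _ (t, y) sphi).
  have c : continuous (fun t => pd [:: ord0] phi (t, y)).
    by move=> t; apply: continuous_slice0; exact: smooth_cont (smooth_pd [:: ord0] sphi).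
  have o t : ~ (- M <= t <= M) -> phi (t, y) = 0 /\ pd [:: ord0] phi (t, y) = 0.
    move=> nt; have nb : ~ box (- M) M (- M) M (t, y) by case=> /=; rewrite in_itv.
    by split; [have := out [::] _ nb; rewrite pd_nil|exact: out].
  exact: (derive_le_integral x M0 D c o).
rewrite (Rintegral_prod12 (m1 := leb) (m2 := leb) i2).
apply: le_Rintegral => //.
  apply: integrable_norm.
  apply: (integrable_out (setT : set (measurableTypeR R)) `[- M, M]%classic) => //.
    by move=> s _ /= ns; apply: out => -[/=]; rewrite in_itv.
  by apply: integrable_continuous_itv => s _; apply: continuous_slice0; exact: smooth_cont (smooth_pd [:: ord0] sphi).
exact: (integrable_prod1 (m1 := leb) (m2 := leb) i2).
Qed.

(** On a set of finite area the $L^2$ norm of the mixed derivative bounds its $L^1$ norm, so by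
    [sup_le_integral] the approximating test functions are uniformly Cauchy. They are 0 outside of
    [O], hence so is their limit. *)
Lemma H02_continuous O psi : open O -> (area O < +oo)%E -> H0k 2 O psi ->
  exists f, [/\ C0 setT f, forall x, ~ O x -> f x = 0 & ae_on O (fun x => psi x = f x)].
Proof.
move=> oO fO H0; have mO := open_measurable2 oO.
have [phi [tphi cphi]] := H0k_approx oO H0.
pose s2 : seq 'I_2 := [:: ord_max; ord0].
pose d n := L2norm area O (fun x => pd s2 (phi n) x - wD O s2 psi x).
have [sp sw cd] := cphi s2 isT.
have one : sqi area O (fun=> 1) by apply/L2_sqi; exact: L2_cst.
pose C := L2norm area O (fun=> 1).
have C0' : 0 <= C by exact: L2norm_ge0.
have key (a b c r : R) : r = a - b -> `|r| <= `|a - c| * 1 + `|b - c| * 1.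
  by move=> ->; rewrite !mulr1 (distrC b) (_ : a - b = (a - c) + (c - b)) ?ler_normD //; ring.
have bnd n m x : `|phi n x - phi m x| <= C * (d n + d m).
  have T : test O (fun x => phi n x + -1 * phi m x) by apply: test_add => //; exact: test_scale.
  have := sup_le_integral x T; rewrite mulN1r => /le_trans; apply.
  have pE z : pd s2 (fun x => phi n x + -1 * phi m x) z = pd s2 (phi n) z - pd s2 (phi m) z.
    by rewrite (smooth_pd_lin _ _ _ (tphi n).1 (tphi m).1) mulN1r.
  have Cd : Cc O (pd s2 (fun x => phi n x + -1 * phi m x)) by apply: test_Cc; exact: test_pd.
  have Cda : Cc O (fun z => `|pd s2 (fun x => phi n x + -1 * phi m x) z|).
    split; first by move=> z _; apply: continuous_comp1; [exact: Cd.1|exact: norm_continuous].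
    by have [_ [K [cK KO k0]]] := Cd; exists K; split => // z /k0 ->; rewrite normr0.
  rewrite -(Cc_Rintegral oO Cda).
  have s1 : sqi area O (fun z => `|pd s2 (phi n) z - wD O s2 psi z|).
    apply: (sqi_le mO _ (sqi_sub mO (sp n) sw)) => [|z _]; last by rewrite normr_id.
    by apply: measurableT_comp => //; have [] := sqi_sub mO (sp n) sw.
  have s1' : sqi area O (fun z => `|pd s2 (phi m) z - wD O s2 psi z|).
    apply: (sqi_le mO _ (sqi_sub mO (sp m) sw)) => [|z _]; last by rewrite normr_id.
    by apply: measurableT_comp => //; have [] := sqi_sub mO (sp m) sw.
  have i1 := sqi_mul mO s1 one; have i1' := sqi_mul mO s1' one.
  apply: (@le_trans _ _ (\int[area]_(z in O) (`|pd s2 (phi n) z - wD O s2 psi z| * 1 + `|pd s2 (phi m) z - wD O s2 psi z| * 1))).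
    apply: (le_Rintegral mO (Cc_integrableO oO Cda) (integrableD_EFin mO i1 i1')) => z _.
    exact: (key _ _ _ _ (pE z)).
  rewrite (RintegralD mO i1 i1') mulrDr.
  have nE k : L2norm area O (fun z => `|pd s2 (phi k) z - wD O s2 psi z|) = d k.
    by rewrite /d /L2norm; congr Num.sqrt; apply: eq_Rintegral => z _; rewrite real_normK ?num_real.
  apply: lerD; (apply: le_trans (ler_norm _) _).
    by rewrite -(nE n) [leRHS]mulrC; exact: (cauchy_schwarz_L2 mO s1 one).
  by rewrite -(nE m) [leRHS]mulrC; exact: (cauchy_schwarz_L2 mO s1' one).
have Cd0 : C * d n @[n --> \oo] --> (0 : R).
  by rewrite -[X in _ --> X](mulr0 C); apply: cvgM; [exact: cvg_cst|exact: cd].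
have cv x : exists l : R, phi n x @[n --> \oo] --> l.
  suff h : cvg (phi n x @[n --> \oo]) by exists (lim (phi n x @[n --> \oo])).
  apply: cauchy_cvg; apply: cauchy_exP => e e0.
  have e4 : 0 < e / 4 by rewrite divr_gt0.
  have [N HN] := cvg0_small Cd0 e4.
  exists (phi N x); exists N => // n /= Nn; rewrite /ball /=.
  apply: le_lt_trans (bnd N n x) _; rewrite mulrDr.
  apply: le_lt_trans (lerD (HN N (leqnn N)) (HN n Nn)) _; lra.
have [f Hf] := choice cv.
have bf n x : `|phi n x - f x| <= C * d n.
  have l1 : `|phi n x - phi m x| @[m --> \oo] --> `|phi n x - f x|.
    by apply: cvg_norm; apply: cvgB; [exact: cvg_cst|exact: Hf].
  have l2 : C * (d n + d m) @[m --> \oo] --> C * (d n + 0).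
    by apply: cvgM; [exact: cvg_cst|apply: cvgD; [exact: cvg_cst|exact: cd]].
  rewrite addr0 in l2; apply: (ler_cvg_to l1 l2).
  by apply: nearW => m; exact: bnd.
have cf : C0 setT f.
  move=> x _; apply/cvgrPdist_le => e e0.
  have e3 : 0 < e / 3 by rewrite divr_gt0.
  have [N HN] := cvg0_small Cd0 e3.
  have hN y : `|phi N y - f y| <= e / 3.
    exact: le_trans (bf N y) (HN N (leqnn N)).
  have cN : {for x, continuous (phi N)} by exact: smooth_cont (tphi N).1.
  have cN' := proj1 (cvgrPdist_le _ _) cN _ e3; apply: filterS (cN' _) => y hy.
  have E : f x - f y = - (phi N x - f x) + (phi N x - phi N y) + (phi N y - f y) by ring.
  rewrite E (_ : e = e / 3 + e / 3 + e / 3); last by field.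
  apply: le_trans (ler_normD _ _) _; apply: lerD; last exact: hN.
  by apply: le_trans (ler_normD _ _) _; apply: lerD; [rewrite normrN; exact: hN|exact: hy].
exists f; split => //.
- move=> x nO; apply: (cvg_unique _ (Hf x)) => //; apply: cvg_near_cst; apply: nearW => n.
  by have [_ [K [_ KO k0]]] := tphi n; apply: k0 => /KO.
have c0 := cphi [::] isT.
have w0 : ae_on O (fun x => wD O [::] psi x = psi x) := wD_nil oO (L2_L1loc oO H0.1.1).
have ff : sqi area O f.
  have [M M0 HM] := Cc_bounded (test_Cc (tphi 0%N)).
  have mf : measurable_fun (O : set mplane) f by apply: measurable_funTS; apply: (C0_measurable openT).
  apply: (sqi_le mO mf (sqi_scale mO (M + C * d 0%N) one)) => x _; rewrite mulr1.
  apply: le_trans (ler_norm _); rewrite (_ : f x = phi 0%N x - (phi 0%N x - f x)); last by ring.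
  by apply: le_trans (ler_normB _ _) _; apply: lerD; [exact: HM|exact: bf].
have [s0 sw0 _] := c0.
have cfn : cvgL2 area O phi f.
  split => //.
  have le n : L2norm area O (fun x => phi n x - f x) <= C * d n * C.
    apply: (L2norm_le mO _ (sqi_sub mO (s0 n) ff) one) => [|x _].
      by rewrite mulr_ge0 // L2norm_ge0.
    by rewrite normr1 mulr1; exact: bf.
  apply: (squeeze_cvgr (f := fun=> 0) (h := fun n => C * d n * C)).
  - by apply: nearW => n; rewrite L2norm_ge0 le.
  - exact: cvg_cst.
  - by rewrite -[X in _ --> X](mul0r C); apply: cvgM; [exact: Cd0|exact: cvg_cst].
suff E : ae_on O (fun x => wD O [::] psi x = f x).
  by apply: (ae_on_imply2 w0 E) => x _ <-.
apply: (fundamental_eq oO (L2_L1loc oO (proj2 (L2_sqi _ _) sw0)) (L2_L1loc oO (proj2 (L2_sqi _ _) ff))) => h Th.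
have sh : sqi area O h by apply/L2_sqi; exact: Cc_L2 oO (test_Cc Th).
have l1 := cvgL2_mul mO cfn (cvgL2_cst sh).
exact: (cvg_unique _ (cvgL2_mul mO c0 (cvgL2_cst sh)) l1).
Qed.

End ContinuousRepresentative.

(** * Orthogonality of the gradients of the stream function and the pressure *)

Section OrthogonalGradients.
Context {R : realType}.
Notation mplane := (measurableTypeR R * measurableTypeR R)%type.
Implicit Types (O : set (plane R)) (f g p psi : plane R -> R).

Lemma pd_cons i (s : seq 'I_2) f : pd (i :: s) f = pd [:: i] (pd s f).
Proof. by []. Qed.

(** The new index comes last because the derivative of the test function along [i] is taken first;
    no symmetry of weak second derivatives enters. *)
Lemma is_wD_iter O psi i j k : open O -> (1 < k)%N -> Hk k O psi ->
  is_wD O [:: i] (wD O [:: j] psi) (wD O [:: j; i] psi).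
Proof.
move=> oO k1 H.
have [[L0 L1 H1] _] := Hk_wD (s := [:: j]) oO H (ltnW k1).
have [[_ L2 H2] _] := Hk_wD (s := [:: j; i]) oO H k1.
split=> // phi T; have := H1 _ (test_pd [:: i] T); have := H2 _ T.
rewrite -(pd_cons j [:: i]) => ->; rewrite /= sqrrN expr1n mul1r !expr1 !mulN1r => ->.
by rewrite opprK.
Qed.

Lemma curl_gradient_zero O f eta : open O -> C1 O f -> test O eta ->
  \int[area]_(x in O) (pd [:: ord0] f x * pd [:: ord_max] eta x - pd [:: ord_max] f x * pd [:: ord0] eta x) = 0.
Proof.
move=> oO Cf T; have mO := open_measurable2 oO.
have ii i j : area.-integrable O (EFin \o (fun x => pd [:: i] f x * pd [:: j] eta x)).
  by apply: L1loc_Cc => //; [apply: C0_L1loc => //; exact: C1_pd_C0|apply: test_Cc; exact: test_pd].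
rewrite (RintegralB mO (ii ord0 ord_max) (ii ord_max ord0)).
have ibp i j : \int[area]_(x in O) (pd [:: i] f x * pd [:: j] eta x) = - \int[area]_(x in O) (f x * pd [:: i; j] eta x).
  have := integration_by_parts2 i oO (test_C1c (test_pd [:: j] T)) Cf.
  by rewrite -(pd_cons i [:: j]) => ->; rewrite opprK.
by rewrite !ibp (smooth_pdC2 ord0 ord_max T.1) subrr.
Qed.

Lemma cvgL2_mul3 O (an bn : nat -> plane R -> R) (a b h : plane R -> R) : open O ->
  cvgL2 area O an a -> cvgL2 area O bn b -> Cc O h ->
  [/\ forall n, area.-integrable O (EFin \o (fun x => an n x * bn n x * h x)),
      area.-integrable O (EFin \o (fun x => a x * b x * h x)) &
      \int[area]_(x in O) (an n x * bn n x * h x) @[n --> \oo] --> \int[area]_(x in O) (a x * b x * h x)].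
Proof.
move=> oO ca cb ch; have mO := open_measurable2 oO.
have [M M0 HM] := Cc_bounded ch; have mh : measurable_fun (O : set mplane) h by exact: Cc_measurable ch.
have c := cvgL2_bndM mO cb mh (fun x _ => HM x).
have E (u v : plane R -> R) : (fun x => u x * v x * h x) = (fun x => u x * (v x * h x)) by apply/funext => x; rewrite mulrA.
have [sa sa' _] := ca; have [sc sc' _] := c.
split; [by move=> n; rewrite E; exact: (sqi_mul mO)|by rewrite E; exact: (sqi_mul mO)|].
by under eq_fun do rewrite E; rewrite E; exact: (cvgL2_mul mO ca c).
Qed.

(* The hypothesis is [curl ((u . grad) u) = 0] tested with [eta].  Up to a gradient,
   [(u . grad) u] is [- Delta psi grad psi], where [Delta psi = Q - lam psi]. *)
Lemma orthogonal_gradients O p psi (lam : R) (Q : plane R -> R) : open O -> Defs.harmonic O p -> H0k 2 O psi ->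
  C0 O Q -> (forall i x, O x -> is_derive x (unit_vec i) Q (rot_grad p i x)) ->
  ae_on O (fun x => wlap O psi x + lam * psi x = Q x) ->
  (forall eta, test O eta -> \int[area]_(x in O)
     (- (wD O [:: ord_max] psi x * wD O [:: ord_max; ord0] psi x - wD O [:: ord0] psi x * wD O [:: ord_max; ord_max] psi x) * pd [:: ord_max] eta x +
      (- (wD O [:: ord_max] psi x * wD O [:: ord0; ord0] psi x) + wD O [:: ord0] psi x * wD O [:: ord0; ord_max] psi x) * pd [:: ord0] eta x) = 0) ->
  ae_on O (fun x => wD O [:: ord0] psi x * pd [:: ord0] p x + wD O [:: ord_max] psi x * pd [:: ord_max] p x = 0).
Proof.
move=> oO hp H0 cQ dQ QE NC; have mO := open_measurable2 oO.
have [phi [tphi cphi]] := H0k_approx oO H0.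
have CQ : C1 O Q by apply: (C1_intro oO cQ dQ) => i; exact: rot_grad_C0.
have dQE i x : O x -> pd [:: i] Q x = rot_grad p i x by move=> Ox; rewrite pdE; exact: is_deriveE (dQ i x Ox).
have Cp := harmonic_C1 oO hp.
have Cpp i := harmonic_C1_pd (s := [:: i]) oO hp isT.
have c s : (size s <= 2)%N -> cvgL2 area O (fun n => pd s (phi n)) (wD O s psi) := cphi s.
have key eta : test O eta -> \int[area]_(x in O)
    ((wD O [:: ord0] psi x * pd [:: ord0] p x + wD O [:: ord_max] psi x * pd [:: ord_max] p x) * eta x) = 0.
  move=> T; have Te i := test_Cc (test_pd [:: i] T).
  pose I2 (u v h : plane R -> R) := \int[area]_(x in O) (u x * v x * h x).
  pose g n s := pd s (phi n).
  have sg n s : smooth (g n s) by apply: smooth_pd; exact: (tphi n).1.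
  have gE n i s x : pd [:: i] (g n s) x = g n (i :: s) x by [].
  have gC n i j x : g n [:: i; j] x = g n [:: j; i] x by rewrite /g (smooth_pdC2 i j (tphi n).1).
  have lim s t i : (size s <= 2)%N -> (size t <= 2)%N ->
     [/\ forall n, area.-integrable O (EFin \o (fun x => g n s x * g n t x * pd [:: i] eta x)),
      area.-integrable O (EFin \o (fun x => wD O s psi x * wD O t psi x * pd [:: i] eta x)) &
      I2 (g n s) (g n t) (pd [:: i] eta) @[n --> \oo] --> I2 (wD O s psi) (wD O t psi) (pd [:: i] eta)].
    by move=> hs ht; exact: (cvgL2_mul3 oO (c s hs) (c t ht) (Te i)).
  have [j1 i1 l1] := lim [:: ord_max] [:: ord_max; ord0] ord_max isT isT.
  have [j2 i2 l2] := lim [:: ord0] [:: ord0; ord0] ord_max isT isT.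
  have [j3 i3 l3] := lim [:: ord0] [:: ord0; ord_max] ord0 isT isT.
  have [j4 i4 l4] := lim [:: ord_max] [:: ord_max; ord_max] ord0 isT isT.
  have [_ i5 _] := lim [:: ord0] [:: ord_max; ord_max] ord_max isT isT.
  have [_ i6 _] := lim [:: ord_max] [:: ord0; ord0] ord0 isT isT.
  have [j7 i7 l7] := lim [::] [:: ord0] ord_max isT isT.
  have [j8 i8 l8] := lim [::] [:: ord_max] ord0 isT isT.
  have fin4 (A B C D : plane R -> R) : area.-integrable O (EFin \o A) -> area.-integrable O (EFin \o B) ->
      area.-integrable O (EFin \o C) -> area.-integrable O (EFin \o D) ->
      \int[area]_(x in O) ((A x + B x) - (C x + D x)) =
      \int[area]_(x in O) A x + \int[area]_(x in O) B x - (\int[area]_(x in O) C x + \int[area]_(x in O) D x).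
    move=> iA iB iC iD; rewrite -(RintegralD mO iA iB) -(RintegralD mO iC iD) -(RintegralB mO) //; exact: (integrableD_EFin mO).
  (* The curl of $\nabla(|\nabla\psi|^2/2)$ is 0: true for the approximating test functions, and
     each product converges as an $L^2$ pairing. *)
  have P : I2 (wD O [:: ord_max] psi) (wD O [:: ord_max; ord0] psi) (pd [:: ord_max] eta) +
     I2 (wD O [:: ord0] psi) (wD O [:: ord0; ord0] psi) (pd [:: ord_max] eta) -
     (I2 (wD O [:: ord0] psi) (wD O [:: ord0; ord_max] psi) (pd [:: ord0] eta) +
     I2 (wD O [:: ord_max] psi) (wD O [:: ord_max; ord_max] psi) (pd [:: ord0] eta)) = 0.
    apply: (cvg_unique _ (cvgB (cvgD l1 l2) (cvgD l3 l4))) => //.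
    apply: cvg_near_cst; apply: nearW => n.
    rewrite -[RHS](curl_gradient_zero (f := fun x => 2^-1 * (g n [:: ord0] x ^+ 2 + g n [:: ord_max] x ^+ 2)) oO _ T); last first.
      by apply: smooth_C1; apply: smooth_scale; apply: smooth_add; exact: smooth_exp.
    apply: etrans (esym (fin4 _ _ _ _ (j1 n) (j2 n) (j3 n) (j4 n))) _; apply: eq_Rintegral => x _.
    have D i : pd [:: i] (fun x => 2^-1 * (g n [:: ord0] x ^+ 2 + g n [:: ord_max] x ^+ 2)) x =
        g n [:: ord0] x * g n [:: i; ord0] x + g n [:: ord_max] x * g n [:: i; ord_max] x.
      rewrite pdE; apply: is_deriveE.
      have d s : is_derive x (unit_vec i) (g n s) (g n (i :: s) x) by rewrite -gE pdE; exact: smooth_is_derive.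
      apply: is_derive_eq' (is_derive_scale 2^-1 (is_derive_add (is_derive_exp 2 (d [:: ord0])) (is_derive_exp 2 (d [:: ord_max])))) _.
      have aux (a1 a2 a3 a4 : R) : 2^-1 * (2%:R * a1 ^+ 1 * a2 + 2%:R * a3 ^+ 1 * a4) = a1 * a2 + a3 * a4 by rewrite !expr1; field.
      exact: aux.
    rewrite !D (gC n ord_max ord0).
    have aux (a1 a2 b0 b1 b2 e0 e1 : R) : a2 * b1 * e1 + a1 * b0 * e1 - (a1 * b1 * e0 + a2 * b2 * e0) =
        (a1 * b0 + a2 * b1) * e1 - (a1 * b1 + a2 * b2) * e0 by ring.
    exact: aux.
  (* Adding [P] to the hypothesis leaves the weak form of
     $\mathrm{curl}(\Delta\psi\,\nabla\psi)=0$. *)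
  have E1 : \int[area]_(x in O) (wlap O psi x * wD O [:: ord0] psi x * pd [:: ord_max] eta x - wlap O psi x * wD O [:: ord_max] psi x * pd [:: ord0] eta x) = 0.
    have := NC eta T.
    have -> : \int[area]_(x in O) (- (wD O [:: ord_max] psi x * wD O [:: ord_max; ord0] psi x - wD O [:: ord0] psi x * wD O [:: ord_max; ord_max] psi x) * pd [:: ord_max] eta x +
      (- (wD O [:: ord_max] psi x * wD O [:: ord0; ord0] psi x) + wD O [:: ord0] psi x * wD O [:: ord0; ord_max] psi x) * pd [:: ord0] eta x) =
      I2 (wD O [:: ord0] psi) (wD O [:: ord_max; ord_max] psi) (pd [:: ord_max] eta) + I2 (wD O [:: ord0] psi) (wD O [:: ord0; ord_max] psi) (pd [:: ord0] eta) -
      (I2 (wD O [:: ord_max] psi) (wD O [:: ord_max; ord0] psi) (pd [:: ord_max] eta) + I2 (wD O [:: ord_max] psi) (wD O [:: ord0; ord0] psi) (pd [:: ord0] eta)).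
      apply: etrans (fin4 _ _ _ _ i5 i3 i1 i6); apply: eq_Rintegral => x _.
      have aux (a1 a2 b0 b1 b2 b3 e0 e1 : R) : - (a2 * b1 - a1 * b2) * e1 + (- (a2 * b0) + a1 * b3) * e0 =
        a1 * b2 * e1 + a1 * b3 * e0 - (a2 * b1 * e1 + a2 * b0 * e0) by ring.
      exact: aux.
    move=> N.
    have -> : \int[area]_(x in O) (wlap O psi x * wD O [:: ord0] psi x * pd [:: ord_max] eta x - wlap O psi x * wD O [:: ord_max] psi x * pd [:: ord0] eta x) =
      I2 (wD O [:: ord0] psi) (wD O [:: ord_max; ord_max] psi) (pd [:: ord_max] eta) + I2 (wD O [:: ord0] psi) (wD O [:: ord0; ord0] psi) (pd [:: ord_max] eta) -
      (I2 (wD O [:: ord_max] psi) (wD O [:: ord0; ord0] psi) (pd [:: ord0] eta) + I2 (wD O [:: ord_max] psi) (wD O [:: ord_max; ord_max] psi) (pd [:: ord0] eta)).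
      apply: etrans (fin4 _ _ _ _ i5 i2 i6 i4); apply: eq_Rintegral => x _; rewrite !wlapE.
      have aux (a1 a2 b0 b2 e0 e1 : R) : (b0 + b2) * a1 * e1 - (b0 + b2) * a2 * e0 =
        a1 * b2 * e1 + a1 * b0 * e1 - (a2 * b0 * e0 + a2 * b2 * e0) by ring.
      exact: aux.
    have aux (A B C D E F : R) : A + B - (C + D) = 0 -> E + C - (A + F) = 0 -> E + B - (F + D) = 0 by clear; lra.
    exact: aux P N.
  (* The weak form of $\mathrm{curl}(\psi\nabla\psi)=0$, as $\psi\nabla\psi=\nabla(\psi^2/2)$. *)
  have E2 : I2 (wD O [::] psi) (wD O [:: ord0] psi) (pd [:: ord_max] eta) - I2 (wD O [::] psi) (wD O [:: ord_max] psi) (pd [:: ord0] eta) = 0.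
    apply: (cvg_unique _ (cvgB l7 l8)) => //.
    apply: cvg_near_cst; apply: nearW => n.
    rewrite -[RHS](curl_gradient_zero (f := fun x => 2^-1 * (g n [::] x ^+ 2)) oO _ T); last first.
      by apply: smooth_C1; apply: smooth_scale; exact: smooth_exp.
    apply: etrans (esym (RintegralB mO (j7 n) (j8 n))) _; apply: eq_Rintegral => x _.
    have D i : pd [:: i] (fun x => 2^-1 * (g n [::] x ^+ 2)) x = g n [::] x * g n [:: i] x.
      rewrite pdE; apply: is_deriveE.
      have d s : is_derive x (unit_vec i) (g n s) (g n (i :: s) x) by rewrite -gE pdE; exact: smooth_is_derive.
      by apply: is_derive_eq' (is_derive_scale 2^-1 (is_derive_exp 2 (d [::]))) _; rewrite /= expr1; field.
    by rewrite !D.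
  have Ch (h : plane R -> R) : Cc O h -> sqi area O h by move=> ?; apply/L2_sqi; exact: Cc_L2.
  have cQe i : Cc O (fun x => pd [:: i] eta x * Q x) by exact: Cc_mul (Te i) cQ.
  have cpe i : Cc O (fun x => eta x * pd [:: i] p x) by exact: Cc_mul (test_Cc T) (C1_pd_C0 i Cp).
  have cg1 i := c [:: i] isT.
  have lm i h (ch : Cc O h) : \int[area]_(x in O) (g n [:: i] x * h x) @[n --> \oo] --> \int[area]_(x in O) (wD O [:: i] psi x * h x).
    exact: (cvgL2_mul mO (cg1 i) (cvgL2_cst (Ch _ ch))).
  have im i h n (ch : Cc O h) : area.-integrable O (EFin \o (fun x => g n [:: i] x * h x)).
    by have [s _ _] := cg1 i; exact: (sqi_mul mO (s n) (Ch _ ch)).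
  have iw i h (ch : Cc O h) : area.-integrable O (EFin \o (fun x => wD O [:: i] psi x * h x)).
    by have [_ s _] := cg1 i; exact: (sqi_mul mO s (Ch _ ch)).
  (* Since $\nabla Q=F$, this is $\mathrm{curl}(Q\nabla\psi)=-\nabla\psi\cdot\nabla p$ tested with
     [eta]. For the approximations [g n [::]] of $\psi$ it combines $\mathrm{curl}\,\nabla(Qg)=0$
     with $\mathrm{div}(g\nabla p)=\nabla g\cdot\nabla p$, where [p] is harmonic. *)
  have E3 : \int[area]_(x in O) (wD O [:: ord0] psi x * (pd [:: ord_max] eta x * Q x)) + \int[area]_(x in O) (wD O [:: ord0] psi x * (eta x * pd [:: ord0] p x)) -
     (\int[area]_(x in O) (wD O [:: ord_max] psi x * (pd [:: ord0] eta x * Q x)) - \int[area]_(x in O) (wD O [:: ord_max] psi x * (eta x * pd [:: ord_max] p x))) = 0.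
    apply: (cvg_unique _ (cvgB (cvgD (lm ord0 _ (cQe ord_max)) (lm ord0 _ (cpe ord0))) (cvgB (lm ord_max _ (cQe ord0)) (lm ord_max _ (cpe ord_max))))) => //.
    apply: cvg_near_cst; apply: nearW => n.
    have sg0 : smooth (g n [::]) by exact: sg.
    have Cg : C1 O (g n [::]) by exact: smooth_C1.
    have Cgp i : C1 O (fun x => g n [::] x * pd [:: i] p x) by exact: (C1_mul oO Cg (Cpp i)).
    have iM i j : area.-integrable O (EFin \o (fun x => g n [::] x * pd [:: i] p x * pd [:: j] eta x)).
      exact: (L1loc_Cc oO (C0_L1loc oO (C1_C0 (Cgp i))) (Te j)).
    have iP i : area.-integrable O (EFin \o (fun x => pd [:: i] (fun x => g n [::] x * pd [:: i] p x) x * eta x)).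
      exact: (L1loc_Cc oO (C0_L1loc oO (C1_pd_C0 i (Cgp i))) (test_Cc T)).
    have ibp i := integration_by_parts2 i oO (test_C1c T) (Cgp i).
    have dgp i x : O x -> pd [:: i] (fun x => g n [::] x * pd [:: i] p x) x = g n [::] x * pd [:: i; i] p x + pd [:: i] p x * g n [:: i] x.
      by move=> Ox; rewrite (C1_pd_mul i Cg (Cpp i) Ox).
    have S : \int[area]_(x in O) (pd [:: ord0] (fun x => g n [::] x * pd [:: ord0] p x) x * eta x) +
        \int[area]_(x in O) (pd [:: ord_max] (fun x => g n [::] x * pd [:: ord_max] p x) x * eta x) =
        \int[area]_(x in O) (g n [:: ord0] x * (eta x * pd [:: ord0] p x)) + \int[area]_(x in O) (g n [:: ord_max] x * (eta x * pd [:: ord_max] p x)).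
      rewrite -(RintegralD mO (iP ord0) (iP ord_max)) -(RintegralD mO (im ord0 _ n (cpe ord0)) (im ord_max _ n (cpe ord_max))).
      apply: eq_Rintegral => x /[!inE] Ox; rewrite !(dgp _ _ Ox).
      have := hp.2 x Ox; rewrite lapE => L.
      have aux (g0 g1 g2 p0 p1 q0 q1 e : R) : q0 + q1 = 0 -> (g0 * q0 + p0 * g1) * e + (g0 * q1 + p1 * g2) * e =
        g1 * (e * p0) + g2 * (e * p1) by clear; move=> ?; have -> : q0 = - q1; [lra|ring].
      exact: aux L.
    have K := curl_gradient_zero oO (C1_mul oO CQ Cg) T.
    have iN : area.-integrable O (EFin \o (fun x => - (g n [::] x * pd [:: ord_max] p x * pd [:: ord_max] eta x))).
      exact: (integrableN_EFin mO (iM ord_max ord_max)).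
    have F := fin4 _ _ _ _ (im ord0 _ n (cQe ord_max)) iN (im ord_max _ n (cQe ord0)) (iM ord0 ord0).
    rewrite (RintegralN mO (iM ord_max ord_max)) !ibp in F.
    have {}K : \int[area]_(x in O) (g n [:: ord0] x * (pd [:: ord_max] eta x * Q x) + - (g n [::] x * pd [:: ord_max] p x * pd [:: ord_max] eta x) -
      (g n [:: ord_max] x * (pd [:: ord0] eta x * Q x) + g n [::] x * pd [:: ord0] p x * pd [:: ord0] eta x)) = 0.
      rewrite -[RHS]K; apply: eq_Rintegral => x /[!inE] Ox.
      rewrite !(C1_pd_mul _ CQ Cg Ox) !(dQE _ _ Ox) /rot_grad eqxx /= !gE.
      have aux (g0 g1 g2 p0 p1 q e0 e1 : R) : g1 * (e1 * q) + - (g0 * p1 * e1) - (g2 * (e0 * q) + g0 * p0 * e0) =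
        (q * g1 + g0 * - p1) * e1 - (q * g2 + g0 * p0) * e0 by ring.
      exact: aux.
    rewrite K in F.
    have aux (a1 a2 a3 d1 e1 f1 : R) : 0 = a1 - - e1 - (a2 + - d1) -> d1 + e1 = a3 + f1 -> a1 + a3 - (a2 - f1) = 0 by clear; lra.
    exact: aux F S.
  (* As $Q=\Delta\psi+\lambda\psi$ almost everywhere, [E1] and [E2] give the weak form of
     $\mathrm{curl}(Q\nabla\psi)=0$; against [E3] only $\nabla\psi\cdot\nabla p$ remains. *)
  have E4 : \int[area]_(x in O) (wD O [:: ord0] psi x * (pd [:: ord_max] eta x * Q x)) - \int[area]_(x in O) (wD O [:: ord_max] psi x * (pd [:: ord0] eta x * Q x)) = 0.
    have iA : area.-integrable O (EFin \o (fun x => wlap O psi x * wD O [:: ord0] psi x * pd [:: ord_max] eta x - wlap O psi x * wD O [:: ord_max] psi x * pd [:: ord0] eta x)).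
      have -> : (fun x => wlap O psi x * wD O [:: ord0] psi x * pd [:: ord_max] eta x - wlap O psi x * wD O [:: ord_max] psi x * pd [:: ord0] eta x) =
        (fun x => (wD O [:: ord0] psi x * wD O [:: ord_max; ord_max] psi x * pd [:: ord_max] eta x + wD O [:: ord0] psi x * wD O [:: ord0; ord0] psi x * pd [:: ord_max] eta x) -
        (wD O [:: ord_max] psi x * wD O [:: ord0; ord0] psi x * pd [:: ord0] eta x + wD O [:: ord_max] psi x * wD O [:: ord_max; ord_max] psi x * pd [:: ord0] eta x)).
        apply/funext => x; rewrite !wlapE.
        have aux (a1 a2 b0 b2 e0 e1 : R) : (b0 + b2) * a1 * e1 - (b0 + b2) * a2 * e0 =
          a1 * b2 * e1 + a1 * b0 * e1 - (a2 * b0 * e0 + a2 * b2 * e0) by ring.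
        exact: aux.
      exact: (integrableB_EFin mO (integrableD_EFin mO i5 i2) (integrableD_EFin mO i6 i4)).
    have iB := integrableB_EFin mO i7 i8.
    have iB' := integrableZ_EFin lam mO iB.
    have E2' := RintegralB mO i7 i8.
    rewrite -(RintegralB mO (iw _ _ (cQe ord_max)) (iw _ _ (cQe ord0))).
    have -> : 0 = 0 + lam * 0 :> R by rewrite mulr0 addr0.
    rewrite -{1}E1 -[X in lam * X]E2; apply: etrans _ (f_equal (fun c => _ + lam * c) E2').
    apply: etrans _ (f_equal (fun c => _ + c) (RintegralZl lam mO iB)).
    apply: etrans _ (RintegralD mO iA iB').
    have wn : ae_on O (fun x => wD O [::] psi x = psi x) by apply: wD_nil => //; apply: L2_L1loc => //; exact: H0.1.1.
    apply: (ae_on_eq_Rintegral oO).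
    - exact: integrable_mfun (integrableB_EFin mO (iw _ _ (cQe ord_max)) (iw _ _ (cQe ord0))).
    - exact: integrable_mfun (integrableD_EFin mO iA iB').
    apply: (ae_on_imply2 QE wn) => x Ox <- ->.
    have aux (w0 q a1 a2 e0 e1 : R) : a1 * (e1 * (w0 + lam * q)) - a2 * (e0 * (w0 + lam * q)) =
      w0 * a1 * e1 - w0 * a2 * e0 + lam * (q * a1 * e1 - q * a2 * e0) by ring.
    exact: aux.
  have aux3 (a1 a2 a3 a4 : R) : a1 + a2 - (a3 - a4) = 0 -> a1 - a3 = 0 -> a2 + a4 = 0 by clear; lra.
  apply: etrans _ (aux3 _ _ _ _ E3 E4).
  apply: etrans _ (RintegralD mO (iw _ _ (cpe ord0)) (iw _ _ (cpe ord_max))).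
  apply: eq_Rintegral => x _.
  have aux (a0 a1 p0 p1 e : R) : (a0 * p0 + a1 * p1) * e = a0 * (e * p0) + a1 * (e * p1) by ring.
  exact: aux.
have w2 i : L1loc O (wD O [:: i] psi).
  by apply: (L2_L1loc oO); apply/L2_sqi; have [_ ? _] := c [:: i] isT.
have wp i := L1loc_mulC0 oO (w2 i) (C1_pd_C0 i Cp).
exact: (fundamental_open oO (L1loc_add oO (wp ord0) (wp ord_max)) key).
Qed.

End OrthogonalGradients.

Section Collinear.
Context {R : realType}.
Notation mplane := (measurableTypeR R * measurableTypeR R)%type.
Implicit Types (O U : set (plane R)) (f g p psi : plane R -> R).

Lemma cvg_eq (u v : nat -> R) (a b : R) : u n @[n --> \oo] --> a -> v n @[n --> \oo] --> b ->
  (forall n, u n = v n) -> a = b.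
Proof. by move=> ua vb uv; apply: cvg_unique ua _ => //; rewrite (_ : u = v) //; apply/funext. Qed.

(** Weak derivatives are defined with smooth test functions, but the multipliers used later are only
    treated as $C^1$. Approximating [psi] instead of [zeta] reduces the formula to classical
    integration by parts. *)
Lemma C1c_weak_parts O psi i j zeta : open O -> H0k 2 O psi -> C1c O zeta ->
  \int[area]_(x in O) (wD O [:: j] psi x * pd [:: i] zeta x) = - \int[area]_(x in O) (wD O [:: i; j] psi x * zeta x).
Proof.
move=> oO H0 Cz; have mO := open_measurable2 oO.
have [phi [tphi c]] := H0k_approx oO H0.
have s1 : sqi area O (pd [:: i] zeta) by apply/L2_sqi; apply: Cc_L2 => //; exact: C1c_pd_Cc.
have s0 : sqi area O zeta by apply/L2_sqi; apply: Cc_L2 => //; exact: C1c_Cc.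
have l1 := cvgL2_mul mO (c [:: j] isT) (cvgL2_cst s1).
have l2 := cvgN (cvgL2_mul mO (c [:: i; j] isT) (cvgL2_cst s0)).
apply: (cvg_eq l1 (l2 _)) => n.
exact: (integration_by_parts2 i oO Cz (smooth_C1 O (smooth_pd [:: j] (tphi n).1))).
Qed.

Lemma wD_mixed O psi zeta : open O -> H0k 2 O psi -> C1c O zeta ->
  \int[area]_(x in O) (wD O [:: ord0; ord_max] psi x * zeta x) = \int[area]_(x in O) (wD O [:: ord_max; ord0] psi x * zeta x).
Proof.
move=> oO H0 Cz; have mO := open_measurable2 oO.
have [phi [tphi c]] := H0k_approx oO H0.
have s0 : sqi area O zeta by apply/L2_sqi; apply: Cc_L2 => //; exact: C1c_Cc.
have l1 := cvgL2_mul mO (c [:: ord0; ord_max] isT) (cvgL2_cst s0).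
have l2 := cvgL2_mul mO (c [:: ord_max; ord0] isT) (cvgL2_cst s0).
apply: (cvg_eq l1 l2) => n.
by rewrite (smooth_pdC2 ord0 ord_max (tphi n).1).
Qed.

Lemma is_wD_sub O U s f g : open O -> open U -> U `<=` O -> is_wD O s f g -> is_wD U s f g.
Proof.
move=> oO oU UO [Lf Lg H]; have mO := open_measurable2 oO; have mU := open_measurable2 oU.
split; [exact: (L1loc_subset oO UO mU Lf)|exact: (L1loc_subset oO UO mU Lg)|].
move=> phi T; have := H phi (test_sub UO T).
have E (h k : plane R -> R) : test U k -> \int[area]_(x in O) (h x * k x) = \int[area]_(x in U) (h x * k x).
  move=> [_ [K [_ KU k0]]]; apply: Rintegral_out => // x _ nU; rewrite k0 ?mulr0 // => Kx; exact: nU (KU _ Kx).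
by rewrite (E f _ (test_pd s T)) (E g _ T).
Qed.

(** The hypotheses say that $f_0-if_1$ is holomorphic and without zeros; $a+ib$ is its
    reciprocal. *)
Lemma inverse_conjugate_CR U (f0 f1 : plane R -> R) : open U -> C1 U f0 -> C1 U f1 ->
  (forall x, U x -> f0 x ^+ 2 + f1 x ^+ 2 != 0) ->
  (forall x, U x -> pd [:: ord0] f0 x = - pd [:: ord_max] f1 x /\ pd [:: ord_max] f0 x = pd [:: ord0] f1 x) ->
  let a := fun x => f0 x * (f0 x ^+ 2 + f1 x ^+ 2)^-1 in
  let b := fun x => f1 x * (f0 x ^+ 2 + f1 x ^+ 2)^-1 in
  [/\ C1 U a, C1 U b & forall x, U x -> pd [:: ord0] a x = pd [:: ord_max] b x /\ pd [:: ord_max] a x = - pd [:: ord0] b x].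
Proof.
move=> oU C0f C1f n0 CR a b.
have Cn : C1 U (fun x => f0 x ^+ 2 + f1 x ^+ 2).
  have -> : (fun x => f0 x ^+ 2 + f1 x ^+ 2) = (fun x => f0 x * f0 x + f1 x * f1 x) by apply/funext => x; rewrite !expr2.
  exact: (C1_add oU (C1_mul oU C0f C0f) (C1_mul oU C1f C1f)).
have Ci := C1_inv oU Cn n0.
have Ca : C1 U a by exact: (C1_mul oU C0f Ci).
have Cb : C1 U b by exact: (C1_mul oU C1f Ci).
split=> // x Ux.
have D j (f : plane R -> R) : C1 U f -> pd [:: j] (fun x => f x * (f0 x ^+ 2 + f1 x ^+ 2)^-1) x =
   f x * (- (f0 x ^+ 2 + f1 x ^+ 2) ^- 2 * (2%:R * f0 x ^+ 1 * pd [:: j] f0 x + 2%:R * f1 x ^+ 1 * pd [:: j] f1 x)) +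
   (f0 x ^+ 2 + f1 x ^+ 2)^-1 * pd [:: j] f x.
  move=> Cf; rewrite pdE; apply: is_deriveE.
  have d := is_derive_add (is_derive_exp 2 (C1_derive j C0f Ux)) (is_derive_exp 2 (C1_derive j C1f Ux)).
  exact: (is_derive_mul (C1_derive j Cf Ux) (is_derive_inv (f := fun x => f0 x ^+ 2 + f1 x ^+ 2) (n0 x Ux) d)).
have [e1 e2] := CR x Ux; have := n0 x Ux; rewrite /a /b !(D _ f0 C0f) !(D _ f1 C1f) e1 e2.
have aux (u v s t : R) : u ^+ 2 + v ^+ 2 != 0 ->
   u * (- (u ^+ 2 + v ^+ 2) ^- 2 * (2%:R * u ^+ 1 * (- s) + 2%:R * v ^+ 1 * t)) + (u ^+ 2 + v ^+ 2)^-1 * (- s) =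
   v * (- (u ^+ 2 + v ^+ 2) ^- 2 * (2%:R * u ^+ 1 * t + 2%:R * v ^+ 1 * s)) + (u ^+ 2 + v ^+ 2)^-1 * s /\
   u * (- (u ^+ 2 + v ^+ 2) ^- 2 * (2%:R * u ^+ 1 * t + 2%:R * v ^+ 1 * s)) + (u ^+ 2 + v ^+ 2)^-1 * t =
   - (v * (- (u ^+ 2 + v ^+ 2) ^- 2 * (2%:R * u ^+ 1 * (- s) + 2%:R * v ^+ 1 * t)) + (u ^+ 2 + v ^+ 2)^-1 * t).
  by clear=> n; split; field.
exact: aux.
Qed.

Definition nrm2 p x := rot_grad p ord0 x ^+ 2 + rot_grad p ord_max x ^+ 2.
(* [inv_grad] is [F / |F|^2] for [F = rot_grad p]: the inverse of the holomorphic
   function [F_0 - i F_1], so it satisfies the Cauchy-Riemann equations. *)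
Definition inv_grad p i x := rot_grad p i x * (nrm2 p x)^-1.
Definition regular O p := [set x | O x /\ nrm2 p x != 0].

Lemma nrm2_C0 O p : open O -> Defs.harmonic O p -> C0 O (nrm2 p).
Proof.
move=> oO hp.
have -> : nrm2 p = fun x => rot_grad p ord0 x * rot_grad p ord0 x + rot_grad p ord_max x * rot_grad p ord_max x.
  by apply/funext => x; rewrite /nrm2 !expr2.
by apply: C0_add; apply: C0_mul; exact: rot_grad_C0.
Qed.

Lemma regular_open O p : open O -> Defs.harmonic O p -> open (regular O p).
Proof.
move=> oO hp; have := open_preimage_open (A := [set t : R | t != 0]) oO (nrm2_C0 oO hp).
by apply; exact: open_neq.
Qed.

Lemma rot_grad_CR O p x : open O -> Defs.harmonic O p -> O x ->
  pd [:: ord0] (rot_grad p ord0) x = - pd [:: ord_max] (rot_grad p ord_max) x /\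
  pd [:: ord_max] (rot_grad p ord0) x = pd [:: ord0] (rot_grad p ord_max) x.
Proof.
move=> oO hp Ox; have Cp i := harmonic_C1_pd (s := [:: i]) oO hp isT.
have D j : pd [:: j] (rot_grad p ord0) x = - pd [:: j; ord_max] p x.
  by rewrite pdE; apply: is_deriveE; exact: is_derive_opp (C1_derive j (Cp ord_max) Ox).
have D' j : pd [:: j] (rot_grad p ord_max) x = pd [:: j; ord0] p x by [].
rewrite !D !D' (harmonic_pdC oO hp Ox); split=> //.
have := hp.2 x Ox; rewrite lapE => L; by apply/esym/eqP; rewrite -addr_eq0; apply/eqP.
Qed.

Lemma inv_grad_CR O p : open O -> Defs.harmonic O p ->
  (forall i, C1 (regular O p) (inv_grad p i)) /\ forall x, regular O p x ->
    pd [:: ord0] (inv_grad p ord0) x = pd [:: ord_max] (inv_grad p ord_max) x /\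
    pd [:: ord_max] (inv_grad p ord0) x = - pd [:: ord0] (inv_grad p ord_max) x.
Proof.
move=> oO hp; have oE := regular_open oO hp.
have C i : C1 (regular O p) (rot_grad p i) by apply: C1_sub (rot_grad_C1 i oO hp) => x [].
have [c0 c1 CR] := inverse_conjugate_CR oE (C ord0) (C ord_max) (fun x Ex => Ex.2) (fun x Ex => rot_grad_CR oO hp Ex.1).
by split; [exact: (ord2P c0 c1)|exact: CR].
Qed.

End Collinear.

Section GradientRatio.
Context {R : realType}.
Notation mplane := (measurableTypeR R * measurableTypeR R)%type.
Implicit Types (O U : set (plane R)) (f g p psi : plane R -> R).

Lemma Rintegral_supp O U (h k : plane R -> R) : open O -> open U -> U `<=` O -> compact_supp U k ->
  \int[area]_(x in O) (h x * k x) = \int[area]_(x in U) (h x * k x).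
Proof.
move=> oO oU UO [K [_ KU k0]]; apply: Rintegral_out => //.
- exact: open_measurable2.
- exact: open_measurable2.
- by move=> x _ nU; rewrite k0 ?mulr0 // => Kx; exact: nU (KU _ Kx).
Qed.

Lemma C1c_weak_parts_sub O U psi i j zeta : open O -> open U -> U `<=` O -> H0k 2 O psi -> C1c U zeta ->
  \int[area]_(x in U) (wD O [:: j] psi x * pd [:: i] zeta x) = - \int[area]_(x in U) (wD O [:: i; j] psi x * zeta x).
Proof.
move=> oO oU UO H0 Cz; have := C1c_weak_parts i j oO H0 (C1c_sub UO Cz).
by rewrite (Rintegral_supp _ oO oU UO (C1c_pd_Cc i Cz).2) (Rintegral_supp _ oO oU UO (C1c_Cc Cz).2).
Qed.

Lemma wD_mixed_sub O U psi zeta : open O -> open U -> U `<=` O -> H0k 2 O psi -> C1c U zeta ->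
  \int[area]_(x in U) (wD O [:: ord0; ord_max] psi x * zeta x) = \int[area]_(x in U) (wD O [:: ord_max; ord0] psi x * zeta x).
Proof.
move=> oO oU UO H0 Cz; have S h := Rintegral_supp h oO oU UO (C1c_Cc Cz).2.
exact: etrans (esym (S _)) (etrans (wD_mixed oO H0 (C1c_sub UO Cz)) (S _)).
Qed.

(** The terms with [z2] are the weak curl of $\nabla\psi$, which is 0; the terms with [z1] give the
    Laplacian. Having two free multipliers allows them to be chosen so that their own derivatives
    cancel. *)
Lemma gradient_pair O U psi z1 z2 : open O -> open U -> U `<=` O -> H0k 2 O psi -> C1c U z1 -> C1c U z2 ->
  area.-integrable U (EFin \o (fun x => wD O [:: ord0] psi x * pd [:: ord0] z1 x + wD O [:: ord_max] psi x * pd [:: ord_max] z1 x +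
     (wD O [:: ord0] psi x * pd [:: ord_max] z2 x - wD O [:: ord_max] psi x * pd [:: ord0] z2 x))) /\
  \int[area]_(x in U) (wD O [:: ord0] psi x * pd [:: ord0] z1 x + wD O [:: ord_max] psi x * pd [:: ord_max] z1 x +
     (wD O [:: ord0] psi x * pd [:: ord_max] z2 x - wD O [:: ord_max] psi x * pd [:: ord0] z2 x)) =
  - \int[area]_(x in U) (wlap O psi x * z1 x).
Proof.
move=> oO oU UO H0 C1z C2z; have mU := open_measurable2 oU; have mO := open_measurable2 oO.
have L s : (size s <= 2)%N -> L1loc U (wD O s psi).
  by move=> hs; apply: (L1loc_subset oO UO mU); apply: (L2_L1loc oO); have [] := Hk_wD oO H0.1 hs.
have i1 i j z : C1c U z -> area.-integrable U (EFin \o (fun x => wD O [:: i] psi x * pd [:: j] z x)).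
  by move=> Cz; exact: (L1loc_Cc oU (L [:: i] isT) (C1c_pd_Cc j Cz)).
have i2 i j z : C1c U z -> area.-integrable U (EFin \o (fun x => wD O [:: i; j] psi x * z x)).
  by move=> Cz; exact: (L1loc_Cc oU (L [:: i; j] isT) (C1c_Cc Cz)).
have I1 := integrableD_EFin mU (i1 ord0 ord0 _ C1z) (i1 ord_max ord_max _ C1z).
have I2 := integrableB_EFin mU (i1 ord0 ord_max _ C2z) (i1 ord_max ord0 _ C2z).
split; first exact: (integrableD_EFin mU I1 I2).
apply: etrans (RintegralD mU I1 I2) _.
rewrite (RintegralD mU (i1 ord0 ord0 _ C1z) (i1 ord_max ord_max _ C1z)) (RintegralB mU (i1 ord0 ord_max _ C2z) (i1 ord_max ord0 _ C2z)).
have P i j z (Cz : C1c U z) := C1c_weak_parts_sub i j oO oU UO H0 Cz.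
have e3 := wD_mixed_sub oO oU UO H0 C2z.
have aux (a1 a2 a3 a4 w1 w2 m1 m2 : R) : a1 = - w1 -> a2 = - w2 -> a3 = - m1 -> a4 = - m2 -> m2 = m1 ->
   a1 + a2 + (a3 - a4) = - (w1 + w2) by clear=> -> -> -> -> ->; ring.
apply: etrans (aux _ _ _ _ _ _ _ _ (P ord0 ord0 _ C1z) (P ord_max ord_max _ C1z) (P ord_max ord0 _ C2z) (P ord0 ord_max _ C2z) e3) _.
apply: f_equal.
apply: etrans (esym (RintegralD mU (i2 ord0 ord0 _ C1z) (i2 ord_max ord_max _ C1z))) _.
by apply: eq_Rintegral => x _; rewrite wlapE mulrDl.
Qed.

(* Let [a = F_0 / |F|^2], [b = F_1 / |F|^2].  In [gradient_pair], [z1 = phi a] and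
   [z2 = - phi b] leave only [M d_1 phi], while [z1 = phi b] and [z2 = phi a] leave
   only [M d_2 phi]: the derivatives of [a] and [b] cancel by Cauchy-Riemann. *)
Lemma gradient_ratio O p psi (lam : R) f Q : open O -> Defs.harmonic O p -> H0k 2 O psi ->
  C0 O f -> ae_on O (fun x => psi x = f x) -> C0 O Q ->
  ae_on O (fun x => wlap O psi x + lam * psi x = Q x) ->
  ae_on O (fun x => wD O [:: ord0] psi x * pd [:: ord0] p x + wD O [:: ord_max] psi x * pd [:: ord_max] p x = 0) ->
  exists M, [/\ C0 (regular O p) M,
    forall i x, regular O p x -> is_derive x (unit_vec i) M (- ((lam * f x - Q x) * inv_grad p i x)),
    forall i x, regular O p x -> is_derive x (unit_vec i) f (M x * rot_grad p i x) &
    forall i, ae_on (regular O p) (fun x => wD O [:: i] psi x = M x * rot_grad p i x)].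
Proof.
move=> oO hp H0 cf fE cQ QE OG; set E := regular O p; have oE : open E by exact: regular_open.
have EO : E `<=` O by move=> x [].
have mE := open_measurable2 oE; have mO := open_measurable2 oO.
have L s : (size s <= 2)%N -> L1loc E (wD O s psi).
  by move=> hs; apply: (L1loc_subset oO EO mE); apply: (L2_L1loc oO); have [] := Hk_wD oO H0.1 hs.
have [CI CR] := inv_grad_CR oO hp.
have CF i : C1 E (rot_grad p i) by apply: C1_sub EO _; exact: rot_grad_C1.
pose W x := lam * f x - Q x.
have cW : C0 E W.
  by apply: (C0_sub EO); apply: C0_sub2 _ cQ; apply: C0_mul _ cf; exact: C0_cst.
(* The only possible factor in $\nabla\psi=\mu F$: the scalar product of $\nabla\psi$ with
   $F/|F|^2$. The hypothesis $\nabla\psi\cdot\nabla p=0$ makes $\nabla\psi$ parallel to $F$. *)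
pose mu x := wD O [:: ord0] psi x * inv_grad p ord0 x + wD O [:: ord_max] psi x * inv_grad p ord_max x.
have Lmu : L1loc E mu.
  have Li i := L1loc_mulC0 oE (L [:: i] isT) (C1_C0 (CI i)).
  exact: (L1loc_add oE (Li ord0) (Li ord_max)).
have muE i : ae_on E (fun x => wD O [:: i] psi x = mu x * rot_grad p i x).
  apply: (ae_on_imply (ae_on_sub EO OG)) => x Ex; have := Ex.2.
  rewrite /mu /inv_grad /nrm2 /rot_grad eqxx /=.
  have aux (a b u v : R) : (- v) ^+ 2 + u ^+ 2 != 0 -> a * u + b * v = 0 ->
    a = (a * (- v * ((- v) ^+ 2 + u ^+ 2)^-1) + b * (u * ((- v) ^+ 2 + u ^+ 2)^-1)) * - v /\
    b = (a * (- v * ((- v) ^+ 2 + u ^+ 2)^-1) + b * (u * ((- v) ^+ 2 + u ^+ 2)^-1)) * u.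
    clear=> n0 e; split; apply: (mulIf n0).
      transitivity (a * v ^+ 2 + (a * u) * u); [by ring|].
      have -> : a * u = - (b * v) by lra.
      by field.
    transitivity (b * u ^+ 2 + (b * v) * v); [by ring|].
    have -> : b * v = - (a * u) by lra.
    by field.
  by move=> n0 e; have [e1 e2] := aux _ _ _ _ n0 e; case: (ord2_cases i) => ->; rewrite ?eqxx /=.
have WE : ae_on E (fun x => wlap O psi x = - W x).
  apply: (ae_on_imply2 (ae_on_sub EO fE) (ae_on_sub EO QE)) => x _ e1 e2; rewrite /W -e2 e1.
  by rewrite opprB addrK.
(* With [z1 = phi * A] and [z2 = phi * B], the first two conditions single out the derivative of
   [phi] along [k], and the third removes all terms in which [A] or [B] is differentiated. *)
have key k (A B phi : plane R -> R) : C1 E A -> C1 E B -> test E phi ->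
    (forall x, E x -> rot_grad p ord0 x * A x - rot_grad p ord_max x * B x = (k == ord0)%:R) ->
    (forall x, E x -> rot_grad p ord_max x * A x + rot_grad p ord0 x * B x = (k == ord_max)%:R) ->
    (forall x, E x -> pd [:: ord0] A x + pd [:: ord_max] B x = 0 /\ pd [:: ord_max] A x - pd [:: ord0] B x = 0) ->
    \int[area]_(x in E) (mu x * pd [:: k] phi x) = \int[area]_(x in E) (W x * A x * phi x).
  move=> CA CB T hA hB hC.
  have [Cz1 dz1] := C1c_mul oE (test_C1c T) CA.
  have [Cz2 dz2] := C1c_mul oE (test_C1c T) CB.
  have [I1 E1] := gradient_pair oO oE EO H0 Cz1 Cz2.
  have I3 := L1loc_Cc oE Lmu (test_Cc (test_pd [:: k] T)).
  have I4 : area.-integrable E (EFin \o (fun x => wlap O psi x * (phi x * A x))).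
    apply: (L1loc_Cc oE _ (C1c_Cc Cz1)); apply: (L1loc_subset oO EO mE); apply: (L2_L1loc oO); exact: (wlap_L2 oO H0.1).
  have I5 : area.-integrable E (EFin \o (fun x => W x * A x * phi x)).
    exact: (L1loc_Cc oE (C0_L1loc oE (C0_mul cW (C1_C0 CA))) (test_Cc T)).
  have -> : \int[area]_(x in E) (W x * A x * phi x) = - \int[area]_(x in E) (wlap O psi x * (phi x * A x)).
    apply: etrans _ (RintegralN mE I4); apply: (ae_on_eq_Rintegral oE).
    - exact: integrable_mfun I5.
    - exact: integrable_mfun (integrableN_EFin mE I4).
    apply: (ae_on_imply WE) => x _ ->.
    have aux (a b c : R) : a * b * c = - (- a * (c * b)) by clear; ring.
    exact: aux.
  apply: etrans _ E1; apply: (ae_on_eq_Rintegral oE).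
  - exact: integrable_mfun I3.
  - exact: integrable_mfun I1.
  apply: (ae_on_imply2 (muE ord0) (muE ord_max)) => x Ex -> ->.
  rewrite !dz1 !dz2; have [h1 h2] := hC x Ex; have := hA x Ex; have := hB x Ex.
  have aux (m F0 F1 a b a0 a1 b0 b1 ph p0 p1 k0 k1 : R) : F1 * a + F0 * b = k1 -> F0 * a - F1 * b = k0 ->
     a0 + b1 = 0 -> a1 - b0 = 0 ->
     m * F0 * (ph * a0 + a * p0) + m * F1 * (ph * a1 + a * p1) + (m * F0 * (ph * b1 + b * p1) - m * F1 * (ph * b0 + b * p0)) =
     m * (k0 * p0 + k1 * p1).
    clear=> <- <- e1 e2; have -> : b1 = - a0 by lra. have -> : b0 = a1 by lra. by ring.
  move=> hb ha; rewrite (aux _ _ _ _ _ _ _ _ _ _ _ _ _ _ hb ha h1 h2); apply: f_equal.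
  by case: (ord2_cases k) => ->; rewrite eqxx /= ?mul1r ?mul0r ?addr0 ?add0r.
have wk k A : C1 E A -> (forall phi, test E phi ->
    \int[area]_(x in E) (mu x * pd [:: k] phi x) = \int[area]_(x in E) (W x * A x * phi x)) ->
    is_wD E [:: k] mu (fun x => - (W x * A x)).
  move=> CA H; have cWA := C0_mul cW (C1_C0 CA).
  split=> //; first exact: (C0_L1loc oE (C0_opp cWA)).
  move=> phi T; rewrite (H phi T) /= expr1 mulN1r.
  have I5 := L1loc_Cc oE (C0_L1loc oE cWA) (test_Cc T).
  apply: etrans (esym (opprK _)) _; apply: f_equal; apply: etrans (esym (RintegralN mE I5)) _.
  by apply: eq_Rintegral => x _; rewrite mulNr.
have CN : C1 E (fun x => -1 * inv_grad p ord_max x) by exact: (C1_mul oE (C1_cst (-1) oE) (CI ord_max)).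
have dN i x : E x -> pd [:: i] (fun x => -1 * inv_grad p ord_max x) x = - pd [:: i] (inv_grad p ord_max) x.
  move=> Ex; rewrite pdE; apply: is_deriveE.
  by apply: is_derive_eq' (is_derive_scale (-1) (C1_derive i (CI ord_max) Ex)) _; rewrite mulN1r.
have nE x : E x -> nrm2 p x != 0 by case.
have w0 : is_wD E [:: ord0] mu (fun x => - (W x * inv_grad p ord0 x)).
  apply: (wk _ _ (CI ord0)) => phi T; apply: (key ord0 _ _ _ (CI ord0) CN T) => x Ex.
  - have := nE x Ex; rewrite /inv_grad /nrm2 /=.
    have aux (u v : R) : u ^+ 2 + v ^+ 2 != 0 ->
      u * (u * (u ^+ 2 + v ^+ 2)^-1) - v * (-1 * (v * (u ^+ 2 + v ^+ 2)^-1)) = 1 by clear=> n; field.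
    exact: aux.
  - rewrite /inv_grad /=.
    have aux (u v w : R) : v * (u * w) + u * (-1 * (v * w)) = 0 by clear; ring.
    exact: aux.
  - rewrite !(dN _ _ Ex); have [-> ->] := CR x Ex; split; first exact: subrr.
    by rewrite opprK addrC subrr.
have w1 : is_wD E [:: ord_max] mu (fun x => - (W x * inv_grad p ord_max x)).
  apply: (wk _ _ (CI ord_max)) => phi T; apply: (key ord_max _ _ _ (CI ord_max) (CI ord0) T) => x Ex.
  - rewrite /inv_grad /=.
    have aux (u v w : R) : u * (v * w) - v * (u * w) = 0 by clear; ring.
    exact: aux.
  - have := nE x Ex; rewrite /inv_grad /nrm2 /=.
    have aux (u v : R) : u ^+ 2 + v ^+ 2 != 0 ->
      v * (v * (u ^+ 2 + v ^+ 2)^-1) + u * (u * (u ^+ 2 + v ^+ 2)^-1) = 1 by clear=> n; field.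
    exact: aux.
  - have [-> ->] := CR x Ex; split; exact: subrr.
have [M [cM dM aM]] := weak_C1 (g := fun i x => - (W x * inv_grad p i x)) oE w0 w1
  (fun i => C0_opp (C0_mul cW (C1_C0 (CI i)))).
have psiM i : ae_on E (fun x => wD O [:: i] psi x = M x * rot_grad p i x).
  by apply: (ae_on_imply2 (muE i) aM) => x _ -> ->.
have cMF i : C0 E (fun x => M x * rot_grad p i x) := C0_mul cM (C1_C0 (CF i)).
have wf i : is_wD E [:: i] f (fun x => M x * rot_grad p i x).
  have [w _] := Hk_wD (s := [:: i]) oO H0.1 isT.
  apply: (is_wD_ae oE (is_wD_sub oO oE EO w)).
  - exact: (C0_measurable oE (C0_sub EO cf)).
  - exact: (C0_measurable oE (cMF i)).
  - exact: ae_on_sub EO fE.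
  - exact: psiM.
(* The weak gradient $\mu F$ of [f] is now continuous, so the continuous [f] is itself
   differentiable on the regular set, with no change on a null set. *)
have [G [cG dG aG]] := weak_C1 (g := fun i x => M x * rot_grad p i x) oE (wf ord0) (wf ord_max) cMF.
have fG := C0_ae_eq oE (C0_sub EO cf) cG aG.
exists M; split=> // i x Ex.
apply: (is_derive_near _ (dG i x Ex)); apply: filterS (open_nbhs_nbhs (conj oE Ex)) => y Ey.
by rewrite fG.
Qed.

End GradientRatio.

Section FlowTools.
Context {R : realType}.
Notation leb := (@lebesgue_measure R).
Notation mplane := (measurableTypeR R * measurableTypeR R)%type.
Implicit Types (O U : set (plane R)) (f g h p : plane R -> R).

Lemma real_induction (P : R -> Prop) : P 0 ->
  (forall t, 0 <= t -> P t -> exists2 e, 0 < e & forall s, 0 <= s -> `|s - t| < e -> P s) ->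
  (forall t, 0 < t -> (forall s, 0 <= s < t -> P s) -> P t) ->
  forall t, 0 <= t -> P t.
Proof.
move=> P0 Po Pc t t0; apply: contrapT => nPt.
pose A := [set s | 0 <= s /\ ~ P s].
have hA : has_inf A by split; [exists t|exists 0 => s []].
have m0 : 0 <= inf A by apply: lb_le_inf; [exists t|move=> s []].
have Plt s : 0 <= s < inf A -> P s.
  move=> /andP[s0 sm]; apply: contrapT => nPs.
  by have := ge_inf hA.2 (conj s0 nPs); rewrite leNgt sm.
have Pm : P (inf A).
  by move: m0; rewrite le_eqVlt => /orP[/eqP <- //|m0]; exact: Pc.
have [e e0 He] := Po _ m0 Pm.
have [s [s0 nPs] sm] := inf_adherent e0 hA.
have ms := ge_inf hA.2 (conj s0 nPs).
apply: nPs; apply: He => //.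
by rewrite ger0_norm ?subr_ge0 // ltrBlDl.
Qed.

(** [f] depends on the first coordinate only and [g] on the second only, yet both have the slope
    [h]. So [h] is independent of the second coordinate through [f] and of the first through [g]: it
    is constant. *)
Lemma affine_pair a b c d f g h z y :
  (forall x, obox a b c d x -> [/\ is_derive x (unit_vec ord0) f (h x), is_derive x (unit_vec ord_max) f 0,
     is_derive x (unit_vec ord0) g 0 & is_derive x (unit_vec ord_max) g (h x)]) ->
  obox a b c d z -> obox a b c d y ->
  f y = f z + h z * (y.1 - z.1) /\ g y = g z + h z * (y.2 - z.2).
Proof.
move=> D.
have in1 (s t : R) : obox a b c d (s, t) <-> a < s < b /\ c < t < d by rewrite /obox /= !in_itv.
have h2 s t t' : obox a b c d (s, t) -> obox a b c d (s, t') -> h (s, t) = h (s, t').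
  move=> /in1[sb tb] /in1[_ tb'].
  have E s' : a < s' < b -> f (s', t') = f (s', t).
    move=> s'b; apply: (mvt_const (a := c) (b := d) (F := fun u => f (s', u))) => // u ub.
    by apply/is_derive_slice1; have [] := D (s', u) (proj2 (in1 _ _) (conj s'b ub)).
  have [d1 _ _ _] := D (s, t) (proj2 (in1 _ _) (conj sb tb)).
  have [d2 _ _ _] := D (s, t') (proj2 (in1 _ _) (conj sb tb')).
  move/is_derive_slice0 in d1; move/is_derive_slice0 in d2.
  have d3 : is_derive s 1 (fun u => f (u, t)) (h (s, t')).
    apply: (is_derive_near _ d2).
    have : s \in `]a, b[ by rewrite in_itv.
    move=> /near_in_itvoo; apply: filterS => u; rewrite in_itv /=; exact: E.
  by rewrite -(is_deriveE d1) (is_deriveE d3).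
have h1 s s' t : obox a b c d (s, t) -> obox a b c d (s', t) -> h (s, t) = h (s', t).
  move=> /in1[sb tb] /in1[sb' _].
  have E t' : c < t' < d -> g (s', t') = g (s, t').
    move=> t'b; apply: (mvt_const (a := a) (b := b) (F := fun u => g (u, t'))) => // u ub.
    by apply/is_derive_slice0; have [] := D (u, t') (proj2 (in1 _ _) (conj ub t'b)).
  have [_ _ _ d1] := D (s, t) (proj2 (in1 _ _) (conj sb tb)).
  have [_ _ _ d2] := D (s', t) (proj2 (in1 _ _) (conj sb' tb)).
  move/is_derive_slice1 in d1; move/is_derive_slice1 in d2.
  have d3 : is_derive t 1 (fun u => g (s, u)) (h (s', t)).
    apply: (is_derive_near _ d2).
    have : t \in `]c, d[ by rewrite in_itv.
    move=> /near_in_itvoo; apply: filterS => u; rewrite in_itv /=; exact: E.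
  by rewrite -(is_deriveE d1) (is_deriveE d3).
case: z => z1 z2; case: y => y1 y2 Bz By.
have [zb1 zb2] := proj1 (in1 _ _) Bz; have [yb1 yb2] := proj1 (in1 _ _) By.
have hc s t : a < s < b -> c < t < d -> h (s, t) = h (z1, z2).
  move=> sb tb; rewrite (h2 s t z2); [|by apply/in1|by apply/in1].
  by apply: h1; apply/in1.
have F1 : f (y1, y2) = f (y1, z2).
  apply: (mvt_const (a := c) (b := d) (F := fun u => f (y1, u))) => // u ub.
  by apply/is_derive_slice1; have [] := D (y1, u) (proj2 (in1 _ _) (conj yb1 ub)).
have G1 : g (y1, y2) = g (z1, y2).
  apply: (mvt_const (a := a) (b := b) (F := fun u => g (u, y2))) => // u ub.
  by apply/is_derive_slice0; have [] := D (u, y2) (proj2 (in1 _ _) (conj ub yb2)).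
have idd (s : R) : is_derive s 1 (fun u : R => u) 1 by exact: is_derive_id.
rewrite F1 G1 /=; split.
  have := @mvt_const _ a b (fun u => f (u, z2) - h (z1, z2) * u) _ y1 z1 yb1 zb1.
  have H (x : R) : a < x < b -> is_derive x 1 (fun u => f (u, z2) - h (z1, z2) * u) 0.
    move=> xb; have [d1 _ _ _] := D (x, z2) (proj2 (in1 _ _) (conj xb zb2)); move/is_derive_slice0 in d1.
    apply: is_derive_eq' (is_derive_sub d1 (is_derive_scale (h (z1, z2)) (idd x))) _.
    by rewrite (hc x z2 xb zb2) mulr1 subrr.
  move=> /(_ H) e; have aux (u v k s t : R) : u - k * s = v - k * t -> u = v + k * (s - t) by clear; lra.
  exact: aux.
have := @mvt_const _ c d (fun u => g (z1, u) - h (z1, z2) * u) _ y2 z2 yb2 zb2.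
have H (x : R) : c < x < d -> is_derive x 1 (fun u => g (z1, u) - h (z1, z2) * u) 0.
  move=> xb; have [_ _ _ d1] := D (z1, x) (proj2 (in1 _ _) (conj zb1 xb)); move/is_derive_slice1 in d1.
  apply: is_derive_eq' (is_derive_sub d1 (is_derive_scale (h (z1, z2)) (idd x))) _.
  by rewrite (hc z1 x zb1 xb) mulr1 subrr.
move=> /(_ H) e; have aux (u v k s t : R) : u - k * s = v - k * t -> u = v + k * (s - t) by clear; lra.
exact: aux.
Qed.

(* A straight line if [al = 0], otherwise a circle around
   [(- a0 / al, - b0 / al)]. *)
Lemma affine_flow (al a0 b0 : R) (z : plane R) : exists c1 c2 : R -> R,
  [/\ c1 0 = z.1 /\ c2 0 = z.2,
      forall t : R, is_derive t 1 c1 (b0 + al * c2 t),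
      forall t : R, is_derive t 1 c2 (- (a0 + al * c1 t)),
      al != 0 -> exists2 T, 0 < T & c1 T = z.1 /\ c2 T = z.2 &
      al = 0 -> forall t, c1 t = z.1 + t * b0 /\ c2 t = z.2 - t * a0].
Proof.
have idd (s : R) : is_derive s 1 (fun u : R => u) 1 by exact: is_derive_id.
have [->|al0] := eqVneq al 0.
  exists (fun t => z.1 + t * b0), (fun t => z.2 - t * a0); split=> //.
  - by rewrite !mul0r addr0 subr0.
  - move=> t; apply: is_derive_eq' (is_derive_add (is_derive_const _ _ _) (is_derive_mul (idd t) (is_derive_const _ _ _))) _.
    by rewrite mulr0 add0r add0r mulr1 mul0r addr0.
  - move=> t; apply: is_derive_eq' (is_derive_sub (is_derive_const _ _ _) (is_derive_mul (idd t) (is_derive_const _ _ _))) _.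
    by rewrite mulr0 add0r add0r mulr1 mul0r addr0.
pose k1 := - a0 / al; pose k2 := - b0 / al; pose u := z.1 - k1; pose v := z.2 - k2.
have dl (t : R) : is_derive t 1 (fun s : R => al * s) al.
  by apply: is_derive_eq' (is_derive_scale al (idd t)) _; rewrite mulr1.
have dc (t : R) : is_derive t 1 (fun s : R => cos (al * s)) (- sin (al * t) * al) := is_derive_comp1 (is_derive_cos (al * t)) (dl t).
have ds (t : R) : is_derive t 1 (fun s : R => sin (al * s)) (cos (al * t) * al) := is_derive_comp1 (is_derive_sin (al * t)) (dl t).
exists (fun t => k1 + (u * cos (al * t) + v * sin (al * t))), (fun t => k2 + (v * cos (al * t) - u * sin (al * t))); split.
- by rewrite mulr0 cos0 sin0 !mulr1 !mulr0 addr0 subr0 /u /v; split; ring.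
- move=> t; apply: is_derive_eq' (is_derive_add (is_derive_const k1 _ _) (is_derive_add (is_derive_scale u (dc t)) (is_derive_scale v (ds t)))) _.
  by rewrite /k2; field.
- move=> t; apply: is_derive_eq' (is_derive_add (is_derive_const k2 _ _) (is_derive_sub (is_derive_scale v (dc t)) (is_derive_scale u (ds t)))) _.
  by rewrite /k1; field.
- move=> _; exists (pi *+ 2 / `|al|); first by rewrite divr_gt0 ?normr_gt0 // mulr2n addr_gt0 // pi_gt0.
  have cs : cos (al * (pi *+ 2 / `|al|)) = 1 /\ sin (al * (pi *+ 2 / `|al|)) = 0.
    have [p0|n0] := ltrP 0 al.
      have -> : al * (pi *+ 2 / `|al|) = pi *+ 2 by rewrite gtr0_norm // mulrC divfK.
      by rewrite cos2pi sin2pi.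
    have -> : al * (pi *+ 2 / `|al|) = - (pi *+ 2) by rewrite ler0_norm // invrN mulrN mulrN mulrC divfK.
    by rewrite cosN sinN cos2pi sin2pi oppr0.
  by rewrite cs.1 cs.2 !mulr1 !mulr0 addr0 subr0 /u /v; split; ring.
- by move=> e; rewrite e eqxx in al0.
Qed.

Lemma box_area_eq (a b c d : R) : a < b -> c < d -> area (box a b c d) = ((b - a) * (d - c))%:E.
Proof.
move=> ab cd.
rewrite /area/= product_measure1E; [|exact: measurable_itv|exact: measurable_itv].
rewrite [X in (X * _)%E](_ : _ = lebesgue_measure `[a, b]%classic)// [X in (_ * X)%E](_ : _ = lebesgue_measure `[c, d]%classic)//.
by rewrite !lebesgue_measure_itv /= !lte_fin ab cd -?EFinB -?EFinM.
Qed.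

Lemma halfstrip_area O (z e : plane R) (c : R) : open O -> e.1 ^+ 2 + e.2 ^+ 2 = 1 -> 0 < c ->
  (forall a b, 0 <= a -> `|b| < c -> O (frame z e a b)) -> ~ (area O < +oo)%E.
Proof.
move=> oO e1 c0 H fin; have mO := open_measurable2 oO.
have [mf pf] := area_frame z e1.
have le (n : R) : 0 < n -> ((n * c)%:E <= area O)%E.
  move=> n0; rewrite -(pf _ mO).
  have -> : (n * c)%:E = area (box 0 n (- (c / 2)) (c / 2)).
    by rewrite box_area_eq //; [congr (_%:E); field|lra].
  apply: le_measure; rewrite ?inE.
  - exact: box_measurable.
  - by rewrite -[X in measurable X]setTI; exact: mf.
  move=> [a b] [/=]; rewrite !in_itv /= => /andP[a0 _] /andP[b1 b2].
  by apply: H => //; rewrite ltr_norml; apply/andP; split; lra.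
have fO : area O \is a fin_num by rewrite ge0_fin_numE.
have := le ((Num.trunc (fine (area O) / c)).+1)%:R (ltr0Sn _ _).
rewrite -(fineK fO) lee_fin leNgt => /negP; apply.
by rewrite -ltr_pdivrMr //; exact: truncnS_gt.
Qed.

End FlowTools.

Section RealIdentities.
Context {R : realType}.

Lemma inv_sq_identity (u v : R) : u ^+ 2 + v ^+ 2 != 0 ->
  (u ^+ 2 + v ^+ 2) * ((u * (u ^+ 2 + v ^+ 2)^-1) ^+ 2 + (v * (u ^+ 2 + v ^+ 2)^-1) ^+ 2) = 1.
Proof. by move=> n; field. Qed.

Lemma unit_speed_identity (u v : R) : (- v) ^+ 2 + u ^+ 2 != 0 ->
  u * (u * ((- v) ^+ 2 + u ^+ 2)^-1) - v * (- v * ((- v) ^+ 2 + u ^+ 2)^-1) - 1 = 0.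
Proof. by move=> n; field. Qed.

Lemma collinear_identity (m u v w : R) : m * u * (v * w) - m * v * (u * w) = 0.
Proof. by ring. Qed.

Lemma curl_identity (w a1 b0 u v n k : R) : w != 0 -> a1 = - b0 ->
  - (w * b0 + v * n * (k * u)) = - (w * a1 + u * n * (k * v)) -> a1 = 0.
Proof.
move=> w0 e1 e2; apply: (mulfI w0); rewrite mulr0.
have e3 : v * n * (k * u) = u * n * (k * v) by ring.
have e4 : w * a1 = - (w * b0) by rewrite e1 mulrN.
by move: e2; rewrite e3; lra.
Qed.

Lemma frame_shift (z : plane R) (a0 b0 n s t : R) :
  ((frame z (b0 / n, - a0 / n) 0 s).1 + t / n * b0, (frame z (b0 / n, - a0 / n) 0 s).2 - t / n * a0) =
  frame z (b0 / n, - a0 / n) t s.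
Proof. by rewrite /frame /=; congr (_, _); ring. Qed.

Lemma near_affine_eq (z : plane R) (al al' a0 a0' b0 b0' : R) :
  (\forall y \near z, a0 + al * y.1 = a0' + al' * y.1) -> (\forall y \near z, b0 + al * y.2 = b0' + al' * y.2) ->
  [/\ al = al', a0 = a0' & b0 = b0'].
Proof.
move=> N1 N2.
have d (k l t : R) : is_derive t 1 (fun s : R => k + l * s) l.
  apply: is_derive_eq' (is_derive_add (is_derive_const k _ _) (is_derive_scale l (is_derive_id t 1))) _.
  by rewrite add0r mulr1.
have e : al = al'.
  case: z N1 {N2} => z1 z2 N1.
  have D k l : is_derive (z1, z2) (unit_vec ord0 : plane R) (fun y : plane R => k + l * y.1) l by apply/is_derive_slice0; exact: d.
  by rewrite -(is_deriveE (is_derive_near N1 (D a0 al))) (is_deriveE (D a0' al')).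
have := nbhs_singleton N1; have := nbhs_singleton N2; rewrite e.
by move=> /addIr -> /addIr ->.
Qed.

End RealIdentities.

(** * Flow lines in the set where the pressure gradient does not vanish *)

Section StreamLines.
Context {R : realType}.
Notation mplane := (measurableTypeR R * measurableTypeR R)%type.
Variables (O : set (plane R)) (p f Q M : plane R -> R) (lam : R).
Hypotheses (oO : open O) (hp : Defs.harmonic O p).
Hypotheses (cf : C0 setT f) (f0 : forall x, ~ O x -> f x = 0) (cQ : C0 O Q).
Hypothesis (dQ : forall i x, O x -> is_derive x (unit_vec i) Q (rot_grad p i x)).
Hypothesis (cM : C0 (regular O p) M).
Hypothesis (dM : forall i x, regular O p x ->
  is_derive x (unit_vec i) M (- ((lam * f x - Q x) * inv_grad p i x))).
Hypothesis (df : forall i x, regular O p x -> is_derive x (unit_vec i) f (M x * rot_grad p i x)).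
Let E := regular O p.
Let W x := lam * f x - Q x.
Let a := inv_grad p ord0.
Let b := inv_grad p ord_max.

Let onz : open [set t : R | t != 0]. Proof. exact: open_neq. Qed.

Let oE : open E. Proof. exact: regular_open. Qed.
Let EO : E `<=` O. Proof. by move=> x []. Qed.
Let CI : forall i, C1 E (inv_grad p i). Proof. exact: (inv_grad_CR oO hp).1. Qed.
Let CF i : C1 E (rot_grad p i). Proof. by apply: C1_sub EO _; exact: rot_grad_C1. Qed.
Let cW : C0 O W.
Proof. by apply: C0_sub2 _ cQ; apply: C0_mul; [exact: C0_cst|exact: C0_sub cf]. Qed.
Let Cf : C1 E f.
Proof.
apply: (C1_intro oE (C0_sub _ cf) df) => // i; exact: (C0_mul cM (C1_C0 (CF i))).
Qed.
Let CQ : C1 E Q.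
Proof.
apply: (C1_intro oE (C0_sub EO cQ) (fun i x Ex => dQ i (EO Ex))) => i; exact: (C1_C0 (CF i)).
Qed.
Let CM : C1 E M.
Proof.
apply: (C1_intro oE cM dM) => i; apply: C0_opp; exact: (C0_mul (C0_sub EO cW) (C1_C0 (CI i))).
Qed.

Let dW i x : E x -> is_derive x (unit_vec i) W ((lam * M x - 1) * rot_grad p i x).
Proof.
move=> Ex; apply: is_derive_eq' (is_derive_sub (is_derive_scale lam (df i Ex)) (dQ i (EO Ex))) _.
by rewrite mulrBl mul1r mulrA.
Qed.

(* Equality of the mixed derivatives of [M] reads [W * d_2 a = W * d_1 b], while
   [d_2 a = - d_1 b] by the Cauchy-Riemann equations. *)
Let curl_zero x : E x -> W x != 0 -> pd [:: ord_max] a x = 0.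
Proof.
move=> Ex Wx.
have pdM i y : E y -> pd [:: i] M y = - (W y * inv_grad p i y).
  by move=> Ey; rewrite pdE; exact: is_deriveE (dM i Ey).
pose h i j y := - (W y * pd [:: j] (inv_grad p i) y + inv_grad p i y * ((lam * M y - 1) * rot_grad p j y)).
have dh i j y : E y -> is_derive y (unit_vec j) (pd [:: i] M) (h i j y).
  move=> Ey; apply: (is_derive_near (f := fun y => - (W y * inv_grad p i y))).
    by apply: filterS (open_nbhs_nbhs (conj oE Ey)) => z Ez; rewrite pdM.
  exact: is_derive_opp (is_derive_mul (dW j Ey) (C1_derive j (CI i) Ey)).
have ch i j : C0 E (h i j).
  apply: C0_opp; apply: C0_add; first exact: (C0_mul (C0_sub EO cW) (C1_pd_C0 j (CI i))).
  apply: C0_mul; first exact: C1_C0 (CI i).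
  apply: C0_mul (C1_C0 (CF j)); apply: C0_sub2; last exact: C0_cst.
  by apply: C0_mul cM; exact: C0_cst.
have := schwarz oE CM (fun x Ex => dh ord_max ord0 x Ex) (fun x Ex => dh ord0 ord_max x Ex) (ch _ _) (ch _ _) Ex.
have := ((inv_grad_CR oO hp).2 x Ex).2; rewrite /h /a /inv_grad.
by move=> e1 e2; exact: curl_identity Wx e1 e2.
Qed.

Let inv_sq x : E x -> nrm2 p x * (a x ^+ 2 + b x ^+ 2) = 1.
Proof.
move=> Ex; have := Ex.2; rewrite /a /b /inv_grad /nrm2.
exact: inv_sq_identity.
Qed.

(** With [curl_zero] the Cauchy-Riemann equations become $\partial_2a=\partial_1b=0$ and
    $\partial_1a=\partial_2b$, which are the hypotheses of [affine_pair]. In these terms $\nabla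
    p/|\nabla p|^2=(b,-a)$. *)
Let near_affine z : E z -> W z != 0 -> exists al a0 b0 : R,
  \forall y \near z, [/\ E y, a y = a0 + al * y.1 & b y = b0 + al * y.2].
Proof.
move=> Ez Wz.
have oU : open (E `&` W @^-1` [set t : R | t != 0]).
  exact: open_preimage_open oE (C0_sub EO cW) onz.
case: z Ez Wz => z1 z2 Ez Wz.
have [r r0 rU] := nbhs_box oU (conj Ez Wz).
set B := obox (z1 - r) (z1 + r) (z2 - r) (z2 + r).
have Bz : B (z1, z2) by exact: obox_center.
have CR := (inv_grad_CR oO hp).2.
have D x : B x -> [/\ is_derive x (unit_vec ord0) a (pd [:: ord0] a x), is_derive x (unit_vec ord_max) a 0,
     is_derive x (unit_vec ord0) b 0 & is_derive x (unit_vec ord_max) b (pd [:: ord0] a x)].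
  move=> Bx; have [Ex Wx] := rU _ (obox_box Bx); have [e1 e2] := CR x Ex.
  have e3 := curl_zero Ex Wx.
  split; [exact: C1_derive (CI _) Ex|..].
  - by rewrite -e3; exact: C1_derive (CI _) Ex.
  - apply: is_derive_eq' (C1_derive ord0 (CI ord_max) Ex) _.
    by apply/eqP; rewrite -oppr_eq0 -e2; apply/eqP.
  - by rewrite /a e1; exact: C1_derive (CI _) Ex.
exists (pd [:: ord0] a (z1, z2)), (a (z1, z2) - pd [:: ord0] a (z1, z2) * z1), (b (z1, z2) - pd [:: ord0] a (z1, z2) * z2).
have oB : open B by exact: obox_open.
apply: filterS (open_nbhs_nbhs (conj oB Bz)) => y By.
have [-> ->] := affine_pair D Bz By.
have [Ey _] := rU _ (obox_box By).
by split=> //=; rewrite mulrBr addrAC addrA.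
Qed.

Section Curve.
Variables (al a0 b0 : R) (c1 c2 : R -> R) (z : plane R).
Hypotheses (fz : f z != 0) (Wz : W z != 0).
Hypothesis (Nz : \forall y \near z, [/\ E y, a y = a0 + al * y.1 & b y = b0 + al * y.2]).
Hypotheses (cz : c1 0 = z.1 /\ c2 0 = z.2) (d1 : forall t : R, is_derive t 1 c1 (b0 + al * c2 t))
  (d2 : forall t : R, is_derive t 1 c2 (- (a0 + al * c1 t))).
Let c t : plane R := (c1 t, c2 t).

Let cc t (A : set (plane R)) : nbhs (c t) A -> \forall s \near t, A (c s).
Proof. by have := continuous_pair (is_derive_continuous1 (d1 t)) (is_derive_continuous1 (d2 t)); move=> h /h. Qed.

(** The invariant of the induction along the curve. It includes the affine form with the given
    constants, because the curve is defined by these constants and follows $\nabla p/|\nabla p|^2$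
    only where they are the right ones. *)
Let P t := [/\ f (c t) = f z, W (c t) = W z, p (c t) = p z + t &
  \forall y \near c t, [/\ E y, a y = a0 + al * y.1 & b y = b0 + al * y.2]].

Let P0 : P 0.
Proof. by rewrite /P /c cz.1 cz.2 -surjective_pairing addr0. Qed.

Let left_limit (g : R -> R) (t k : R) : 0 < t -> {for t, continuous g} ->
  (forall s, 0 <= s < t -> g s = k) -> g t = k.
Proof.
move=> t0 cg H.
have cl : g x @[x --> t^'-] --> g t by apply: cvg_at_left_filter.
apply: (cvg_unique _ cl) => //; apply: cvg_near_cst.
have : \forall x \near t^'-, 0 < x < t.
  near=> x; apply/andP; split; near: x; [exact: nbhs_left_gt|exact: nbhs_left_lt].
by apply: filterS => x /andP[x0 xt]; apply: H; rewrite (ltW x0).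
Unshelve. all: end_near. Qed.

Let P_open t : 0 <= t -> P t -> exists2 e, 0 < e & forall s, 0 <= s -> `|s - t| < e -> P s.
Proof.
move=> t0 [e1 e2 e3 N].
pose S := [set y | [/\ E y, a y = a0 + al * y.1 & b y = b0 + al * y.2]].
have oU : open (interior S) by exact: open_interior.
have Uc : interior S (c t) by exact: N.
have UN : interior S `<=` S by exact: interior_subset.
pose U := interior S.
have : \forall s \near t, U (c s) by apply: cc; exact: open_nbhs_nbhs.
move=> /nbhs_ballP[e /= e0 He].
have inU s : t - e < s < t + e -> U (c s).
  move=> /andP[s1 s2]; apply: He; rewrite /ball /= ltr_norml; apply/andP; split; lra.
have D g s : C1 E g -> t - e < s < t + e ->
    is_derive s 1 (fun s => g (c s)) (pd [:: ord0] g (c s) * b (c s) - pd [:: ord_max] g (c s) * a (c s)).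
  move=> Cg sb; have [Es as_ bs] := UN _ (inU s sb).
  apply: is_derive_eq' (C1_chain oE Cg Es (d1 s) (d2 s)) _.
  by rewrite -[in LHS]/(c s) as_ bs mulrN.
(* The velocity $(b,-a)$ is orthogonal to $F$, so functions whose gradient is a multiple of $F$ are
   constant along the curve. This serves for [f], with factor [M], and for [Q], with factor 1. *)
have par k g : (forall i x, E x -> is_derive x (unit_vec i) g (k x * rot_grad p i x)) -> C1 E g ->
    forall s, t - e < s < t + e -> g (c s) = g (c t).
  move=> dg Cg s sb; apply: (mvt_const (a := t - e) (b := t + e) (F := fun s => g (c s))) => //; last by apply/andP; split; lra.
  move=> u ub; have [Eu _ _] := UN _ (inU u ub).
  apply: is_derive_eq' (D _ _ Cg ub) _; rewrite !pdE !(is_deriveE (dg _ _ Eu)) /a /b /inv_grad.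
  exact: collinear_identity.
exists e => // s s0 se.
have sb : t - e < s < t + e by move: se; rewrite ltr_norml => /andP[? ?]; apply/andP; split; lra.
have fs : f (c s) = f z by rewrite -e1; exact: (par M).
have Qs : Q (c s) = Q (c t).
  apply: (par (fun=> 1)) => // i x Ex; rewrite mul1r; exact: dQ (EO Ex).
split=> //.
- by rewrite -e2 /W Qs fs e1.
- have := @mvt_const _ (t - e) (t + e) (fun s => p (c s) - s) _ s t sb.
  have tb : t - e < t < t + e by apply/andP; split; lra.
  have H (u : R) : t - e < u < t + e -> is_derive u 1 (fun s => p (c s) - s) 0.
    move=> ub; have [Eu _ _] := UN _ (inU u ub).
    have idd : is_derive u 1 (fun s : R => s) 1 by exact: is_derive_id.
    apply: is_derive_eq' (is_derive_sub (D _ _ (C1_sub EO (harmonic_C1 oO hp)) ub) idd) _.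
    have := Eu.2; rewrite /a /b /inv_grad /nrm2 /rot_grad eqxx /=.
    exact: unit_speed_identity.
  move=> /(_ H tb); rewrite e3.
  by rewrite addrK => /eqP; rewrite subr_eq => /eqP.
- by apply: filterS (open_nbhs_nbhs (conj oU (inU s sb))) => y /UN.
Qed.

Let P_closed t : 0 < t -> (forall s, 0 <= s < t -> P s) -> P t.
Proof.
move=> t0 H.
have ct (g : plane R -> R) : {for c t, continuous g} -> {for t, continuous (fun s => g (c s))}.
  by move=> cg A /cg; exact: cc.
have fE : f (c t) = f z.
  by apply: (left_limit t0 (ct f (cf I))) => s /H[].
(* [f] keeps its nonzero value up to the limit and vanishes off [O], so the curve cannot leave
   [O]. *)
have Ot : O (c t) by apply: contrapT => /f0 e; move: fz; rewrite -fE e eqxx.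
have WE : W (c t) = W z.
  by apply: (left_limit t0 (ct W (cW Ot))) => s /H[].
have pE : p (c t) = p z + t.
  have cp := C1_C0 (harmonic_C1 oO hp) Ot.
  have ci : {for t, continuous (fun s : R => s)} by move=> ?.
  have e : p (c t) - t = p z.
    by apply: (left_limit t0 (continuous_sub (ct p cp) ci)) => s /H[_ _ -> _]; rewrite addrK.
  by rewrite -e subrK.
(* Before [t] this is $|F|^2(a^2+b^2)=1$. Written with the affine expressions it is continuous at
   [t], so $F$ does not vanish at [c t]. *)
pose g s := nrm2 p (c s) * ((a0 + al * c1 s) * (a0 + al * c1 s) + (b0 + al * c2 s) * (b0 + al * c2 s)).
have gE : g t = 1.
  have lin k (h : R -> R) : {for t, continuous h} -> {for t, continuous (fun s => k + al * h s)}.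
    by move=> ch; apply: continuous_add; [exact: continuous_const|apply: continuous_mul ch; exact: continuous_const].
  have l1 := lin a0 _ (is_derive_continuous1 (d1 t)); have l2 := lin b0 _ (is_derive_continuous1 (d2 t)).
  apply: (left_limit t0 (continuous_mul (ct _ (nrm2_C0 oO hp Ot)) (continuous_add (continuous_mul l1 l1) (continuous_mul l2 l2)))).
  move=> s /H[_ _ _ N]; have [Es as_ bs] := nbhs_singleton N.
  by rewrite -as_ -bs -!expr2; exact: inv_sq.
have Et : E (c t).
  by split=> //; apply/eqP => n0; move: gE; rewrite /g n0 mul0r => /eqP; rewrite eq_sym oner_eq0.
have [al' [a0' [b0' N]]] := near_affine Et (eq_ind_r (fun x => x != 0) Wz WE).
split=> //.
have N2 : \forall x \near c t, \forall y \near x, [/\ E y, a y = a0' + al' * y.1 & b y = b0' + al' * y.2].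
  by move/nbhs_interior: N.
have /nbhs_ballP[e /= e0 He] := cc N2.
(* At a time [s] shortly before [t] both affine forms hold near [c s]: the old one by the invariant
   and the one just found at [c t]. Hence their constants coincide. *)
have [s [s0 st] Ns] : exists2 s, 0 < s /\ s < t & \forall y \near c s, [/\ E y, a y = a0' + al' * y.1 & b y = b0' + al' * y.2].
  exists (Num.max (t / 2) (t - e / 2)).
    by rewrite lt_max gt_max; split; [apply/orP; left; lra|apply/andP; split; lra].
  apply: He; rewrite /ball /= ger0_norm ?subr_ge0 ?ge_max; last by apply/andP; split; lra.
  by rewrite ltrBlDl -ltrBlDr lt_max; apply/orP; right; lra.
have [|_ _ _ Ps] := H s; first by rewrite (ltW s0).
have [] := near_affine_eq (z := c s) (al := al) (al' := al') (a0 := a0) (a0' := a0') (b0 := b0) (b0' := b0').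
- by apply: filterS2 Ns Ps => y [_ e1 _] [_ e2 _]; rewrite -e1 -e2.
- by apply: filterS2 Ns Ps => y [_ _ e1] [_ _ e2]; rewrite -e1 -e2.
- by move=> -> -> ->.
Qed.

Lemma stream_line t : 0 <= t -> E (c t) /\ p (c t) = p z + t.
Proof.
move=> t0; have [_ _ e N] := real_induction P0 P_open P_closed t0.
by have [] := nbhs_singleton N.
Qed.

End Curve.

Hypothesis fin : (area O < +oo)%E.

Let stationary z : E z -> f z != 0 -> W z != 0 -> False.
Proof.
move=> Ez fz Wz; have [al [a0 [b0 N]]] := near_affine Ez Wz.
have [al0|al0] := eqVneq al 0; last first.
  have [c1 [c2 [cz d1 d2 per _]]] := affine_flow al a0 b0 z.
  have [T T0 [e1 e2]] := per al0.
  have [_] := stream_line fz Wz N cz d1 d2 (ltW T0).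
  rewrite e1 e2 -surjective_pairing => /eqP; rewrite -subr_eq0 opprD addrA subrr sub0r oppr_eq0 => /eqP e.
  by rewrite e ltxx in T0.
have [_ az bz] := nbhs_singleton N; rewrite al0 !mul0r !addr0 in az bz.
have v0 : a0 ^+ 2 + b0 ^+ 2 != 0.
  by apply/eqP => e; have := inv_sq Ez; rewrite az bz e mulr0 => /eqP; rewrite eq_sym oner_eq0.
have vp : 0 < a0 ^+ 2 + b0 ^+ 2 by rewrite lt_def v0 addr_ge0 ?sqr_ge0.
pose n := Num.sqrt (a0 ^+ 2 + b0 ^+ 2).
have n0 : 0 < n by rewrite sqrtr_gt0.
have n2 : n ^+ 2 = a0 ^+ 2 + b0 ^+ 2 by rewrite sqr_sqrtr // ltW.
(* The direction of the straight flow lines, whose constant velocity is [(b0, - a0)], of length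
   [n]. *)
pose e : plane R := (b0 / n, - a0 / n).
have e1 : e.1 ^+ 2 + e.2 ^+ 2 = 1.
  by rewrite /e /= !expr_div_n sqrrN -mulrDl addrC -n2 divff // expf_neq0 // gt_eqF.
(* All conditions on the starting point are open, so the lines through a short segment across the
   flow satisfy them too; together they sweep out a half-strip. *)
have good : \forall y \near z, [/\ f y != 0, W y != 0 & \forall x \near y, [/\ E x, a x = a0 + al * x.1 & b x = b0 + al * x.2]].
  have Nf : \forall y \near z, f y != 0.
    have oU := open_preimage_open openT cf onz.
    by apply: filterS (open_nbhs_nbhs (conj oU (conj I fz))) => y [].
  have NW : \forall y \near z, W y != 0.
    have oU := open_preimage_open oO cW onz.
    by apply: filterS (open_nbhs_nbhs (conj oU (conj (EO Ez) Wz))) => y [].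
  have NN : \forall y \near z, \forall x \near y, [/\ E x, a x = a0 + al * x.1 & b x = b0 + al * x.2].
    by move/nbhs_interior: N.
  by apply: filterS3 Nf NW NN => y.
have cfr (A : set (plane R)) : nbhs (frame z e 0 0) A -> \forall s \near (0 : R), A (frame z e 0 s).
  suff h : {for (0 : R), continuous (fun s : R => frame z e 0 s)} by move=> /h.
  apply: continuous_pair; rewrite /frame /=.
    by apply: continuous_sub; [exact: continuous_const|apply: continuous_mul; [move=> ?|exact: continuous_const]].
  by apply: continuous_add; [exact: continuous_const|apply: continuous_mul; [move=> ?|exact: continuous_const]].
have fz0 : frame z e 0 0 = z by rewrite /frame !mul0r subr0 !addr0 -surjective_pairing.
have /nbhs_ballP[r /= r0 Hr] : \forall s \near (0 : R), [/\ f (frame z e 0 s) != 0, W (frame z e 0 s) != 0 &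
    \forall x \near frame z e 0 s, [/\ E x, a x = a0 + al * x.1 & b x = b0 + al * x.2]].
  exact: (cfr _ (eq_ind_r (fun w => nbhs w _) good fz0)).
apply: (halfstrip_area (z := z) oO e1 r0 _ fin) => t s t0 sr.
have [|fy Wy Ny] := Hr s; first by rewrite /ball /= sub0r normrN.
have [Ey _ _] := nbhs_singleton Ny.
have [c1 [c2 [cy d1 d2 _ lin]]] := affine_flow al a0 b0 (frame z e 0 s).
(* At speed [n] the time [t / n] carries the starting point over the distance [t], to
   [frame z e t s]. *)
have [/EO Ot _] := stream_line fy Wy Ny cy d1 d2 (divr_ge0 t0 (ltW n0)).
have [e3 e4] := lin al0 (t / n).
by move: Ot; rewrite e3 e4 frame_shift.
Qed.

(** By [stationary], [f] is 0 on the open set of points of [E] where [W] is not. There $0=\nabla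
    f=MF$ gives $M=0$, and then $0=\nabla M=-WF/|F|^2$ contradicts $W\ne0$. *)
Lemma collinear_vorticity_zero z : E z -> W z = 0.
Proof.
move=> Ez; apply/eqP/negP => /negP Wz.
have oU : open (E `&` W @^-1` [set t : R | t != 0]).
  exact: open_preimage_open oE (C0_sub EO cW) onz.
set U := _ `&` _ in oU.
have zU : U z by [].
have fU x : U x -> f x = 0.
  by move=> [Ex Wx]; apply/eqP/negP => /negP fx; exact: stationary Ex fx Wx.
have nz x : E x -> exists i, rot_grad p i x != 0.
  move=> [_ n0]; have [e0|] := eqVneq (rot_grad p ord0 x) 0; last by exists ord0.
  exists ord_max; apply/eqP => e1; move: n0; rewrite /nrm2 e0 e1 expr0n /= addr0 eqxx //.
have MU x : U x -> M x = 0.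
  move=> Ux; have [i Fi] := nz x Ux.1.
  have : is_derive x (unit_vec i) f 0.
    have nU : \forall y \near x, 0 = f y by apply: filterS (open_nbhs_nbhs (conj oU Ux)) => y Uy; rewrite fU.
    exact: (is_derive_near nU (is_derive_const 0 x (unit_vec i))).
  move=> d; have := is_deriveE (df i Ux.1); rewrite (is_deriveE d) => /esym/eqP.
  by rewrite mulf_eq0 (negbTE Fi) orbF => /eqP.
have [i Fi] := nz z Ez.
have d : is_derive z (unit_vec i) M 0.
  have nU : \forall y \near z, 0 = M y by apply: filterS (open_nbhs_nbhs (conj oU zU)) => y Uy; rewrite MU.
  exact: (is_derive_near nU (is_derive_const 0 z (unit_vec i))).
have := is_deriveE (dM i Ez); rewrite (is_deriveE d) => /esym/eqP.
rewrite oppr_eq0 mulf_eq0 -/(W z) (negbTE Wz) /inv_grad mulf_eq0 (negbTE Fi) invr_eq0 /=.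
by move: Ez => [_ /negbTE ->].
Qed.

End StreamLines.

Section ConvectionRigidity.
Context {R : realType}.
Notation mplane := (measurableTypeR R * measurableTypeR R)%type.
Implicit Types (O : set (plane R)) (f g p psi : plane R -> R).

(** Until its end the argument knows $F$ only as a continuous field. Its square integrability comes
    from $F=\lambda1_E\nabla\psi$ ([FE]), and only then can it be paired with $\nabla\psi$. *)
Lemma convection_grad_zero O p psi (lam : R) : open O -> (area O < +oo)%E -> Defs.harmonic O p -> H0k 2 O psi ->
  (forall i, is_wD O [:: i] (fun x => wlap O psi x + lam * psi x) (rot_grad p i)) ->
  (forall eta, test O eta -> \int[area]_(x in O)
     (- (wD O [:: ord_max] psi x * wD O [:: ord_max; ord0] psi x - wD O [:: ord0] psi x * wD O [:: ord_max; ord_max] psi x) * pd [:: ord_max] eta x +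
      (- (wD O [:: ord_max] psi x * wD O [:: ord0; ord0] psi x) + wD O [:: ord0] psi x * wD O [:: ord0; ord_max] psi x) * pd [:: ord0] eta x) = 0) ->
  grad_zero O p.
Proof.
move=> oO fin hp H0 wq NC; have mO := open_measurable2 oO.
have cF i : C0 O (rot_grad p i) by exact: rot_grad_C0.
have [Q [cQ dQ QE]] := weak_C1 oO (wq ord0) (wq ord_max) cF.
have [f [cf f0 fE]] := H02_continuous oO fin H0.
have OG := orthogonal_gradients oO hp H0 cQ dQ QE NC.
have cfO : C0 O f by exact: C0_sub cf.
have [M [cM dM df psiM]] := gradient_ratio oO hp H0 cfO fE cQ QE OG.
have W0 := collinear_vorticity_zero oO hp cf f0 cQ dQ cM dM df fin.
set E := regular O p in cM dM df psiM W0; have oE : open E by exact: regular_open.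
have EO : E `<=` O by move=> x [].
have mE := open_measurable2 oE.
(* [W] vanishes on the open set [E], hence so does its gradient $\lambda MF-F$. *)
have FM i x : E x -> rot_grad p i x = lam * (M x * rot_grad p i x).
  move=> Ex; have d : is_derive x (unit_vec i) (fun x => lam * f x - Q x) 0.
    have nU : \forall y \near x, 0 = lam * f y - Q y.
      by apply: filterS (open_nbhs_nbhs (conj oE Ex)) => y Ey; rewrite W0.
    exact: (is_derive_near nU (is_derive_const 0 x (unit_vec i))).
  have := is_deriveE (is_derive_sub (is_derive_scale lam (df i x Ex)) (dQ i x (EO _ Ex))).
  by rewrite (is_deriveE d) => /esym/eqP; rewrite subr_eq0 => /eqP.
have F0 i x : O x -> ~ E x -> rot_grad p i x = 0.
  move=> Ox nE; have : nrm2 p x == 0 by apply/negP => /negP n0; exact: nE.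
  rewrite /nrm2 paddr_eq0 ?sqr_ge0 // !sqrf_eq0 => /andP[/eqP e0 /eqP e1].
  by case: (ord2_cases i) => ->.
have FE i : ae_on O (fun x => wD O [:: i] psi x * (lam * \1_E x) = rot_grad p i x).
  have : ae_on O (fun x => E x -> wD O [:: i] psi x = M x * rot_grad p i x).
    by move: (psiM i); rewrite /ae_on => h; apply: (ae_imply h) => x H Ox Ex; exact: H.
  move=> H; apply: (ae_on_imply H) => x Ox Hx; rewrite indicE.
  have [Ex|nE] := pselect (E x).
    by rewrite mem_set // mulr1 (Hx Ex) mulrC -FM.
  by rewrite memNset // !mulr0 F0.
have s1 i : sqi area O (wD O [:: i] psi).
  by apply/L2_sqi; have [] := Hk_wD (s := [:: i]) oO H0.1 isT.
have mF i : measurable_fun (O : set mplane) (rot_grad p i) := C0_measurable oO (cF i).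
have F2 i : L2 O (rot_grad p i).
  apply/L2_sqi; apply: (sqi_ae mO (mF i) (FE i)); apply: (sqi_bndM mO (M := `|lam|) (s1 i)).
    apply: measurable_funM; first exact: measurable_cst.
    exact: measurable_indic.
  by move=> x _; rewrite normrM ler_piMr // indicE; case: (x \in E); rewrite ?normr1 ?normr0.
apply: (rot_grad_zero oO hp F2).
have iF i (g : plane R -> R) : sqi area O g -> area.-integrable O (EFin \o (fun x => rot_grad p i x * g x)).
  by move=> sg; apply: (sqi_mul mO) sg; apply/L2_sqi; exact: F2.
have iD := integrableD_EFin mO (iF ord0 _ (s1 ord0)) (iF ord_max _ (s1 ord_max)).
have sF i : sqi area O (rot_grad p i) by apply/L2_sqi; exact: F2.
have iFF := integrableD_EFin mO (iF ord0 _ (sF ord0)) (iF ord_max _ (sF ord_max)).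
have Z := divfree_orthogonal (F := rot_grad p) oO (isT : (0 < 2)%N) F2 (fun eta C => rot_grad_divfree oO hp C) H0.
transitivity (lam * 0 : R); last by rewrite mulr0.
rewrite -[X in lam * X]Z; apply: etrans _ (RintegralZl lam mO iD).
apply: (ae_on_eq_Rintegral oO).
- exact: integrable_mfun iFF.
- exact: integrable_mfun (integrableZ_EFin lam mO iD).
apply: (ae_on_imply2 (FE ord0) (FE ord_max)) => x Ox.
rewrite indicE; have [Ex|nE] := pselect (E x).
  rewrite mem_set //= mulr1.
  have aux (u v a b l : R) : a * l = u -> b * l = v -> u * u + v * v = l * (u * a + v * b) by clear=> <- <-; ring.
  exact: aux.
have aux (u v a b l : R) : u = 0 -> v = 0 -> u * u + v * v = l * (u * a + v * b) by clear=> -> ->; ring.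
by move=> _ _; exact: aux (F0 _ _ Ox nE) (F0 _ _ Ox nE).
Qed.

End ConvectionRigidity.

#[local] Transparent pd wD Rintegral.

(** * The Navier-Stokes system *)

Section Products.
Context {R : realType} {V W : normedModType R}.

Lemma derive_fst (g : V -> R) (v z : V * W) : 'D_v (fun z : V * W => g z.1) z = 'D_(v.1) g z.1.
Proof. by case: v z => [v1 v2] [z1 z2]. Qed.

Lemma derive_snd (g : W -> R) (v z : V * W) : 'D_v (fun z : V * W => g z.2) z = 'D_(v.2) g z.2.
Proof. by case: v z => [v1 v2] [z1 z2]. Qed.

Lemma smooth_fst (g : V -> R) : smooth g -> smooth (fun z : V * W => g z.1).
Proof.
move=> sg s z.
have -> : iter_deriv s (fun z : V * W => g z.1) = fun z : V * W => iter_deriv (map fst s) g z.1.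
  by elim: s => //= v s ->; apply/funext => y; rewrite derive_fst.
have [c d] := sg (map fst s) z.1; split.
  by case: z c {d} => z1 z2 c A /c nA; exists ([set x | A (iter_deriv (map fst s) g x)], setT); [split; [exact: nA|exact: filterT]|by move=> y []].
by move=> v; move: (d v.1); case: v z {c d} => [v1 v2] [z1 z2].
Qed.

Lemma smooth_snd (g : W -> R) : smooth g -> smooth (fun z : V * W => g z.2).
Proof.
move=> sg s z.
have -> : iter_deriv s (fun z : V * W => g z.2) = fun z : V * W => iter_deriv (map snd s) g z.2.
  by elim: s => //= v s ->; apply/funext => y; rewrite derive_snd.
have [c d] := sg (map snd s) z.2; split.
  by case: z c {d} => z1 z2 c A /c nA; exists (setT, [set x | A (iter_deriv (map snd s) g x)]); [split; [exact: filterT|exact: nA]|by move=> y []].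
by move=> v; move: (d v.2); case: v z {c d} => [v1 v2] [z1 z2].
Qed.

End Products.

Section Spacetime.
Context {R : realType}.
Notation leb := (@lebesgue_measure R).
Notation mplane := (measurableTypeR R * measurableTypeR R)%type.
Notation mspace := (measurableTypeR R * measurableTypeR R * measurableTypeR R)%type.
Implicit Types (O : set (plane R)) (f phi : spacetime R -> R) (chi h : plane R -> R) (th c : R -> R).

Lemma area_sigma_finite : sigma_finite setT (@area R).
Proof.
exists (fun n => box (- n%:R) n%:R (- n%:R) n%:R) => [|n].
  apply/seteqP; split=> // -[x y] _; exists (Num.trunc (Num.max `|x| `|y|)).+1 => //.
  have := truncnS_gt (Num.max `|x| `|y|); rewrite gt_max => /andP[/ltW hx /ltW hy].
  by rewrite /box /= !in_itv /= -!ler_norml.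
by split; [exact: box_measurable|exact: box_area].
Qed.

Lemma Rintegral_volume f : volume.-integrable setT (EFin \o f) ->
  \int[volume]_z f z = \int[leb]_t \int[area]_x f (x, t) /\
  leb.-integrable setT (EFin \o (fun t => \int[area]_x f (x, t))).
Proof.
(* [area] is declared as a plain measure; Fubini on space-time asks for a sigma-finite one, so the
   missing structure is packed around the same measure. *)
pose mix := @Measure_isSigmaFinite.Build _ _ R (@area R) area_sigma_finite.
pose m : {sigma_finite_measure set _ -> \bar R} := HB.pack_for
  {sigma_finite_measure set mplane -> \bar R} (Measure.sort (@area R)) (Measure.class (@area R)) mix.
move=> fi; split; first exact: (@Rintegral_prod21 _ _ _ _ R m).
exact: (@integrable_prod2 _ _ _ _ R m).
Qed.

Lemma cylinder_open O : open O -> open (cylinder O).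
Proof.
rewrite !openE => oO [x t] [/= /oO Ox t0].
exists (O, `]0, +oo[%classic) => /=; last by move=> [y s] [/= Oy]; rewrite in_itv /= andbT.
split=> //; apply: open_nbhs_nbhs; split; first exact: interval_open.
by rewrite /= in_itv /= t0.
Qed.

Lemma test_tensor_cyl O chi th (a b : R) : 0 < a -> test O chi -> test1 a b th ->
  test (cylinder O) (fun z : spacetime R => chi z.1 * th z.2).
Proof.
move=> a0 [schi [K [cK KO chi0]]] [sth th0].
split; first by apply: smooth_mul; [exact: smooth_fst|exact: smooth_snd].
exists (K `*` `[a, b]%classic); split.
- by apply: compact_setX => //; exact: segment_compact.
- move=> [x t] [/= Kx]; rewrite in_itv /= => /andP[at_ _]; split; first exact: KO.
  exact: lt_le_trans at_.
- move=> [x t] /= n; have [Kx|/chi0 ->] := pselect (K x); last by rewrite mul0r.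
  rewrite th0 ?mulr0 //; apply/negP => /andP[/ltW at_ /ltW tb]; apply: n; split=> //=.
  by rewrite in_itv /= at_ tb.
Qed.

Lemma iter_dt_tensor chi th (z : spacetime R) : smooth chi -> smooth th ->
  iter_deriv [:: dt] (fun z : spacetime R => chi z.1 * th z.2) z = chi z.1 * 'D_1 th z.2.
Proof.
move=> sc st; apply: is_deriveE.
have d1 := smooth_is_derive z dt (smooth_fst (W := R) sc).
have d2 := smooth_is_derive z dt (smooth_snd (V := (R * R)%type) st).
apply: is_derive_eq' (is_derive_mul d1 d2) _; rewrite derive_fst derive_snd /= (_ : 'D_(0, 0) chi z.1 = 0).
  by rewrite mulr0 addr0.
exact: derive0.
Qed.

Lemma iter_dx_tensor i chi th : smooth chi -> smooth th ->
  iter_deriv [:: dx i] (fun z : spacetime R => chi z.1 * th z.2) = fun z => pd [:: i] chi z.1 * th z.2.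
Proof.
move=> sc st; apply/funext => z; apply: is_deriveE.
have d1 := smooth_is_derive z (dx i) (smooth_fst (W := R) sc).
have d2 := smooth_is_derive z (dx i) (smooth_snd (V := (R * R)%type) st).
apply: is_derive_eq' (is_derive_mul d1 d2) _; rewrite derive_fst derive_snd /=.
have -> : 'D_0 th z.2 = 0 by exact: derive0.
by rewrite mulr0 add0r mulrC pdE.
Qed.

Lemma L1loc_cyl_test O f phi : open O -> L1loc_cyl O f -> test (cylinder O) phi ->
  volume.-integrable (cylinder O) (EFin \o (fun z => f z * phi z)) /\
  volume.-integrable setT (EFin \o (fun z => f z * phi z)) /\
  \int[volume]_(z in cylinder O) (f z * phi z) = \int[volume]_z (f z * phi z).
Proof.
move=> oO [mf fi] [sphi [K [cK KO phi0]]].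
have mC := open_measurable3 (cylinder_open oO).
have mK := compact_measurable3 cK.
have cphi x : {for x, continuous phi} by exact: smooth_cont.
have [M M0 HM] := continuous_bounded_on cK (fun x _ => cphi x).
have iK : volume.-integrable K (EFin \o (fun z => f z * phi z)).
  apply: (integrable_bndM (M := M)) => //; first exact: fi.
  exact: (measurable_funS (E := setT) _ _ (continuous_measurable3 openT (fun x _ => cphi x))).
have z0 z : ~ K z -> f z * phi z = 0 by move=> /phi0 ->; rewrite mulr0.
split; first by apply: (integrable_out (cylinder O : set mspace) K) => // z _; exact: z0.
split; first by apply: (integrable_out (setT : set mspace) K) => // z _; exact: z0.
apply/esym; apply: (Rintegral_out (setT : set mspace) _) => // z _ nC; apply: z0 => Kz; exact: nC (KO _ Kz).
Qed.

(** [f] agrees with [c t * h x] only for almost every [x] in each time slice. The integral is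
    therefore computed slice by slice, where measurability of the slices is enough; [a > 0] keeps
    the test function in positive times. *)
Lemma Rintegral_cyl_separated O f h chi c th (a b : R) : open O -> L1loc_cyl O f -> 0 < a ->
  test O chi -> test1 a b th ->
  (forall t, 0 < t -> measurable_fun (O : set mplane) (fun x => f (x, t)) /\ ae_on O (fun x => f (x, t) = c t * h x)) ->
  area.-integrable O (EFin \o (fun x => h x * chi x)) -> leb.-integrable setT (EFin \o (fun t => c t * th t)) ->
  \int[volume]_(z in cylinder O) (f z * (chi z.1 * th z.2)) =
  (\int[leb]_t (c t * th t)) * \int[area]_(x in O) (h x * chi x).
Proof.
move=> oO Lf a0 Tc Tt H ih ic; have mO := open_measurable2 oO.
have [_ [iT ->]] := L1loc_cyl_test oO Lf (test_tensor_cyl a0 Tc Tt).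
rewrite (Rintegral_volume iT).1 -RintegralZr //.
apply: eq_Rintegral => t _ /=.
have [t0|t0] := leP t 0.
  have -> : th t = 0 by apply: Tt.2; rewrite negb_and -leNgt (le_trans t0 (ltW a0)).
  by rewrite mulr0 mul0r; under eq_Rintegral do rewrite !mulr0; rewrite Rintegral0.
have [mf fE] := H t t0.
rewrite -(RintegralZl (c t * th t) mO ih).
have mchi : measurable_fun (O : set mplane) chi by exact: Cc_measurable (test_Cc Tc).
transitivity (\int[area]_(x in O) (f (x, t) * (chi x * th t))).
  apply: (Rintegral_out (setT : set mplane) _) => // x _ nO.
  by have [_ [K [_ KO ->]]] := Tc; rewrite ?mul0r ?mulr0 // => /KO.
apply: (ae_on_eq_Rintegral oO).
- apply: measurable_funM => //; apply: measurable_funM => //; exact: measurable_cst.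
- by apply: measurable_funM; [exact: measurable_cst|exact: integrable_mfun ih].
apply: (ae_on_imply fE) => x _ ->.
have aux (p q r s : R) : p * q * (r * s) = p * s * (q * r) by clear; ring.
exact: aux.
Qed.

End Spacetime.

#[local] Opaque pd wD Rintegral.

Section DecayingFlow.
Context {R : realType}.
Notation leb := (@lebesgue_measure R).
Notation mplane := (measurableTypeR R * measurableTypeR R)%type.
Implicit Types (O : set (plane R)) (p psi : plane R -> R) (u : 'I_2 -> plane R -> R) (th c : R -> R).

Lemma integrable_test1_mul (a b : R) c th : continuous c -> test1 a b th ->
  leb.-integrable setT (EFin \o (fun t => c t * th t)).
Proof.
move=> cc [st th0].
apply: (integrable_out (setT : set (measurableTypeR R)) (`[a, b]%classic : set (measurableTypeR R))) => //.
  move=> t _ /=; rewrite in_itv /= => n; rewrite th0 ?mulr0 //; apply/negP => /andP[/ltW at_ /ltW tb].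
  by apply: n; rewrite at_ tb.
apply: integrable_continuous_itv => t _; apply: continuous_mul; [exact: cc|exact: smooth_cont].
Qed.

Lemma is_derive_decay (k t : R) : is_derive t 1 (fun t : R => expR (- (k * t))) (- k * expR (- (k * t))).
Proof.
have d : is_derive t 1 (fun t : R => - (k * t)) (- k).
  by apply: is_derive_eq' (is_derive_opp (is_derive_scale k (is_derive_id t 1))) _; rewrite mulr1.
by apply: is_derive_eq' (is_derive_comp1 (is_derive_expR _) d) _; rewrite mulrC.
Qed.

Lemma decay_continuous (k : R) : continuous (fun t : R => expR (- (k * t))).
Proof. exact: is_derive_continuousT (is_derive_decay k). Qed.

Lemma decay_parts (k a b : R) th : test1 a b th ->
  \int[leb]_t (expR (- (k * t)) * 'D_1 th t) = k * \int[leb]_t (expR (- (k * t)) * th t).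
Proof.
move=> T; have [ba|ab] := leP b a.
  have t0 t : th t = 0.
    by apply: T.2; apply/negP => /andP[h1 h2]; move: (lt_trans h1 h2); rewrite ltNge ba.
  have e : th = fun=> 0 by apply/funext.
  rewrite e; under eq_Rintegral do rewrite derive_cst mulr0.
  by under [in RHS]eq_Rintegral do rewrite mulr0; rewrite Rintegral0 mulr0.
have i1 := integrable_test1_mul (@decay_continuous k) (test1_D ab T).
have i2 := integrable_test1_mul (@decay_continuous k) T.
have i3 := integrableZ_EFin (- k) measurableT i2.
pose M := `|a| + `|b| + 1.
have : \int[leb]_t (expR (- (k * t)) * 'D_1 th t + - k * (expR (- (k * t)) * th t)) = 0.
  apply: (Rintegral_derive_compact (F := fun t => expR (- (k * t)) * th t) (M := M)).
  - by rewrite /M ltr_wpDl // addr_ge0.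
  - move=> t; apply: is_derive_eq' (is_derive_mul (is_derive_decay k t) (smooth_is_derive t 1 T.1)) _.
    have aux (u v w : R) : u * v + w * (- k * u) = u * v + - k * (u * w) by ring.
    exact: aux.
  - apply: continuous_for => t; apply: continuous_add; apply: continuous_mul.
    + exact: decay_continuous.
    + exact: (proj1 (T.1 [:: 1] t)).
    + exact: continuous_const.
    + by apply: continuous_mul; [exact: decay_continuous|exact: smooth_cont T.1].
  - move=> t n; rewrite T.2 ?mulr0 //; apply/negP => /andP[h1 h2]; apply: n; rewrite /M.
    have := ler_norm b; have := ler_norm (- a); have := normr_ge0 a; have := normr_ge0 b; rewrite normrN.
    by move=> ? ? ? ?; apply/andP; split; lra.
rewrite (RintegralD measurableT i1 i3) (RintegralZl (- k) measurableT i2).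
by move=> /eqP; rewrite addr_eq0 mulNr opprK => /eqP.
Qed.

Lemma lap_tensor chi th (z : spacetime R) : smooth chi -> smooth th ->
  \sum_(i < 2) iter_deriv [:: dx i; dx i] (fun z : spacetime R => chi z.1 * th z.2) z = lap chi z.1 * th z.2.
Proof.
move=> sc st; rewrite sum2 lapE mulrDl.
have E i : iter_deriv [:: dx i; dx i] (fun z : spacetime R => chi z.1 * th z.2) = fun z => pd [:: i; i] chi z.1 * th z.2.
  rewrite -[LHS]/(iter_deriv [:: dx i] (iter_deriv [:: dx i] _)) (iter_dx_tensor i sc st).
  exact: (iter_dx_tensor i (smooth_pd [:: i] sc) st).
by rewrite !E.
Qed.

(** The derivative of $u^j$ along $x_i$ in terms of $\psi$, with the order of indices that
    [is_wD_iter] produces. *)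
Definition velocity_gradient O psi (i j : 'I_2) (x : plane R) : R :=
  if j == ord0 then wD O [:: ord_max; i] psi x else - wD O [:: ord0; i] psi x.

Lemma stream_velocity O u psi : ae_on O (fun x => forall j, u j x = - grad_perp O psi j x) ->
  ae_on O (fun x => u ord0 x = wD O [:: ord_max] psi x) /\ ae_on O (fun x => u ord_max x = - wD O [:: ord0] psi x).
Proof.
by move=> H; split; apply: (ae_on_imply H) => x _ /(_ _) ->; rewrite /grad_perp /= ?opprK.
Qed.

Lemma velocity_gradient_wD O u psi i j : open O -> H0k 2 O psi -> (forall j, H0k 1 O (u j)) ->
  ae_on O (fun x => forall j, u j x = - grad_perp O psi j x) ->
  is_wD O [:: i] (u j) (velocity_gradient O psi i j).
Proof.
move=> oO H0 Hu uE; have [e0 e1] := stream_velocity uE.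
have mu j' : measurable_fun (O : set mplane) (u j') by have [[[]]] := Hu j'.
have it j' := is_wD_iter i j' oO (isT : (1 < 2)%N) H0.1.
case: (ord2_cases j) => ->; rewrite /velocity_gradient ?eqxx /=.
  apply: (is_wD_ae oO (it ord_max)) => //; [by have [_ [m _] _] := it ord_max; exact: m| |exact: ae_on_all].
  by apply: (ae_on_imply e0) => x _ ->.
have sN : (fun x => - wD O [:: ord0; i] psi x) = (fun x => -1 * wD O [:: ord0; i] psi x).
  by apply/funext => x; rewrite mulN1r.
rewrite sN; have := is_wD_scale (-1) oO (it ord0) => w.
apply: (is_wD_ae oO w) => //; [by have [_ [m _] _] := w; exact: m| |exact: ae_on_all].
by apply: (ae_on_imply e1) => x _ ->; rewrite mulN1r.
Qed.

(* The momentum equation is tested with [th t * (- d_2 eta, d_1 eta)]: the pressure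
   term vanishes, the linear terms cancel by the Stokes system, and the convection
   term carries the positive factor [\int exp (- 2 nu lam t) * th t]. *)
Lemma navier_stokes_convection O nu lam u p psi eta : open O -> 0 < nu -> H0k 2 O psi ->
  (forall j, H0k 1 O (u j)) -> stokes_pressure O lam u p ->
  ae_on O (fun x => forall j, u j x = - grad_perp O psi j x) ->
  navier_stokes O nu (decaying nu lam u) u -> test O eta ->
  \int[area]_(x in O)
     (- (wD O [:: ord_max] psi x * wD O [:: ord_max; ord0] psi x - wD O [:: ord0] psi x * wD O [:: ord_max; ord_max] psi x) * pd [:: ord_max] eta x +
      (- (wD O [:: ord_max] psi x * wD O [:: ord0; ord0] psi x) + wD O [:: ord0] psi x * wD O [:: ord0; ord_max] psi x) * pd [:: ord0] eta x) = 0.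
Proof.
move=> oO nu0 H0 Hu [hp sp] uE [G [pi [[Lv LG LC Lp] slices mom _]]] T; have mO := open_measurable2 oO.
have mC := open_measurable3 (cylinder_open oO).
have cp := C1_C0 (harmonic_C1 oO hp).
have [e0 e1] := stream_velocity uE.
pose g := velocity_gradient O psi.
have wg i j : is_wD O [:: i] (u j) (g i j) by exact: velocity_gradient_wD.
have su j : sqi area O (u j) by apply/L2_sqi; have [[]] := Hu j.
have sg i j : sqi area O (g i j).
  rewrite /g /velocity_gradient; have s2 k l : sqi area O (wD O [:: k; l] psi).
    by apply/L2_sqi; have [] := Hk_wD (s := [:: k; l]) oO H0.1 isT.
  by case: (ord2_cases j) => ->; rewrite ?eqxx /=; [exact: s2|exact: (sqi_opp mO)].
have mu j : measurable_fun (O : set mplane) (u j) := (su j).1.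
have mg i j : measurable_fun (O : set mplane) (g i j) := (sg i j).1.
pose c (t : R) := expR (- (nu * lam * t)).
have cc : continuous c by exact: decay_continuous.
(* A nonnegative weight in positive times, positive on an interval, so that the factor of the
   convection term is not 0. *)
pose th : R -> R := bump 1 2.
have Tth : test1 1 2 th by split; [exact: smooth_bump|exact: bump_out].
have sth := Tth.1.
have h12 : (1 : R) < 2 by lra.
have Tth' : test1 1 2 (fun t : R => 'D_1 th t) by exact: test1_D.
pose chi (j : 'I_2) (x : plane R) := if j == ord0 then - pd [:: ord_max] eta x else pd [:: ord0] eta x.
have Tchi j : test O (chi j).
  rewrite /chi; case: (ord2_cases j) => ->; rewrite ?eqxx /=; last exact: (test_pd [:: ord0] T).
  have -> : (fun x => - pd [:: ord_max] eta x) = (fun x => -1 * pd [:: ord_max] eta x) by apply/funext => x; rewrite mulN1r.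
  exact: (test_scale (-1) (test_pd [:: ord_max] T)).
have schi j := (Tchi j).1.
(* The system provides some weak derivatives [G] of each slice; by uniqueness they are the decaying
   multiples of those of [u]. *)
have Gae t : 0 < t -> forall i j, measurable_fun (O : set mplane) (fun x => G i j (x, t)) /\
    ae_on O (fun x => G i j (x, t) = c t * g i j x).
  move=> t0 i j; have [_ wG _] := slices t t0; have w := wG i j.
  split; first by have [_ [m _] _] := w; exact: m.
  exact: (is_wD_unique oO w (is_wD_scale (c t) oO (wg i j))).
pose conv j (x : plane R) := u ord0 x * g ord0 j x + u ord_max x * g ord_max j x.
have Cchi j : Cc O (chi j) by exact: test_Cc.
have a0 : (0 : R) < 1 by [].
have iu j (k : plane R -> R) : Cc O k -> area.-integrable O (EFin \o (fun x => u j x * k x)).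
  by move=> ck; apply: (sqi_mul mO (su j)); apply/L2_sqi; exact: Cc_L2.
have sv j t : 0 < t -> measurable_fun (O : set mplane) (fun x => decaying nu lam u j (x, t)) /\
    ae_on O (fun x => decaying nu lam u j (x, t) = c t * u j x).
  move=> _; split; last exact: ae_on_all.
  by apply: (measurable_funM (f := fun=> c t)) (mu j); exact: measurable_cst.
have T1 j := Rintegral_cyl_separated (h := u j) (c := c) oO (Lv j) a0 (Tchi j) Tth'
   (sv j)
   (iu j _ (Cchi j)) (integrable_test1_mul cc Tth').
have T3 j := Rintegral_cyl_separated (h := u j) (c := c) oO (Lv j) a0 (test_pd_lap (Tchi j)) Tth
   (sv j)
   (iu j _ (test_Cc (test_pd_lap (Tchi j)))) (integrable_test1_mul cc Tth).
have ic j : area.-integrable O (EFin \o (fun x => conv j x * chi j x)).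
  have [M M0 HM] := Cc_bounded (Cchi j).
  apply: (integrable_bndM (M := M)) => //.
    by apply: (integrableD_EFin mO); exact: (sqi_mul mO).
  exact: Cc_measurable (Cchi j).
have c2 : continuous (fun t => c t * c t).
  by apply: continuous_for => t; apply: continuous_mul; exact: cc.
have LC' j : L1loc_cyl O (fun z => decaying nu lam u ord0 z * G ord0 j z + decaying nu lam u ord_max z * G ord_max j z).
  by have := LC j; under eq_fun do rewrite sum2.
have sconv j t : 0 < t -> measurable_fun (O : set mplane) (fun x => decaying nu lam u ord0 (x, t) * G ord0 j (x, t) + decaying nu lam u ord_max (x, t) * G ord_max j (x, t)) /\
    ae_on O (fun x => decaying nu lam u ord0 (x, t) * G ord0 j (x, t) + decaying nu lam u ord_max (x, t) * G ord_max j (x, t) = c t * c t * conv j x).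
  move=> t0; have [m0 E0] := Gae t t0 ord0 j; have [m1 E1] := Gae t t0 ord_max j; split.
    have mv k : measurable_fun (O : set mplane) (fun x => decaying nu lam u k (x, t)) by exact: (sv k t t0).1.
    exact: (measurable_funD (measurable_funM (mv ord0) m0) (measurable_funM (mv ord_max) m1)).
  apply: (ae_on_imply2 E0 E1) => x _ -> ->; rewrite /decaying /conv /=.
  have aux (k a b d e : R) : k * a * (k * b) + k * d * (k * e) = k * k * (a * b + d * e) by clear; ring.
  exact: aux.
have T2 j := Rintegral_cyl_separated (h := conv j) (c := fun t => c t * c t) oO (LC' j) a0 (Tchi j) Tth
   (sconv j) (ic j) (integrable_test1_mul c2 Tth).
pose D j := \int[volume]_(z in cylinder O) (pi z * (pd [:: j] (chi j) z.1 * th z.2)).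
pose A := \int[leb]_t (c t * th t).
pose B := \int[leb]_t (c t * c t * th t).
have mj j : - (nu * lam * A * \int[area]_(x in O) (u j x * chi j x)) + B * \int[area]_(x in O) (conv j x * chi j x) -
    nu * (A * \int[area]_(x in O) (u j x * lap (chi j) x)) - D j = 0.
  have := mom j _ (test_tensor_cyl a0 (Tchi j) Tth).
  have [i1 _] := L1loc_cyl_test oO (Lv j) (test_tensor_cyl a0 (Tchi j) Tth').
  have [i2 _] := L1loc_cyl_test oO (LC' j) (test_tensor_cyl a0 (Tchi j) Tth).
  have [i3 _] := L1loc_cyl_test oO (Lv j) (test_tensor_cyl a0 (test_pd_lap (Tchi j)) Tth).
  have [i4 _] := L1loc_cyl_test oO Lp (test_tensor_cyl a0 (test_pd [:: j] (Tchi j)) Tth).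
  have n1 := integrableN_EFin mC i1; have n3 := integrableZ_EFin nu mC i3.
  have s1 := integrableD_EFin mC n1 i2; have s2 := integrableB_EFin mC s1 n3.
  have -> : \int[volume]_(z in cylinder O)
     (- (decaying nu lam u j z * iter_deriv [:: dt] (fun z : spacetime R => chi j z.1 * th z.2) z)
      + (\sum_(i < 2) decaying nu lam u i z * G i j z) * (chi j z.1 * th z.2)
      - nu * (decaying nu lam u j z * \sum_(i < 2) iter_deriv [:: dx i; dx i] (fun z : spacetime R => chi j z.1 * th z.2) z)
      - pi z * iter_deriv [:: dx j] (fun z : spacetime R => chi j z.1 * th z.2) z) =
    \int[volume]_(z in cylinder O)
     (- (decaying nu lam u j z * (chi j z.1 * 'D_1 th z.2)) +
      (decaying nu lam u ord0 z * G ord0 j z + decaying nu lam u ord_max z * G ord_max j z) * (chi j z.1 * th z.2)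
      - nu * (decaying nu lam u j z * (lap (chi j) z.1 * th z.2)) - pi z * (pd [:: j] (chi j) z.1 * th z.2)).
    by apply: eq_Rintegral => z _; rewrite (iter_dt_tensor z (schi j) sth) (lap_tensor z (schi j) sth) (iter_dx_tensor j (schi j) sth) sum2.
  move=> E0; apply: etrans _ E0; apply/esym.
  apply: etrans (RintegralB mC s2 i4) _; apply: (f_equal (fun y => y - D j)).
  apply: etrans (RintegralB mC s1 n3) _; apply: (f_equal2 (fun x y => x - y)); last first.
    by apply: etrans (RintegralZl nu mC i3) _; apply: f_equal; exact: T3 j.
  apply: etrans (RintegralD mC n1 i2) _; apply: (f_equal2 +%R); last exact: T2 j.
  apply: etrans (RintegralN mC i1) _; apply: f_equal; apply: etrans (T1 j) _.
  by rewrite (decay_parts (nu * lam) Tth).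
have chi0 : chi ord0 = fun x => - pd [:: ord_max] eta x by [].
have chi1 : chi ord_max = pd [:: ord0] eta by [].
have dd x : pd [:: ord0] (chi ord0) x + pd [:: ord_max] (chi ord_max) x = 0.
  have -> : pd [:: ord0] (chi ord0) x = - pd [:: ord0; ord_max] eta x.
    rewrite pdE; apply: is_deriveE; rewrite chi0.
    by have := is_derive_opp (smooth_is_derive x (unit_vec ord0) (smooth_pd [:: ord_max] T.1)).
  by rewrite chi1 -(pd_cons ord_max [:: ord0]) (smooth_pdC2 ord0 ord_max T.1) addNr.
have D0 : D ord0 + D ord_max = 0.
  have i4 j := (L1loc_cyl_test oO Lp (test_tensor_cyl a0 (test_pd [:: j] (Tchi j)) Tth)).1.
  apply: etrans (esym (RintegralD mC (i4 ord0) (i4 ord_max))) _.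
  apply: etrans _ (Rintegral0 volume (cylinder O)); apply: eq_Rintegral => z _.
  have aux (q a b t : R) : a + b = 0 -> q * (a * t) + q * (b * t) = 0 by clear=> e; rewrite -mulrDr -mulrDl e mul0r mulr0.
  exact: aux (dd z.1).
have ip j : area.-integrable O (EFin \o (fun x => p x * pd [:: j] (chi j) x)).
  by apply: (L1loc_Cc oO (C0_L1loc oO cp)); exact: test_Cc (test_pd [:: j] (Tchi j)).
have sj j : \int[area]_(x in O) (u j x * lap (chi j) x) + lam * \int[area]_(x in O) (u j x * chi j x) =
    - \int[area]_(x in O) (p x * pd [:: j] (chi j) x).
  have i1 := iu j _ (test_Cc (test_pd_lap (Tchi j))); have i2 := iu j _ (Cchi j).
  apply: etrans _ (sp j _ (Tchi j)); apply: etrans _ (esym (RintegralD mO i1 (integrableZ_EFin lam mO i2))).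
  by apply: f_equal; exact: esym (RintegralZl lam mO i2).
have P0 : \int[area]_(x in O) (p x * pd [:: ord0] (chi ord0) x) + \int[area]_(x in O) (p x * pd [:: ord_max] (chi ord_max) x) = 0.
  apply: etrans (esym (RintegralD mO (ip ord0) (ip ord_max))) _.
  apply: etrans _ (Rintegral0 area O); apply: eq_Rintegral => x _.
  have aux (q a b : R) : a + b = 0 -> q * a + q * b = 0 by clear=> e; rewrite -mulrDr e mulr0.
  exact: aux (dd x).
have B0 : B != 0.
  apply/eqP => Bz.
  have pos t : 0 <= c t * c t * th t by rewrite mulr_ge0 ?bump_ge0 // mulr_ge0 // expR_ge0.
  have := ae_zero_of_integral_zero measurableT (integrable_test1_mul c2 Tth) (fun t _ => pos t) Bz.
  move=> /(ae_exists h12)[t t12 /(_ I)/eqP].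
  by apply/negP; rewrite gt_eqF // mulr_gt0 ?bump_gt0 // mulr_gt0 ?expR_gt0.
have C0 : \int[area]_(x in O) (conv ord0 x * chi ord0 x) + \int[area]_(x in O) (conv ord_max x * chi ord_max x) = 0.
  have aux (n l A' B' a1 a2 b1 b2 c3 c4 d1 d2 D1 D2 : R) : B' != 0 ->
      - (n * l * A' * a1) + B' * c3 - n * (A' * b1) - D1 = 0 ->
      - (n * l * A' * a2) + B' * c4 - n * (A' * b2) - D2 = 0 -> D1 + D2 = 0 ->
      b1 + l * a1 = - d1 -> b2 + l * a2 = - d2 -> d1 + d2 = 0 -> c3 + c4 = 0.
    clear=> Bn h1 h2 h3 h4 h5 h6; apply: (mulfI Bn); rewrite mulr0.
    have -> : B' * (c3 + c4) = (- (n * l * A' * a1) + B' * c3 - n * (A' * b1) - D1) +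
       (- (n * l * A' * a2) + B' * c4 - n * (A' * b2) - D2) + n * A' * ((b1 + l * a1) + (b2 + l * a2)) + (D1 + D2) by ring.
    by rewrite h1 h2 h3 h4 h5 -opprD h6 oppr0 mulr0 !addr0.
  exact: aux B0 (mj ord0) (mj ord_max) D0 (sj ord0) (sj ord_max) P0.
apply: etrans _ C0; apply: etrans _ (RintegralD mO (ic ord0) (ic ord_max)).
have mN (h : plane R -> R) : measurable_fun (O : set mplane) h -> measurable_fun (O : set mplane) (fun x => - h x).
  move=> mh; have -> : (fun x => - h x) = (fun x => 0 - h x) by apply/funext => x; rewrite sub0r.
  by apply: (measurable_funB (f := fun=> 0)) mh; exact: measurable_cst.
have mw s : (size s <= 2)%N -> measurable_fun (O : set mplane) (wD O s psi).
  by move=> hs; have [_ [m _]] := Hk_wD oO H0.1 hs; exact: m.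
have me i : measurable_fun (O : set mplane) (pd [:: i] eta) by exact: Cc_measurable (test_Cc (test_pd [:: i] T)).
apply: (ae_on_eq_Rintegral oO).
- have mm s t (hs : (size s <= 2)%N) (ht : (size t <= 2)%N) := measurable_funM (mw s hs) (mw t ht).
  apply: measurable_funD; apply: measurable_funM (me _).
    by apply: mN; apply: measurable_funB; exact: mm.
  apply: measurable_funD; last exact: mm.
  by apply: mN; exact: mm.
- exact: integrable_mfun (integrableD_EFin mO (ic ord0) (ic ord_max)).
apply: (ae_on_imply2 e0 e1) => x _ h0 h1; rewrite /conv h0 h1 chi0 chi1 /g /velocity_gradient !eqxx /=.
have aux (q0 q1 w10 w11 w00 w01 n0 n1 : R) :
  - (q1 * w10 - q0 * w11) * n1 + (- (q1 * w00) + q0 * w01) * n0 =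
  (q1 * w10 + - q0 * w11) * - n1 + (q1 * - w00 + - q0 * - w01) * n0 by clear; ring.
exact: aux.
Qed.

End DecayingFlow.

Section Slices.
Context {R : realType} {V W : normedModType R}.

Lemma quotient_pair1 (f : V * W -> R) (t : W) (v x : V) :
  (fun h : R => h^-1 *: ((f \o shift (x, t)) (h *: ((v, 0) : V * W)) - f (x, t))) =
  (fun h : R => h^-1 *: (((fun x => f (x, t)) \o shift x) (h *: v) - f (x, t))).
Proof.
apply/funext => h /=; congr (_ *: (f (_, _) - _)).
by transitivity (h *: (0 : W) + t); [|rewrite scaler0 add0r].
Qed.

Lemma quotient_pair2 (f : V * W -> R) (x : V) (w t : W) :
  (fun h : R => h^-1 *: ((f \o shift (x, t)) (h *: ((0, w) : V * W)) - f (x, t))) =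
  (fun h : R => h^-1 *: (((fun t => f (x, t)) \o shift t) (h *: w) - f (x, t))).
Proof.
apply/funext => h /=; congr (_ *: (f (_, _) - _)).
by transitivity (h *: (0 : V) + x); [|rewrite scaler0 add0r].
Qed.

Lemma derive_pair1 (f : V * W -> R) (t : W) (v x : V) : 'D_v (fun x => f (x, t)) x = 'D_((v, 0) : V * W) f (x, t).
Proof. by rewrite /derive quotient_pair1. Qed.

Lemma derive_pair2 (f : V * W -> R) (x : V) (w t : W) : 'D_w (fun t => f (x, t)) t = 'D_((0, w) : V * W) f (x, t).
Proof. by rewrite /derive quotient_pair2. Qed.

Lemma smooth_pair1 (f : V * W -> R) (t : W) : smooth f -> smooth (fun x => f (x, t)).
Proof.
move=> sf s x.
have -> : iter_deriv s (fun x => f (x, t)) = fun x => iter_deriv (map (fun v : V => ((v, 0) : V * W)) s) f (x, t).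
  by elim: s => //= v s ->; apply/funext => y; rewrite derive_pair1.
have [c d] := sf (map (fun v : V => ((v, 0) : V * W)) s) (x, t); split.
  move=> A /c [[B1 B2] /= [n1 n2] BA]; apply: filterS n1 => y By; apply: (BA (y, t)).
  by split=> //; exact: nbhs_singleton n2.
by move=> v; have := d ((v, 0) : V * W); rewrite /derivable quotient_pair1.
Qed.

Lemma smooth_pair2 (f : V * W -> R) (x : V) : smooth f -> smooth (fun t => f (x, t)).
Proof.
move=> sf s t.
have -> : iter_deriv s (fun t => f (x, t)) = fun t => iter_deriv (map (fun w : W => ((0, w) : V * W)) s) f (x, t).
  by elim: s => //= v s ->; apply/funext => y; rewrite derive_pair2.
have [c d] := sf (map (fun w : W => ((0, w) : V * W)) s) (x, t); split.
  move=> A /c [[B1 B2] /= [n1 n2] BA]; apply: filterS n2 => y By; apply: (BA (x, y)).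
  by split=> //; exact: nbhs_singleton n1.
by move=> w; have := d ((0, w) : V * W); rewrite /derivable quotient_pair2.
Qed.

End Slices.

Section SeparatedFields.
Context {R : realType}.
Notation leb := (@lebesgue_measure R).
Notation mplane := (measurableTypeR R * measurableTypeR R)%type.
Notation mspace := (measurableTypeR R * measurableTypeR R * measurableTypeR R)%type.
Implicit Types (O : set (plane R)) (f phi : spacetime R -> R) (chi h : plane R -> R) (c : R -> R).

Lemma test_slice O phi t : test (cylinder O) phi -> test O (fun x => phi (x, t)).
Proof.
move=> [sphi [K [cK KO phi0]]]; split; first exact: smooth_pair1.
exists (fst @` K); split.
- by apply: continuous_compact cK; apply: continuous_subspaceT => z; exact: cvg_fst.
- by move=> x [z /KO [Oz _] <-].
- by move=> x n; apply: phi0 => Kz; apply: n; exists (x, t).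
Qed.

Lemma test_iter_dt O phi (x : plane R) : test (cylinder O) phi ->
  exists2 M : R, 0 < M & forall t, ~ (- M <= t <= M) -> phi (x, t) = 0 /\ iter_deriv [:: dt] phi (x, t) = 0.
Proof.
move=> T; have [_ [K [cK KO phi0]]] := T.
have cS : compact (snd @` K).
  by apply: continuous_compact cK; apply: continuous_subspaceT => z; exact: cvg_snd.
have [M M0 HM] := compact_itv_sub cS; exists M => // t n.
have nK : ~ K (x, t) by move=> Kt; apply: n; have := HM t (ex_intro2 _ _ _ Kt erefl); rewrite /= in_itv.
split; first exact: phi0.
exact: (iter_deriv_out [:: dt] cK phi0).
Qed.

Lemma Rintegral_volume12 f : volume.-integrable setT (EFin \o f) ->
  \int[volume]_z f z = \int[area]_x \int[leb]_t f (x, t).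
Proof.
pose mix := @Measure_isSigmaFinite.Build _ _ R (@area R) area_sigma_finite.
pose m : {sigma_finite_measure set _ -> \bar R} := HB.pack_for
  {sigma_finite_measure set mplane -> \bar R} (Measure.sort (@area R)) (Measure.class (@area R)) mix.
exact: (@Rintegral_prod12 _ _ _ _ R m).
Qed.

Lemma volume_tensor (u : plane R -> R) (v : R -> R) :
  area.-integrable setT (EFin \o u) -> leb.-integrable setT (EFin \o v) ->
  volume.-integrable setT (EFin \o (fun z : mspace => u z.1 * v z.2)).
Proof.
pose mix := @Measure_isSigmaFinite.Build _ _ R (@area R) area_sigma_finite.
pose m : {sigma_finite_measure set _ -> \bar R} := HB.pack_for
  {sigma_finite_measure set mplane -> \bar R} (Measure.sort (@area R)) (Measure.class (@area R)) mix.
exact: (@integrable_tensor _ _ _ _ R m).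
Qed.

Lemma L1loc_cyl_tensor O h c : open O -> L1loc O h -> continuous c ->
  L1loc_cyl O (fun z => c z.2 * h z.1).
Proof.
move=> oO [mh ih] cc; have mO := open_measurable2 oO; have mC := open_measurable3 (cylinder_open oO).
have mc : measurable_fun setT c by exact: continuous_measurable_fun.
split.
  have m2 : measurable_fun (cylinder O : set mspace) (snd : mspace -> measurableTypeR R) by exact: measurable_funTS measurable_snd.
  apply: measurable_funM; first exact: (measurableT_comp mc m2).
  apply: (measurable_comp (F := (O : set mplane))) => //; first by move=> x [z [Oz _] <-].
  exact: measurable_funTS measurable_fst.
move=> K cK KO.
have cF : compact (fst @` K).
  by apply: continuous_compact cK; apply: continuous_subspaceT => z; exact: cvg_fst.
have cS : compact (snd @` K).
  by apply: continuous_compact cK; apply: continuous_subspaceT => z; exact: cvg_snd.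
have [M M0 HM] := compact_itv_sub cS.
have FO : fst @` K `<=` O by move=> x [z /KO [Oz _] <-].
have mF := compact_measurable2 cF; have mK := compact_measurable3 cK.
have i1 : area.-integrable setT (EFin \o (h \_ (fst @` K))) by apply: integrable_patch => //; exact: ih.
have i2 : leb.-integrable setT (EFin \o (c \_ `[- M, M])).
  by apply: integrable_patch => //; apply: integrable_continuous_itv => t _; exact: cc.
have := volume_tensor i1 i2; move=> /(integrableS measurableT mK (@subsetT _ _)).
apply: eq_integrable => // z /[!inE] Kz /=.
have e1 : (h \_ (fst @` K)) z.1 = h z.1 by rewrite patchE mem_set //; exists z.
have e2 : (c \_ `[- M, M]) z.2 = c z.2 by rewrite patchE mem_set //; apply: HM; exists z.
by rewrite e1 e2 mulrC.
Qed.

Lemma pd_slice (phi : spacetime R -> R) (i : 'I_2) (t : R) (x : plane R) :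
  pd [:: i] (fun x => phi (x, t)) x = iter_deriv [:: dx i] phi (x, t).
Proof. by rewrite pdE derive_pair1. Qed.

Lemma lap_slice (phi : spacetime R -> R) (t : R) (x : plane R) :
  lap (fun x => phi (x, t)) x = \sum_(i < 2) iter_deriv [:: dx i; dx i] phi (x, t).
Proof.
rewrite /lap; apply: eq_bigr => i _; rewrite (pd_cons i [:: i]).
have -> : pd [:: i] (fun x => phi (x, t)) = fun x => iter_deriv [:: dx i] phi (x, t).
  by apply/funext => y; exact: pd_slice.
exact: (pd_slice (iter_deriv [:: dx i] phi)).
Qed.

End SeparatedFields.

Section Bernoulli.
Context {R : realType}.
Notation leb := (@lebesgue_measure R).
Notation mplane := (measurableTypeR R * measurableTypeR R)%type.
Notation mspace := (measurableTypeR R * measurableTypeR R * measurableTypeR R)%type.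
Implicit Types (O : set (plane R)) (f phi : spacetime R -> R) (p psi h : plane R -> R) (u : 'I_2 -> plane R -> R).

Lemma L1loc_mul_sqi O (a b : plane R -> R) : open O -> sqi area O a -> sqi area O b -> L1loc O (fun x => a x * b x).
Proof.
move=> oO sa sb; have mO := open_measurable2 oO; have i := sqi_mul mO sa sb.
split; first exact: integrable_mfun i.
by move=> K cK KO; apply: integrableS i => //; exact: compact_measurable2.
Qed.

(** The Leibniz rule holds for the approximating test functions, and a product of two sequences that
    converge in $L^2$ may be passed to the limit against a bounded test function. *)
Lemma is_wD_square O psi s j : open O -> H0k 2 O psi -> (size s <= 1)%N ->
  is_wD O [:: j] (fun x => wD O s psi x * wD O s psi x) (fun x => 2 * (wD O s psi x * wD O (j :: s) psi x)).
Proof.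
move=> oO H0 hs; have mO := open_measurable2 oO.
have [phi [tphi c]] := H0k_approx oO H0.
have hs2 : (size s <= 2)%N by exact: leq_trans hs _.
have c1 := c s hs2; have c2 := c (j :: s) hs.
have [s1 s1' _] := c1; have [s2 s2' _] := c2.
split.
- exact: L1loc_mul_sqi.
- by apply: L1loc_scale => //; exact: L1loc_mul_sqi.
move=> chi T /=; rewrite expr1 mulN1r.
have [j1 i1 l1] := cvgL2_mul3 oO c1 c1 (test_Cc (test_pd [:: j] T)).
have [j2 i2 l2] := cvgL2_mul3 oO c1 c2 (test_Cc T).
have -> : \int[area]_(x in O) (2 * (wD O s psi x * wD O (j :: s) psi x) * chi x) =
    2 * \int[area]_(x in O) (wD O s psi x * wD O (j :: s) psi x * chi x).
  by apply: etrans _ (RintegralZl 2 mO i2); apply: eq_Rintegral => x _; rewrite -mulrA.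
have l3 : - (2 * \int[area]_(x in O) (pd s (phi n) x * pd (j :: s) (phi n) x * chi x)) @[n --> \oo] -->
    - (2 * \int[area]_(x in O) (wD O s psi x * wD O (j :: s) psi x * chi x)).
  by apply: cvgN; apply: cvgM l2; exact: cvg_cst.
apply: (cvg_eq l1 l3) => n.
have C : C1 O (pd s (phi n)) by apply: smooth_C1; apply: smooth_pd; exact: (tphi n).1.
have C2 := C1_mul oO C C.
apply: etrans (integration_by_parts2 j oO (test_C1c T) C2) _; apply: f_equal.
apply: etrans _ (RintegralZl 2 mO (j2 n)); apply: eq_Rintegral => x /[!inE] Ox.
rewrite (C1_pd_mul j C C Ox) (pd_cons j s).
have aux (a b d : R) : (a * b + a * b) * d = 2 * (a * b * d) by clear; ring.
exact: aux.
Qed.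

Definition convection u (g : 'I_2 -> 'I_2 -> plane R -> R) (j : 'I_2) (x : plane R) : R :=
  u ord0 x * g ord0 j x + u ord_max x * g ord_max j x.

(* With [Delta psi = k - lam psi],
   [(u . grad) u = grad (|grad psi|^2 / 2 + lam psi^2 / 2 - k psi)]. *)
Lemma bernoulli_gradient O u psi (lam k : R) j : open O -> H0k 2 O psi -> (forall j, H0k 1 O (u j)) ->
  ae_on O (fun x => forall j, u j x = - grad_perp O psi j x) ->
  ae_on O (fun x => wlap O psi x + lam * psi x = k) ->
  is_wD O [:: j] (fun x => 2^-1 * (wD O [:: ord0] psi x * wD O [:: ord0] psi x) +
     2^-1 * (wD O [:: ord_max] psi x * wD O [:: ord_max] psi x) +
     (lam / 2 * (wD O [::] psi x * wD O [::] psi x) + - k * wD O [::] psi x))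
    (convection u (velocity_gradient O psi) j).
Proof.
move=> oO H0 Hu uE qE; have [e0 e1] := stream_velocity uE.
have wS s (hs : (size s <= 1)%N) := is_wD_square j oO H0 hs.
have Lp : L1loc O psi by apply: L2_L1loc => //; exact: H0.1.1.
have [wp _] := Hk_wD (s := [:: j]) oO H0.1 isT.
have sw s (hs : (size s <= 2)%N) : sqi area O (wD O s psi).
  by apply/L2_sqi; have [] := Hk_wD oO H0.1 hs.
have nil := wD_nil oO Lp.
have wn : is_wD O [:: j] (wD O [::] psi) (wD O [:: j] psi).
  have e : ae_on O (fun x => psi x = wD O [::] psi x) by apply: (ae_on_imply nil) => x _ ->.
  exact: (is_wD_ae oO wp (sw [::] isT).1 (sw [:: j] isT).1 e (ae_on_all (fun x _ => erefl))).
have w1 := is_wD_scale 2^-1 oO (wS [:: ord0] isT); have w2 := is_wD_scale 2^-1 oO (wS [:: ord_max] isT).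
have w3 := is_wD_scale (lam / 2) oO (wS [::] isT); have w4 := is_wD_scale (- k) oO wn.
have w := is_wD_add oO (is_wD_add oO w1 w2) (is_wD_add oO w3 w4).
have [[m1 _] [m2 _] _] := w.
have su i : sqi area O (u i) by apply/L2_sqi; have [[]] := Hu i.
have sg i l : measurable_fun (O : set mplane) (velocity_gradient O psi i l).
  have := velocity_gradient_wD i l oO H0 Hu uE; by case=> _ [].
apply: (is_wD_ae oO w) => //; [|exact: ae_on_all|].
  by apply: measurable_funD; apply: measurable_funM => //; exact: (su _).1.
have eU : ae_on O (fun x => u ord0 x = wD O [:: ord_max] psi x /\ u ord_max x = - wD O [:: ord0] psi x).
  exact: (ae_on_imply2 e0 e1 (fun x _ a b => conj a b)).
have eQ : ae_on O (fun x => wlap O psi x + lam * wD O [::] psi x = k).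
  by apply: (ae_on_imply2 qE nil) => x _ + ->.
have eM : ae_on O (fun x => wD O [:: ord0; ord_max] psi x = wD O [:: ord_max; ord0] psi x).
  apply: (fundamental_eq oO) => [||chi T].
  - by apply: L2_L1loc => //; apply/L2_sqi; exact: sw.
  - by apply: L2_L1loc => //; apply/L2_sqi; exact: sw.
  - exact: (wD_mixed oO H0 (test_C1c T)).
have eA : ae_on O (fun x => [/\ u ord0 x = wD O [:: ord_max] psi x, u ord_max x = - wD O [:: ord0] psi x,
   wlap O psi x + lam * wD O [::] psi x = k & wD O [:: ord0; ord_max] psi x = wD O [:: ord_max; ord0] psi x]).
  have eB : ae_on O (fun x => wlap O psi x + lam * wD O [::] psi x = k /\ wD O [:: ord0; ord_max] psi x = wD O [:: ord_max; ord0] psi x).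
    exact: (ae_on_imply2 eQ eM (fun x _ a b => conj a b)).
  exact: (ae_on_imply2 eU eB (fun x _ a b => And4 a.1 a.2 b.1 b.2)).
apply: (ae_on_imply eA) => x _ [h0 h1 hq hm].
rewrite /convection /velocity_gradient h0 h1; rewrite wlapE in hq.
case: (ord2_cases j) => ->; rewrite ?eqxx /= -hq.
  rewrite hm.
  have aux (q q0 q1 w00 w10 w11 l : R) :
    2^-1 * (2 * (q0 * w00)) + 2^-1 * (2 * (q1 * w10)) + (l / 2 * (2 * (q * q0)) + - (w00 + w11 + l * q) * q0) =
    q1 * w10 + - q0 * w11 by clear; field.
  exact: aux.
rewrite -hm.
have aux (q q0 q1 w00 w01 w11 l : R) :
  2^-1 * (2 * (q0 * w01)) + 2^-1 * (2 * (q1 * w11)) + (l / 2 * (2 * (q * q1)) + - (w00 + w11 + l * q) * q1) =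
  q1 * - w00 + - q0 * - w01 by clear; field.
exact: aux.
Qed.

Lemma Rintegral_slicewise_zero O f : open O -> volume.-integrable setT (EFin \o f) ->
  (forall x t, ~ O x -> f (x, t) = 0) -> (forall t, \int[area]_(x in O) f (x, t) = 0) ->
  \int[volume]_z f z = 0.
Proof.
move=> oO fi f0 H; have mO := open_measurable2 oO; rewrite (Rintegral_volume fi).1.
apply: etrans _ (Rintegral0 leb setT); apply: eq_Rintegral => t _.
apply: etrans _ (H t); apply: (Rintegral_out (setT : set mplane) _) => // x _; exact: f0.
Qed.

Lemma H0k1_scale O (c : R) h : open O -> H0k 1 O h -> H0k 1 O (fun x => c * h x).
Proof.
move=> oO Hh; have mO := open_measurable2 oO.
have [phi [tphi cv]] := H0k_approx oO Hh.
have w s : (size s <= 1)%N -> is_wD O s (fun x => c * h x) (fun x => c * wD O s h x) /\ L2 O (fun x => c * wD O s h x).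
  move=> hs; have [w L] := Hk_wD oO Hh.1 hs; split; [exact: is_wD_scale|exact: L2_scale].
have Hc : Hk 1 O (fun x => c * h x).
  split; first by apply: L2_scale => //; exact: Hh.1.1.
  by move=> s hs; exists (fun x => c * wD O s h x); exact: w.
split=> //; exists (fun n x => c * phi n x); split; first by move=> n; exact: test_scale.
move=> s hs; have E := wD_ae oO (w s hs).1.
have c1 := cvgL2_scale mO c (cv s hs).
have [s1 s2 l] := c1.
have pE n : pd s (fun x => c * phi n x) = fun x => c * pd s (phi n) x.
  apply/funext => x; have [->|[i ->]] := size_le1 hs; first by rewrite !pd_nil.
  by rewrite pdE; apply: is_deriveE; exact: is_derive_scale (smooth_is_derive _ _ (tphi n).1).
have sW : sqi area O (wD O s (fun x => c * h x)) by apply/L2_sqi; have [] := Hk_wD oO Hc hs.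
have s3 n : sqi area O (pd s (fun x => c * phi n x)) by rewrite pE.
apply/(cvgL2P mO s3 sW); split=> //.
have -> : (fun n => L2norm area O (fun x => pd s (fun y => c * phi n y) x - wD O s (fun y => c * h y) x)) =
  (fun n => L2norm area O (fun x => c * pd s (phi n) x - c * wD O s h x)); last exact: l.
apply/funext => n; rewrite /L2norm; congr (Num.sqrt _).
have d1 := sqi_sub mO (s3 n) sW; have d2 := sqi_sub mO (s1 n) s2.
apply: (ae_on_eq_Rintegral oO).
- exact: measurable_funX d1.1.
- exact: measurable_funX d2.1.
- by apply: (ae_on_imply E) => x _ ->; rewrite pE.
Qed.

End Bernoulli.

#[local] Transparent pd wD Rintegral.

Lemma EFin_Rintegral d (T : measurableType d) (R : realType) (mu : {measure set T -> \bar R}) (D : set T) (f : T -> R) :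
  measurable D -> mu.-integrable D (EFin \o f) -> (\int[mu]_(x in D) f x)%:E = (\int[mu]_(x in D) (f x)%:E)%E.
Proof. by move=> mD fi; rewrite /Rintegral fineK //; exact: integrable_fin_num. Qed.

#[local] Opaque pd wD Rintegral.

Section DecayingSolution.
Context {R : realType}.
Notation leb := (@lebesgue_measure R).
Notation mplane := (measurableTypeR R * measurableTypeR R)%type.
Notation mspace := (measurableTypeR R * measurableTypeR R * measurableTypeR R)%type.
Implicit Types (O : set (plane R)) (f phi : spacetime R -> R) (p psi h : plane R -> R) (u : 'I_2 -> plane R -> R).

Lemma stokes_grad_zero O lam u p j chi : open O -> stokes_pressure O lam u p -> grad_zero O p -> test O chi ->
  \int[area]_(x in O) (u j x * lap chi x + lam * (u j x * chi x)) = 0.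
Proof.
move=> oO [hp sp] gz T; rewrite (sp j _ T) (integration_by_parts2 j oO (test_C1c T) (harmonic_C1 oO hp)) opprK.
apply: etrans _ (Rintegral0 area O); apply: eq_Rintegral => x /[!inE] Ox.
by rewrite pdE (gz x Ox j) mul0r.
Qed.

Lemma tests_vanish O phi x t : test (cylinder O) phi -> ~ O x ->
  [/\ phi (x, t) = 0, iter_deriv [:: dt] phi (x, t) = 0, (forall j, iter_deriv [:: dx j] phi (x, t) = 0) &
     \sum_(i < 2) iter_deriv [:: dx i; dx i] phi (x, t) = 0].
Proof.
move=> [_ [K [cK KO phi0]]] nO.
have nK : ~ K (x, t) by move=> /KO[].
split; [exact: phi0|exact: (iter_deriv_out [:: dt] cK phi0 nK)|by move=> j; exact: (iter_deriv_out [:: dx j] cK phi0 nK)|].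
by apply: big1 => i _; exact: (iter_deriv_out [:: dx i; dx i] cK phi0 nK).
Qed.

Lemma test_lap_cyl O phi : test (cylinder O) phi ->
  test (cylinder O) (fun z => \sum_(i < 2) iter_deriv [:: dx i; dx i] phi z).
Proof.
move=> T; under eq_fun do rewrite sum2.
by apply: test_add; exact: test_iter.
Qed.

(** Integrated in time first: for fixed [x] the integrand is the derivative of
    $h(x)e^{-kt}\phi(x,t)$, which has compact support in $t$. So [h] needs no regularity. *)
Lemma decay_time_integral O (k : R) h phi : open O -> L1loc O h -> test (cylinder O) phi ->
  let f z := expR (- (k * z.2)) * h z.1 in
  volume.-integrable setT (EFin \o (fun z => f z * iter_deriv [:: dt] phi z - k * (f z * phi z))) /\
  \int[volume]_z (f z * iter_deriv [:: dt] phi z - k * (f z * phi z)) = 0.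
Proof.
move=> oO Lh T f; have Lf := L1loc_cyl_tensor oO Lh (@decay_continuous _ k).
have [_ [i1 _]] := L1loc_cyl_test oO Lf (test_iter [:: dt] T); have [_ [i2 _]] := L1loc_cyl_test oO Lf T.
have i := integrableB_EFin measurableT i1 (integrableZ_EFin k measurableT i2); split=> //.
rewrite (Rintegral_volume12 i); apply: etrans _ (Rintegral0 area setT); apply: eq_Rintegral => x _.
have [M M0 HM] := test_iter_dt x T.
have sphi : smooth (fun t => phi (x, t)) by apply: smooth_pair2; case: T.
have dphi (t : R) : is_derive t 1 (fun t => phi (x, t)) (iter_deriv [:: dt] phi (x, t)).
  by apply: is_derive_eq' (smooth_is_derive t 1 sphi) _; rewrite derive_pair2.
have cdphi : continuous (fun t => iter_deriv [:: dt] phi (x, t)).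
  by apply: continuous_for => t; apply: smooth_cont; apply: smooth_pair2; have [] := test_iter [:: dt] T.
apply: (Rintegral_derive_compact (F := fun t => h x * (expR (- (k * t)) * phi (x, t))) (M := M)) => //.
- move=> t; apply: is_derive_eq' (is_derive_scale (h x) (is_derive_mul (is_derive_decay k t) (dphi t))) _.
  have aux (a b c d l : R) : a * (b * c + d * (- l * b)) = b * a * c - l * (b * a * d) by clear; ring.
  exact: aux.
- apply: continuous_for => t; have ce := @decay_continuous _ k t.
  have cl : {for t, continuous (fun t => expR (- (k * t)) * h x)} by apply: continuous_mul ce _; exact: continuous_const.
  apply: continuous_sub; first by apply: continuous_mul cl _; exact: cdphi.
  apply: continuous_mul; first exact: continuous_const.
  by apply: continuous_mul cl _; exact: smooth_cont.
- by move=> t n; rewrite (HM t n).1 !mulr0.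
Qed.

Lemma decaying_navier_stokes O nu lam u p psi (k : R) : open O -> H0k 2 O psi ->
  (forall j, H0k 1 O (u j)) -> divfree O u -> stokes_pressure O lam u p ->
  ae_on O (fun x => forall j, u j x = - grad_perp O psi j x) -> grad_zero O p ->
  ae_on O (fun x => wlap O psi x + lam * psi x = k) ->
  navier_stokes O nu (decaying nu lam u) u.
Proof.
move=> oO H0 Hu du sp uE gz qE; have mO := open_measurable2 oO; have mC := open_measurable3 (cylinder_open oO).
pose g := velocity_gradient O psi.
have wg i j : is_wD O [:: i] (u j) (g i j) by exact: velocity_gradient_wD.
have wP j := bernoulli_gradient j oO H0 Hu uE qE.
set P := fun x : plane R => _ in wP.
pose kap := nu * lam.
pose c (t : R) := expR (- (kap * t)).
have cc : continuous c by exact: decay_continuous.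
have c2 : continuous (fun t => c t * c t).
  by apply: continuous_for => t; apply: continuous_mul; exact: cc.
have Lu j : L1loc O (u j) by have [] := wg ord0 j.
have Lg i j : L1loc O (g i j) by have [] := wg i j.
have LP : L1loc O P by have [] := wP ord0.
have Lc j : L1loc O (convection u g j) by have [] := wP j.
have LU j : L1loc_cyl O (decaying nu lam u j) by exact: (L1loc_cyl_tensor oO (Lu j) cc).
pose G i j (z : spacetime R) := c z.2 * g i j z.1.
(* Convection is quadratic in the velocity, hence the squared decay factor; $(u\cdot\nabla)u=\nabla
   P$ by [bernoulli_gradient], and the pressure has to cancel it. *)
pose pi (z : spacetime R) := - (c z.2 * c z.2) * P z.1.
have convEz j z : \sum_(i < 2) decaying nu lam u i z * G i j z = c z.2 * c z.2 * convection u g j z.1.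
  rewrite sum2 /decaying /G /convection.
  have aux (e a b d f : R) : e * a * (e * b) + e * d * (e * f) = e * e * (a * b + d * f) by clear; ring.
  exact: aux.
have convE j : (fun z => \sum_(i < 2) decaying nu lam u i z * G i j z) = (fun z : spacetime R => c z.2 * c z.2 * convection u g j z.1).
  by apply/funext => z; exact: convEz.
have LC j : L1loc_cyl O (fun z => c z.2 * c z.2 * convection u g j z.1) by exact: (L1loc_cyl_tensor oO (Lc j) c2).
have LPi : L1loc_cyl O pi.
  apply: (L1loc_cyl_tensor oO LP (c := fun t => - (c t * c t))).
  by apply: continuous_for => t; apply: continuous_opp; exact: c2.
exists G, pi; split.
- split=> // [i j|j]; first exact: (L1loc_cyl_tensor oO (Lg i j) cc).
  by rewrite convE.
- move=> t t0; split=> [j|i j|].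
  + exact: (H0k1_scale (c t) oO (Hu j)).
  + exact: (is_wD_scale (c t) oO (wg i j)).
  + have e i := wD_ae oO (wg i i).
    have eA := ae_on_imply2 (e ord0) (e ord_max) (fun x _ a b => conj a b).
    apply: (ae_on_imply2 du eA) => x _ + [a b]; rewrite !sum2 /G /= a b => s.
    by rewrite -mulrDr s mulr0.
- move=> j phi T.
  have Tl := test_lap_cyl T; have Tx := test_iter [:: dx j] T.
  (* The momentum equation is a sum of three integrals, each 0: the time derivative plus [kap] times
     the field, the Stokes system with zero pressure gradient in each slice, and convection against
     [pi]. The term with [kap] is inserted and removed to balance the first two. *)
  have [iI1 I1] := decay_time_integral kap oO (Lu j) T.
  have [_ [i1 _]] := L1loc_cyl_test oO (LU j) Tl.
  have [_ [i2 _]] := L1loc_cyl_test oO (LU j) T.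
  have [_ [i3 _]] := L1loc_cyl_test oO (LC j) T.
  have [_ [i4 _]] := L1loc_cyl_test oO LPi Tx.
  have iI2 := integrableD_EFin measurableT (integrableZ_EFin nu measurableT i1) (integrableZ_EFin kap measurableT i2).
  have iI3 := integrableB_EFin measurableT i3 i4.
  have I2 : \int[volume]_z (nu * (decaying nu lam u j z * \sum_(i < 2) iter_deriv [:: dx i; dx i] phi z) + kap * (decaying nu lam u j z * phi z)) = 0.
    apply: (Rintegral_slicewise_zero oO iI2).
      by move=> x t nO; have [-> _ _ ->] := tests_vanish t T nO; rewrite !mulr0 addr0.
    move=> t; have Tt := test_slice t T; have Z := stokes_grad_zero j oO sp gz Tt.
    have ii : area.-integrable O (EFin \o (fun x => u j x * lap (fun x => phi (x, t)) x + lam * (u j x * phi (x, t)))).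
      apply: (integrableD_EFin mO); first exact: (L1loc_Cc oO (Lu j) (test_Cc (test_pd_lap Tt))).
      by apply: (integrableZ_EFin _ mO); exact: (L1loc_Cc oO (Lu j) (test_Cc Tt)).
    transitivity (c t * nu * 0 : R); last by rewrite mulr0.
    rewrite -[X in _ * X]Z; apply: etrans _ (RintegralZl (c t * nu) mO ii); apply: eq_Rintegral => x _.
    rewrite lap_slice /decaying -/(c t) /kap.
    have aux (e a l f n m : R) : n * (e * a * l) + n * m * (e * a * f) = e * n * (a * l + m * (a * f)) by clear; ring.
    exact: aux.
  have I3 : \int[volume]_z (c z.2 * c z.2 * convection u g j z.1 * phi z - pi z * iter_deriv [:: dx j] phi z) = 0.
    apply: (Rintegral_slicewise_zero oO iI3).
      by move=> x t nO; have [-> _ -> _] := tests_vanish t T nO; rewrite !mulr0 subr0.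
    move=> t; have Tt := test_slice t T; have [_ _ /(_ _ Tt)] := wP j.
    rewrite /= expr1 mulN1r => Z.
    have j1 := L1loc_Cc oO (Lc j) (test_Cc Tt); have j2 := L1loc_Cc oO LP (test_Cc (test_pd [:: j] Tt)).
    have j3 := integrableD_EFin mO j1 j2.
    transitivity (c t * c t * 0 : R); last by rewrite mulr0.
    have {}Z : \int[area]_(x in O) (convection u g j x * phi (x, t) + P x * pd [:: j] (fun x => phi (x, t)) x) = 0.
      by apply: etrans (RintegralD mO j1 j2) _; rewrite Z addrN.
    apply: etrans _ (f_equal (fun y => c t * c t * y) Z); apply: etrans _ (RintegralZl (c t * c t) mO j3); apply: eq_Rintegral => x _.
    rewrite pd_slice /pi /=.
    have aux (e a b d f : R) : e * a * b - - e * d * f = e * (a * b + d * f) by clear; ring.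
    exact: aux.
  have iN1 := integrableN_EFin measurableT iI1.
  have iS := integrableB_EFin measurableT iN1 iI2.
  have S : \int[volume]_z (- (decaying nu lam u j z * iter_deriv [:: dt] phi z - kap * (decaying nu lam u j z * phi z)) -
     (nu * (decaying nu lam u j z * \sum_(i < 2) iter_deriv [:: dx i; dx i] phi z) + kap * (decaying nu lam u j z * phi z)) +
     (c z.2 * c z.2 * convection u g j z.1 * phi z - pi z * iter_deriv [:: dx j] phi z)) = 0.
    apply: etrans (RintegralD measurableT iS iI3) _; rewrite I3 addr0.
    apply: etrans (RintegralB measurableT iN1 iI2) _; rewrite I2 subr0.
    by apply: etrans (RintegralN measurableT iI1) _; rewrite I1 oppr0.
  apply: etrans _ S.
  transitivity (\int[volume]_(z in cylinder O) (- (decaying nu lam u j z * iter_deriv [:: dt] phi z) + c z.2 * c z.2 * convection u g j z.1 * phi z -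
    nu * (decaying nu lam u j z * \sum_(i < 2) iter_deriv [:: dx i; dx i] phi z) - pi z * iter_deriv [:: dx j] phi z)).
    by apply: eq_Rintegral => z _; rewrite convEz.
  transitivity (\int[volume]_z (- (decaying nu lam u j z * iter_deriv [:: dt] phi z) + c z.2 * c z.2 * convection u g j z.1 * phi z -
    nu * (decaying nu lam u j z * \sum_(i < 2) iter_deriv [:: dx i; dx i] phi z) - pi z * iter_deriv [:: dx j] phi z)).
    apply/esym; apply: (Rintegral_out (setT : set mspace) _) => // z _ nC.
    have [_ [K [cK KO phi0]]] := T; have nK : ~ K z by move=> /KO.
    rewrite (phi0 z nK) (iter_deriv_out [:: dt] cK phi0 nK) (iter_deriv_out [:: dx j] cK phi0 nK) big1; last first.
      by move=> i _; exact: (iter_deriv_out [:: dx i; dx i] cK phi0 nK).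
    by rewrite !mulr0 oppr0 !addr0.
  apply: eq_Rintegral => z _.
  have aux (a b d e f : R) : - a + e - b - f = - (a - d) - (b + d) + (e - f) by clear; ring.
  exact: aux.
- move=> j; split.
    by apply: ae_on_all => x _; rewrite /decaying /= mulr0 oppr0 expR0 mul1r.
  have su : sqi area O (u j) by apply/L2_sqi; have [[]] := Hu j.
  have iu := su.2.
  have E t : (\int[area]_(x in O) ((decaying nu lam u j (x, t) - u j x) ^+ 2)%:E)%E =
      ((c t - 1) ^+ 2 * \int[area]_(x in O) (u j x ^+ 2))%:E.
    have i2 := integrableZ_EFin ((c t - 1) ^+ 2) mO iu.
    apply: etrans _ (f_equal EFin (RintegralZl ((c t - 1) ^+ 2) mO iu)).
    apply: etrans _ (esym (EFin_Rintegral mO i2)).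
    apply: eq_integral => x _; rewrite /decaying -/(c t) /=; congr (_%:E).
    have aux (a b : R) : (a * b - b) ^+ 2 = (a - 1) ^+ 2 * b ^+ 2 by clear; ring.
    exact: aux.
  have C : (c t - 1) ^+ 2 * \int[area]_(x in O) (u j x ^+ 2) @[t --> (0 : R)^'+] --> (0 : R).
    have c0 : (c 0 - 1) ^+ 2 * \int[area]_(x in O) (u j x ^+ 2) = 0.
      by rewrite /c mulr0 oppr0 expR0 subrr expr0n mul0r.
    have cm : {for (0 : R), continuous (fun t => (c t - 1) * (c t - 1) * \int[area]_(x in O) (u j x ^+ 2))}.
      have c1 : {for (0 : R), continuous (fun t => c t - 1)} by apply: continuous_sub; [exact: cc|exact: continuous_const].
      by apply: continuous_mul (continuous_mul c1 c1) _; exact: continuous_const.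
    have h : (c t - 1) ^+ 2 * \int[area]_(x in O) (u j x ^+ 2) @[t --> (0 : R)^'+] --> (c 0 - 1) ^+ 2 * \int[area]_(x in O) (u j x ^+ 2).
      by apply: cvg_at_right_filter; exact: cm.
    by rewrite c0 in h.
  under eq_fun do rewrite E.
  apply: cvg_EFin; first by apply: nearW.
  exact: C.
Qed.

End DecayingSolution.

Theorem theorem3 (R : realType) (Omega : set (plane R)) (lam : R)
    (u : 'I_2 -> plane R -> R) (p psi w : plane R -> R)
    (Omega_sc : simply_connected Omega)
    (Omega_lip : lipschitz_open Omega)
    (Omega_fin : (area Omega < +oo)%E)
    (lam_gt0 : 0 < lam)
    (u_eig : stokes_eigenfield Omega lam u)
    (u_neq0 : ~ ae_on Omega (fun x => forall j, u j x = 0))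
    (u_p : stokes_pressure Omega lam u p)
    (psi_eig : buckling_eigenfunction Omega lam psi)
    (w_eig : vorticity_eigenfunction Omega lam w)
    (u_psi : ae_on Omega (fun x => forall j, u j x = - grad_perp Omega psi j x))
    (w_u : ae_on Omega (fun x => w x = curl Omega u x))
    (w_psi : ae_on Omega (fun x => w x = - wlap Omega psi x)) :
  [/\ [/\ const_on_boundary Omega (wlap Omega psi) <-> weak_neumann Omega p,
          const_on_boundary Omega w <-> weak_neumann Omega p &
          weak_neumann Omega p <-> grad_zero Omega p],
      weak_neumann Omega p ->
        forall nu : R, 0 < nu -> navier_stokes Omega nu (decaying nu lam u) u &
      forall alpha : R, 0 < alpha <= 1 -> C2alpha_open alpha Omega ->
        forall nu : R, 0 < nu ->
          navier_stokes Omega nu (decaying nu lam u) u -> weak_neumann Omega p].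
Proof.
have oO := Omega_lip.1.
have hp := u_p.1.
have psi2 := psi_eig.1.
have [u_H du _] := u_eig.
have con := Omega_sc.1.
have psi1 : H0k 1 Omega psi.
  split; first split; first exact: psi2.1.1.
    by move=> s hs; apply: psi2.1.2; exact: leq_trans hs _.
  have [phi [tphi cphi]] := psi2.2; exists phi; split=> // s hs.
  by apply: cphi; exact: leq_trans hs _.
have wq := weak_gradient_rotated_pressure oO psi2 u_H u_p u_psi.
have neumann : weak_neumann Omega p <-> grad_zero Omega p.
  by split; [exact: weak_neumann_grad_zero|exact: grad_zero_weak_neumann].
(* With $\nabla p=0$ the weak gradient of $\Delta\psi+\lambda\psi$ is 0, and connectedness gives one
   constant for all of [Omega]. *)
have Bernoulli : grad_zero Omega p -> exists k, ae_on Omega (fun x => wlap Omega psi x + lam * psi x = k).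
  move=> gz; apply: (weak_gradient_zero oO con) => i; exists (rot_grad p i) => // x Ox.
  by rewrite /rot_grad !pdE !gz // oppr0; case: ifP.
have wlap2 := wlap_L2 oO psi2.1.
have mw : measurable_fun (Omega : set (measurableTypeR R * measurableTypeR R)%type) w by have [[]] := w_eig.
(* The function $k-\lambda\psi$, almost everywhere equal to $\Delta\psi$, has trace $k$ because
   $\psi\in H^1_0$. *)
have const_trace k : const_on_boundary Omega (fun x => k + - lam * psi x).
  exact: const_on_boundary_affine oO (L2_cst 1 oO Omega_fin) psi1.
have const_w k : const_on_boundary Omega (fun x => - k + lam * psi x).
  exact: const_on_boundary_affine oO (L2_cst 1 oO Omega_fin) psi1.
split.
- split=> //.
  + split=> [cb|/neumann/Bernoulli[k E]].
      apply/neumann; apply: (constant_trace_grad_zero (f := wlap Omega psi) (sg := 1) Omega_lip Omega_fin hp psi2 wq) => //.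
      by apply: ae_on_all => x _; rewrite mul1r.
    apply: (const_on_boundary_ae oO wlap2.1) (const_trace k).
    by apply: (ae_on_imply E) => x _ <-; rewrite mulNr addrK.
  + split=> [cb|/neumann/Bernoulli[k E]].
      apply/neumann; apply: (constant_trace_grad_zero (f := w) (sg := -1) Omega_lip Omega_fin hp psi2 wq) => //.
      by apply: (ae_on_imply w_psi) => x _ ->; rewrite mulN1r opprK.
    apply: (const_on_boundary_ae oO mw) (const_w k).
    by apply: (ae_on_imply2 E w_psi) => x _ <- ->; rewrite opprD subrK.
- move=> /neumann gz nu nu0; have [k E] := Bernoulli gz.
  exact: (decaying_navier_stokes nu oO psi2 u_H du u_p u_psi gz E).
- move=> alpha _ _ nu nu0 ns; apply/neumann.
  apply: (convection_grad_zero oO Omega_fin hp psi2 wq) => eta.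
  exact: (navier_stokes_convection oO nu0 psi2 u_H u_p u_psi ns).
Qed.
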